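(* Let $p$ be a prime, $M\in\omega$, and let $\mathcal{A}$ be a computable reduced Abelian $p$-group of length greater than $\omega M$. Then for any $\Delta^0_{2M+1}$ set $S$, there is a uniformly computable sequence $(\mathcal{A}_n)_{n\in\omega}$ of structures such that $\mathcal{A}_n\cong\mathcal{A}$ iff $n\in S$. That is, $I(\mathcal{A})$ is $\Delta^0_{2M+1}$-hard.
   Context: For a countable Abelian $p$-group $G$: $G_0=G$, $G_{\alpha+1}=pG_\alpha$, $G_\alpha=\bigcap_{\beta<\alpha}G_\beta$ for limit $\alpha$; the length is the least $\alpha$ with $G_\alpha=G_{\alpha+1}$; $G$ is reduced if $G_{\text{length}}=\{0\}$. A structure (universe $\subseteq\omega$) is computable if its atomic diagram is computable; a sequence is uniformly computable if the atomic diagrams are uniformly computable. $I(\mathcal{A})$ is the set of indices $a$ (i.e. $\varphi_a$ is the characteristic function of the atomic diagram) of computable copies of $\mathcal{A}$. *)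

(* Defs.v *)
From Stdlib Require Import Arith List ZArith Znumtheory.
Import ListNotations.
Open Scope nat_scope.

Inductive code : Type :=
  | CZero : code
  | CSucc : code
  | CProj : nat -> code
  | CComp : code -> list code -> code
  | CPrec : code -> code -> code
  | CMu   : code -> code.

Inductive eval : code -> list nat -> nat -> Prop :=
  | ev_zero xs : eval CZero xs 0
  | ev_succ x xs : eval CSucc (x :: xs) (S x)
  | ev_proj i xs y : nth_error xs i = Some y -> eval (CProj i) xs y
  | ev_comp f gs xs ys z :
      Forall2 (fun g y => eval g xs y) gs ys -> eval f ys z ->
      eval (CComp f gs) xs z
  | ev_prec0 f g xs z : eval f xs z -> eval (CPrec f g) (0 :: xs) z
  | ev_precS f g n xs r z :
      eval (CPrec f g) (n :: xs) r -> eval g (n :: r :: xs) z ->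
      eval (CPrec f g) (S n :: xs) z
  | ev_mu f xs y :
      eval f (y :: xs) 0 ->
      (forall z, z < y -> exists v, eval f (z :: xs) (S v)) ->
      eval (CMu f) xs y.

Definition computable_rel (k : nat) (R : list nat -> Prop) : Prop :=
  exists c, forall xs, length xs = k ->
    exists y, eval c xs y /\ (R xs <-> y = 0).

Definition computable_fun (k : nat) (f : list nat -> nat) : Prop :=
  exists c, forall xs, length xs = k -> eval c xs (f xs).

Fixpoint Sigma (n k : nat) (R : list nat -> Prop) : Prop :=
  match n with
  | 0 => computable_rel k R
  | S m => exists Q : list nat -> Prop,
      Sigma m (S k) (fun xs => ~ Q xs) /\   (* Q is Pi_m *)
      forall xs, length xs = k -> (R xs <-> exists y, Q (y :: xs))
  end.

Definition Pi (n k : nat) (R : list nat -> Prop) : Prop :=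
  Sigma n k (fun xs => ~ R xs).

Definition Delta_set (n : nat) (S : nat -> Prop) : Prop :=
  Sigma n 1 (fun xs => S (hd 0 xs)) /\ Pi n 1 (fun xs => S (hd 0 xs)).

Record Struct : Type := {
  dom  : nat -> Prop;
  add  : nat -> nat -> nat;   (* only its values on dom matter *)
  zero : nat;
  zero_dom : dom zero;
  add_dom : forall x y, dom x -> dom y -> dom (add x y)
}.

(* Computable structure: computable atomic diagram, i.e. computable
   universe and computable operation on it. *)
Definition computable_structure (A : Struct) : Prop :=
  computable_rel 1 (fun xs => dom A (hd 0 xs)) /\
  exists g, computable_fun 2 g /\
    forall x y, dom A x -> dom A y -> g [x; y] = add A x y.

Definition unif_computable (As : nat -> Struct) : Prop :=
  computable_rel 2 (fun xs => dom (As (nth 0 xs 0)) (nth 1 xs 0)) /\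
  (exists z, computable_fun 1 z /\ forall n, z [n] = zero (As n)) /\
  exists g, computable_fun 3 g /\
    forall n x y, dom (As n) x -> dom (As n) y ->
      g [n; x; y] = add (As n) x y.

Definition iso (A B : Struct) : Prop :=
  exists f : nat -> nat,
    (forall x, dom A x -> dom B (f x)) /\
    (forall x y, dom A x -> dom A y -> f x = f y -> x = y) /\
    (forall y, dom B y -> exists x, dom A x /\ f x = y) /\
    f (zero A) = zero B /\
    (forall x y, dom A x -> dom A y -> f (add A x y) = add B (f x) (f y)).

Definition nsmul (A : Struct) (n x : nat) : nat := Nat.iter n (add A x) (zero A).

Definition abelian_pgroup (p : nat) (A : Struct) : Prop :=
  (forall x y z, dom A x -> dom A y -> dom A z ->
     add A (add A x y) z = add A x (add A y z)) /\
  (forall x y, dom A x -> dom A y -> add A x y = add A y x) /\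
  (forall x, dom A x -> add A (zero A) x = x) /\
  (forall x, dom A x -> exists y, dom A y /\ add A x y = zero A) /\
  (forall x, dom A x -> exists k, nsmul A (p ^ k) x = zero A).

Definition pmul (p : nat) (A : Struct) (S : nat -> Prop) : nat -> Prop :=
  fun x => exists y, S y /\ x = nsmul A p y.

Definition pmul_iter (p : nat) (A : Struct) (n : nat) (S : nat -> Prop) :=
  Nat.iter n (pmul p A) S.

Fixpoint ulm_omega (p : nat) (A : Struct) (k : nat) : nat -> Prop :=
  match k with
  | 0 => dom A
  | S k' => fun x => forall n, pmul_iter p A n (ulm_omega p A k') x
  end.

Definition ulm_fin (p : nat) (A : Struct) (k n : nat) : nat -> Prop :=
  pmul_iter p A n (ulm_omega p A k).

(* length of A > omega * M : for every beta <= omega * M,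
   G_beta <> G_{beta+1}. *)
Definition length_gt_omega_mul (p : nat) (A : Struct) (M : nat) : Prop :=
  forall k n, (k < M \/ (k = M /\ n = 0)) ->
    ~ (forall x, ulm_fin p A k n x <-> ulm_fin p A k (S n) x).

(* The transfinite sequence (G_alpha)_alpha, described ordinal-free as the
   least family containing G, closed under S |-> pS and under intersections
   of nonempty subfamilies.  Its members are exactly the G_alpha. *)
Inductive UlmStage (p : nat) (A : Struct) : (nat -> Prop) -> Prop :=
  | us_base : UlmStage p A (dom A)
  | us_succ S : UlmStage p A S -> UlmStage p A (pmul p A S)
  | us_inter (F : (nat -> Prop) -> Prop) :
      (exists S, F S) -> (forall S, F S -> UlmStage p A S) ->
      UlmStage p A (fun x => forall S, F S -> S x).

(* Reduced: G_{length} (= intersection of all G_alpha) is {0}. *)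
Definition reduced (p : nat) (A : Struct) : Prop :=
  forall x, (forall S, UlmStage p A S -> S x) -> x = zero A.

(* Main.v *)
(* For a class [K] of functions let [Lim K] consist of the limits of functions in [K].  A Delta_{2M+1} set has its
   characteristic function in [Lim^{2M}] of the computable functions, and the subgroup A_{omega i} is presented
   in [Lim^{2i}].  By downward induction on i <= M there is, in [Lim^{2i}], a sequence of groups C_n with
   C_n isomorphic to A_{omega i} iff n is in S; for i = M take A_{omega M} or the trivial group.

   For the step from i + 1 to i let X = A_{omega i} be presented in [K] and let (H_n) be the given sequence in
   [Lim (Lim K)].  One constructs, in [K], groups C_n with first Ulm subgroup isomorphic to H_n and with the
   finite-index Ulm invariants of X.  A back-and-forth argument then shows that C_n is isomorphic to X iff
   H_n is isomorphic to X_omega.  The invariants of X are the limits of nondecreasing approximations: since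
   X_omega <> p X_omega, arbitrarily large finite invariants are nonzero, and these absorb the wrong guesses.
   The group H_n is guessed along a tree.  A node on the true path is represented by an element that is divided
   by longer and longer cyclic components, hence of infinite height; the representative of any other
   node ends up in one final component, and so has finite height. *)

(* The obstacle is that a presentation built in stages can only grow. What was erected for a wrong
   guess cannot be removed; it can only be enlarged or split off as a cyclic summand, and the
   invariants of X must then have room for this summand. Hence exponents enter only as nondecreasing
   approximations with finite limits, and a component that loses its index is led to a limit at
   which X is known to have a nonzero invariant; the surplus there is cancelled by suppressing one
   index with the same limit. Such limits come from an x0 in X_omega outside p X_omega: dividing x0
   by p^(N+1) gives z_N of height at least N with p z_N = x0, the height of z_N is finite, and the
   differences of the z_N lie in the socle. One descent through an Ulm subgroup costs two limits
   because membership in X_omega is a forall-exists statement over K, and a statement of the same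
   form, confirmed infinitely often, is what a node of the tree can test. Only invariants of finite
   index have to be matched, since the partial isomorphisms of the back-and-forth contain the whole
   first Ulm subgroup from the start. *)
Require Import Defs.
From Stdlib Require Import Arith List ZArith Znumtheory Lia FinFun Cantor Eqdep_dec.
From Stdlib Require Import Classical ClassicalEpsilon FunctionalExtensionality.
Import ListNotations.
Open Scope bool_scope.
Open Scope nat_scope.

(** * Classes of total functions closed under recursion and search *)

Lemma fun_choice {X Y} (R : X -> Y -> Prop) : (forall x, exists y, R x y) -> exists f, forall x, R x (f x).
Proof.
  intros H. exists (fun x => proj1_sig (constructive_indefinite_description _ (H x))).
  intros x. apply (proj2_sig (constructive_indefinite_description _ (H x))).
Qed.

Definition cp (x y : nat) : nat := Cantor.to_nat (x, y).
Definition c1 (z : nat) : nat := fst (Cantor.of_nat z).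
Definition c2 (z : nat) : nat := snd (Cantor.of_nat z).

Lemma c1_cp x y : c1 (cp x y) = x.
Proof. unfold c1, cp. now rewrite Cantor.cancel_of_to. Qed.

Lemma c2_cp x y : c2 (cp x y) = y.
Proof. unfold c2, cp. now rewrite Cantor.cancel_of_to. Qed.

Lemma cp_c z : cp (c1 z) (c2 z) = z.
Proof. unfold cp, c1, c2. rewrite <- surjective_pairing. apply Cantor.cancel_to_of. Qed.

Lemma cp_le x y : x + y <= cp x y.
Proof. unfold cp. pose proof (Cantor.to_nat_non_decreasing x y). lia. Qed.

Lemma cp_inj x y x' y' : cp x y = cp x' y' -> x = x' /\ y = y'.
Proof.
  intros E. split.
  - now rewrite <- (c1_cp x y), E, c1_cp.
  - now rewrite <- (c2_cp x y), E, c2_cp.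
Qed.

(** These closure properties hold for the computable functions and pass from [K] to [Lim K], so that
    one construction serves every level of the induction. Minimisation is restricted to searches
    that succeed everywhere, which keeps all members total. *)
Record CClass (K : (nat -> nat) -> Prop) : Prop := {
  K_ext : forall f g, (forall x, f x = g x) -> K f -> K g;
  K_id : K (fun x => x);
  K_O : K (fun _ => 0);
  K_S : K S;
  K_comp : forall f g, K f -> K g -> K (fun x => f (g x));
  K_pair : forall f g, K f -> K g -> K (fun x => cp (f x) (g x));
  K_c1 : K c1;
  K_c2 : K c2;
  K_rec : forall f g, K f -> K g ->
    K (fun z => nat_rect (fun _ => nat) (f (c1 z))
                  (fun i r => g (cp (c1 z) (cp i r))) (c2 z));
  K_mu : forall f h, K f ->
    (forall x, f (cp x (h x)) = 0 /\ forall y, y < h x -> f (cp x y) <> 0) -> K h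
}.

Existing Class CClass.

Definition K0 (f : nat -> nat) : Prop := computable_fun 1 (fun xs => f (hd 0 xs)).

Definition Lim (K : (nat -> nat) -> Prop) (f : nat -> nat) : Prop :=
  exists g, K g /\ forall x, exists s0, forall s, s0 <= s -> g (cp x s) = f x.

Lemma cf_ext k f g : (forall xs, length xs = k -> f xs = g xs) ->
  computable_fun k f -> computable_fun k g.
Proof.
  intros E [c H]. exists c. intros xs L. rewrite <- (E xs L). now apply H.
Qed.

Lemma cf_proj k i : i < k -> computable_fun k (fun xs => nth i xs 0).
Proof.
  intros L. exists (CProj i). intros xs E. constructor.
  apply nth_error_nth'. lia.
Qed.

Lemma cf_comp k m f gs : length gs = m -> computable_fun m f ->
  Forall (computable_fun k) gs ->
  computable_fun k (fun xs => f (map (fun g => g xs) gs)).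
Proof.
  intros L [c H] F.
  assert (exists cs, forall xs, length xs = k ->
            Forall2 (fun c y => eval c xs y) cs (map (fun g => g xs) gs)) as [cs Hcs].
  { clear H L. induction F as [|g gs [cg Hg] F [cs IH]].
    - exists []. constructor.
    - exists (cg :: cs). intros xs L. simpl. constructor; auto. }
  exists (CComp c cs). intros xs E. econstructor; [now apply Hcs|].
  apply H. now rewrite length_map.
Qed.

Lemma cf_comp1 k f g : computable_fun 1 f -> computable_fun k g ->
  computable_fun k (fun xs => f [g xs]).
Proof.
  intros Hf Hg. apply (cf_comp k 1 f [g]); auto.
Qed.

Lemma cf_comp2 k f g h : computable_fun 2 f -> computable_fun k g -> computable_fun k h ->
  computable_fun k (fun xs => f [g xs; h xs]).
Proof.
  intros Hf Hg Hh. apply (cf_comp k 2 f [g; h]); auto.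
Qed.

Lemma cf_zero k : computable_fun k (fun _ => 0).
Proof. exists CZero. constructor. Qed.

Lemma cf_S k f : computable_fun k f -> computable_fun k (fun xs => S (f xs)).
Proof.
  intros Hf. apply (cf_comp1 k (fun ys => S (hd 0 ys)) f); auto.
  exists CSucc. intros [|x [|]] L; simpl in L; try discriminate. constructor.
Qed.

Lemma cf_rec k f g : computable_fun k f -> computable_fun (S (S k)) g ->
  computable_fun (S k) (fun xs => nat_rect (fun _ => nat) (f (tl xs))
     (fun i r => g (i :: r :: tl xs)) (hd 0 xs)).
Proof.
  intros [cf Hf] [cg Hg]. exists (CPrec cf cg).
  intros [|n xs] L; simpl in L; [discriminate|]. injection L as L. simpl.
  induction n as [|n IH]; simpl.
  - constructor. now apply Hf.
  - econstructor; [exact IH|]. apply Hg. simpl. lia.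
Qed.

Lemma cf_mu k f h : computable_fun (S k) f ->
  (forall xs, length xs = k -> f (h xs :: xs) = 0 /\ forall y, y < h xs -> f (y :: xs) <> 0) ->
  computable_fun k h.
Proof.
  intros [c H] Hh. exists (CMu c). intros xs L. destruct (Hh xs L) as [E M].
  constructor.
  - rewrite <- E. apply H. simpl. lia.
  - intros z Hz. specialize (M z Hz). destruct (f (z :: xs)) as [|v] eqn:E'; [easy|].
    exists v. rewrite <- E'. apply H. simpl. lia.
Qed.

Ltac cf_list := intros [|?x [|?y [|?z [|?w ?l]]]] ?L; simpl in L; try discriminate; simpl.

Lemma cf_add k f g : computable_fun k f -> computable_fun k g ->
  computable_fun k (fun xs => f xs + g xs).
Proof.
  intros Hf Hg.
  assert (A : computable_fun 2 (fun xs => nth 0 xs 0 + nth 1 xs 0)).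
  { eapply cf_ext; [|apply (cf_rec 1 (fun xs => nth 0 xs 0) (fun xs => S (nth 1 xs 0)));
      [apply cf_proj; lia | apply cf_S, cf_proj; lia]].
    cf_list. induction x; simpl; auto. }
  apply (cf_comp2 k _ f g A Hf Hg).
Qed.

Lemma cf_pred k f : computable_fun k f -> computable_fun k (fun xs => pred (f xs)).
Proof.
  intros Hf.
  assert (A : computable_fun 1 (fun xs => pred (nth 0 xs 0))).
  { eapply cf_ext; [|apply (cf_rec 0 (fun xs => 0) (fun xs => nth 0 xs 0));
      [apply cf_zero | apply cf_proj; lia]].
    cf_list. destruct x; simpl; auto. }
  apply (cf_comp1 k _ f A Hf).
Qed.

Lemma cf_sub k f g : computable_fun k f -> computable_fun k g ->
  computable_fun k (fun xs => f xs - g xs).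
Proof.
  intros Hf Hg.
  assert (A : computable_fun 2 (fun xs => nth 1 xs 0 - nth 0 xs 0)).
  { eapply cf_ext; [|apply (cf_rec 1 (fun xs => nth 0 xs 0) (fun xs => pred (nth 1 xs 0)));
      [apply cf_proj; lia | apply cf_pred, cf_proj; lia]].
    cf_list. induction x; simpl; lia. }
  apply (cf_comp2 k _ g f A Hg Hf).
Qed.

Definition tri (n : nat) : nat := nat_rec (fun _ => nat) 0 (fun i m => S i + m) n.

Lemma cf_tri k f : computable_fun k f -> computable_fun k (fun xs => tri (f xs)).
Proof.
  intros Hf.
  assert (A : computable_fun 1 (fun xs => tri (nth 0 xs 0))).
  { eapply cf_ext; [|apply (cf_rec 0 (fun xs => 0) (fun xs => S (nth 0 xs 0) + nth 1 xs 0));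
      [apply cf_zero | apply (cf_add _ (fun xs => S (nth 0 xs 0)) (fun xs => nth 1 xs 0));
         [apply cf_S|]; apply cf_proj; lia]].
    cf_list. induction x; simpl; auto. }
  apply (cf_comp1 k _ f A Hf).
Qed.

Lemma cp_tri x y : cp x y = y + tri (y + x).
Proof. reflexivity. Qed.

Lemma cf_cp k f g : computable_fun k f -> computable_fun k g ->
  computable_fun k (fun xs => cp (f xs) (g xs)).
Proof.
  intros Hf Hg. eapply cf_ext; [intros; symmetry; apply cp_tri|].
  apply cf_add; auto. apply (cf_tri k (fun xs => g xs + f xs)). now apply cf_add.
Qed.

Lemma tri_S n : tri (S n) = S n + tri n.
Proof. reflexivity. Qed.

Lemma tri_mono m n : m <= n -> tri m <= tri n.
Proof. induction 1; auto. rewrite tri_S. lia. Qed.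

(** The sum of the two components is the least [s] with [z < tri (S s)], hence found by search; both
    projections then follow by subtraction. *)
Lemma cf_csum : computable_fun 1 (fun xs => c1 (hd 0 xs) + c2 (hd 0 xs)).
Proof.
  apply (cf_mu 1 (fun xs => S (nth 1 xs 0) - tri (S (nth 0 xs 0)))).
  - apply cf_sub; [apply cf_S, cf_proj; lia|].
    apply (cf_tri 2 (fun xs => S (nth 0 xs 0))). apply cf_S, cf_proj; lia.
  - intros [|z [|]] L; simpl in L; try discriminate. cbn [hd nth].
    pose proof (cp_c z) as E. rewrite cp_tri in E.
    set (x := c1 z) in *. set (y := c2 z) in *. rewrite (Nat.add_comm x y). split.
    + rewrite tri_S. lia.
    + intros s Hs. pose proof (tri_mono (S s) (y + x) Hs). lia.
Qed.

Lemma K0_c2 : K0 c2.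
Proof.
  eapply (cf_ext 1 (fun xs => hd 0 xs - tri (c1 (hd 0 xs) + c2 (hd 0 xs)))).
  - cf_list. pose proof (cp_c x) as E. rewrite cp_tri in E. rewrite Nat.add_comm. lia.
  - apply cf_sub; [eapply cf_ext; [|apply (cf_proj 1 0); lia]; cf_list; auto|].
    apply (cf_tri 1 (fun xs => c1 (hd 0 xs) + c2 (hd 0 xs))). apply cf_csum.
Qed.

Lemma K0_c1 : K0 c1.
Proof.
  eapply (cf_ext 1 (fun xs => (c1 (hd 0 xs) + c2 (hd 0 xs)) - c2 (hd 0 xs))).
  - cf_list. lia.
  - apply cf_sub; [apply cf_csum | apply K0_c2].
Qed.

Lemma K0_app k f g : K0 f -> computable_fun k g -> computable_fun k (fun xs => f (g xs)).
Proof. intros Hf Hg. exact (cf_comp1 k _ g Hf Hg). Qed.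

Lemma K0_class : CClass K0.
Proof.
  constructor.
  - intros f g E. apply cf_ext. intros. apply E.
  - eapply cf_ext; [|apply (cf_proj 1 0); lia]. cf_list. auto.
  - apply cf_zero.
  - eapply cf_ext; [|apply (cf_S 1 (fun xs => nth 0 xs 0)), cf_proj; lia]. cf_list. auto.
  - intros f g Hf Hg. apply (K0_app 1 f (fun xs => g (hd 0 xs)) Hf Hg).
  - intros f g Hf Hg. now apply cf_cp.
  - apply K0_c1.
  - apply K0_c2.
  - intros f g Hf Hg.
    assert (A : computable_fun 2 (fun xs => nat_rect (fun _ => nat) (f (nth 1 xs 0))
                  (fun i r => g (cp (nth 1 xs 0) (cp i r))) (nth 0 xs 0))).
    { eapply cf_ext; [|apply (cf_rec 1 (fun xs => f (nth 0 xs 0))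
         (fun xs => g (cp (nth 2 xs 0) (cp (nth 0 xs 0) (nth 1 xs 0)))))].
      - cf_list. auto.
      - apply K0_app; auto. apply cf_proj; lia.
      - apply K0_app; auto. apply cf_cp; [apply cf_proj; lia|].
        apply cf_cp; apply cf_proj; lia. }
    exact (cf_comp2 1 _ _ _ A K0_c2 K0_c1).
  - intros f h Hf Hh.
    apply (cf_mu 1 (fun xs => f (cp (nth 1 xs 0) (nth 0 xs 0)))).
    + apply K0_app; auto. apply cf_cp; apply cf_proj; lia.
    + intros [|z [|]] L; simpl in L; try discriminate. apply Hh.
Qed.

(** * Encodable types *)

(** A bijection with [nat] and not just an injection, so that on codes both [enc] and [dec] are the
    identity and no test for being a code is needed. *)
Class Enc (X : Type) := {
  enc : X -> nat;
  dec : nat -> X;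
  dec_enc : forall x, dec (enc x) = x;
  enc_dec : forall n, enc (dec n) = n
}.

#[export] Instance Enc_nat : Enc nat.
Proof. refine {| enc := fun x => x; dec := fun x => x |}; auto. Defined.

#[export] Instance Enc_prod {X Y} `{Enc X} `{Enc Y} : Enc (X * Y).
Proof.
  refine {| enc := fun q => cp (enc (fst q)) (enc (snd q));
            dec := fun n => (dec (c1 n), dec (c2 n)) |}.
  - intros [x y]. simpl. now rewrite c1_cp, c2_cp, !dec_enc.
  - intros n. simpl. rewrite !enc_dec. apply cp_c.
Defined.

Fixpoint encl {X} `{Enc X} (l : list X) : nat :=
  match l with [] => 0 | x :: l => S (cp (enc x) (encl l)) end.

(** The code of a tail is smaller but not structurally so; the fuel bounds the depth, and by [cp_le]
    the code itself is always enough fuel. *)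
Fixpoint decl {X} `{Enc X} (fuel n : nat) : list X :=
  match fuel, n with
  | S fuel, S n => dec (c1 n) :: decl fuel (c2 n)
  | _, _ => []
  end.

Lemma decl_encl {X} `{Enc X} (l : list X) fuel : encl l <= fuel -> decl fuel (encl l) = l.
Proof.
  revert fuel. induction l as [|x l IH]; intros [|fuel] L; simpl in *; try lia; auto.
  rewrite c1_cp, c2_cp, dec_enc, IH; auto.
  pose proof (cp_le (enc x) (encl l)). lia.
Qed.

Lemma encl_decl {X} `{Enc X} fuel n : n <= fuel -> encl (decl fuel n : list X) = n.
Proof.
  revert n. induction fuel as [|fuel IH]; intros [|n] L; simpl; auto; try lia.
  pose proof (cp_le (c1 n) (c2 n)) as B. rewrite cp_c in B.
  rewrite enc_dec, IH by lia. now rewrite cp_c.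
Qed.

#[export] Instance Enc_list {X} `{Enc X} : Enc (list X).
Proof.
  refine {| enc := encl; dec := fun n => decl n n |}.
  - intros l. now apply decl_encl.
  - intros n. now apply encl_decl.
Defined.

Lemma length_le_enc {X} `{Enc X} (l : list X) : length l <= enc l.
Proof.
  simpl. induction l as [|x l IH]; simpl; auto. pose proof (cp_le (enc x) (encl l)). lia.
Qed.

Definition Comp (K : (nat -> nat) -> Prop) {X Y} `{Enc X} `{Enc Y} (f : X -> Y) : Prop :=
  K (fun n => enc (f (dec n))).

Definition CompB (K : (nat -> nat) -> Prop) {X} `{Enc X} (f : X -> bool) : Prop :=
  Comp K (fun x => Nat.b2n (f x)).

Definition iterate {Y} (n : nat) (f : Y -> Y) (y : Y) : Y :=
  nat_rect (fun _ => Y) y (fun _ r => f r) n.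

Lemma iterate_S {Y} n f (y : Y) : iterate (S n) f y = f (iterate n f y).
Proof. reflexivity. Qed.

Lemma iterate_S' {Y} n f (y : Y) : iterate (S n) f y = iterate n f (f y).
Proof. induction n; auto. rewrite iterate_S, IHn. reflexivity. Qed.

(* The bounded search [bmu n f] returns [n] when no smaller argument satisfies [f]. *)
Fixpoint bmu (n : nat) (f : nat -> bool) : nat :=
  match n with
  | 0 => 0
  | S n => let r := bmu n f in if r <? n then r else if f n then n else S n
  end.

Lemma bmu_le n f : bmu n f <= n.
Proof.
  induction n; simpl; auto. destruct (Nat.ltb_spec (bmu n f) n); [lia|]. destruct (f n); lia.
Qed.

Lemma bmu_least n f y : y < bmu n f -> f y = false.
Proof.
  revert y. induction n; simpl; intros y L; [lia|].
  destruct (Nat.ltb_spec (bmu n f) n); [auto|]. pose proof (bmu_le n f).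
  destruct (f n) eqn:E; [apply IHn; lia|].
  destruct (Nat.eq_dec y n) as [->|]; auto. apply IHn. lia.
Qed.

Lemma bmu_true n f : bmu n f < n -> f (bmu n f) = true.
Proof.
  induction n; simpl; intros L; [lia|].
  destruct (Nat.ltb_spec (bmu n f) n); [auto|]. destruct (f n) eqn:E; [auto|lia].
Qed.

Lemma bmu_found n f y : y < n -> f y = true -> bmu n f <= y.
Proof.
  intros L E. destruct (Nat.le_gt_cases (bmu n f) y); auto.
  rewrite (bmu_least n f y) in E; easy.
Qed.

Definition bex (n : nat) (f : nat -> bool) : bool := bmu n f <? n.

Lemma bex_spec n f : bex n f = true <-> exists y, y < n /\ f y = true.
Proof.
  unfold bex. rewrite Nat.ltb_lt. split.
  - intros L. exists (bmu n f). split; auto. now apply bmu_true.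
  - intros (y & L & E). pose proof (bmu_found n f y L E). lia.
Qed.

Definition ball (n : nat) (f : nat -> bool) : bool := negb (bex n (fun y => negb (f y))).

Lemma ball_spec n f : ball n f = true <-> forall y, y < n -> f y = true.
Proof.
  unfold ball. rewrite Bool.negb_true_iff, <- Bool.not_true_iff_false, bex_spec. split.
  - intros H y L. destruct (f y) eqn:E; auto. destruct H. exists y. now rewrite E.
  - intros H (y & L & E). rewrite H in E; easy.
Qed.

Section Closure.
Context (K : (nat -> nat) -> Prop) {HK : CClass K}.

Lemma Comp_ext {X Y} `{Enc X} `{Enc Y} (f g : X -> Y) :
  (forall x, f x = g x) -> Comp K f -> Comp K g.
Proof. intros E. apply (K_ext K HK). intros. now rewrite E. Qed.

Lemma Comp_app {X Y Z} `{Enc X} `{Enc Y} `{Enc Z} (g : Y -> Z) (f : X -> Y) :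
  Comp K g -> Comp K f -> Comp K (fun x => g (f x)).
Proof.
  intros Hg Hf. eapply (K_ext K HK); [|apply (K_comp K HK _ _ Hg Hf)].
  intros n. simpl. now rewrite dec_enc.
Qed.

Lemma K_const n : K (fun _ => n).
Proof.
  induction n; [apply (K_O K HK)|]. apply (K_comp K HK S _ (K_S K HK) IHn).
Qed.

Lemma Comp_const {X Y} `{Enc X} `{Enc Y} (y : Y) : Comp K (fun _ : X => y).
Proof. exact (K_const (enc y)). Qed.

Lemma Comp_id {X} `{Enc X} : Comp K (fun x : X => x).
Proof. eapply (K_ext K HK); [|apply (K_id K HK)]. intros. now rewrite enc_dec. Qed.

Lemma Comp_enc {X} `{Enc X} : Comp K (fun x : X => enc x).
Proof. eapply (K_ext K HK); [|apply (K_id K HK)]. intros. now rewrite <- (enc_dec x) at 1. Qed.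

Lemma Comp_dec {X} `{Enc X} : Comp K (fun n : nat => dec n : X).
Proof. exact Comp_enc. Qed.

Lemma Comp_pair {X Y Z} `{Enc X} `{Enc Y} `{Enc Z} (f : X -> Y) (g : X -> Z) :
  Comp K f -> Comp K g -> Comp K (fun x => (f x, g x)).
Proof. intros Hf Hg. exact (K_pair K HK _ _ Hf Hg). Qed.

Lemma Comp_fst {X Y Z} `{Enc X} `{Enc Y} `{Enc Z} (f : X -> Y * Z) :
  Comp K f -> Comp K (fun x => fst (f x)).
Proof.
  apply (Comp_app fst). eapply (K_ext K HK); [|apply (K_c1 K HK)].
  intros n. simpl. now rewrite enc_dec.
Qed.

Lemma Comp_snd {X Y Z} `{Enc X} `{Enc Y} `{Enc Z} (f : X -> Y * Z) :
  Comp K f -> Comp K (fun x => snd (f x)).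
Proof.
  apply (Comp_app snd). eapply (K_ext K HK); [|apply (K_c2 K HK)].
  intros n. simpl. now rewrite enc_dec.
Qed.

Lemma Comp_S {X} `{Enc X} (f : X -> nat) : Comp K f -> Comp K (fun x => S (f x)).
Proof. apply (Comp_app S). apply (K_S K HK). Qed.

Lemma Comp_cp {X} `{Enc X} (f g : X -> nat) :
  Comp K f -> Comp K g -> Comp K (fun x => cp (f x) (g x)).
Proof. intros Hf Hg. exact (K_pair K HK _ _ Hf Hg). Qed.

Lemma Comp_c1 {X} `{Enc X} (f : X -> nat) : Comp K f -> Comp K (fun x => c1 (f x)).
Proof. apply (Comp_app c1). apply (K_c1 K HK). Qed.

Lemma Comp_c2 {X} `{Enc X} (f : X -> nat) : Comp K f -> Comp K (fun x => c2 (f x)).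
Proof. apply (Comp_app c2). apply (K_c2 K HK). Qed.

Lemma Comp_rec {X Y} `{Enc X} `{Enc Y} (n : X -> nat) (a : X -> Y) (g : X -> nat -> Y -> Y) :
  Comp K n -> Comp K a -> Comp K (fun q : X * (nat * Y) => g (fst q) (fst (snd q)) (snd (snd q))) ->
  Comp K (fun x => nat_rect (fun _ => Y) (a x) (g x) (n x)).
Proof.
  intros Hn Ha Hg.
  pose proof (K_rec K HK _ _ Ha Hg) as R.
  pose proof (K_comp K HK _ _ R (K_pair K HK _ _ (K_id K HK) Hn)) as R'.
  eapply (K_ext K HK); [|exact R']. intros x. cbn beta. rewrite c1_cp, c2_cp.
  change (enc (n (dec x))) with (n (dec x)). induction (n (dec x)) as [|m IH]; [reflexivity|].
  cbn [nat_rect]. rewrite IH. simpl. rewrite !c1_cp, !c2_cp, !c1_cp, ?c2_cp, dec_enc. reflexivity.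
Qed.

Lemma Comp_iterate {X Y} `{Enc X} `{Enc Y} (n : X -> nat) (g : X -> Y -> Y) (a : X -> Y) :
  Comp K n -> Comp K a -> Comp K (fun q : X * Y => g (fst q) (snd q)) ->
  Comp K (fun x => iterate (n x) (g x) (a x)).
Proof.
  intros Hn Ha Hg. apply (Comp_rec n a (fun x _ r => g x r)); auto.
  apply (Comp_app (fun q : X * Y => g (fst q) (snd q)) (fun q : X * (nat * Y) => (fst q, snd (snd q)))); auto.
  apply Comp_pair; [apply Comp_fst, Comp_id | apply Comp_snd, Comp_snd, Comp_id].
Qed.

Lemma Comp_natcase {X Y} `{Enc X} `{Enc Y} (n : X -> nat) (a : X -> Y) (g : X -> nat -> Y) :
  Comp K n -> Comp K a -> Comp K (fun q : X * nat => g (fst q) (snd q)) ->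
  Comp K (fun x => match n x with 0 => a x | S m => g x m end).
Proof.
  intros Hn Ha Hg.
  apply (Comp_ext (fun x => nat_rect (fun _ => Y) (a x) (fun i _ => g x i) (n x))).
  - intros x. now destruct (n x).
  - apply Comp_rec; auto.
    apply (Comp_app (fun q : X * nat => g (fst q) (snd q)) (fun q : X * (nat * Y) => (fst q, fst (snd q)))); auto.
    apply Comp_pair; [apply Comp_fst, Comp_id | apply Comp_fst, Comp_snd, Comp_id].
Qed.

Lemma Comp_if {X Y} `{Enc X} `{Enc Y} (b : X -> bool) (f g : X -> Y) :
  CompB K b -> Comp K f -> Comp K g -> Comp K (fun x => if b x then f x else g x).
Proof.
  intros Hb Hf Hg.
  apply (Comp_ext (fun x => match Nat.b2n (b x) with 0 => g x | S _ => f x end)).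
  - intros x. now destruct (b x).
  - apply (Comp_natcase _ _ (fun x _ => f x)); auto.
    apply (Comp_app f fst); auto. apply Comp_fst, Comp_id.
Qed.

Lemma Comp_pred {X} `{Enc X} (f : X -> nat) : Comp K f -> Comp K (fun x => pred (f x)).
Proof.
  intros Hf. eapply Comp_ext; [|apply (Comp_natcase f (fun _ => 0) (fun _ m => m)); auto].
  - intros x. simpl. now destruct (f x).
  - apply Comp_const.
  - apply Comp_snd, Comp_id.
Qed.

Lemma Comp_add {X} `{Enc X} (f g : X -> nat) :
  Comp K f -> Comp K g -> Comp K (fun x => f x + g x).
Proof.
  intros Hf Hg. apply (Comp_ext (fun x => iterate (f x) S (g x))).
  - intros x. induction (f x) as [|m IH]; auto. rewrite iterate_S, IH. reflexivity.
  - apply (Comp_iterate f (fun _ => S)); auto. apply Comp_S, Comp_snd, Comp_id.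
Qed.

Lemma Comp_sub {X} `{Enc X} (f g : X -> nat) :
  Comp K f -> Comp K g -> Comp K (fun x => f x - g x).
Proof.
  intros Hf Hg. apply (Comp_ext (fun x => iterate (g x) pred (f x))).
  - intros x. induction (g x) as [|m IH]; [unfold iterate; simpl; lia|].
    rewrite iterate_S, IH. lia.
  - apply (Comp_iterate g (fun _ => pred)); auto. apply Comp_pred, Comp_snd, Comp_id.
Qed.

Lemma Comp_mul {X} `{Enc X} (f g : X -> nat) :
  Comp K f -> Comp K g -> Comp K (fun x => f x * g x).
Proof.
  intros Hf Hg. apply (Comp_ext (fun x => iterate (f x) (fun r => g x + r) 0)).
  - intros x. induction (f x) as [|m IH]; auto. rewrite iterate_S, IH. reflexivity.
  - apply (Comp_iterate f (fun x r => g x + r)); auto; [apply Comp_const|].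
    apply Comp_add; [apply (Comp_app g fst); auto; apply Comp_fst, Comp_id | apply Comp_snd, Comp_id].
Qed.

Lemma Comp_pow {X} `{Enc X} (f g : X -> nat) :
  Comp K f -> Comp K g -> Comp K (fun x => f x ^ g x).
Proof.
  intros Hf Hg. apply (Comp_ext (fun x => iterate (g x) (fun r => f x * r) 1)).
  - intros x. induction (g x) as [|m IH]; auto. rewrite iterate_S, IH. reflexivity.
  - apply (Comp_iterate g (fun x r => f x * r)); auto; [apply Comp_const|].
    apply Comp_mul; [apply (Comp_app f fst); auto; apply Comp_fst, Comp_id | apply Comp_snd, Comp_id].
Qed.

Lemma CompB_const {X} `{Enc X} (b : bool) : CompB K (fun _ : X => b).
Proof. apply (Comp_const (Nat.b2n b)). Qed.

Lemma CompB_leb {X} `{Enc X} (f g : X -> nat) :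
  Comp K f -> Comp K g -> CompB K (fun x => f x <=? g x).
Proof.
  intros Hf Hg. apply (Comp_ext (fun x => match f x - g x with 0 => 1 | S _ => 0 end)).
  - intros x. destruct (Nat.leb_spec (f x) (g x)) as [L|L]; destruct (f x - g x) eqn:E; simpl; auto; lia.
  - apply (Comp_natcase _ _ (fun _ _ => 0)); [now apply Comp_sub | apply Comp_const | apply Comp_const].
Qed.

Lemma CompB_ltb {X} `{Enc X} (f g : X -> nat) :
  Comp K f -> Comp K g -> CompB K (fun x => f x <? g x).
Proof. intros Hf Hg. apply (CompB_leb (fun x => S (f x))); auto. now apply Comp_S. Qed.

Lemma CompB_ite {X} `{Enc X} (b f g : X -> bool) :
  CompB K b -> CompB K f -> CompB K g -> CompB K (fun x => if b x then f x else g x).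
Proof.
  intros Hb Hf Hg. eapply Comp_ext; [|apply (Comp_if b _ _ Hb Hf Hg)].
  intros x. simpl. now destruct (b x).
Qed.

Lemma CompB_negb {X} `{Enc X} (f : X -> bool) : CompB K f -> CompB K (fun x => negb (f x)).
Proof. intros Hf. apply (CompB_ite f (fun _ => false) (fun _ => true)); auto; apply CompB_const. Qed.

Lemma CompB_andb {X} `{Enc X} (f g : X -> bool) :
  CompB K f -> CompB K g -> CompB K (fun x => f x && g x)%bool.
Proof. intros Hf Hg. apply (CompB_ite f g (fun _ => false)); auto; apply CompB_const. Qed.

Lemma CompB_orb {X} `{Enc X} (f g : X -> bool) :
  CompB K f -> CompB K g -> CompB K (fun x => f x || g x)%bool.
Proof. intros Hf Hg. apply (CompB_ite f (fun _ => true) g); auto; apply CompB_const. Qed.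

Lemma CompB_eqb {X} `{Enc X} (f g : X -> nat) :
  Comp K f -> Comp K g -> CompB K (fun x => f x =? g x).
Proof.
  intros Hf Hg. apply (Comp_ext (fun x => Nat.b2n ((f x <=? g x) && (g x <=? f x))%bool)).
  - intros x. destruct (Nat.eqb_spec (f x) (g x)), (Nat.leb_spec (f x) (g x)),
      (Nat.leb_spec (g x) (f x)); simpl; auto; lia.
  - now apply (CompB_andb (fun x => f x <=? g x)); apply CompB_leb.
Qed.

Lemma CompB_app {X Y} `{Enc X} `{Enc Y} (g : Y -> bool) (f : X -> Y) :
  CompB K g -> Comp K f -> CompB K (fun x => g (f x)).
Proof. intros Hg Hf. exact (Comp_app _ f Hg Hf). Qed.

Lemma Comp_bmu {X} `{Enc X} (n : X -> nat) (f : X -> nat -> bool) :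
  Comp K n -> CompB K (fun q : X * nat => f (fst q) (snd q)) ->
  Comp K (fun x => bmu (n x) (f x)).
Proof.
  intros Hn Hf.
  apply (Comp_ext (fun x => nat_rect (fun _ => nat) 0
     (fun m r => if r <? m then r else if f x m then m else S m) (n x))).
  - intros x. induction (n x) as [|m IH]; auto. simpl. now rewrite IH.
  - apply (Comp_rec n (fun _ => 0) (fun x m r => if r <? m then r else if f x m then m else S m)); auto;
      [apply Comp_const|].
    assert (H1 : Comp K (fun q : X * (nat * nat) => snd (snd q))) by apply Comp_snd, Comp_snd, Comp_id.
    assert (H2 : Comp K (fun q : X * (nat * nat) => fst (snd q))) by apply Comp_fst, Comp_snd, Comp_id.
    apply Comp_if; [now apply CompB_ltb | auto |]. apply Comp_if; auto; [|now apply Comp_S].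
    apply (CompB_app (fun q : X * nat => f (fst q) (snd q)) (fun q : X * (nat * nat) => (fst q, fst (snd q)))); auto.
    apply Comp_pair; auto. apply Comp_fst, Comp_id.
Qed.

Lemma CompB_bex {X} `{Enc X} (n : X -> nat) (f : X -> nat -> bool) :
  Comp K n -> CompB K (fun q : X * nat => f (fst q) (snd q)) ->
  CompB K (fun x => bex (n x) (f x)).
Proof. intros Hn Hf. apply CompB_ltb; auto. now apply Comp_bmu. Qed.

Lemma CompB_ball {X} `{Enc X} (n : X -> nat) (f : X -> nat -> bool) :
  Comp K n -> CompB K (fun q : X * nat => f (fst q) (snd q)) ->
  CompB K (fun x => ball (n x) (f x)).
Proof.
  intros Hn Hf. apply CompB_negb. apply (CompB_bex n (fun x y => negb (f x y))); auto.
  now apply CompB_negb.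
Qed.

Lemma Comp_mu {X} `{Enc X} (f : X -> nat -> bool) (h : X -> nat) :
  CompB K (fun q : X * nat => f (fst q) (snd q)) ->
  (forall x, f x (h x) = true /\ forall y, y < h x -> f x y = false) -> Comp K h.
Proof.
  intros Hf Hh. apply CompB_negb in Hf.
  apply (K_mu K HK _ _ Hf). intros n. simpl. rewrite c1_cp, c2_cp.
  destruct (Hh (dec n)) as [E L]. rewrite E. split; auto.
  intros y Hy. rewrite c1_cp, c2_cp, L; auto.
Qed.

Lemma Comp_mu_ex {X} `{Enc X} (f : X -> nat -> bool) :
  CompB K (fun q : X * nat => f (fst q) (snd q)) -> (forall x, exists y, f x y = true) ->
  exists h, Comp K h /\ forall x, f x (h x) = true.
Proof.
  intros Hf Ex.
  assert (Min : forall x, exists y, f x y = true /\ forall y', y' < y -> f x y' = false).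
  { intros x. destruct (Ex x) as [y Hy]. exists (bmu (S y) (f x)). split.
    - apply bmu_true. pose proof (bmu_found (S y) (f x) y ltac:(lia) Hy). lia.
    - intros y'. apply bmu_least. }
  destruct (fun_choice _ Min) as [r Hr]. exists r. split; [now apply (Comp_mu f) | apply Hr].
Qed.

Lemma Comp_div {X} `{Enc X} (f g : X -> nat) :
  Comp K f -> Comp K g -> Comp K (fun x => f x / g x).
Proof.
  intros Hf Hg.
  (* The first branch reproduces the convention that a quotient by 0 is 0. If the bounded search
     fails, its default [f x] is the right quotient, as then [g x = 1] or [f x = 0]. *)
  apply (Comp_ext (fun x => if g x =? 0 then 0 else bmu (f x) (fun q => f x <? g x * S q))).
  - intros x. destruct (Nat.eqb_spec (g x) 0) as [->|N]; auto.
    set (q := bmu _ _).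
    pose proof (Nat.div_mod (f x) (g x) N) as D.
    pose proof (Nat.mod_upper_bound (f x) (g x) N) as U.
    assert (f x / g x <= f x) by (apply Nat.Div0.div_le_upper_bound; nia).
    destruct (Nat.lt_trichotomy q (f x / g x)) as [L|[L|L]]; auto.
    + assert (T : (f x <? g x * S q) = true) by (apply (bmu_true (f x) (fun q => f x <? g x * S q)); fold q; lia).
      apply Nat.ltb_lt in T. nia.
    + pose proof (bmu_least (f x) (fun q => f x <? g x * S q) _ L) as T. apply Nat.ltb_ge in T. nia.
  - apply Comp_if; [apply CompB_eqb; auto; apply Comp_const | apply Comp_const|].
    apply (Comp_bmu f (fun x q => f x <? g x * S q)); auto. apply CompB_ltb.
    + apply (Comp_app f fst); auto. apply Comp_fst, Comp_id.
    + apply Comp_mul; [apply (Comp_app g fst); auto; apply Comp_fst, Comp_id|].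
      apply Comp_S, Comp_snd, Comp_id.
Qed.

Lemma Comp_mod {X} `{Enc X} (f g : X -> nat) :
  Comp K f -> Comp K g -> Comp K (fun x => f x mod g x).
Proof.
  intros Hf Hg. apply (Comp_ext (fun x => f x - g x * (f x / g x))).
  - intros x. destruct (Nat.eq_dec (g x) 0) as [->|N]; [simpl; lia|].
    pose proof (Nat.div_mod (f x) (g x) N). lia.
  - apply Comp_sub; auto. apply Comp_mul; auto. now apply Comp_div.
Qed.

Lemma Comp_max {X} `{Enc X} (f g : X -> nat) :
  Comp K f -> Comp K g -> Comp K (fun x => Nat.max (f x) (g x)).
Proof.
  intros Hf Hg. apply (Comp_ext (fun x => if f x <=? g x then g x else f x)).
  - intros x. destruct (Nat.leb_spec (f x) (g x)); lia.
  - apply Comp_if; auto. now apply CompB_leb.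
Qed.

Lemma Comp_cons {X Y} `{Enc X} `{Enc Y} (f : X -> Y) (g : X -> list Y) :
  Comp K f -> Comp K g -> Comp K (fun x => f x :: g x).
Proof.
  intros Hf Hg. exact (K_comp K HK S _ (K_S K HK) (K_pair K HK _ _ Hf Hg)).
Qed.

Lemma Comp_listcase {X Y Z} `{Enc X} `{Enc Y} `{Enc Z} (l : X -> list Y) (a : X -> Z)
    (g : X -> Y -> list Y -> Z) :
  Comp K l -> Comp K a -> Comp K (fun q : X * (Y * list Y) => g (fst q) (fst (snd q)) (snd (snd q))) ->
  Comp K (fun x => match l x with [] => a x | h :: t => g x h t end).
Proof.
  intros Hl Ha Hg.
  apply (Comp_ext (fun x => match enc (l x) with 0 => a x | S m => g x (dec (c1 m)) (dec (c2 m)) end)).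
  - intros x. destruct (l x) as [|y t]; simpl; auto. rewrite c1_cp, c2_cp, dec_enc, (decl_encl t) by auto. auto.
  - apply (Comp_natcase (fun x => enc (l x)) a (fun x m => g x (dec (c1 m)) (dec (c2 m)))); auto.
Qed.

(** The step is iterated as often as the code of the list says, which is at least its length; the
    surplus steps meet the empty list and change nothing. *)
Lemma Comp_fold {X Y Z} `{Enc X} `{Enc Y} `{Enc Z} (l : X -> list Y) (a : X -> Z)
    (g : X -> Z -> Y -> Z) :
  Comp K l -> Comp K a -> Comp K (fun q : X * (Z * Y) => g (fst q) (fst (snd q)) (snd (snd q))) ->
  Comp K (fun x => fold_left (g x) (l x) (a x)).
Proof.
  intros Hl Ha Hg.
  pose (step := fun (x : X) (r : list Y * Z) =>
    match fst r with [] => r | y :: t => (t, g x (snd r) y) end).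
  apply (Comp_ext (fun x => snd (iterate (enc (l x)) (step x) (l x, a x)))).
  - intros x. pose proof (length_le_enc (l x)) as L. revert L.
    generalize (enc (l x)) as n. generalize (l x) as u, (a x) as z.
    induction u as [|y u IH]; intros z n L.
    + clear L. induction n; auto. rewrite iterate_S'. apply IHn.
    + simpl in L. destruct n; [lia|]. rewrite iterate_S'. simpl. apply IH. lia.
  - apply Comp_snd. apply (Comp_iterate (fun x => enc (l x)) step (fun x => (l x, a x))).
    + exact Hl.
    + now apply Comp_pair.
    + unfold step. apply (Comp_listcase (fun q : X * (list Y * Z) => fst (snd q)) (fun q => snd q)
          (fun q y t => (t, g (fst q) (snd (snd q)) y))).
      * apply Comp_fst, Comp_snd, Comp_id.
      * apply Comp_snd, Comp_id.
      * apply Comp_pair; [apply Comp_snd, Comp_snd, Comp_id|].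
        apply (Comp_app (fun q : X * (Z * Y) => g (fst q) (fst (snd q)) (snd (snd q)))
          (fun q : (X * (list Y * Z)) * (Y * list Y) => (fst (fst q), (snd (snd (fst q)), fst (snd q))))); auto.
        apply Comp_pair; [apply Comp_fst, Comp_fst, Comp_id|].
        apply Comp_pair; [apply Comp_snd, Comp_snd, Comp_fst, Comp_id | apply Comp_fst, Comp_snd, Comp_id].
Qed.

Definition Comp2 {X Y Z} `{Enc X} `{Enc Y} `{Enc Z} (f : X -> Y -> Z) : Prop :=
  Comp K (fun q : X * Y => f (fst q) (snd q)).

Definition Comp3 {W X Y Z} `{Enc W} `{Enc X} `{Enc Y} `{Enc Z} (f : W -> X -> Y -> Z) : Prop :=
  Comp K (fun q : W * (X * Y) => f (fst q) (fst (snd q)) (snd (snd q))).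

Lemma Comp_app2 {V X Y Z} `{Enc V} `{Enc X} `{Enc Y} `{Enc Z} (f : X -> Y -> Z)
    (a : V -> X) (b : V -> Y) :
  Comp2 f -> Comp K a -> Comp K b -> Comp K (fun v => f (a v) (b v)).
Proof.
  intros Hf Ha Hb. exact (Comp_app _ (fun v => (a v, b v)) Hf (Comp_pair a b Ha Hb)).
Qed.

Lemma Comp_app3 {V W X Y Z} `{Enc V} `{Enc W} `{Enc X} `{Enc Y} `{Enc Z} (f : W -> X -> Y -> Z)
    (a : V -> W) (b : V -> X) (c : V -> Y) :
  Comp3 f -> Comp K a -> Comp K b -> Comp K c -> Comp K (fun v => f (a v) (b v) (c v)).
Proof.
  intros Hf Ha Hb Hc.
  exact (Comp_app _ (fun v => (a v, (b v, c v))) Hf (Comp_pair _ _ Ha (Comp_pair _ _ Hb Hc))).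
Qed.

Definition CompB2 {X Y} `{Enc X} `{Enc Y} (f : X -> Y -> bool) : Prop :=
  CompB K (fun q : X * Y => f (fst q) (snd q)).

Lemma CompB_app2 {V X Y} `{Enc V} `{Enc X} `{Enc Y} (f : X -> Y -> bool)
    (a : V -> X) (b : V -> Y) :
  CompB2 f -> Comp K a -> Comp K b -> CompB K (fun v => f (a v) (b v)).
Proof.
  intros Hf Ha Hb. exact (CompB_app _ (fun v => (a v, b v)) Hf (Comp_pair a b Ha Hb)).
Qed.

Lemma Comp_b2n {X} `{Enc X} (f : X -> bool) : CompB K f -> Comp K (fun x => Nat.b2n (f x)).
Proof. auto. Qed.

End Closure.

(** A hook, redefined once the memory operations are available. *)
Ltac kc_user := fail.

#[global] Opaque cp c1 c2.

(** Hypotheses about functions are tried before the closure lemmas, so that a function already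
    treated is handled as a black box. *)
Ltac kc_step :=
  match goal with
  | |- CClass _ => typeclasses eauto
  | |- Enc _ => typeclasses eauto
  | H : Comp ?K ?f |- Comp ?K ?f => exact H
  | H : CompB ?K ?f |- CompB ?K ?f => exact H
  | |- Comp ?K (@fst ?X ?Y) => change (Comp K (fun q : X * Y => fst q))
  | |- Comp ?K (@snd ?X ?Y) => change (Comp K (fun q : X * Y => snd q))
  | |- Comp ?K S => change (Comp K (fun x : nat => S x))
  | |- Comp _ (fun x => x) => simple apply Comp_id
  | |- Comp _ (fun _ => ?c) => simple apply Comp_const
  | |- CompB _ (fun _ => ?c) => simple apply CompB_const
  | |- Comp2 _ _ => unfold Comp2; cbn beta
  | |- Comp3 _ _ => unfold Comp3; cbn beta
  | |- CompB2 _ _ => unfold CompB2; cbn beta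
  | _ => kc_user
  | H : Comp2 _ ?f |- Comp _ _ => eapply (Comp_app2 _ f _ _ H)
  | H : Comp3 _ ?f |- Comp _ _ => eapply (Comp_app3 _ f _ _ _ H)
  | H : CompB2 _ ?f |- CompB _ _ => eapply (CompB_app2 _ f _ _ H)
  | H : Comp _ ?f |- Comp _ _ => eapply (Comp_app _ f _ H)
  | H : CompB _ ?f |- CompB _ _ => eapply (CompB_app _ f _ H)
  | |- CompB _ _ => first [simple apply CompB_leb | simple apply CompB_ltb | simple apply CompB_eqb | simple apply CompB_negb
      | simple apply CompB_andb | simple apply CompB_orb | simple apply CompB_bex | simple apply CompB_ball | simple apply CompB_ite]
  | |- Comp _ _ => first [simple eapply Comp_fst | simple eapply Comp_snd | simple apply Comp_pair | simple apply Comp_S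
      | simple apply Comp_add | simple apply Comp_mul | simple apply Comp_sub | simple apply Comp_pow | simple apply Comp_div
      | simple apply Comp_mod | simple apply Comp_max | simple apply Comp_pred | simple apply Comp_cp | simple apply Comp_c1
      | simple apply Comp_c2 | simple apply Comp_cons | simple apply Comp_if | simple apply Comp_bmu | simple apply Comp_b2n
      | simple apply Comp_iterate | simple eapply Comp_fold | simple eapply Comp_listcase | simple apply Comp_natcase
      | simple apply Comp_rec ]
  end.

Ltac kc := repeat kc_step.

(** * Limits *)

Section Limits.
Context (K : (nat -> nat) -> Prop) {HK : CClass K}.

Lemma K_Lim f : K f -> Lim K f.
Proof.
  intros Hf. exists (fun z => f (c1 z)). split.
  - exact (K_comp K HK _ _ Hf (K_c1 K HK)).
  - intros x. exists 0. intros s _. now rewrite c1_cp.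
Qed.

Lemma eventually_all (P : nat -> nat -> Prop) n :
  (forall y, y < n -> exists s0, forall s, s0 <= s -> P y s) ->
  exists s0, forall s, s0 <= s -> forall y, y < n -> P y s.
Proof.
  induction n as [|n IH]; intros H.
  - exists 0. lia.
  - destruct IH as [s0 H0]; [auto|]. destruct (H n) as [s1 H1]; [lia|].
    exists (s0 + s1). intros s L y Hy. destruct (Nat.eq_dec y n) as [->|].
    + apply H1; lia. + apply H0; lia.
Qed.

(** All ingredients are approximated at one common stage [s], and finitely many of them have settled
    from some stage on. For a minimisation the search is bounded by [s], which finally exceeds the
    true value, and only the finitely many tests up to that value have to settle. *)
#[export] Instance Lim_class : CClass (Lim K).
Proof.
  constructor.
  - intros f g E [h [Hh C]]. exists h. split; auto. intros x. rewrite <- E. apply C.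
  - apply K_Lim, (K_id K HK).
  - apply K_Lim, (K_O K HK).
  - apply K_Lim, (K_S K HK).
  - intros f g [F [HF CF]] [G [HG CG]].
    exists (fun z => F (cp (G z) (c2 z))). split.
    + change (Comp K F) in HF. change (Comp K G) in HG.
      enough (Comp K (fun z => F (cp (G z) (c2 z)))) by auto. kc.
    + intros x. destruct (CG x) as [s0 H0], (CF (g x)) as [s1 H1]. exists (s0 + s1).
      intros s L. rewrite c2_cp, H0, H1 by lia. auto.
  - intros f g [F [HF CF]] [G [HG CG]].
    exists (fun z => cp (F z) (G z)). split; [now apply (K_pair K HK)|].
    intros x. destruct (CG x) as [s0 H0], (CF x) as [s1 H1]. exists (s0 + s1).
    intros s L. rewrite H0, H1 by lia. auto.
  - apply K_Lim, (K_c1 K HK).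
  - apply K_Lim, (K_c2 K HK).
  - intros f g [F [HF CF]] [G [HG CG]].
    exists (fun w => nat_rect (fun _ => nat) (F (cp (c1 (c1 w)) (c2 w)))
        (fun i r => G (cp (cp (c1 (c1 w)) (cp i r)) (c2 w))) (c2 (c1 w))). split.
    + change (Comp K F) in HF. change (Comp K G) in HG.
      enough (Comp K (fun w => nat_rect (fun _ => nat) (F (cp (c1 (c1 w)) (c2 w)))
        (fun i r => G (cp (cp (c1 (c1 w)) (cp i r)) (c2 w))) (c2 (c1 w)))) by auto. kc.
    + intros z.
      enough (exists s0, forall s, s0 <= s -> nat_rect (fun _ => nat) (F (cp (c1 z) s))
        (fun i r => G (cp (cp (c1 z) (cp i r)) s)) (c2 z) = nat_rect (fun _ => nat) (f (c1 z))
        (fun i r => g (cp (c1 z) (cp i r))) (c2 z)) as [s0 H0].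
      { exists s0. intros s L. rewrite c1_cp, c2_cp. now apply H0. }
      induction (c2 z) as [|n [s0 IH]]; simpl.
      * destruct (CF (c1 z)) as [s0 H0]. exists s0. auto.
      * set (r := nat_rect _ _ _ n) in *.
        destruct (CG (cp (c1 z) (cp n r))) as [s1 H1]. exists (s0 + s1). intros s L.
        rewrite IH by lia. apply H1. lia.
  - intros f h [F [HF CF]] Hh.
    exists (fun w => bmu (c2 w) (fun y => F (cp (cp (c1 w) y) (c2 w)) =? 0)). split.
    + change (Comp K F) in HF.
      enough (Comp K (fun w => bmu (c2 w) (fun y => F (cp (cp (c1 w) y) (c2 w)) =? 0))) by auto. kc.
    + intros x. destruct (Hh x) as [E M].
      destruct (eventually_all (fun y s => F (cp (cp x y) s) = f (cp x y)) (S (h x))) as [s0 H0].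
      { intros y _. apply CF. }
      exists (s0 + S (h x)). intros s L. rewrite c1_cp, c2_cp.
      set (b := bmu _ _).
      assert (b <= h x).
      { apply bmu_found; [lia|]. apply Nat.eqb_eq. rewrite H0 by lia. auto. }
      assert (T : (F (cp (cp x b) s) =? 0) = true).
      { apply (bmu_true s (fun y => F (cp (cp x y) s) =? 0)). fold b. lia. }
      apply Nat.eqb_eq in T. rewrite H0 in T by lia.
      destruct (Nat.eq_dec b (h x)); auto. destruct (M b); auto. lia.
Qed.

(** An existential quantifier costs one limit: the search bounded by the stage changes its answer at
    most once. *)
Lemma CompB_Lim_ex {X} `{Enc X} (f : X -> nat -> bool) (P : X -> Prop) :
  CompB2 K f -> (forall x, P x <-> exists y, f x y = true) ->
  exists g, CompB (Lim K) g /\ forall x, P x <-> g x = true.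
Proof.
  intros Hf HP.
  exists (fun x => if excluded_middle_informative (P x) then true else false). split.
  - exists (fun z => Nat.b2n (bex (c2 z) (f (dec (c1 z))))). split.
    + pose proof (Comp_dec K (X := X)) as D.
      enough (Comp K (fun z : nat => Nat.b2n (bex (c2 z) (f (dec (c1 z)))))) by auto.
      kc.
    + intros n. destruct (excluded_middle_informative _) as [Q|Q].
      * apply HP in Q. destruct Q as [y E]. exists (S y). intros s L. rewrite c1_cp, c2_cp.
        replace (bex s (f (dec n))) with true; auto. symmetry. apply bex_spec. exists y. split; [lia|auto].
      * exists 0. intros s _. rewrite c1_cp, c2_cp.
        replace (bex s (f (dec n))) with false; auto. symmetry. apply Bool.not_true_is_false.
        rewrite bex_spec. intros (y & _ & E). apply Q, HP. eauto.
  - intros x. destruct (excluded_middle_informative (P x)); split; auto; easy.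
Qed.

End Limits.

Fixpoint LimN (n : nat) : (nat -> nat) -> Prop :=
  match n with 0 => K0 | S n => Lim (LimN n) end.

#[export] Existing Instance K0_class.

#[export] Instance LimN_class n : CClass (LimN n).
Proof. induction n; simpl; [apply K0_class | now apply Lim_class]. Qed.

Lemma Comp_Lim (K : (nat -> nat) -> Prop) {HK : CClass K} {X Y} `{Enc X} `{Enc Y} (f : X -> Y) :
  Comp K f -> Comp (Lim K) f.
Proof. apply (K_Lim K). Qed.

(** * The arithmetical hierarchy *)

(** A code of arity [k] takes its arguments separately, a member of a class takes one coded list;
    these codes translate between the two. *)
Lemma eval_projs k (l : nat) : exists cs, length cs = k /\
  forall e : nat, Forall2 (fun c y => eval c [e] y) cs
     (map (fun i => nth i (dec e : list nat) 0) (seq l k)).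
Proof.
  revert l. induction k as [|k IH]; intros l.
  - exists []. split; auto; intros; constructor.
  - destruct (IH (S l)) as [cs [L H]].
    assert (N : Comp K0 (fun e : nat => nth l (dec e : list nat) 0)).
    { apply (Comp_app _ (fun u : list nat => nth l u 0) (fun e : nat => dec e : list nat)).
      - clear. induction l as [|l IH].
        + apply (Comp_ext _ (fun u : list nat => match u with [] => 0 | h :: t => h end));
            [now intros [] | kc].
        + apply (Comp_ext _ (fun u : list nat => match u with [] => 0 | h :: t => nth l t 0 end));
            [now intros [] | kc].
      - exact (Comp_dec K0 (X := list nat)). }
    destruct N as [c Hc]. exists (c :: cs). split; [simpl; auto|].
    intros e. simpl. constructor; auto; now apply (Hc [e]).
Qed.

Lemma Sigma_LimN n : forall k R, Sigma n k R ->
  exists f : list nat -> bool, CompB (LimN n) f /\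
    forall xs, length xs = k -> (R xs <-> f xs = true).
Proof.
  induction n as [|n IH]; intros k R HR.
  - destruct HR as [c Hc].
    assert (exists y : list nat -> nat, forall xs, length xs = k -> eval c xs (y xs) /\ (R xs <-> y xs = 0)) as [y Hy].
    { exists (fun xs => match excluded_middle_informative (length xs = k) with
        | left L => proj1_sig (constructive_indefinite_description _ (Hc xs L)) | right _ => 0 end).
      intros xs L. destruct (excluded_middle_informative _) as [L'|]; [|easy].
      apply (proj2_sig (constructive_indefinite_description _ (Hc xs L'))). }
    (* Lists of another length are cut, or filled up with 0, so that the code [c] halts on every
       input and the function obtained is total. *)
    pose (trim := fun e : nat => map (fun i => nth i (dec e : list nat) 0) (seq 0 k)).
    assert (Y : Comp K0 (fun e : nat => y (trim e))).
    { destruct (eval_projs k 0) as [cs [L H]]. exists (CComp c cs).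
      intros [|e [|]] E; simpl in E; try discriminate. econstructor; [apply H|].
      apply Hy. rewrite length_map, length_seq. auto. }
    exists (fun xs => y (trim (enc xs)) =? 0). split.
    + apply (CompB_app _ (fun e : nat => y (trim e) =? 0) (fun xs : list nat => enc xs)); [kc | exact (Comp_enc K0)].
    + intros xs L. assert (T : trim (enc xs) = xs).
      { unfold trim. rewrite dec_enc, <- L. clear. 
        apply (nth_ext _ _ 0 0); rewrite length_map, length_seq; auto.
        intros i Hi. rewrite (nth_indep _ 0 (nth 0 xs 0)) by (rewrite length_map, length_seq; auto).
        rewrite (map_nth (fun i => nth i xs 0)), seq_nth; auto. }
      rewrite T, Nat.eqb_eq. now apply Hy.
  - destruct HR as (Q & HQ & E). apply IH in HQ. destruct HQ as (f & Hf & Sf).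
    destruct (CompB_Lim_ex (LimN n) (fun xs y => negb (f (y :: xs)))
                (fun xs => exists y, negb (f (y :: xs)) = true)) as (g & Hg & Sg).
    + kc.
    + reflexivity.
    + exists g. split; auto. intros xs L. rewrite E, <- Sg by auto.
      split; intros [y Hy]; exists y; specialize (Sf (y :: xs)); simpl in Sf.
      * destruct (f (y :: xs)); auto. destruct Sf; auto. now destruct H0.
      * apply NNPP. intros N. apply Sf in N; auto. now rewrite N in Hy.
Qed.

(** Witnesses for [S] and for its complement are searched simultaneously. The search always succeeds
    and its matrix lies in [LimN n], so the decision costs no further limit. *)
Lemma Delta_LimN n S : Delta_set (n + 1) S ->
  exists f : nat -> bool, CompB (LimN n) f /\ forall x, S x <-> f x = true.
Proof.
  intros [HS HP]. rewrite Nat.add_1_r in *.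
  destruct HS as (Q & HQ & E), HP as (Q' & HQ' & E').
  apply Sigma_LimN in HQ, HQ'. destruct HQ as (f & Hf & Sf), HQ' as (f' & Hf' & Sf').
  pose (t := fun x y : nat => (negb (f [y; x]) || negb (f' [y; x]))%bool).
  assert (Ex : forall x, exists y, t x y = true).
  { intros x. unfold t. destruct (classic (S x)) as [H|H].
    - apply (E [x]) in H; auto. destruct H as [y Hy]. exists y.
      destruct (f [y; x]) eqn:F; auto. apply Sf in F; easy.
    - apply (E' [x]) in H; auto. destruct H as [y Hy]. exists y.
      destruct (f' [y; x]) eqn:F; [|now rewrite Bool.orb_true_r]. apply Sf' in F; easy. }
  destruct (Comp_mu_ex (LimN n) t) as (h & C & Hh); auto; [unfold t; kc|].
  exists (fun x => negb (f [h x; x])). split; [kc|].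
  intros x. specialize (Sf [h x; x] eq_refl). specialize (Sf' [h x; x] eq_refl).
  specialize (Hh x) as T. unfold t in T.
  destruct (f [h x; x]); simpl in *.
  - split; [|easy]. intros H. destruct (f' [h x; x]); [easy|].
    exfalso. assert (Q' [h x; x]) by (apply NNPP; intros N; apply Sf' in N; easy).
    assert (~ S x) by (apply (E' [x]); eauto). auto.
  - split; auto. intros _. apply (E [x]); auto. exists (h x). apply NNPP. intros N. apply Sf in N. easy.
Qed.

(** * Abelian groups *)

Record Grp : Type := {
  car :> Type;
  gadd : car -> car -> car;
  g0 : car;
  gopp : car -> car;
  gaddA : forall x y z, gadd (gadd x y) z = gadd x (gadd y z);
  gaddC : forall x y, gadd x y = gadd y x;
  gadd0 : forall x, gadd g0 x = x;
  gaddN : forall x, gadd x (gopp x) = g0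
}.

Arguments gadd {g} x y.
Arguments g0 {g}.
Arguments gopp {g} x.

Declare Scope grp_scope.
Delimit Scope grp_scope with G.
Infix "⊕" := gadd (at level 50, left associativity) : grp_scope.
Notation "⊖ x" := (gopp x) (at level 35, right associativity) : grp_scope.
Notation "x ⊖ y" := (gadd x (gopp y)) (at level 50, left associativity) : grp_scope.
Open Scope grp_scope.

Definition nmul {G : Grp} (n : nat) (x : G) : G := Nat.iter n (gadd x) g0.

Definition zmul {G : Grp} (z : Z) (x : G) : G :=
  match z with
  | Z0 => g0
  | Zpos q => nmul (Pos.to_nat q) x
  | Zneg q => ⊖ nmul (Pos.to_nat q) x
  end.

Infix "•" := zmul (at level 40, no associativity) : grp_scope.

Section Laws.
Context {G : Grp}.
Implicit Types x y z : G.

Lemma gadd0r x : x ⊕ g0 = x.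
Proof. rewrite gaddC. apply gadd0. Qed.

Lemma gaddI x y z : x ⊕ y = x ⊕ z -> y = z.
Proof.
  intros E. rewrite <- (gadd0 G y), <- (gadd0 G z), <- (gaddN G x), (gaddC G x), !gaddA.
  now rewrite E.
Qed.

Lemma gopp_unique x y : x ⊕ y = g0 -> y = ⊖ x.
Proof. intros E. apply (gaddI x). now rewrite gaddN. Qed.

Lemma gopp0 : ⊖ g0 = g0 :> G.
Proof. symmetry. apply gopp_unique, gadd0. Qed.

Lemma goppK x : ⊖ ⊖ x = x.
Proof. symmetry. apply gopp_unique. rewrite gaddC. apply gaddN. Qed.

Lemma gaddACA (a b c d : G) : (a ⊕ b) ⊕ (c ⊕ d) = (a ⊕ c) ⊕ (b ⊕ d).
Proof. rewrite !gaddA. f_equal. rewrite <- !gaddA. f_equal. apply gaddC. Qed.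

Lemma goppD x y : ⊖ (x ⊕ y) = ⊖ x ⊕ ⊖ y.
Proof. symmetry. apply gopp_unique. now rewrite gaddACA, !gaddN, gadd0. Qed.

Lemma nmul_S n x : nmul (S n) x = x ⊕ nmul n x.
Proof. reflexivity. Qed.

Lemma nmul_add m n x : nmul (m + n) x = nmul m x ⊕ nmul n x.
Proof.
  induction m; [symmetry; apply gadd0|]. now rewrite Nat.add_succ_l, !nmul_S, IHm, gaddA.
Qed.

Lemma nmulD n x y : nmul n (x ⊕ y) = nmul n x ⊕ nmul n y.
Proof.
  induction n; [symmetry; apply gadd0|]. now rewrite !nmul_S, IHn, gaddACA.
Qed.

Lemma nmul0 n : nmul n g0 = g0 :> G.
Proof. induction n; auto. now rewrite nmul_S, IHn, gadd0. Qed.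

Lemma zmul_nat n x : Z.of_nat n • x = nmul n x.
Proof. destruct n; auto. simpl. now rewrite SuccNat2Pos.id_succ. Qed.

Lemma zmul_opp a x : (- a)%Z • x = ⊖ (a • x).
Proof. destruct a; simpl; auto; [now rewrite gopp0 | now rewrite goppK]. Qed.

Lemma zmul_sub m n x : (Z.of_nat m - Z.of_nat n)%Z • x = nmul m x ⊖ nmul n x.
Proof.
  destruct (Nat.le_ge_cases n m) as [L|L].
  - rewrite <- Nat2Z.inj_sub, zmul_nat by auto.
    replace m with (m - n + n) at 2 by lia. rewrite nmul_add, gaddA, gaddN. now rewrite gadd0r.
  - replace (Z.of_nat m - Z.of_nat n)%Z with (- Z.of_nat (n - m))%Z by lia.
    rewrite zmul_opp, zmul_nat. replace n with (m + (n - m)) at 2 by lia.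
    now rewrite nmul_add, goppD, <- gaddA, gaddN, gadd0.
Qed.

Lemma Z_diff (a : Z) : exists m n, (a = Z.of_nat m - Z.of_nat n)%Z.
Proof. exists (Z.to_nat a), (Z.to_nat (- a)). lia. Qed.

Lemma zmul_add a b x : (a + b)%Z • x = a • x ⊕ b • x.
Proof.
  destruct (Z_diff a) as (m & n & ->), (Z_diff b) as (m' & n' & ->).
  replace (_ - _ + _)%Z with (Z.of_nat (m + m') - Z.of_nat (n + n'))%Z by lia.
  now rewrite !zmul_sub, !nmul_add, goppD, gaddACA.
Qed.

Lemma zmulD a x y : a • (x ⊕ y) = a • x ⊕ a • y.
Proof.
  destruct (Z_diff a) as (m & n & ->). now rewrite !zmul_sub, !nmulD, goppD, gaddACA.
Qed.

Lemma zmul_g0 a : a • g0 = g0 :> G.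
Proof. destruct (Z_diff a) as (m & n & ->). now rewrite zmul_sub, !nmul0, gaddN. Qed.

Lemma zmulN a x : a • (⊖ x) = ⊖ (a • x).
Proof. apply gopp_unique. now rewrite <- zmulD, gaddN, zmul_g0. Qed.

Lemma zmul_mul a b x : (a * b)%Z • x = a • (b • x).
Proof.
  assert (N : forall m c, (Z.of_nat m * c)%Z • x = nmul m (c • x)).
  { intros m c. induction m; auto. replace (Z.of_nat (S m) * c)%Z with (c + Z.of_nat m * c)%Z by lia.
    now rewrite zmul_add, IHm, nmul_S. }
  destruct (Z_diff a) as (m & n & ->). rewrite Z.mul_sub_distr_r, zmul_sub, <- !N.
  unfold Z.sub. now rewrite zmul_add, zmul_opp.
Qed.

Lemma zmul_1 x : 1%Z • x = x.
Proof. apply gadd0r. Qed.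

Lemma gsub_eq x y : x ⊖ y = g0 -> x = y.
Proof. intros E. apply (gaddI (⊖ y)). rewrite gaddC, E, gaddC. symmetry. apply gaddN. Qed.

End Laws.

(** * Reflection for identities in abelian groups *)

Inductive gexp : Type :=
  | EV (i : nat) | E0 | EA (a b : gexp) | EN (a : gexp) | EM (z : Z) (a : gexp).

Fixpoint geval {G : Grp} (env : list G) (e : gexp) : G :=
  match e with
  | EV i => nth i env g0
  | E0 => g0
  | EA a b => geval env a ⊕ geval env b
  | EN a => ⊖ geval env a
  | EM z a => z • geval env a
  end.

Fixpoint gcoef (e : gexp) (i : nat) : Z :=
  match e with
  | EV j => if Nat.eqb i j then 1 else 0
  | E0 => 0
  | EA a b => gcoef a i + gcoef b i
  | EN a => - gcoef a i
  | EM z a => z * gcoef a i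
  end%Z.

Fixpoint glin {G : Grp} (env : list G) (c : nat -> Z) : G :=
  match env with
  | [] => g0
  | x :: env => c 0 • x ⊕ glin env (fun i => c (S i))
  end.

Lemma glin_add {G : Grp} (env : list G) : forall c d,
  glin env (fun i => c i + d i)%Z = glin env c ⊕ glin env d.
Proof.
  induction env; intros; simpl; [now rewrite gadd0|].
  rewrite zmul_add, (IHenv (fun i => c (S i)) (fun i => d (S i))). apply gaddACA.
Qed.

Lemma glin_mul {G : Grp} (env : list G) z : forall c,
  glin env (fun i => z * c i)%Z = z • glin env c.
Proof.
  induction env; intros; simpl; [now rewrite zmul_g0|].
  rewrite (IHenv (fun i => c (S i))). now rewrite zmulD, zmul_mul.
Qed.

Lemma glin_ext {G : Grp} (env : list G) : forall c d,
  (forall i, i < length env -> c i = d i) -> glin env c = glin env d.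
Proof.
  induction env; intros c d E; simpl; auto. rewrite (E 0), (IHenv _ (fun i => d (S i))); simpl; auto.
  - intros. apply E. simpl. lia.
  - simpl. lia.
Qed.

Lemma geval_glin {G : Grp} (env : list G) e : geval env e = glin env (gcoef e).
Proof.
  induction e; cbn [geval gcoef].
  - revert i. induction env as [|x env IH]; intros [|i]; simpl; auto.
    + rewrite (glin_ext env _ (fun _ => (0 * 0)%Z)) by auto. rewrite glin_mul. simpl.
      rewrite gadd0r. symmetry. apply gadd0r.
    + rewrite gadd0. apply IH.
  - rewrite (glin_ext env _ (fun _ => (0 * 0)%Z)) by auto. now rewrite glin_mul.
  - now rewrite glin_add, IHe1, IHe2.
  - rewrite IHe. rewrite (glin_ext env (fun i => - gcoef e i)%Z (fun i => (-1) * gcoef e i)%Z) by (intros; cbv beta; ring).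
    now rewrite glin_mul, (zmul_opp 1), zmul_1.
  - now rewrite glin_mul, IHe.
Qed.

Fixpoint all_below (n : nat) (P : nat -> Prop) : Prop :=
  match n with 0 => True | S n => P n /\ all_below n P end.

Lemma gexp_eq {G : Grp} (env : list G) e1 e2 :
  all_below (length env) (fun i => gcoef e1 i = gcoef e2 i) -> geval env e1 = geval env e2.
Proof.
  intros H. rewrite !geval_glin. apply glin_ext. intros i L.
  induction (length env); simpl in *; [lia|]. destruct H as [H1 H2].
  destruct (Nat.eq_dec i n) as [->|]; auto. apply IHn; auto. lia.
Qed.

Ltac inlist x l :=
  match l with
  | ?y :: ?l' => let _ := match goal with _ => constr_eq x y end in constr:(true)
  | ?y :: ?l' => inlist x l'
  | _ => constr:(false)
  end.

Ltac addvar x l :=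
  match inlist x l with true => l | false => constr:(x :: l) end.

Ltac gvars t l :=
  match t with
  | @g0 _ => l
  | gadd ?a ?b => let l' := gvars a l in gvars b l'
  | gopp ?a => gvars a l
  | zmul _ ?a => gvars a l
  | _ => addvar t l
  end.

Ltac gindex x l :=
  match l with
  | ?y :: _ => let _ := match goal with _ => constr_eq x y end in constr:(0)
  | _ :: ?l' => let n := gindex x l' in constr:(S n)
  end.

Ltac greify t l :=
  match t with
  | @g0 _ => constr:(E0)
  | gadd ?a ?b => let a' := greify a l in let b' := greify b l in constr:(EA a' b')
  | gopp ?a => let a' := greify a l in constr:(EN a')
  | zmul ?z ?a => let a' := greify a l in constr:(EM z a')
  | _ => let n := gindex t l in constr:(EV n)
  end.

(* Decides an identity of abelian groups by comparing coefficients; the coefficients are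
   compared with [ring]. *)
Ltac abel :=
  match goal with
  | |- @eq ?T ?x ?y =>
    let G := match x with
             | context [@gadd ?G _ _] => G | context [@gopp ?G _] => G
             | context [@zmul ?G _ _] => G | context [@g0 ?G] => G
             | _ => match y with
               | context [@gadd ?G _ _] => G | context [@gopp ?G _] => G
               | context [@zmul ?G _ _] => G | context [@g0 ?G] => G end
             end in
    let l := gvars x constr:(@nil (car G)) in
    let l := gvars y l in
    let e1 := greify x l in let e2 := greify y l in
    change (@geval G l e1 = @geval G l e2); apply gexp_eq;
    cbn [all_below length gcoef Nat.eqb]; repeat split; try ring
  end.

(** * Heights, and extension of isomorphisms of first Ulm subgroups *)

Section Heights.
Context (p : nat) (Hp : prime (Z.of_nat p)).

Definition pw (m : nat) : Z := Z.of_nat (p ^ m).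

Lemma pw_0 : pw 0 = 1%Z.
Proof. reflexivity. Qed.

Lemma pw_S m : pw (S m) = (Z.of_nat p * pw m)%Z.
Proof. unfold pw. rewrite Nat.pow_succ_r', Nat2Z.inj_mul. reflexivity. Qed.

Lemma pw_1 : pw 1 = Z.of_nat p.
Proof. unfold pw. now rewrite Nat.pow_1_r. Qed.

Lemma pw_add a b : pw (a + b) = (pw a * pw b)%Z.
Proof. unfold pw. now rewrite Nat.pow_add_r, Nat2Z.inj_mul. Qed.

Lemma prime_ge2 : 2 <= p.
Proof. apply prime_ge_2 in Hp. lia. Qed.

Lemma pw_pos m : (0 < pw m)%Z.
Proof.
  unfold pw. pose proof prime_ge2. assert (p ^ m <> 0) by (apply Nat.pow_nonzero; lia). lia.
Qed.

Definition Dv {G : Grp} (m : nat) (x : G) : Prop := exists y, x = pw m • y.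

Definition Om {G : Grp} (x : G) : Prop := forall m, Dv m x.

Definition ptors (G : Grp) : Prop := forall x : G, exists k, pw k • x = g0.

Section Dv.
Context {G : Grp}.
Implicit Types x y : G.

Lemma Dv_0 x : Dv 0 x.
Proof. exists x. rewrite pw_0. now rewrite zmul_1. Qed.

Lemma Dv_g0 m : Dv m (@g0 G).
Proof. exists g0. now rewrite zmul_g0. Qed.

Lemma Dv_add m x y : Dv m x -> Dv m y -> Dv m (x ⊕ y).
Proof. intros [a ->] [b ->]. exists (a ⊕ b). now rewrite zmulD. Qed.

Lemma Dv_zmul m z x : Dv m x -> Dv m (z • x).
Proof. intros [a ->]. exists (z • a). abel. Qed.

Lemma Dv_opp m x : Dv m x -> Dv m (⊖ x).
Proof. intros [a ->]. exists (⊖ a). abel. Qed.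

Lemma Dv_sub m x y : Dv m x -> Dv m y -> Dv m (x ⊖ y).
Proof. intros. apply Dv_add; auto. now apply Dv_opp. Qed.

Lemma Dv_le m n x : m <= n -> Dv n x -> Dv m x.
Proof.
  intros L [a ->]. exists (pw (n - m) • a). rewrite <- zmul_mul, <- pw_add. f_equal. f_equal. lia.
Qed.

Lemma Dv_pw k m x : Dv m x -> Dv (k + m) (pw k • x).
Proof. intros [a ->]. exists a. now rewrite pw_add, zmul_mul. Qed.

Lemma Dv_p m x : Dv m x -> Dv (S m) (Z.of_nat p • x).
Proof. rewrite <- pw_1. apply (Dv_pw 1). Qed.

Lemma Dv_S_inv m x : Dv (S m) x -> exists y, Dv m y /\ x = Z.of_nat p • y.
Proof. intros [a ->]. exists (pw m • a). split; [now exists a|]. now rewrite pw_S, zmul_mul. Qed.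

Lemma Dv_addr m x y : Dv m y -> (Dv m (x ⊕ y) <-> Dv m x).
Proof.
  intros H. split; intros H'; [|now apply Dv_add].
  replace x with ((x ⊕ y) ⊖ y) by abel. now apply Dv_sub.
Qed.

Lemma coprime_inv (k : Z) : ~ (Z.of_nat p | k)%Z -> exists k' u, (k' * k = 1 + u * Z.of_nat p)%Z.
Proof.
  intros N. destruct (Zis_gcd_bezout k (Z.of_nat p) 1) as [u v E].
  - apply Zis_gcd_sym. now apply prime_rel_prime.
  - exists u, (- v)%Z. lia.
Qed.

Lemma coprime_inv_pw (k : Z) m : ~ (Z.of_nat p | k)%Z -> exists k' u, (k' * k = 1 + u * pw m)%Z.
Proof.
  intros N. destruct (Zis_gcd_bezout k (pw m) 1) as [u v E].
  - induction m as [|m IH].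
    + rewrite pw_0. apply Zis_gcd_1.
    + rewrite pw_S. apply rel_prime_mult; auto. now apply rel_prime_sym, prime_rel_prime.
  - exists u, (- v)%Z. lia.
Qed.

Lemma Dv_coprime m (k : Z) x : ~ (Z.of_nat p | k)%Z -> Dv m (k • x) -> Dv m x.
Proof.
  intros N D. destruct (coprime_inv_pw k m N) as (k' & u & E).
  replace x with (k' • (k • x) ⊖ pw m • (u • x)).
  - apply Dv_sub; [now apply Dv_zmul|]. now exists (u • x).
  - rewrite <- zmul_mul, E. abel.
Qed.

End Dv.

(* Modulo [Dv (S m)] this is the [m]-th Ulm factor of [G]. *)
Definition UX {G : Grp} (m : nat) (x : G) : Prop := Dv m x /\ Dv (S (S m)) (Z.of_nat p • x).

(** An inequality between the [m]-th invariants, expressed as one between the numbers of classes; a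
    mere injection on classes is asked for because the extension step argues by counting. *)
Definition Uinj (G H : Grp) (m : nat) : Prop :=
  exists th : G -> H, (forall x, UX m x -> UX m (th x)) /\
    forall x x', UX m x -> UX m x' -> Dv (S m) (th x ⊖ th x') -> Dv (S m) (x ⊖ x').

(** A height-preserving isomorphism between subgroups that contain all elements of infinite height
    and are finite modulo them, given by its graph. Finite heights are all that must be compared,
    since on infinite heights the map is settled. Finiteness gives elements of maximal height in
    cosets and makes counting possible. *)
Record pariso (G H : Grp) (R : G -> H -> Prop) : Prop := {
  pi_sub : forall x y x' y', R x y -> R x' y' -> R (x ⊖ x') (y ⊖ y');
  pi_Dv : forall x y, R x y -> forall m, Dv m x <-> Dv m y;
  pi_0l : forall y, R g0 y -> y = g0;
  pi_0r : forall x, R x g0 -> x = g0;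
  pi_Oml : forall x, Om x -> exists y, R x y;
  pi_Omr : forall y, Om y -> exists x, R x y;
  pi_fin : exists l, Forall (fun q => R (fst q) (snd q)) l /\
    forall x y, R x y -> exists q, In q l /\ Om (x ⊖ fst q) /\ Om (y ⊖ snd q)
}.

Lemma pariso_flip G H R : pariso G H R -> pariso H G (fun y x => R x y).
Proof.
  intros P. constructor; intros.
  - now apply (pi_sub _ _ _ P).
  - symmetry. now apply (pi_Dv _ _ _ P).
  - now apply (pi_0r _ _ _ P).
  - now apply (pi_0l _ _ _ P).
  - now apply (pi_Omr _ _ _ P).
  - now apply (pi_Oml _ _ _ P).
  - destruct (pi_fin _ _ _ P) as (l & F & C).
    exists (map (fun q => (snd q, fst q)) l). split.
    + apply Forall_map. apply F.
    + intros x y Rxy. destruct (C y x Rxy) as (q & I & O1 & O2). exists (snd q, fst q).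
      split; [|auto]. apply in_map_iff. now exists q.
Qed.

Lemma pigeonhole {X Y : Type} (sim : X -> X -> Prop) (E : X -> Y -> Prop) :
  (forall u u' b, E u b -> E u' b -> sim u u') ->
  forall (L : list X) (B : list Y), ForallOrdPairs (fun u u' => ~ sim u u') L ->
  (forall u, In u L -> exists b, In b B /\ E u b) -> length L <= length B.
Proof.
  intros S L. induction L as [|u L IH]; intros B D C; simpl; [lia|].
  inversion D as [|? ? Du DL]; subst.
  destruct (C u) as (b & Ib & Eb); [now left|].
  destruct (in_split b B Ib) as (B1 & B2 & ->).
  assert (length L <= length (B1 ++ B2)).
  { apply IH; auto. intros v Iv. destruct (C v) as (b' & Ib' & Eb'); [now right|].
    exists b'. split; auto. rewrite in_app_iff in *. simpl in Ib'.
    destruct Ib' as [?|[<-|?]]; auto. exfalso.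
    rewrite Forall_forall in Du. apply (Du v Iv). eauto. }
  rewrite length_app in *. simpl. lia.
Qed.

Lemma list_transversal {X : Type} (P : X -> Prop) (sim : X -> X -> Prop) (l : list X) :
  (forall x, sim x x) ->
  exists l', (forall x, In x l' -> In x l /\ P x) /\ ForallOrdPairs (fun u u' => ~ sim u u') l' /\
    forall x, In x l -> P x -> exists y, In y l' /\ (sim x y).
Proof.
  intros Rf. induction l as [|a l (l' & I & D & C)].
  - exists []. repeat split; try easy. constructor.
  - destruct (classic (P a /\ ~ exists y, In y l' /\ sim a y)) as [[Pa N]|N].
    + exists (a :: l'). repeat split.
      * destruct H; subst; simpl; auto. right. now apply I.
      * destruct H; subst; auto. now apply I.
      * constructor; auto. apply Forall_forall. intros y Iy Sy. apply N. eauto.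
      * intros x [<-|Ix] Px.
        { exists a. split; simpl; auto. }
        destruct (C x Ix Px) as (y & ? & ?). exists y. simpl. auto.
    + exists l'. repeat split.
      * simpl. right. now apply I.
      * now apply I.
      * auto.
      * intros x [<-|Ix] Px; [|now apply C]. apply NNPP. intros N'. apply N. split; auto.
Qed.

Section Extend.
Context (G H : Grp).
Context (HU : forall m, Uinj G H m).

Section OneStep.
Context (R : G -> H -> Prop) (P : pariso G H R).

Let Rsub := pi_sub _ _ _ P.
Let RDv := pi_Dv _ _ _ P.

Lemma R_00 : R g0 g0.
Proof.
  destruct (pi_Oml _ _ _ P g0) as [y Ry]; [intros m; apply Dv_g0|].
  now rewrite (pi_0l _ _ _ P y Ry) in Ry.
Qed.

Lemma R_opp x y : R x y -> R (⊖ x) (⊖ y).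
Proof. intros Q. rewrite <- (gadd0 G (⊖ x)), <- (gadd0 H (⊖ y)). apply Rsub; auto. apply R_00. Qed.

Lemma R_add x y x' y' : R x y -> R x' y' -> R (x ⊕ x') (y ⊕ y').
Proof.
  intros Q Q'. rewrite <- (goppK x'), <- (goppK y'). apply Rsub; auto. now apply R_opp.
Qed.

Lemma R_nmul n x y : R x y -> R (nmul n x) (nmul n y).
Proof. intros Q. induction n; [apply R_00|]. rewrite !nmul_S. now apply R_add. Qed.

Lemma R_zmul z x y : R x y -> R (z • x) (z • y).
Proof. intros Q. destruct z; simpl; [apply R_00 | now apply R_nmul | now apply R_opp, R_nmul]. Qed.

Definition adjoin (x : G) (y : H) (a : G) (b : H) : Prop :=
  exists (k : Z) s t, R s t /\ a = s ⊕ k • x /\ b = t ⊕ k • y.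

(** Multiples [k • x] with [p] dividing [k] lie in the old domain, and any other coefficient becomes
    1 after multiplication by its inverse modulo [p]. So it is enough to compare the heights of
    [s ⊕ x] and [t ⊕ y]. *)
Lemma adjoin_pariso x y :
  R (Z.of_nat p • x) (Z.of_nat p • y) -> ~ (exists z, R x z) ->
  (forall s t, R s t -> forall j, Dv j (s ⊕ x) <-> Dv j (t ⊕ y)) ->
  pariso G H (adjoin x y).
Proof.
  intros Rp N C.
  assert (red : forall k s t, R s t -> (Z.of_nat p | k)%Z -> R (s ⊕ k • x) (t ⊕ k • y)).
  { intros k s t Rst [k1 ->]. rewrite !zmul_mul. apply R_add; auto. now apply R_zmul. }
  assert (cop : forall k s t, R s t -> ~ (Z.of_nat p | k)%Z ->
     exists k' s' t', R s' t' /\ ~ (Z.of_nat p | k')%Z /\ k' • (s ⊕ k • x) = s' ⊕ x /\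
        k' • (t ⊕ k • y) = t' ⊕ y).
  { intros k s t Rst Nk. destruct (coprime_inv k Nk) as (k' & u & E).
    exists k', (k' • s ⊕ u • (Z.of_nat p • x)), (k' • t ⊕ u • (Z.of_nat p • y)). repeat split.
    - apply R_add; now apply R_zmul.
    - intros [w ->]. pose proof prime_ge2.
      assert (D : (Z.of_nat p | 1)%Z) by (exists (w * k - u)%Z; lia).
      apply Z.divide_pos_le in D; lia.
    - rewrite zmulD, <- !zmul_mul, E. abel.
    - rewrite zmulD, <- !zmul_mul, E. abel. }
  constructor.
  - intros a b a' b' (k & s & t & Q & -> & ->) (k' & s' & t' & Q' & -> & ->).
    exists (k - k')%Z, (s ⊖ s'), (t ⊖ t'). split; [auto|]. split; abel.
  - intros a b (k & s & t & Q & -> & ->) m.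
    destruct (Znumtheory.Zdivide_dec (Z.of_nat p) k) as [D|D].
    + apply RDv. now apply red.
    + destruct (cop k s t Q D) as (k' & s' & t' & Q' & Nk' & Es & Et).
      split; intros Dm; apply (Dv_coprime m k'); auto; [rewrite Et | rewrite Es]; apply (C s' t' Q').
      * rewrite <- Es. now apply Dv_zmul.
      * rewrite <- Et. now apply Dv_zmul.
  - intros b (k & s & t & Q & E0 & ->).
    destruct (Znumtheory.Zdivide_dec (Z.of_nat p) k) as [D|D].
    + apply (pi_0l _ _ _ P). rewrite E0. now apply red.
    + destruct (cop k s t Q D) as (k' & s' & t' & Q' & Nk' & Es & Et).
      destruct N. exists (⊖ t'). rewrite <- E0, zmul_g0 in Es.
      replace x with (⊖ s'); [now apply R_opp|]. symmetry. now apply gopp_unique.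
  - intros a (k & s & t & Q & -> & E0).
    destruct (Znumtheory.Zdivide_dec (Z.of_nat p) k) as [D|D].
    + apply (pi_0r _ _ _ P). rewrite E0. now apply red.
    + destruct (cop k s t Q D) as (k' & s' & t' & Q' & Nk' & Es & Et).
      rewrite <- E0, zmul_g0 in Et.
      destruct (pi_Oml _ _ _ P (s' ⊕ x)) as [w Rw].
      { intros m. apply (C s' t' Q'). rewrite <- Et. apply Dv_g0. }
      destruct N. exists (w ⊖ t'). replace x with ((s' ⊕ x) ⊖ s') by abel. auto.
  - intros a Oa. destruct (pi_Oml _ _ _ P a Oa) as [b Q]. exists b, 0%Z, a, b.
    split; auto. split; abel.
  - intros b Ob. destruct (pi_Omr _ _ _ P b Ob) as [a Q]. exists a, 0%Z, a, b.
    split; auto. split; abel.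
  - destruct (pi_fin _ _ _ P) as (l & F & Cl).
    exists (flat_map (fun r => map (fun q => (fst q ⊕ Z.of_nat r • x, snd q ⊕ Z.of_nat r • y)) l) (seq 0 p)).
    split.
    + apply Forall_forall. intros q Iq. apply in_flat_map in Iq as (r & _ & Iq).
      apply in_map_iff in Iq as (q' & <- & Iq'). rewrite Forall_forall in F.
      exists (Z.of_nat r), (fst q'), (snd q'). auto.
    + intros a b (k & s & t & Q & -> & ->).
      set (q0 := (k / Z.of_nat p)%Z). set (r0 := (k mod Z.of_nat p)%Z).
      pose proof prime_ge2 as P2.
      assert (Ek : k = (Z.of_nat p * q0 + r0)%Z) by (apply Z.div_mod; lia).
      assert (Br : (0 <= r0 < Z.of_nat p)%Z) by (apply Z.mod_pos_bound; lia).
      assert (Q0 : R (s ⊕ q0 • (Z.of_nat p • x)) (t ⊕ q0 • (Z.of_nat p • y)))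
        by (apply R_add; auto; now apply R_zmul).
      destruct (Cl _ _ Q0) as (q & Iq & O1 & O2).
      exists (fst q ⊕ r0 • x, snd q ⊕ r0 • y). split; [|split].
      * apply in_flat_map. exists (Z.to_nat r0). split; [apply in_seq; lia|].
        apply in_map_iff. exists q. split; auto. now rewrite Z2Nat.id by lia.
      * cbn [fst]. replace (_ ⊖ _) with (s ⊕ q0 • (Z.of_nat p • x) ⊖ fst q); auto. rewrite Ek. abel.
      * cbn [snd]. replace (_ ⊖ _) with (t ⊕ q0 • (Z.of_nat p • y) ⊖ snd q); auto. rewrite Ek. abel.
Qed.

(** The height on the coset of [x] depends only on [s] modulo [Om], that is, on finitely many
    representatives. It is never infinite: an element of [Om] in the coset would put [x] itself into
    the domain. *)
Lemma coset_height x : ~ (exists z, R x z) ->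
  exists m, (exists s t, R s t /\ Dv m (s ⊕ x)) /\ forall s t, R s t -> ~ Dv (S m) (s ⊕ x).
Proof.
  intros N.
  assert (B : exists M, forall s t, R s t -> ~ Dv M (s ⊕ x)).
  { destruct (pi_fin _ _ _ P) as (l & F & Cl).
    assert (Bl : exists M, forall q, In q l -> ~ Dv M (fst q ⊕ x)).
    { clear Cl. induction F as [|q l Rq F [M HM]]; [exists 0; easy|].
      destruct (classic (Om (fst q ⊕ x))) as [O|O].
      - destruct (pi_Oml _ _ _ P _ O) as [w Rw]. destruct N. exists (w ⊖ snd q).
        replace x with ((fst q ⊕ x) ⊖ fst q) by abel. auto.
      - apply not_all_ex_not in O as [m Hm]. exists (M + m). intros q' [<-|Iq'] D.
        + apply Hm. apply (Dv_le m (M + m)); auto. lia.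
        + apply (HM q' Iq'). apply (Dv_le M (M + m)); auto. lia. }
    destruct Bl as [M HM]. exists M. intros s t Q D. destruct (Cl s t Q) as (q & Iq & O & _).
    apply (HM q Iq). replace (fst q ⊕ x) with ((s ⊕ x) ⊖ (s ⊖ fst q)) by abel.
    apply Dv_sub; auto. }
  destruct B as [M HM]. induction M as [|M IH].
  - exfalso. apply (HM g0 g0 R_00). apply Dv_0.
  - destruct (classic (exists s t, R s t /\ Dv M (s ⊕ x))) as [Y|Y].
    + exists M. auto.
    + apply IH. intros s t Q D. apply Y. eauto.
Qed.

(** The key step of the Kaplansky-Mackey proof of Ulm's theorem; call an element proper if its
    height is maximal in its coset. If no element of height [m] in the coset of [x] gains more than
    1 in height under multiplication by [p], every root of [z] of height [m] is proper. Otherwise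
    the partner has to be sought in a class of the [m]-th Ulm factor that the range does not meet,
    and the hypothesis on invariants provides one. *)
Lemma proper_partner x m z : Dv m x -> (forall s t, R s t -> ~ Dv (S m) (s ⊕ x)) ->
  R (Z.of_nat p • x) z ->
  exists x' y, (exists s t, R s t /\ x' = s ⊕ x) /\ Dv m x' /\ R (Z.of_nat p • x') (Z.of_nat p • y) /\ Dv m y /\
    forall s t, R s t -> ~ Dv (S m) (t ⊕ y).
Proof.
  intros Dx Mx Rz.
  destruct (classic (exists s t, R s t /\ Dv m (s ⊕ x) /\ Dv (S (S m)) (Z.of_nat p • (s ⊕ x))))
    as [(s0 & t0 & Q0 & D1 & D2)|N].
  - set (x' := s0 ⊕ x) in *.
    assert (Mx' : forall s t, R s t -> ~ Dv (S m) (x' ⊖ s)).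
    { intros s t Q D. apply (Mx (s0 ⊖ s) (t0 ⊖ t)); [auto|].
      replace (_ ⊕ x) with (x' ⊖ s); auto. unfold x'. abel. }
    (* Suppose the range met every class. The classes met by the domain, together with that of [x'],
       are one more than the list [l']; [th] keeps them apart, yet it sends each to a class
       represented in [l'] because [R] preserves heights. *)
    assert (W : exists w, UX m w /\ forall s t, R s t -> ~ Dv (S m) (w ⊖ t)).
    { apply NNPP. intros NW.
      destruct (pi_fin _ _ _ P) as (l & F & Cl). rewrite Forall_forall in F.
      destruct (list_transversal (fun q : G * H => UX m (fst q))
         (fun q q' => Dv (S m) (fst q ⊖ fst q')) l) as (l' & I & D & C).
      { intros q. replace (fst q ⊖ fst q) with (@g0 G) by abel. apply Dv_g0. }
      destruct (HU m) as (th & T1 & T2).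
      pose (L := x' :: map fst l').
      assert (UL : forall u, In u L -> UX m u).
      { intros u [<-|Iu]; [now split|]. apply in_map_iff in Iu as (q & <- & Iq). now apply I. }
      assert (length L <= length l').
      { apply (pigeonhole (fun u u' => UX m u -> UX m u' -> Dv (S m) (u ⊖ u'))
          (fun u (q : G * H) => Dv (S m) (th u ⊖ snd q))).
        - intros u u' b E E' Uu Uu'. apply T2; auto.
          replace (th u ⊖ th u') with ((th u ⊖ snd b) ⊖ (th u' ⊖ snd b)) by abel. now apply Dv_sub.
        - constructor.
          + apply Forall_forall. intros u Iu E. pose proof Iu as Iu'.
            apply in_map_iff in Iu as (q & <- & Iq).
            apply (Mx' (fst q) (snd q)); [now apply F, I|]. apply E; [now split | now apply I].
          + clear - D I. induction D as [|q l' Fq D IH]; constructor.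
            * rewrite Forall_forall in *. intros u Iu E. apply in_map_iff in Iu as (q' & <- & Iq').
              apply (Fq q' Iq'). apply E; [apply (I q) | apply (I q')]; simpl; auto.
            * apply IH. intros; apply I; simpl; auto.
        - intros u Iu. pose proof (T1 u (UL u Iu)) as Uth.
          assert (exists s t, R s t /\ Dv (S m) (th u ⊖ t)) as (s & t & Q & Dt).
          { apply NNPP. intros N. apply NW. exists (th u). split; auto. intros s t Q Dt. eauto. }
          destruct (Cl s t Q) as (q & Iq & O1 & O2).
          assert (Uq : UX m (fst q)).
          { assert (Dq : Dv (S m) (th u ⊖ snd q)).
            { replace (_ ⊖ _) with ((th u ⊖ t) ⊕ (t ⊖ snd q)) by abel. now apply Dv_add. }
            destruct Uth as [U1 U2]. split.
            - apply (RDv _ _ (F q Iq)). replace (snd q) with (th u ⊖ (th u ⊖ snd q)) by abel.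
              apply Dv_sub; auto. apply (Dv_le m (S m)); auto.
            - apply (RDv _ (Z.of_nat p • snd q)); [apply R_zmul; auto|].
              replace (Z.of_nat p • snd q) with (Z.of_nat p • th u ⊖ Z.of_nat p • (th u ⊖ snd q)) by abel.
              apply Dv_sub; auto. now apply Dv_p. }
          destruct (C q Iq Uq) as (q' & Iq' & Sq'). exists q'. split; auto.
          replace (_ ⊖ _) with ((th u ⊖ t) ⊕ (t ⊖ snd q) ⊕ (snd q ⊖ snd q')) by abel.
          apply Dv_add; [apply Dv_add; auto|].
          apply (RDv (fst q ⊖ fst q')); auto. apply Rsub; apply F; auto. now apply I. }
      unfold L in H0. simpl in H0. rewrite length_map in H0. lia. }
    destruct W as (w & [W1 W2] & W3).
    assert (Rx' : R (Z.of_nat p • x') (Z.of_nat p • t0 ⊕ z)).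
    { unfold x'. rewrite zmulD. apply R_add; auto. now apply R_zmul. }
    assert (Dd : Dv (S (S m)) ((Z.of_nat p • t0 ⊕ z) ⊖ Z.of_nat p • w)).
    { apply Dv_sub; auto. now apply (RDv _ _ Rx'). }
    (* The element [w] has a suitable class but the wrong [p]-multiple; [y'] of height at least
       [m + 1] corrects the multiple and keeps the class. *)
    destruct (Dv_S_inv _ _ Dd) as (y' & Dy' & Ey').
    exists x', (w ⊕ y'). repeat split; auto.
    + exists s0, t0. auto.
    + replace (Z.of_nat p • (w ⊕ y')) with (Z.of_nat p • t0 ⊕ z); auto.
      rewrite zmulD, <- Ey'. abel.
    + apply Dv_add; auto. apply (Dv_le m (S m)); auto.
    + intros s t Q D. apply (W3 (⊖ s) (⊖ t)); [now apply R_opp|].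
      replace (_ ⊖ _) with ((t ⊕ (w ⊕ y')) ⊖ y') by abel. now apply Dv_sub.
  - assert (Dz : Dv (S m) z) by (apply (RDv _ _ Rz); now apply Dv_p).
    destruct (Dv_S_inv _ _ Dz) as (y & Dy & Ey).
    exists x, y. repeat split; auto.
    + exists g0, g0. split; [apply R_00|abel].
    + now rewrite <- Ey.
    + intros s t Q D. apply N. exists s, t.
      assert (Dt : Dv m t).
      { replace t with ((t ⊕ y) ⊖ y) by abel. apply Dv_sub; auto. apply (Dv_le m (S m)); auto. }
      repeat split; auto.
      * apply Dv_add; auto. now apply (RDv _ _ Q).
      * rewrite zmulD. apply (RDv _ (Z.of_nat p • t ⊕ z)); [apply R_add; auto; now apply R_zmul|].
        rewrite Ey, <- zmulD. now apply Dv_p.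
Qed.

Lemma extend_p x : (exists z, R (Z.of_nat p • x) z) ->
  exists R' : G -> H -> Prop, pariso G H R' /\ (forall a b, R a b -> R' a b) /\ exists y, R' x y.
Proof.
  intros [z Rz]. destruct (classic (exists y, R x y)) as [Y|N]; [exists R; auto|].
  destruct (coset_height x N) as (m & (s0 & t0 & Q0 & D0) & M0).
  destruct (proper_partner (s0 ⊕ x) m (Z.of_nat p • t0 ⊕ z)) as (x' & y & (s1 & t1 & Q1 & ->) & Dx & Rp & Dy & My).
  - auto.
  - intros s t Q D. apply (M0 (s ⊕ s0) (t ⊕ t0)); [now apply R_add|].
    replace (s ⊕ s0 ⊕ x) with (s ⊕ (s0 ⊕ x)) by abel. auto.
  - rewrite zmulD. apply R_add; auto. now apply R_zmul.
  - set (x' := s1 ⊕ (s0 ⊕ x)) in *.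
    assert (E : x = x' ⊖ (s1 ⊕ s0)) by (unfold x'; abel).
    exists (adjoin x' y). split; [|split].
    + apply adjoin_pariso; auto.
      * intros [w Rw]. apply N. exists (w ⊖ (t1 ⊕ t0)). rewrite E. apply Rsub; auto. now apply R_add.
      (* Up to [m] the summands [x'] and [y] do not influence divisibility; beyond [m] properness
         excludes it on both sides. *)
      * intros s t Q j. destruct (Nat.le_gt_cases j m) as [L|L].
        { rewrite !Dv_addr by (apply (Dv_le j m); auto). now apply RDv. }
        split; intros D; exfalso.
        { apply (M0 (s ⊕ (s1 ⊕ s0)) (t ⊕ (t1 ⊕ t0))); [now repeat apply R_add|].
          apply (Dv_le (S m) j); auto. replace (_ ⊕ x) with (s ⊕ x'); auto. unfold x'. abel. }
        { apply (My s t Q). now apply (Dv_le (S m) j). }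
    + intros a b Q. exists 0%Z, a, b. split; auto. split; abel.
    + exists (y ⊖ (t1 ⊕ t0)), 1%Z, (⊖ (s1 ⊕ s0)), (⊖ (t1 ⊕ t0)). split; [|split].
      * apply R_opp. now apply R_add.
      * rewrite E at 1. abel.
      * abel.
Qed.

End OneStep.

Lemma extend_pw k : forall R x, pariso G H R -> (exists z, R (pw k • x) z) ->
  exists R' : G -> H -> Prop, pariso G H R' /\ (forall a b, R a b -> R' a b) /\ exists y, R' x y.
Proof.
  induction k as [|k IH]; intros R x P [z Rz].
  - exists R. split; [auto|split; auto]. exists z. now rewrite pw_0, zmul_1 in Rz.
  - destruct (IH R (Z.of_nat p • x) P) as (R1 & P1 & I1 & Y1).
    + exists z. rewrite <- zmul_mul, Z.mul_comm, <- pw_S. auto.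
    + destruct (extend_p R1 P1 x Y1) as (R2 & P2 & I2 & Y2). exists R2. auto.
Qed.

Lemma extend (tG : ptors G) R x : pariso G H R ->
  exists R' : G -> H -> Prop, pariso G H R' /\ (forall a b, R a b -> R' a b) /\ exists y, R' x y.
Proof.
  intros P. destruct (tG x) as [k E]. apply (extend_pw k R x P).
  exists g0. rewrite E. now apply R_00.
Qed.

End Extend.

Definition giso (G H : Grp) (f : G -> H) : Prop :=
  (forall x y, f (x ⊕ y) = f x ⊕ f y) /\ (forall x y, f x = f y -> x = y) /\ (forall y, exists x, f x = y).

Definition Om_iso (G H : Grp) (f : G -> H) : Prop :=
  (forall x, Om x -> Om (f x)) /\ (forall x y, Om x -> Om y -> f (x ⊕ y) = f x ⊕ f y) /\
  (forall x y, Om x -> Om y -> f x = f y -> x = y) /\ (forall y, Om y -> exists x, Om x /\ f x = y).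

Lemma Om_sub {G : Grp} (x y : G) : Om x -> Om y -> Om (x ⊖ y).
Proof. intros A B m. now apply Dv_sub. Qed.

Lemma Om_g0 {G : Grp} : Om (@g0 G).
Proof. intros m. apply Dv_g0. Qed.

Lemma Om_iso_pariso G H f : Om_iso G H f -> pariso G H (fun x y => Om x /\ y = f x).
Proof.
  intros (F1 & F2 & F3 & F4).
  assert (f0 : f g0 = g0).
  { pose proof (F2 g0 g0 Om_g0 Om_g0) as E. rewrite gadd0 in E.
    apply (gaddI (f g0)). now rewrite <- E, gadd0r. }
  assert (fopp : forall x, Om x -> f (⊖ x) = ⊖ f x).
  { intros x Ox. assert (Om (⊖ x)) by (rewrite <- (gadd0 G (⊖ x)); apply Om_sub; auto; apply Om_g0).
    apply gopp_unique. now rewrite <- F2, gaddN. }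
  constructor.
  - intros x y x' y' [O ->] [O' ->]. split; [now apply Om_sub|].
    rewrite F2; auto; [now rewrite fopp|]. rewrite <- (gadd0 G (⊖ x')). apply Om_sub; auto. apply Om_g0.
  - intros x y [O ->] m. split; intros _; [now apply F1 | now apply O].
  - intros y [_ ->]. auto.
  - intros x [O E]. apply F3; auto; [apply Om_g0|]. now rewrite f0.
  - intros x O. exists (f x). auto.
  - intros y O. destruct (F4 y O) as (x & Ox & <-). exists x. auto.
  - exists [(g0, f g0)]. split.
    + constructor; auto. split; auto. apply Om_g0.
    + intros x y [O ->]. exists (g0, f g0). split; [now left|]. cbn [fst snd]. split.
      * apply Om_sub; auto. apply Om_g0.
      * apply Om_sub; [auto | apply F1, Om_g0].
Qed.

Theorem Om_iso_extends (G H : Grp) (eG : nat -> G) (eH : nat -> H) f :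
  ptors G -> ptors H -> (forall x, exists n, eG n = x) -> (forall y, exists n, eH n = y) ->
  (forall m, Uinj G H m) -> (forall m, Uinj H G m) -> Om_iso G H f ->
  exists F, giso G H F.
Proof.
  intros tG tH sG sH U1 U2 If.
  pose (T := {R : G -> H -> Prop | pariso G H R}).
  assert (step : forall (n : nat) (R : T), exists R' : T, (forall a b, proj1_sig R a b -> proj1_sig R' a b) /\
     (exists y, proj1_sig R' (eG n) y) /\ exists x, proj1_sig R' x (eH n)).
  { intros n [R P].
    destruct (extend G H U1 tG R (eG n) P) as (R1 & P1 & I1 & Y1).
    destruct (extend H G U2 tH _ (eH n) (pariso_flip _ _ _ P1)) as (R2 & P2 & I2 & Y2).
    exists (exist _ (fun x y => R2 y x) (pariso_flip _ _ _ P2)). cbn. split; [auto|]. split; auto.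
    destruct Y1 as [y Y1]. exists y. auto. }
  pose (nxt := fun n R => proj1_sig (constructive_indefinite_description _ (step n R))).
  pose (Rs := fix Rs n := match n with
     | 0 => exist _ _ (Om_iso_pariso G H f If) : T | S n => nxt n (Rs n) end).
  assert (Rs_S : forall n a b, proj1_sig (Rs n) a b -> proj1_sig (Rs (S n)) a b).
  { intros n. apply (proj2_sig (constructive_indefinite_description _ (step n (Rs n)))). }
  assert (mono : forall m n, m <= n -> forall a b, proj1_sig (Rs m) a b -> proj1_sig (Rs n) a b).
  { induction 1; auto. }
  pose (Q := fun a b => exists n, proj1_sig (Rs n) a b).
  assert (Qsub : forall x y x' y', Q x y -> Q x' y' -> Q (x ⊖ x') (y ⊖ y')).
  { intros x y x' y' [n A] [n' A']. exists (n + n').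
    apply (pi_sub _ _ _ (proj2_sig (Rs (n + n')))).
    - apply (mono n); auto; lia.
    - apply (mono n'); auto; lia. }
  assert (Q0l : forall y, Q g0 y -> y = g0).
  { intros y [n A]. apply (pi_0l _ _ _ (proj2_sig (Rs n)) y A). }
  assert (Q0r : forall x, Q x g0 -> x = g0).
  { intros x [n A]. apply (pi_0r _ _ _ (proj2_sig (Rs n)) x A). }
  assert (Ql : forall x, exists y, Q x y).
  { intros x. destruct (sG x) as [n <-].
    destruct (proj2_sig (constructive_indefinite_description _ (step n (Rs n)))) as (_ & [y Y] & _).
    exists y, (S n). exact Y. }
  assert (Qr : forall y, exists x, Q x y).
  { intros y. destruct (sH y) as [n <-].
    destruct (proj2_sig (constructive_indefinite_description _ (step n (Rs n)))) as (_ & _ & [x X]).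
    exists x, (S n). exact X. }
  assert (Qfun : forall x y y', Q x y -> Q x y' -> y = y').
  { intros x y y' A A'. apply gsub_eq, Q0l. rewrite <- (gaddN G x). auto. }
  destruct (fun_choice _ Ql) as [F QF].
  exists F. split; [|split].
  - intros x y. apply (Qfun (x ⊕ y)); auto. rewrite <- (goppK y) at 1. rewrite <- (goppK (F y)).
    apply Qsub; auto. rewrite <- (gadd0 G (⊖ y)), <- (gadd0 H (⊖ F y)). apply Qsub; auto.
    destruct (Ql g0) as [w A]. now rewrite (Q0l w A) in A.
  - intros x y E. apply gsub_eq, Q0r. rewrite <- (gaddN H (F x)). apply Qsub; auto. rewrite E. auto.
  - intros y. destruct (Qr y) as [x A]. exists x. now apply (Qfun x).
Qed.

End Heights.

(** * Groups given by digits: the generator [p ^ j] satisfies [p * p ^ j = c j] *)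

Section Digits.
Context (p : nat) (Hp : 2 <= p) (c : nat -> nat).

(** Each digit is an extension by a cyclic group of order [p] with a carry cocycle: an overflow at
    digit [i] is worth [c i]. Reducing [c i] modulo [p ^ i] places it in the span of the lower
    generators for an arbitrary function [c]. *)
Fixpoint padd (j x y : nat) : nat :=
  match j with
  | 0 => 0
  | S i =>
    let q := p ^ i in
    let a := x / q in
    let b := y / q in
    let z := padd i (x mod q) (y mod q) in
    (if p <=? a + b then padd i z (c i mod q) else z) + q * ((a + b) mod p)
  end.

Fixpoint popp (j x : nat) : nat :=
  match j with
  | 0 => 0
  | S i =>
    let q := p ^ i in
    let a := x / q in
    if a =? 0 then popp i (x mod q)
    else popp i (padd i (x mod q) (c i mod q)) + q * (p - a)
  end.

Lemma ppow_pos j : 0 < p ^ j.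
Proof. apply Nat.neq_0_lt_0, Nat.pow_nonzero. lia. Qed.

Lemma ppow_S j : p ^ S j = p ^ j * p.
Proof. simpl. lia. Qed.

Lemma ppow_le i j : i <= j -> p ^ i <= p ^ j.
Proof. intros. apply Nat.pow_le_mono_r; lia. Qed.

Lemma ppow_lt i j : i < j -> p ^ i < p ^ j.
Proof. intros. apply Nat.pow_lt_mono_r; lia. Qed.

Lemma lt_ppow x j : x <= j -> x < p ^ j.
Proof. intros. apply Nat.le_lt_trans with j; auto. apply Nat.pow_gt_lin_r. lia. Qed.

Lemma digit_bound q a b : b < q -> a < p -> b + q * a < q * p.
Proof. intros. assert (q * (a + 1) <= q * p) by (apply Nat.mul_le_mono_l; lia). lia. Qed.

Lemma padd_lt j : forall x y, padd j x y < p ^ j.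
Proof.
  induction j as [|i IH]; intros x y; simpl padd; [simpl; lia|].
  rewrite ppow_S. apply digit_bound; [|apply Nat.mod_upper_bound; lia].
  destruct (p <=? _); apply IH.
Qed.

Lemma dm q x' a : x' < q -> (x' + q * a) mod q = x' /\ (x' + q * a) / q = a.
Proof.
  intros L. split.
  - rewrite Nat.mul_comm, Nat.Div0.mod_add. now apply Nat.mod_small.
  - rewrite Nat.mul_comm, Nat.div_add by lia. rewrite Nat.div_small; lia.
Qed.

Lemma padd_S i x' a y' b : x' < p ^ i -> y' < p ^ i ->
  padd (S i) (x' + p ^ i * a) (y' + p ^ i * b) =
  (if p <=? a + b then padd i (padd i x' y') (c i mod p ^ i) else padd i x' y') + p ^ i * ((a + b) mod p).
Proof.
  intros Lx Ly. simpl padd. destruct (dm _ x' a Lx) as [-> ->], (dm _ y' b Ly) as [-> ->]. reflexivity.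
Qed.

Lemma split_digit i x : x < p ^ S i -> exists x' a, x = x' + p ^ i * a /\ x' < p ^ i /\ a < p.
Proof.
  intros L. pose proof (ppow_pos i). exists (x mod p ^ i), (x / p ^ i). repeat split.
  - rewrite (Nat.div_mod x (p ^ i)) at 1 by lia. lia.
  - apply Nat.mod_upper_bound. lia.
  - apply Nat.Div0.div_lt_upper_bound. now rewrite <- ppow_S.
Qed.

Lemma padd_comm j : forall x y, padd j x y = padd j y x.
Proof.
  induction j as [|i IH]; intros x y; simpl padd; auto.
  rewrite (IH (y mod _)), (Nat.add_comm (y / _)). reflexivity.
Qed.

Lemma padd_0 j : forall x, x < p ^ j -> padd j 0 x = x.
Proof.
  induction j as [|i IH]; intros x L; [simpl in *; lia|].
  destruct (split_digit i x L) as (x' & a & -> & Lx & La).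
  assert (Z : 0 = 0 + p ^ i * 0) by lia. rewrite Z at 1.
  rewrite padd_S by (auto; apply ppow_pos). simpl (0 + a).
  destruct (Nat.leb_spec p a); [lia|]. rewrite Nat.mod_small, IH by auto. reflexivity.
Qed.

Lemma mod_add_cases a b : a < p -> b < p ->
  ((p <=? a + b) = false /\ (a + b) mod p = a + b /\ a + b < p) \/
  ((p <=? a + b) = true /\ (a + b) mod p = a + b - p /\ p <= a + b).
Proof.
  intros La Lb. destruct (Nat.leb_spec p (a + b)); [right | left]; repeat split; auto.
  - symmetry. apply (Nat.mod_unique _ _ 1); lia.
  - now apply Nat.mod_small.
Qed.

(** Both bracketings produce the same number of overflows of the three top digits, hence the same
    number of summands [c i] in the lower part, where associativity is known by induction. *)
Lemma padd_assoc j : forall x y z, x < p ^ j -> y < p ^ j -> z < p ^ j ->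
  padd j (padd j x y) z = padd j x (padd j y z).
Proof.
  induction j as [|i IH]; intros x y z Lx Ly Lz; auto.
  destruct (split_digit i x Lx) as (x' & a & -> & Lx' & La).
  destruct (split_digit i y Ly) as (y' & b & -> & Ly' & Lb).
  destruct (split_digit i z Lz) as (z' & d & -> & Lz' & Ld).
  set (w := c i mod p ^ i). assert (Lw : w < p ^ i) by (apply Nat.mod_upper_bound; pose proof (ppow_pos i); lia).
  assert (swap : forall u v, u < p ^ i -> v < p ^ i -> padd i (padd i u w) v = padd i (padd i u v) w).
  { intros. rewrite !IH by auto. f_equal. apply padd_comm. }
  pose proof (padd_lt i) as LT.
  rewrite (padd_S i x' a y' b), (padd_S i y' b z' d) by auto. fold w.
  rewrite !padd_S by (auto; destruct (p <=? _); auto). fold w.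
  assert (M : forall a b, (a + b) mod p < p) by (intros; apply Nat.mod_upper_bound; lia).
  destruct (mod_add_cases a b La Lb) as [(-> & -> & ?)|(-> & -> & ?)],
    (mod_add_cases b d Lb Ld) as [(-> & -> & ?)|(-> & -> & ?)];
  match goal with |- context [p <=? ?u + d] => destruct (mod_add_cases u d) as [(-> & -> & ?)|(-> & -> & ?)]; [lia|lia|..] end;
  match goal with |- context [p <=? a + ?u] => destruct (mod_add_cases a u) as [(-> & -> & ?)|(-> & -> & ?)]; [lia|lia|..] end;
  try lia; (f_equal; [|f_equal; lia]); rewrite ?swap by auto; rewrite <- ?IH by auto; auto.
Qed.

Lemma popp_spec j : forall x, x < p ^ j -> popp j x < p ^ j /\ padd j x (popp j x) = 0.
Proof.
  induction j as [|i IH]; intros x L; [simpl; lia|].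
  destruct (split_digit i x L) as (x' & a & -> & Lx & La). simpl popp.
  destruct (dm _ x' a Lx) as [-> ->]. set (w := c i mod p ^ i).
  pose proof (ppow_pos i). assert (Lw : w < p ^ i) by (apply Nat.mod_upper_bound; lia).
  destruct (Nat.eqb_spec a 0) as [->|Na].
  - destruct (IH x' Lx) as [L1 E1]. split; [pose proof (ppow_lt i (S i)); lia|].
    replace (popp i x') with (popp i x' + p ^ i * 0) by lia. rewrite padd_S by auto. simpl (0 + 0).
    destruct (Nat.leb_spec p 0); [lia|]. rewrite E1, Nat.mod_small; lia.
  - destruct (IH (padd i x' w) (padd_lt _ _ _)) as [L1 E1]. split.
    + rewrite ppow_S. apply digit_bound; [auto|lia].
    + rewrite padd_S by auto. destruct (Nat.leb_spec p (a + (p - a))); [|lia]. fold w.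
      rewrite padd_comm, <- padd_assoc, (padd_comm i w) by auto using padd_lt.
      rewrite E1. replace (a + (p - a)) with p by lia. rewrite Nat.Div0.mod_same. lia.
Qed.

Lemma padd_coh i x y : x < p ^ i -> y < p ^ i -> padd (S i) x y = padd i x y.
Proof.
  intros Lx Ly. replace x with (x + p ^ i * 0) at 1 by lia. replace y with (y + p ^ i * 0) at 1 by lia.
  rewrite padd_S by auto. simpl (0 + 0). destruct (Nat.leb_spec p 0); [lia|].
  rewrite Nat.mod_small; lia.
Qed.

Lemma padd_stable i j x y : i <= j -> x < p ^ i -> y < p ^ i -> padd j x y = padd i x y.
Proof.
  induction 1 as [|j Hj IH]; auto. intros Lx Ly. pose proof (ppow_le i j Hj).
  rewrite padd_coh by lia. auto.
Qed.

Lemma popp_stable i j x : i <= j -> x < p ^ i -> popp j x = popp i x.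
Proof.
  induction 1 as [|j Hj IH]; auto. intros Lx. pose proof (ppow_le i j Hj).
  simpl popp. rewrite Nat.div_small, Nat.mod_small by lia. auto.
Qed.

Lemma Pg_assoc (x y z : nat) :
  let add x y := padd (x + y) x y in add (add x y) z = add x (add y z).
Proof.
  simpl. set (j := x + y + z + padd (x + y) x y + padd (y + z) y z).
  rewrite <- (padd_stable (padd (x + y) x y + z) j) by (subst j; try apply lt_ppow; lia).
  rewrite <- (padd_stable (x + padd (y + z) y z) j) by (subst j; try apply lt_ppow; lia).
  rewrite <- (padd_stable (x + y) j) by (subst j; try apply lt_ppow; lia).
  rewrite <- (padd_stable (y + z) j) by (subst j; try apply lt_ppow; lia).
  apply padd_assoc; subst j; apply lt_ppow; lia.
Qed.

Lemma Pg_opp (x : nat) : padd (x + popp x x) x (popp x x) = 0.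
Proof.
  destruct (popp_spec x x) as [L E]; [apply lt_ppow; lia|].
  rewrite (padd_stable x) by (auto; try apply lt_ppow; lia). exact E.
Qed.

(** By [padd_stable] any number of digits that is large enough for both arguments gives the same
    sum; [x + y] is a convenient one. *)
Definition Pg : Grp.
Proof.
  refine {| car := nat; gadd := fun x y => padd (x + y) x y; g0 := 0; gopp := fun x => popp x x |}.
  - exact Pg_assoc.
  - intros x y. rewrite Nat.add_comm. apply padd_comm.
  - intros x. apply padd_0. apply lt_ppow. lia.
  - exact Pg_opp.
Defined.

Lemma Pg_add_eq j (x y : nat) : x < p ^ j -> y < p ^ j -> (x : Pg) ⊕ (y : Pg) = padd j x y.
Proof.
  intros Lx Ly. simpl. rewrite <- (padd_stable (x + y) (x + y + j)) by (try apply lt_ppow; lia).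
  apply padd_stable; auto; lia.
Qed.

Lemma Pg_add_lt j (x y : Pg) : x < p ^ j -> y < p ^ j -> x ⊕ y < p ^ j.
Proof. intros Lx Ly. rewrite (Pg_add_eq j) by auto. apply padd_lt. Qed.

Lemma Pg_opp_lt j (x : Pg) : x < p ^ j -> ⊖ x < p ^ j.
Proof.
  intros L. simpl. rewrite <- (popp_stable x (x + j)) by (try apply lt_ppow; lia).
  rewrite (popp_stable j (x + j)) by (auto; lia). now apply popp_spec.
Qed.

Lemma Pg_nmul_lt j n (x : Pg) : x < p ^ j -> nmul n x < p ^ j.
Proof. intros L. induction n; [apply ppow_pos|]. rewrite nmul_S. now apply Pg_add_lt. Qed.

Lemma Pg_zmul_lt j z (x : Pg) : x < p ^ j -> z • x < p ^ j.
Proof.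
  intros L. destruct z; simpl; [apply ppow_pos | now apply Pg_nmul_lt | now apply Pg_opp_lt, Pg_nmul_lt].
Qed.

Definition gen (j : nat) : Pg := p ^ j.

Lemma Pg_digit j (x : Pg) a : x < p ^ j -> a < p -> x ⊕ Z.of_nat a • gen j = x + p ^ j * a.
Proof.
  intros Lx La. rewrite zmul_nat. pose proof (ppow_pos j).
  assert (forall a, a < p -> nmul a (gen j) = p ^ j * a) as E.
  { clear a La. intros a. induction a as [|a IH]; intros La; [simpl; lia|].
    rewrite nmul_S, IH by lia. unfold gen.
    rewrite (Pg_add_eq (S j)).
    - replace (p ^ j) with (0 + p ^ j * 1) at 1 by lia.
      rewrite <- (Nat.add_0_l (p ^ j * a)), padd_S by auto. destruct (Nat.leb_spec p (1 + a)); [lia|].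
      rewrite padd_0, Nat.mod_small by auto. lia.
    - apply ppow_lt. lia.
    - rewrite ppow_S. apply Nat.mul_lt_mono_pos_l; lia. }
  rewrite E by auto. rewrite (Pg_add_eq (S j)).
  - replace x with (x + p ^ j * 0) at 1 by lia. rewrite <- (Nat.add_0_l (p ^ j * a)) at 1.
    rewrite padd_S by auto. simpl (0 + a). destruct (Nat.leb_spec p a); [lia|].
    rewrite padd_comm, padd_0, Nat.mod_small by auto. reflexivity.
  - pose proof (ppow_lt j (S j)). lia.
  - rewrite ppow_S. apply Nat.mul_lt_mono_pos_l; lia.
Qed.

Lemma Pg_pgen j : Z.of_nat p • gen j = (c j mod p ^ j).
Proof.
  replace p with (1 + (p - 1)) at 1 by lia. rewrite zmul_nat, nmul_add, <- !zmul_nat, zmul_1.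
  assert (E : Z.of_nat (p - 1) • gen j = p ^ j * (p - 1)).
  { rewrite <- (gadd0 Pg (_ • _)). rewrite (Pg_digit j (@g0 Pg)); [reflexivity | apply ppow_pos | lia]. }
  rewrite E. rewrite (Pg_add_eq (S j)).
  - unfold gen. replace (p ^ j) with (0 + p ^ j * 1) at 1 by lia.
    rewrite <- (Nat.add_0_l (p ^ j * (p - 1))).
    rewrite padd_S by apply ppow_pos. destruct (Nat.leb_spec p (1 + (p - 1))); [|lia].
    rewrite (padd_0 j 0) by apply ppow_pos. rewrite padd_0 by (apply Nat.mod_upper_bound; pose proof (ppow_pos j); lia).
    replace (1 + (p - 1)) with p by lia. rewrite Nat.Div0.mod_same. simpl. lia.
  - apply ppow_lt. lia.
  - rewrite ppow_S. simpl. apply Nat.mul_lt_mono_pos_l; [apply ppow_pos | lia].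
Qed.

Lemma Pg_kill j (x : Pg) : x < p ^ j -> pw p j • x = g0.
Proof.
  revert x. induction j as [|i IH]; intros x L.
  - simpl in L. replace x with (@g0 Pg) by (simpl; lia). apply zmul_g0.
  - destruct (split_digit i x L) as (x' & a & -> & Lx & La).
    rewrite <- Pg_digit by auto. rewrite zmulD, pw_S.
    replace ((Z.of_nat p * pw p i) • (x' : Pg)) with (Z.of_nat p • (pw p i • (x' : Pg))) by abel.
    rewrite IH by auto.
    replace ((Z.of_nat p * pw p i) • (Z.of_nat a • gen i)) with (Z.of_nat a • (pw p i • (Z.of_nat p • gen i))) by abel.
    rewrite Pg_pgen, IH by (apply Nat.mod_upper_bound; pose proof (ppow_pos i); lia).
    rewrite !zmul_g0. apply gadd0.
Qed.

Lemma Pg_tors : ptors p Pg.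
Proof. intros x. exists x. apply Pg_kill. apply lt_ppow. auto. Qed.

Section Lin.
Context {T : Grp} (v : nat -> T).

Fixpoint lin (j x : nat) : T :=
  match j with
  | 0 => g0
  | S i => lin i (x mod p ^ i) ⊕ Z.of_nat (x / p ^ i) • v i
  end.

Lemma lin_S i x a : x < p ^ i -> lin (S i) (x + p ^ i * a) = lin i x ⊕ Z.of_nat a • v i.
Proof. intros L. simpl. destruct (dm _ x a L) as [-> ->]. reflexivity. Qed.

Lemma lin_coh i x : x < p ^ i -> lin (S i) x = lin i x.
Proof.
  intros L. replace x with (x + p ^ i * 0) at 1 by lia. rewrite lin_S by auto. apply gadd0r.
Qed.

Lemma lin_stable i j x : i <= j -> x < p ^ i -> lin j x = lin i x.
Proof.
  induction 1 as [|j Hj IH]; auto. intros L. pose proof (ppow_le i j Hj). rewrite lin_coh by lia. auto.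
Qed.

Lemma lin_0 j : lin j 0 = g0.
Proof. rewrite (lin_stable 0 j) by (simpl; lia). reflexivity. Qed.

Lemma lin_gen i j : i < j -> lin j (p ^ i) = v i.
Proof.
  intros L. rewrite (lin_stable (S i) j) by (auto; apply ppow_lt; lia).
  replace (p ^ i) with (0 + p ^ i * 1) by lia. rewrite lin_S by apply ppow_pos.
  rewrite lin_0. simpl Z.of_nat. rewrite zmul_1. apply gadd0.
Qed.

(** The universal property of the digit group: a carry replaces [p] copies of [v i] by the image of
    [c i], and the hypothesis makes these equal. *)
Lemma lin_add j : (forall i, i < j -> Z.of_nat p • v i = lin i (c i mod p ^ i)) ->
  forall x y, x < p ^ j -> y < p ^ j -> lin j (padd j x y) = lin j x ⊕ lin j y.
Proof.
  induction j as [|i IH]; intros Hv x y Lx Ly; [symmetry; apply gadd0|].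
  destruct (split_digit i x Lx) as (x' & a & -> & Lx' & La).
  destruct (split_digit i y Ly) as (y' & b & -> & Ly' & Lb).
  rewrite padd_S, !lin_S by (auto; destruct (p <=? _); apply padd_lt).
  assert (Lw : c i mod p ^ i < p ^ i) by (apply Nat.mod_upper_bound; pose proof (ppow_pos i); lia).
  assert (IH' := IH (fun k Hk => Hv k (Nat.lt_lt_succ_r _ _ Hk))).
  destruct (mod_add_cases a b La Lb) as [(-> & -> & ?)|(-> & -> & ?)].
  - rewrite IH', Nat2Z.inj_add by auto. abel.
  - rewrite !IH', <- Hv by auto using padd_lt.
    rewrite Nat2Z.inj_sub, Nat2Z.inj_add by auto. abel.
Qed.

End Lin.

Definition plin {T : Grp} (v : nat -> T) (x : Pg) : T := lin v x x.

Lemma plin_lin {T : Grp} (v : nat -> T) j (x : Pg) : x < p ^ j -> plin v x = lin v j x.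
Proof.
  intros L. unfold plin. rewrite <- (lin_stable v x (x + j)) by (try apply lt_ppow; lia).
  apply lin_stable; auto; lia.
Qed.

Lemma plin_gen {T : Grp} (v : nat -> T) j : plin v (gen j) = v j.
Proof. rewrite (plin_lin v (S j)); [apply lin_gen; lia | apply ppow_lt; lia]. Qed.

End Digits.

Lemma padd_agree p c c' j : (forall i, i < j -> c i = c' i) -> forall x y, padd p c j x y = padd p c' j x y.
Proof.
  induction j as [|i IH]; intros E x y; simpl; auto.
  rewrite !IH, E by (intros; try apply E; lia). reflexivity.
Qed.

(** * Initial segments of digit groups *)

Section Segment.
Context (p : nat) (Hp : prime (Z.of_nat p)) (ok : nat -> Prop) (vv : nat -> nat).
Notation D x := (forall j, p ^ j <= x -> ok j).
Notation Q := (Pg p (prime_ge2 p Hp) vv).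

(** Digits from the first failure of [ok] on must vanish, so [D] is the subgroup spanned by the
    earlier generators; finite groups are covered in this way. *)
Lemma D_iff x : D x <-> exists j, x < p ^ j /\ forall i, i < j -> ok i.
Proof.
  pose proof (prime_ge2 p Hp) as H2. split.
  - intros H. assert (Ex : forall j, x < p ^ j -> exists j', x < p ^ j' /\ forall i, i < j' -> ok i).
    { induction j as [|j IH]; intros L; [exists 0; split; auto; lia|].
      destruct (Nat.lt_ge_cases x (p ^ j)) as [L'|L']; auto. exists (S j). split; auto.
      intros i Li. apply H. etransitivity; [|exact L']. apply ppow_le; auto. lia. }
    apply (Ex x). apply lt_ppow; auto.
  - intros (j & L & H) i Li. apply H. destruct (Nat.lt_ge_cases i j) as [|G]; auto.
    pose proof (ppow_le p H2 j i G). lia.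
Qed.

Lemma D_join x y : D x -> D y -> exists j, x < p ^ j /\ y < p ^ j /\ forall i, i < j -> ok i.
Proof.
  intros Dx Dy. destruct (proj1 (D_iff x) Dx) as (j & L & H). destruct (proj1 (D_iff y) Dy) as (j' & L' & H').
  pose proof (prime_ge2 p Hp) as H2.
  destruct (Nat.le_ge_cases j j') as [Lj|Lj]; pose proof (ppow_le p H2 _ _ Lj); [exists j' | exists j]; repeat split; auto; lia.
Qed.

Lemma D_add x y : D x -> D y -> D ((x : Q) ⊕ (y : Q)).
Proof.
  intros Dx Dy. apply D_iff. destruct (D_join x y Dx Dy) as (j & Lx & Ly & H). exists j. split; auto. now apply Pg_add_lt.
Qed.

Lemma D_opp x : D x -> D (⊖ (x : Q)).
Proof.
  intros Dx. apply D_iff. apply D_iff in Dx. destruct Dx as (j & Lx & H). exists j. split; auto. now apply Pg_opp_lt.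
Qed.

Lemma D_0 : D 0.
Proof. apply D_iff. exists 0. split; [simpl; lia|]. lia. Qed.

Context {T : Grp} (b : nat -> T).
Context (b_rel : forall i, (forall i', i' <= i -> ok i') -> Z.of_nat p • b i = lin p b i (vv i mod p ^ i)).

Definition pf (x : nat) : T := lin p b x x.

Lemma pf_lin j x : x < p ^ j -> pf x = lin p b j x.
Proof. apply (plin_lin p (prime_ge2 p Hp) vv b j x). Qed.

Lemma pf_add x y : D x -> D y -> pf ((x : Q) ⊕ (y : Q)) = pf x ⊕ pf y.
Proof.
  intros Dx Dy. destruct (D_join x y Dx Dy) as (j & Lx & Ly & H).
  assert (L : (x : Q) ⊕ (y : Q) < p ^ j) by now apply Pg_add_lt.
  rewrite (pf_lin j _ L), (pf_lin j x), (pf_lin j y) by auto. rewrite (Pg_add_eq p (prime_ge2 p Hp) vv j) by auto.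
  apply (lin_add p (prime_ge2 p Hp)); auto. intros i Li. apply b_rel. intros; apply H; lia.
Qed.

Lemma pf_opp x : D x -> pf (⊖ (x : Q)) = ⊖ pf x.
Proof.
  intros Dx. apply gopp_unique. rewrite <- pf_add; [now rewrite gaddN | exact Dx | now apply D_opp].
Qed.

Lemma pf_zmul z x j : x < p ^ j -> (forall i, i < j -> ok i) ->
  exists x', x' < p ^ j /\ pf x' = z • pf x.
Proof.
  intros L H. assert (Dj : forall y, y < p ^ j -> D y) by (intros y Ly; apply D_iff; eauto).
  assert (N : forall k, exists x', x' < p ^ j /\ pf x' = nmul k (pf x)).
  { induction k as [|k (x' & L' & E)]; [exists 0; split; [apply ppow_pos, prime_ge2; auto | reflexivity]|].
    exists ((x : Q) ⊕ (x' : Q)). split; [now apply Pg_add_lt|]. rewrite pf_add, E by (apply Dj; auto). reflexivity. }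
  destruct z; [apply (N 0) | apply N|].
  destruct (N (Pos.to_nat p0)) as (x' & L' & E). exists (⊖ (x' : Q)). split; [now apply Pg_opp_lt|].
  rewrite pf_opp, E by (apply Dj; auto). reflexivity.
Qed.

Context (b_new : forall i x, (forall i', i' <= i -> ok i') -> x < p ^ i -> b i <> lin p b i x).

(** A nonzero leading digit is invertible modulo [p]; multiplying the relation by its inverse would
    express [b j] through earlier elements, against [b_new]. *)
Lemma pf_kernel x : D x -> pf x = g0 -> x = 0.
Proof.
  intros Dx. apply D_iff in Dx. destruct Dx as (j & L & H). pose proof (prime_ge2 p Hp) as H2.
  revert x L. induction j as [|j IH]; intros x L E; [simpl in L; lia|].
  destruct (split_digit p H2 j x L) as (x' & d & -> & Lx & Ld).
  destruct (Nat.eq_dec d 0) as [->|Nd].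
  { rewrite Nat.mul_0_r, Nat.add_0_r in *. apply IH; auto. }
  exfalso. rewrite (pf_lin (S j)), lin_S in E by auto.
  assert (Hj : forall i, i <= j -> ok i) by (intros; apply H; lia).
  assert (Hj' : forall i, i < j -> ok i) by (intros; apply H; lia).
  destruct (coprime_inv p Hp (Z.of_nat d)) as (k & u & Ek).
  { intros Dd. apply Z.divide_pos_le in Dd; lia. }
  assert (Ey : b j = (- k)%Z • pf x' ⊕ (- u)%Z • pf (vv j mod p ^ j)).
  { rewrite (pf_lin j (vv j mod p ^ j)) by (apply Nat.mod_upper_bound; pose proof (ppow_pos p H2 j); lia).
    rewrite <- b_rel, (pf_lin j x' Lx) by auto. rewrite <- zmul_mul.
    transitivity ((k * Z.of_nat d)%Z • b j ⊕ (- u * Z.of_nat p)%Z • b j).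
    2: { assert (E3 : (k * Z.of_nat d)%Z • b j = (- k)%Z • lin p b j x'); [|now rewrite E3].
         rewrite zmul_opp, zmul_mul. apply gopp_unique. rewrite <- zmulD, E. apply zmul_g0. }
    rewrite <- zmul_add. replace (_ + _)%Z with 1%Z by lia. symmetry. apply zmul_1. }
  destruct (pf_zmul (- k) x' j Lx Hj') as (x1 & L1 & E1).
  destruct (pf_zmul (- u) (vv j mod p ^ j) j) as (x2 & L2 & E2); auto.
  { apply Nat.mod_upper_bound. pose proof (ppow_pos p H2 j). lia. }
  rewrite <- E1, <- E2, <- pf_add in Ey by (apply D_iff; eauto).
  rewrite (pf_lin j) in Ey by now apply Pg_add_lt. revert Ey. apply b_new; auto. now apply Pg_add_lt.
Qed.

Lemma pf_inj x y : D x -> D y -> pf x = pf y -> x = y.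
Proof.
  intros Dx Dy E. apply (@gsub_eq Q). apply pf_kernel; [apply D_add; auto; now apply D_opp|].
  rewrite pf_add, pf_opp, E; [apply gaddN | exact Dy | exact Dx | now apply D_opp].
Qed.

End Segment.

(** * Finite cyclic groups *)

Section Zq.
Context (q : Z) (Hq : (0 < q)%Z).

(** Canonical representatives, so that equality of the group is Leibniz equality; proofs of integer
    equations are unique. *)
Definition zq_car : Type := {z : Z | (z mod q = z)%Z}.

Lemma zq_eq (x y : zq_car) : proj1_sig x = proj1_sig y -> x = y.
Proof.
  destruct x as [x Hx], y as [y Hy]. simpl. intros <-. f_equal. apply UIP_dec, Z.eq_dec.
Qed.

Definition zq_of (z : Z) : zq_car := exist _ (z mod q)%Z (Zmod_mod z q).

Definition Zq : Grp.
Proof.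
  refine {| car := zq_car; gadd := fun x y => zq_of (proj1_sig x + proj1_sig y)%Z;
            g0 := zq_of 0; gopp := fun x => zq_of (- proj1_sig x)%Z |}.
  - intros x y z. apply zq_eq. simpl. now rewrite Zplus_mod_idemp_l, Zplus_mod_idemp_r, Z.add_assoc.
  - intros x y. now rewrite Z.add_comm.
  - intros x. apply zq_eq. simpl. rewrite ?Z.mod_0_l by lia. apply (proj2_sig x).
  - intros x. apply zq_eq. simpl. rewrite Zplus_mod_idemp_r. now rewrite Z.add_opp_diag_r.
Defined.

Lemma zq_of_add a b : zq_of (a + b) = (zq_of a : Zq) ⊕ (zq_of b : Zq).
Proof. apply zq_eq. simpl. apply Zplus_mod. Qed.

Lemma zq_of_mul z a : zq_of (z * a) = z • (zq_of a : Zq).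
Proof.
  assert (N : forall n, zq_of (Z.of_nat n * a) = nmul n (zq_of a : Zq)).
  { induction n as [|n IH]; [apply zq_eq; reflexivity|].
    rewrite nmul_S, <- IH, <- zq_of_add. f_equal. lia. }
  destruct (Z_diff z) as (m & n & ->). rewrite zmul_sub, <- !N.
  replace ((Z.of_nat m - Z.of_nat n) * a)%Z with (Z.of_nat m * a + - (Z.of_nat n * a))%Z by lia.
  rewrite zq_of_add. f_equal. apply (@gopp_unique Zq). rewrite <- zq_of_add, Z.add_opp_diag_r. reflexivity.
Qed.

Lemma zq_of_0 z : zq_of z = (g0 : Zq) <-> (q | z)%Z.
Proof.
  split.
  - intros E. apply (f_equal (@proj1_sig _ _)) in E. simpl in E. rewrite ?Z.mod_0_l in E by lia.
    now apply Z.mod_divide; [lia|].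
  - intros D. apply zq_eq. simpl. rewrite ?Z.mod_0_l by lia. now apply Z.mod_divide; [lia|].
Qed.

Lemma zq_kill (x : Zq) : q • x = g0.
Proof.
  assert (E : x = zq_of (proj1_sig x)) by (apply zq_eq; symmetry; apply (proj2_sig x)).
  rewrite E, <- zq_of_mul. apply zq_of_0. exists (proj1_sig x). lia.
Qed.

End Zq.

(** * Finite sums *)

Section Sums.
Context {G : Grp}.

Fixpoint gsum (K : nat) (g : nat -> G) : G :=
  match K with 0 => g0 | S K => gsum K g ⊕ g K end.

Lemma gsum_ext K g h : (forall k, k < K -> g k = h k) -> gsum K g = gsum K h.
Proof. induction K; intros E; simpl; auto. rewrite IHK, E; auto. Qed.

Lemma gsum_add K g h : gsum K (fun k => g k ⊕ h k) = gsum K g ⊕ gsum K h.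
Proof. induction K; simpl; [symmetry; apply gadd0|]. rewrite IHK. apply gaddACA. Qed.

Lemma gsum_zmul K z g : gsum K (fun k => z • g k) = z • gsum K g.
Proof. induction K; simpl; [symmetry; apply zmul_g0|]. now rewrite IHK, zmulD. Qed.

Lemma gsum_0 K g : (forall k, k < K -> g k = g0) -> gsum K g = g0.
Proof. induction K; intros E; simpl; auto. rewrite IHK, E; auto. apply gadd0. Qed.

Lemma gsum_single K i (x : G) : i < K -> gsum K (fun k => if k =? i then x else g0) = x.
Proof.
  induction K as [|K IH]; intros L; [lia|]. simpl. destruct (Nat.eqb_spec K i) as [->|N].
  - rewrite gsum_0, gadd0; auto. intros k Hk. destruct (Nat.eqb_spec k i); auto. lia.
  - rewrite IH by lia. apply gadd0r.
Qed.

Lemma gsum_extend K K' g : K <= K' -> (forall k, K <= k -> g k = g0) -> gsum K' g = gsum K g.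
Proof. induction 1; intros E; simpl; auto. rewrite IHle, E by auto. apply gadd0r. Qed.

Lemma gsum_closed (P : G -> Prop) K g : P g0 -> (forall x y, P x -> P y -> P (x ⊕ y)) ->
  (forall k, k < K -> P (g k)) -> P (gsum K g).
Proof. intros H0 HA. induction K; intros Hg; simpl; [auto|]. apply HA; [apply IHK; intros|]; apply Hg; lia. Qed.

End Sums.

(** * Bases of the Ulm factors *)

Section Bases.
Context (p : nat) (Hp : prime (Z.of_nat p)).
Notation Dv := (Dv p). Notation UX := (UX p).

(** A basis, over the field with [p] elements, of the [m]-th Ulm factor. Combinations are written
    with integer sequences that vanish off [I], which avoids enumerating [I]. *)
Record Ubasis (G : Grp) (m : nat) (I : nat -> Prop) (v : nat -> G) : Prop := {
  ub_mem : forall k, I k -> UX m (v k);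
  ub_span : forall x, UX m x -> exists K z, (forall k, I k \/ z k = 0%Z) /\ (forall k, K <= k -> z k = 0%Z) /\
      Dv (S m) (x ⊖ gsum K (fun k => z k • v k));
  ub_indep : forall K z, (forall k, I k \/ z k = 0%Z) -> Dv (S m) (gsum K (fun k => z k • v k)) ->
      forall k, k < K -> (Z.of_nat p | z k)%Z
}.

Lemma Dv_gsum {G : Grp} m K (g : nat -> G) : (forall k, k < K -> Dv m (g k)) -> Dv m (gsum K g).
Proof. intros H. apply gsum_closed; auto; [apply Dv_g0 | intros; now apply Dv_add]. Qed.

Lemma UX_zmul {G : Grp} m z (x : G) : UX m x -> UX m (z • x).
Proof.
  intros [A B]. split; [now apply Dv_zmul|].
  replace (Z.of_nat p • (z • x)) with (z • (Z.of_nat p • x)) by abel. now apply Dv_zmul.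
Qed.

Lemma UX_add {G : Grp} m (x y : G) : UX m x -> UX m y -> UX m (x ⊕ y).
Proof. intros [A B] [A' B']. split; [|rewrite zmulD]; now apply Dv_add. Qed.

Lemma UX_g0 {G : Grp} m : UX m (@g0 G).
Proof. split; [|rewrite zmul_g0]; apply Dv_g0. Qed.

Lemma Ubasis_Uinj (G H : Grp) m I J v w (phi : nat -> nat) :
  Ubasis G m I v -> Ubasis H m J w ->
  (forall k, I k -> J (phi k)) -> (forall k k', I k -> I k' -> phi k = phi k' -> k = k') ->
  Uinj p G H m.
Proof.
  intros [M1 S1 I1] [M2 S2 I2] Hphi Hinj.
  assert (indep : forall K z, (forall k, I k \/ z k = 0%Z) -> Dv (S m) (gsum K (fun k => z k • w (phi k))) ->
      forall k, k < K -> (Z.of_nat p | z k)%Z).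
  { intros K z Hz D.
    (* The coefficients pushed forward along [phi]: position [j] collects those of its preimages
       below [K]. *)
    pose (z' := fix z' K j := match K with 0 => 0%Z
       | S K => (z' K j + if Nat.eqb j (phi K) then z K else 0)%Z end).
    assert (exists B, forall k, k < K -> phi k < B) as [B HB].
    { clear. induction K as [|K [B HB]]; [exists 0; lia|]. exists (B + S (phi K)). intros k L.
      destruct (Nat.eq_dec k K) as [->|]; [lia|]. specialize (HB k). lia. }
    assert (E : gsum K (fun k => z k • w (phi k)) = gsum B (fun j => z' K j • w j)).
    { clear D. induction K as [|K IH].
      - symmetry. apply gsum_0. auto.
      - simpl. rewrite IH by auto.
        rewrite (gsum_ext B (fun j => (z' K j + _)%Z • w j)
          (fun j => z' K j • w j ⊕ (if j =? phi K then z K • w (phi K) else g0))).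
        + rewrite gsum_add, gsum_single; auto.
        + intros j _. rewrite zmul_add. destruct (Nat.eqb_spec j (phi K)) as [->|]; auto. }
    assert (Jz : forall j, J j \/ z' K j = 0%Z).
    { clear - Hz Hphi. intros j. induction K as [|K IH]; [now right|]. simpl.
      destruct IH as [|IH]; auto. rewrite IH. destruct (Nat.eqb_spec j (phi K)) as [->|]; auto.
      destruct (Hz K) as [IK | ->]; auto. }
    assert (vz : forall k, k < K -> I k -> z' K (phi k) = z k).
    { clear - Hz Hinj. intros k Lk Ik. 
      assert (far : forall K, K <= k -> z' K (phi k) = 0%Z).
      { clear Lk K. induction K as [|K IH]; intros L; auto. simpl. rewrite IH by lia.
        destruct (Nat.eqb_spec (phi k) (phi K)) as [E|]; auto.
        destruct (Hz K) as [IK | ->]; auto. apply Hinj in E; auto. lia. }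
      induction K as [|K IH]; [lia|]. simpl. destruct (Nat.eq_dec k K) as [->|N].
      - rewrite far, Nat.eqb_refl; auto; lia.
      - rewrite IH by lia. destruct (Nat.eqb_spec (phi k) (phi K)) as [E|]; [|lia].
        destruct (Hz K) as [IK | ->]; [|lia]. now apply Hinj in E. }
    rewrite E in D. intros k Lk. destruct (Hz k) as [Ik | ->]; [|apply Z.divide_0_r].
    rewrite <- (vz k Lk Ik). apply (I2 B (z' K)); auto. }
  pose (rep := fun x (q : nat * (nat -> Z)) => (forall k, I k \/ snd q k = 0%Z) /\
     (forall k, fst q <= k -> snd q k = 0%Z) /\ Dv (S m) (x ⊖ gsum (fst q) (fun k => snd q k • v k))).
  assert (Ex : forall x, exists q, UX m x -> rep x q).
  { intros x. destruct (classic (UX m x)) as [U|U]; [|exists (0, fun _ => 0%Z); easy].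
    destruct (S1 x U) as (K & z & A & B & C). exists (K, z). intros _. now split. }
  destruct (fun_choice _ Ex) as [ch Hch].
  exists (fun x => gsum (fst (ch x)) (fun k => snd (ch x) k • w (phi k))). split.
  - intros x U. destruct (Hch x U) as (A & B & C).
    apply gsum_closed; [apply UX_g0 | intros; now apply UX_add|].
    intros k _. destruct (A k) as [Ik | ->]; [apply UX_zmul; auto | apply UX_g0].
  - intros x x' U U' D. destruct (Hch x U) as (A & B & C), (Hch x' U') as (A' & B' & C').
    set (K := fst (ch x)) in *. set (z := snd (ch x)) in *.
    set (K' := fst (ch x')) in *. set (z' := snd (ch x')) in *.
    set (N := K + K').
    assert (ext1 : forall (T : Grp) (u : nat -> T), gsum K (fun k => z k • u k) = gsum N (fun k => z k • u k)).
    { intros T u. symmetry. apply gsum_extend; [unfold N; lia|]. intros k L. now rewrite B. }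
    assert (ext2 : forall (T : Grp) (u : nat -> T), gsum K' (fun k => z' k • u k) = gsum N (fun k => z' k • u k)).
    { intros T u. symmetry. apply gsum_extend; [unfold N; lia|]. intros k L. now rewrite B'. }
    assert (dif : forall (T : Grp) (u : nat -> T), gsum N (fun k => z k • u k) ⊖ gsum N (fun k => z' k • u k)
        = gsum N (fun k => (z k - z' k)%Z • u k)).
    { intros T u. rewrite (gsum_ext N (fun k => (z k - z' k)%Z • u k) (fun k => z k • u k ⊕ (-1)%Z • (z' k • u k))).
      - rewrite gsum_add, gsum_zmul. abel.
      - intros k _. abel. }
    rewrite (ext1 H (fun k => w (phi k))), (ext2 H (fun k => w (phi k))), dif in D.
    rewrite ext1 in C. rewrite ext2 in C'.
    assert (Dz : forall k, k < N -> (Z.of_nat p | z k - z' k)%Z).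
    { apply indep; auto. intros k. destruct (A k) as [|Ez]; auto. destruct (A' k) as [|Ez']; auto. right. lia. }
    replace (x ⊖ x') with ((x ⊖ gsum N (fun k => z k • v k)) ⊖ (x' ⊖ gsum N (fun k => z' k • v k)) ⊕
       (gsum N (fun k => z k • v k) ⊖ gsum N (fun k => z' k • v k))) by abel.
    apply Dv_add; [now apply Dv_sub|]. rewrite dif. apply Dv_gsum. intros k Lk.
    destruct (Dz k Lk) as [u E]. destruct (classic (I k)) as [Ik|Ik].
    + rewrite E. replace ((u * Z.of_nat p)%Z • v k) with (Z.of_nat p • (u • v k)) by abel.
      apply Dv_p, Dv_zmul, M1; auto.
    + destruct (A k) as [|Ez]; [easy|]. destruct (A' k) as [|Ez']; [easy|]. rewrite Ez, Ez'. apply Dv_g0.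
Qed.

(* A coordinate system with values in cyclic groups; it need only be defined on finitely many
   elements at a time.  [n k = 0] marks an unused index. *)
Lemma basic_Ubasis (C : Grp) (e : nat -> C) (n : nat -> nat) :
  (forall x, exists K z y, x = gsum K (fun k => z k • e k) ⊕ Z.of_nat p • y) ->
  (forall k, Dv (S (n k)) (pw p (n k) • e k)) ->
  (forall k K y, n k <> 0 -> exists (D : C -> Prop) (f : C -> Zq (pw p (n k))),
     D y /\ (forall l, l < K -> D (e l)) /\ (forall x x', D x -> D x' -> D (x ⊕ x')) /\ (forall x, D x -> D (⊖ x)) /\
     (forall x x', D x -> D x' -> f (x ⊕ x') = f x ⊕ f x') /\
     f (e k) = zq_of _ 1 /\ forall l, l < K -> l <> k -> exists w, f (e l) = Z.of_nat p • w) ->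
  forall m, Ubasis C m (fun k => n k = S m) (fun k => pw p m • e k).
Proof.
  intros gen hdiv coord m.
  (* Under the coordinate [f] of index [k] all other terms and the right side fall into the
     multiples of [p^(a+1)], hence so does [z k * p^a] modulo [p^(n k)]; as [a < n k], this forces
     [p] to divide [z k]. *)
  assert (key : forall a K z y, gsum K (fun k => z k • (pw p a • e k)) = pw p (S a) • y ->
     (forall k, k < K -> n k > a \/ z k = 0%Z) -> forall k, k < K -> (Z.of_nat p | z k)%Z).
  { intros a K z y E Hz k Lk. destruct (Hz k Lk) as [Hk | ->]; [|apply Z.divide_0_r].
    destruct (coord k K y) as (D & f & Dy & De & Da & Do & fa & fk & fl); [lia|].
    assert (D0 : D g0) by (rewrite <- (gaddN C y); auto).
    assert (f0 : f g0 = g0).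
    { pose proof (fa g0 g0 D0 D0) as F. rewrite gadd0 in F. apply (gaddI (f g0)). now rewrite <- F, gadd0r. }
    assert (fo : forall x, D x -> f (⊖ x) = ⊖ f x).
    { intros x Dx. apply gopp_unique. rewrite <- fa, gaddN; auto. }
    assert (Dn : forall j x, D x -> D (nmul j x)).
    { intros j x Dx. induction j; [auto|]. rewrite nmul_S. auto. }
    assert (fn : forall j x, D x -> f (nmul j x) = nmul j (f x)).
    { intros j x Dx. induction j; [auto|]. rewrite !nmul_S, fa, IHj; auto. }
    assert (Dz : forall j x, D x -> D (j • x)).
    { intros j x Dx. destruct j; simpl; auto. }
    assert (fz : forall j x, D x -> f (j • x) = j • f x).
    { intros j x Dx. destruct j; simpl; auto. rewrite fo; auto. now rewrite fn. }
    assert (fsum : forall K', K' <= K -> D (gsum K' (fun k => z k • (pw p a • e k))) /\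
       exists w, f (gsum K' (fun k => z k • (pw p a • e k))) =
         (if k <? K' then (z k * pw p a)%Z • (zq_of _ 1 : Zq (pw p (n k))) else g0) ⊕ (pw p (S a)) • w).
    { induction K' as [|K' IH]; intros L.
      - cbn [gsum]. split; auto. exists (@g0 (Zq (pw p (n k)))). destruct (Nat.ltb_spec k 0); [lia|].
        now rewrite f0, zmul_g0, gadd0.
      - destruct IH as [IHD [w IHf]]; [lia|]. simpl gsum. split; [auto|].
        rewrite fa, IHf, !fz by auto.
        destruct (Nat.eq_dec k K') as [->|N].
        + exists w. destruct (Nat.ltb_spec K' K'), (Nat.ltb_spec K' (S K')); try lia. rewrite fk. abel.
        + destruct (fl K') as [w' Ew']; [lia|auto|]. exists (w ⊕ z K' • w'). rewrite Ew', pw_S.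
          destruct (Nat.ltb_spec k K'), (Nat.ltb_spec k (S K')); try lia; abel. }
    destruct (fsum K) as [_ [w Ew]]; auto. rewrite E, fz in Ew by auto.
    destruct (Nat.ltb_spec k K); [|lia].
    assert (E1 : (z k * pw p a)%Z • (zq_of _ 1 : Zq (pw p (n k))) = pw p (S a) • (f y ⊖ w)).
    { rewrite zmulD, Ew. abel. }
    rewrite <- zq_of_mul in E1.
    assert (E2 : pw p (n k - S a) • (zq_of _ (z k * pw p a * 1) : Zq (pw p (n k))) = g0).
    { rewrite E1. rewrite <- zmul_mul, <- pw_add. replace (n k - S a + S a) with (n k) by lia.
      apply zq_kill, (pw_pos p Hp). }
    rewrite <- zq_of_mul in E2. apply zq_of_0 in E2; [|apply (pw_pos p Hp)]. destruct E2 as [u Eu].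
    replace (n k) with ((n k - S a) + S a) in Eu at 2 by lia.
    rewrite pw_add, pw_S in Eu. exists u.
    pose proof (pw_pos p Hp (n k - S a)). pose proof (pw_pos p Hp a).
    apply (Z.mul_reg_l _ _ (pw p (n k - S a) * pw p a)); [nia|]. lia. }
  constructor.
  - intros k Hk. split; [now exists (e k)|].
    replace (Z.of_nat p • (pw p m • e k)) with (pw p (n k) • e k).
    + rewrite <- Hk. apply hdiv.
    + rewrite Hk, pw_S. abel.
  - intros x [[y ->] Ux]. destruct (gen y) as (K & z & y' & ->).
    (* The indices are sorted by whether [n k] equals, exceeds or stays below [S m]. Those below
       contribute nothing modulo [p^(m+1)] by [hdiv]; for those above, [key] at [S m] shows that the
       coefficients are divisible by [p]. *)
    set (zm := fun k => if k <? K then if n k =? S m then z k else 0%Z else 0%Z).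
    exists K, zm. split; [|split].
    + intros k. unfold zm. destruct (Nat.eqb_spec (n k) (S m)); auto. right. now destruct (k <? K).
    + intros k L. unfold zm. destruct (Nat.ltb_spec k K); auto. lia.
    + set (zb := fun k => if S m <? n k then z k else 0%Z).
      set (zs := fun k => if n k <=? m then z k else 0%Z).
      assert (split : gsum K (fun k => z k • e k) =
         gsum K (fun k => zm k • e k) ⊕ gsum K (fun k => zb k • e k) ⊕ gsum K (fun k => zs k • e k)).
      { rewrite <- !gsum_add. apply gsum_ext. intros k L. unfold zm, zb, zs.
        destruct (Nat.ltb_spec k K), (Nat.eqb_spec (n k) (S m)), (Nat.ltb_spec (S m) (n k)),
          (Nat.leb_spec (n k) m); try lia; abel. }
      assert (Ds : Dv (S m) (pw p m • gsum K (fun k => zs k • e k))).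
      { rewrite <- gsum_zmul. apply Dv_gsum. intros k L. unfold zs.
        destruct (Nat.leb_spec (n k) m) as [B|B]; [|simpl; rewrite zmul_g0; apply Dv_g0].
        replace (pw p m • (z k • e k)) with (z k • (pw p (m - n k) • (pw p (n k) • e k))).
        - apply Dv_zmul. replace (S m) with ((m - n k) + S (n k)) by lia. now apply Dv_pw.
        - replace m with ((m - n k) + n k) at 2 by lia. rewrite pw_add. abel. }
      assert (Dm : Dv (S (S m)) (Z.of_nat p • (pw p m • gsum K (fun k => zm k • e k)))).
      { rewrite <- gsum_zmul, <- gsum_zmul. apply Dv_gsum. intros k L. unfold zm.
        destruct (Nat.ltb_spec k K); [|lia].
        destruct (Nat.eqb_spec (n k) (S m)) as [B|B]; [|simpl; rewrite !zmul_g0; apply Dv_g0].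
        replace (Z.of_nat p • (pw p m • (z k • e k))) with (z k • (pw p (n k) • e k)).
        - apply Dv_zmul. rewrite <- B. apply hdiv.
        - rewrite B, pw_S. abel. }
      assert (Db : forall k, k < K -> (Z.of_nat p | zb k)%Z).
      { assert (DD : Dv (S (S m)) (Z.of_nat p • (pw p m • gsum K (fun k => zb k • e k)))).
        { replace (Z.of_nat p • (pw p m • gsum K (fun k => zb k • e k))) with
            (Z.of_nat p • (pw p m • (gsum K (fun k => z k • e k) ⊕ Z.of_nat p • y'))
             ⊖ Z.of_nat p • (pw p m • gsum K (fun k => zm k • e k))
             ⊖ Z.of_nat p • (pw p m • gsum K (fun k => zs k • e k))
             ⊖ Z.of_nat p • (Z.of_nat p • (pw p m • y'))) by (rewrite split; abel).
          apply Dv_sub; [apply Dv_sub; [apply Dv_sub|]|]; auto.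
          - now apply Dv_p.
          - apply Dv_p, Dv_p. now exists y'. }
        destruct DD as [u Eu]. apply (key (S m) K zb u).
        - rewrite <- Eu, pw_S, <- gsum_zmul, <- gsum_zmul. apply gsum_ext. intros. abel.
        - intros k L. unfold zb. destruct (Nat.ltb_spec (S m) (n k)); [left; lia | auto]. }
      assert (Db' : Dv (S m) (pw p m • gsum K (fun k => zb k • e k))).
      { rewrite <- gsum_zmul. apply Dv_gsum. intros k L. destruct (Db k L) as [u ->].
        replace (pw p m • ((u * Z.of_nat p)%Z • e k)) with (Z.of_nat p • (pw p m • (u • e k))) by abel.
        apply Dv_p. now exists (u • e k). }
      replace (gsum K (fun k => zm k • (pw p m • e k))) with (pw p m • gsum K (fun k => zm k • e k)).
      2: { rewrite <- gsum_zmul. apply gsum_ext. intros. abel. }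
      rewrite split.
      replace (_ ⊖ _) with (pw p m • gsum K (fun k => zb k • e k) ⊕ pw p m • gsum K (fun k => zs k • e k)
        ⊕ Z.of_nat p • (pw p m • y')) by abel.
      apply Dv_add; [now apply Dv_add|]. apply Dv_p. now exists y'.
  - intros K z Hz [y E] k L. apply (key m K z y); auto.
    intros j _. destruct (Hz j); auto. left. lia.
Qed.

End Bases.

(** * Memory *)

Definition mem : Type := list (nat * nat * nat).

(** The accumulator 0 means that nothing was found yet and a hit is stored as its successor; so the
    latest write counts and cells never written read 0. *)
Definition get (m : mem) (t i : nat) : nat :=
  pred (fold_left (fun r q => if r =? 0 then
    (if (fst (fst q) =? t) && (snd (fst q) =? i) then S (snd q) else 0) else r)%bool m 0).

Definition upd (m : mem) (t i v : nat) : mem := (t, i, v) :: m.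

Lemma get_upd m t i v t' i' :
  get (upd m t i v) t' i' = if ((t =? t') && (i =? i'))%bool then v else get m t' i'.
Proof.
  unfold get, upd. simpl. destruct (_ && _)%bool; auto.
  set (f := fun _ _ => _). assert (E : fold_left f m (S v) = S v) by (induction m; auto).
  now rewrite E.
Qed.

Lemma get_nil t i : get [] t i = 0.
Proof. reflexivity. Qed.

#[global] Opaque get upd.

Ltac gu := repeat rewrite get_upd; cbn [Nat.eqb andb].

(* The state of the construction: [fLen] generators exist so far, and [fC i] is the relation of the [i]-th.
   [fB s] represents the tree node [s] in the group ([0] while [s] is inactive).  [fE k] generates the
   component [k], of current exponent [fCur k] ([0] while [k] is unused); [fOwn k] is the node whose
   representative is divided by [fE k], or [0] once [k] is retired, that is, split off as a direct summand.
   [fKap s] is one more than the component owned by [s], and [fLv s] the last level of [s] acted upon. *)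
Notation fC m i := (get m 0 i).
Notation fB m i := (get m 1 i).
Notation fE m i := (get m 2 i).
Notation fCur m i := (get m 3 i).
Notation fOwn m i := (get m 4 i).
Notation fKap m i := (get m 5 i).
Notation fLv m i := (get m 6 i).
Notation fLen m := (get m 7 0).

Section Ops.
Context (p : nat) (par : nat -> nat) (dig : nat -> nat -> nat).

(** Ordered from the top of the tree down to [s], which is included; 0 is not a node but marks a
    missing parent. As parents are smaller, [s] steps are enough. *)
Definition ancs (s : nat) : list nat :=
  snd (iterate s (fun q : nat * list nat =>
    if fst q =? 0 then q else (par (fst q), fst q :: snd q)) (s, [])).

Definition el_add (m : mem) (x y : nat) : nat := padd p (fun i => fC m i) (fLen m) x y.
Definition el_mul (m : mem) (k x : nat) : nat := iterate k (el_add m x) 0.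
(** The group built so far is killed by [p ^ fLen m]. *)
Definition el_opp (m : mem) (x : nat) : nat := el_mul m (p ^ fLen m - 1) x.

(** Adjoins a generator whose [p]-multiple is [y]; as a group element it is the number
    [p ^ fLen m]. *)
Definition root (y : nat) (m : mem) : mem := upd (upd m 0 (fLen m) y) 7 0 (S (fLen m)).

Definition chain (y k : nat) (m : mem) : nat * mem :=
  iterate k (fun q => (p ^ fLen (snd q), root (fst q) (snd q))) (y, m).

(** The value prescribed for [p] times the representative of [s]; [dig s t] is the digit, at the
    level of [t], of the relation guessed by [s]. *)
Definition el_csum (m : mem) (s : nat) : nat :=
  fold_left (fun acc t => el_add m acc (el_mul m (dig s t) (fB m t))) (ancs (par s)) 0.

Definition act (s : nat) (m : mem) : mem := upd (root (el_csum m s) m) 1 s (p ^ fLen m).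

(** Only [pred len] roots are taken, since [p^(len-1)] times the generator of the new component is
    to be the representative of [s] itself. *)
Definition newcar (s K len : nat) (m : mem) : mem :=
  let q := chain (fB m s) (pred len) m in
  upd (upd (upd (upd (snd q) 5 s (S K)) 4 K s) 3 K len) 2 K (fst q).

(** For two components of one owner, [p^(fCur k - 1) e_k] and [p^(fCur K - 1) e_K] are both its
    representative. Therefore a root of [e_k - p^(fCur K - fCur k) e_K] is killed by [p^(fCur k)]:
    the component keeps its exponent and no longer divides anything. *)
Definition retire (k K : nat) (m : mem) : mem :=
  upd (upd (root (el_add m (fE m k) (el_opp m (el_mul m (p ^ (fCur m K - fCur m k)) (fE m K)))) m) 4 k 0)
    2 k (p ^ fLen m).

Definition raise (k : nat) (m : mem) : mem :=
  upd (upd (root (fE m k) m) 3 k (S (fCur m k))) 2 k (p ^ fLen m).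

Definition newret (K len : nat) (m : mem) : mem :=
  let q := chain 0 len m in upd (upd (snd q) 3 K len) 2 K (fst q).

Lemma root_get y m t i : get (root y m) t i =
  if ((7 =? t) && (0 =? i))%bool then S (fLen m)
  else if ((0 =? t) && (fLen m =? i))%bool then y else get m t i.
Proof. unfold root. gu. reflexivity. Qed.

Lemma chain_S y k m : chain y (S k) m =
  (p ^ fLen (snd (chain y k m)), root (fst (chain y k m)) (snd (chain y k m))).
Proof. reflexivity. Qed.

Lemma chain_get y k m t i : t <> 0 -> t <> 7 -> get (snd (chain y k m)) t i = get m t i.
Proof.
  intros N0 N7. induction k as [|k IH]; auto. rewrite chain_S. cbn [snd]. rewrite root_get.
  destruct (Nat.eqb_spec 7 t), (Nat.eqb_spec 0 t); try lia. exact IH.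
Qed.

Lemma chain_len y k m : fLen (snd (chain y k m)) = k + fLen m.
Proof.
  induction k as [|k IH]; auto. rewrite chain_S. cbn [snd]. rewrite root_get. simpl. now rewrite IH.
Qed.

Definition mext (m m' : mem) : Prop :=
  fLen m <= fLen m' /\ forall i, i < fLen m -> fC m' i = fC m i.

Lemma mext_refl m : mext m m.
Proof. split; auto. Qed.

Lemma mext_trans m m' m'' : mext m m' -> mext m' m'' -> mext m m''.
Proof. intros [L E] [L' E']. split; [lia|]. intros i Hi. rewrite E' by lia. auto. Qed.

Lemma mext_root y m : mext m (root y m).
Proof.
  split; rewrite ?root_get; simpl; [lia|]. intros i Hi. rewrite root_get. simpl.
  destruct (Nat.eqb_spec (fLen m) i); auto. lia.
Qed.

Lemma mext_upd m m' t i v : t <> 0 -> t <> 7 -> mext m m' -> mext m (upd m' t i v).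
Proof.
  intros N0 N7 [L E]. split; gu.
  - destruct (Nat.eqb_spec t 7); [lia|]. auto.
  - intros j Hj. gu. destruct (Nat.eqb_spec t 0); [lia|]. simpl. auto.
Qed.

Lemma mext_chain y k m : mext m (snd (chain y k m)).
Proof.
  induction k as [|k IH]; [apply mext_refl|]. rewrite chain_S. cbn [snd].
  eapply mext_trans; [exact IH | apply mext_root].
Qed.

Lemma mext_act s m : mext m (act s m).
Proof. apply mext_upd; [discriminate | discriminate |]. apply mext_root. Qed.

Lemma mext_newcar s K len m : mext m (newcar s K len m).
Proof. repeat (apply mext_upd; [discriminate | discriminate |]). apply mext_chain. Qed.

Lemma mext_retire k K m : mext m (retire k K m).
Proof. repeat (apply mext_upd; [discriminate | discriminate |]). apply mext_root. Qed.

Lemma mext_raise k m : mext m (raise k m).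
Proof. repeat (apply mext_upd; [discriminate | discriminate |]). apply mext_root. Qed.

Lemma mext_newret K len m : mext m (newret K len m).
Proof. repeat (apply mext_upd; [discriminate | discriminate |]). apply mext_chain. Qed.

End Ops.

(** * Invariants of the construction *)

Section Tree.
Context (par : nat -> nat) (par_lt : forall s, s <> 0 -> par s < s).
Notation ancs := (ancs par).

Inductive tle (s : nat) : nat -> Prop :=
  | tle_refl : s <> 0 -> tle s s
  | tle_par t : t <> 0 -> tle s (par t) -> tle s t.

Lemma tle_le s t : tle s t -> s <= t.
Proof. induction 1; auto. specialize (par_lt t H). lia. Qed.

Lemma tle_nz s t : tle s t -> s <> 0 /\ t <> 0.
Proof. induction 1; tauto. Qed.

Lemma tle_trans s t u : tle s t -> tle t u -> tle s u.
Proof. intros A B. revert A. induction B; auto. intros A. apply tle_par; auto. Qed.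

Lemma ancs_in s t : In s (ancs t) <-> tle s t.
Proof.
  assert (A : forall n x l, x <= n ->
    (In s (snd (iterate n (fun q : nat * list nat =>
      if fst q =? 0 then q else (par (fst q), fst q :: snd q)) (x, l))) <-> tle s x \/ In s l)).
  { induction n as [|n IH]; intros x l L.
    - assert (x = 0) by lia. subst. simpl. split; auto. intros [T|]; auto. apply tle_nz in T. lia.
    - rewrite iterate_S'. cbn [fst snd]. destruct (Nat.eqb_spec x 0) as [->|N].
      + apply IH. lia.
      + pose proof (par_lt x N). rewrite IH by lia. simpl. split.
        * intros [T|[->|]]; auto; left; [now apply tle_par | now constructor].
        * intros [T|]; auto. inversion T; subst; auto. }
  unfold ancs. rewrite A by auto. simpl. tauto.
Qed.

Context (dig : nat -> nat -> nat).

Definition lsum {G : Grp} (s : nat) (be : nat -> G) : G :=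
  fold_left (fun acc t => acc ⊕ Z.of_nat (dig s t) • be t) (ancs (par s)) g0.

Lemma lsum_ext {G : Grp} s (be be' : nat -> G) :
  (forall t, tle t (par s) -> be t = be' t) -> lsum s be = lsum s be'.
Proof.
  intros E. unfold lsum. setoid_rewrite <- ancs_in in E.
  generalize (@g0 G) as a. induction (ancs (par s)) as [|t l IH]; intros a; simpl; auto.
  rewrite E by (simpl; auto). apply IH. intros. apply E. simpl. auto.
Qed.

Lemma lsum_closed {G : Grp} s (be : nat -> G) (Q : G -> Prop) : Q g0 ->
  (forall x y, Q x -> Q y -> Q (x ⊕ y)) ->
  (forall t, tle t (par s) -> Q (Z.of_nat (dig s t) • be t)) -> Q (lsum s be).
Proof.
  intros H0 HA HQ. unfold lsum. setoid_rewrite <- ancs_in in HQ. revert H0.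
  generalize (@g0 G) as a. induction (ancs (par s)) as [|t l IH]; intros a Ha; simpl; auto.
  apply IH; [intros; apply HQ; simpl; auto|]. apply HA; auto. apply HQ. simpl. auto.
Qed.

End Tree.

Section Agree.
Context (c : nat -> nat).

(** The relations [c] of the finished group are fixed in advance, and a stage only has to know an
    initial part of them. In this way the elements of all stages live in one group. *)
Definition agree (m : mem) : Prop := forall i, i < fLen m -> c i = fC m i.

Lemma agree_ext m m' : mext m m' -> agree m' -> agree m.
Proof. intros [L E] A i Hi. rewrite A by lia. auto. Qed.

End Agree.

Section Inv.
Context (p : nat) (Hp : prime (Z.of_nat p)).
Context (par : nat -> nat) (par_lt : forall s, s <> 0 -> par s < s) (dig : nat -> nat -> nat).
Context (c : nat -> nat).

Let Hp2 : 2 <= p := prime_ge2 p Hp.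
Notation P := (Pg p Hp2 c).
Notation ancs := (ancs par).
Notation ad := (el_add p). Notation nm := (el_mul p). Notation ng := (el_opp p).
Notation csum := (el_csum p par dig). Notation chain := (chain p).
Notation pZ := (Z.of_nat p).
Notation tle := (tle par). Notation lsum := (lsum par dig). Notation agree := (agree c).
Notation "x '<^' j" := ((x : nat) < p ^ j) (at level 70).

Section Elements.
Context (m : mem) (A : agree m).

Lemma ad_eq (x y : P) : x <^ fLen m -> y <^ fLen m -> ad m x y = x ⊕ y.
Proof.
  intros Lx Ly. rewrite (Pg_add_eq p Hp2 c (fLen m)) by auto. unfold el_add.
  apply padd_agree. intros i Hi. symmetry. now apply A.
Qed.

Lemma nm_eq k (x : P) : x <^ fLen m -> nm m k x = Z.of_nat k • x.
Proof.
  intros L. rewrite zmul_nat. unfold el_mul. induction k as [|k IH]; auto.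
  rewrite iterate_S, IH, nmul_S. apply ad_eq; auto. now apply Pg_nmul_lt.
Qed.

Lemma ng_eq (x : P) : x <^ fLen m -> ng m x = ⊖ x.
Proof.
  intros L. unfold el_opp. rewrite nm_eq by auto.
  apply (@gopp_unique P). rewrite <- (Pg_kill p Hp2 c (fLen m) x L). unfold pw.
  pose proof (ppow_pos p Hp2 (fLen m)). rewrite Nat2Z.inj_sub by lia. simpl (Z.of_nat 1).
  abel.
Qed.

Lemma csum_eq s : (forall t, fB m t <^ fLen m) ->
  csum m s = lsum s (fun t => fB m t : P) /\ csum m s <^ fLen m.
Proof.
  intros HB. unfold el_csum, lsum.
  assert (G : forall l (a : P), a <^ fLen m ->
    fold_left (fun acc t => ad m acc (nm m (dig s t) (fB m t))) l a =
    fold_left (fun acc t => acc ⊕ Z.of_nat (dig s t) • (fB m t : P)) l a /\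
    fold_left (fun acc t => ad m acc (nm m (dig s t) (fB m t))) l a <^ fLen m).
  { induction l as [|t l IH]; intros a La; simpl; auto.
    rewrite nm_eq, ad_eq by auto using Pg_zmul_lt. apply IH.
    apply Pg_add_lt; auto. now apply Pg_zmul_lt. }
  apply G. apply ppow_pos. auto.
Qed.

End Elements.

Lemma root_agree y m : agree (root y m) -> c (fLen m) = y.
Proof.
  intros A. rewrite A; rewrite root_get; simpl; [|lia]. now rewrite Nat.eqb_refl.
Qed.

Lemma root_mul y m : agree (root y m) -> y <^ fLen m -> pZ • (gen p Hp2 c (fLen m)) = y.
Proof. intros A L. rewrite Pg_pgen, (root_agree y m A). now apply Nat.mod_small. Qed.

(** The images [v] respect the relations of the first [l] generators, which makes [plin v] additive
    below [p ^ l]. *)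
Definition Hv {T : Grp} (v : nat -> T) (l : nat) : Prop :=
  forall i, i < l -> pZ • v i = plin p Hp2 c v (c i mod p ^ i).

Notation plin := (plin p Hp2 c).

Lemma plin_agree {T : Grp} (v v' : nat -> T) j (x : P) : x <^ j ->
  (forall i, i < j -> v i = v' i) -> plin v x = plin v' x.
Proof.
  intros L E. rewrite !(plin_lin p Hp2 c _ j) by auto. clear L. revert x.
  induction j as [|j IH]; intros x; simpl; auto. rewrite E by lia. now rewrite IH by (intros; apply E; lia).
Qed.

Lemma Hv_add {T : Grp} (v : nat -> T) l (x y : P) : Hv v l -> x <^ l -> y <^ l ->
  plin v (x ⊕ y) = plin v x ⊕ plin v y.
Proof.
  intros H Lx Ly. rewrite !(plin_lin p Hp2 c _ l) by auto using Pg_add_lt.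
  rewrite (Pg_add_eq p Hp2 c l) by auto. apply (lin_add p Hp2 c v l); auto.
  intros i Hi. rewrite (H i Hi). apply plin_lin.
  apply Nat.mod_upper_bound. pose proof (ppow_pos p Hp2 i). lia.
Qed.

Lemma plin_0 {T : Grp} (v : nat -> T) : plin v (@g0 P) = g0.
Proof. reflexivity. Qed.

Lemma Hv_opp {T : Grp} (v : nat -> T) l (x : P) : Hv v l -> x <^ l -> plin v (⊖ x) = ⊖ plin v x.
Proof.
  intros H L. apply gopp_unique. rewrite <- (Hv_add v l), gaddN; auto. now apply Pg_opp_lt.
Qed.

Lemma Hv_zmul {T : Grp} (v : nat -> T) l z (x : P) : Hv v l -> x <^ l -> plin v (z • x) = z • plin v x.
Proof.
  intros H L.
  assert (N : forall k, plin v (nmul k x) = nmul k (plin v x)).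
  { induction k as [|k IH]; [apply plin_0|]. rewrite !nmul_S, (Hv_add v l), IH by auto using Pg_nmul_lt. auto. }
  destruct z; [apply plin_0 | apply N|]. cbn [zmul]. rewrite (Hv_opp v l) by auto using Pg_nmul_lt. now rewrite N.
Qed.

Lemma Hv_lsum {T : Grp} (v : nat -> T) l s (be : nat -> P) : Hv v l -> (forall t, be t <^ l) ->
  plin v (lsum s be) = lsum s (fun t => plin v (be t)).
Proof.
  intros H L. unfold lsum.
  assert (G : forall u (a : P), a <^ l -> plin v (fold_left (fun acc t => acc ⊕ Z.of_nat (dig s t) • be t) u a)
    = fold_left (fun acc t => acc ⊕ Z.of_nat (dig s t) • plin v (be t)) u (plin v a)).
  { induction u as [|t u IH]; intros a La; cbn [fold_left]; auto.
    assert (Lz : Z.of_nat (dig s t) • be t <^ l) by now apply Pg_zmul_lt.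
    rewrite IH by now apply Pg_add_lt. rewrite (Hv_add v l), (Hv_zmul v l); auto. }
  apply G. apply (ppow_pos p Hp2).
Qed.

Lemma Hv_extend {T : Grp} (v : nat -> T) l w y : Hv v l -> y <^ l -> c l = y -> pZ • w = plin v y ->
  exists v', Hv v' (S l) /\ (forall i, i < l -> v' i = v i) /\ plin v' (gen p Hp2 c l) = w.
Proof.
  intros H Ly Ec Ew. exists (fun i => if i =? l then w else v i).
  assert (Ea : forall i, i < l -> (if i =? l then w else v i) = v i).
  { intros i Hi. destruct (Nat.eqb_spec i l); auto. lia. }
  split; [|split; auto].
  - intros i Hi. pose proof (ppow_pos p Hp2 i).
    destruct (Nat.eqb_spec i l) as [->|N].
    + rewrite Ec, Nat.mod_small, Ew by auto. symmetry. apply (plin_agree _ _ l); auto.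
    + rewrite H by lia. symmetry. apply (plin_agree _ _ i); [apply Nat.mod_upper_bound; lia|].
      intros. apply Ea. lia.
  - rewrite plin_gen. now rewrite Nat.eqb_refl.
Qed.

Lemma chain_spec y k m : agree (snd (chain y k m)) -> y <^ fLen m ->
  fst (chain y k m) <^ fLen (snd (chain y k m)) /\ pw p k • (fst (chain y k m) : P) = y /\
  (forall x : P, x <^ fLen (snd (chain y k m)) -> exists (x0 : P) z, x0 <^ fLen m /\ x = x0 ⊕ z • (fst (chain y k m) : P)) /\
  (forall (T : Grp) (v : nat -> T) w, Hv v (fLen m) -> pw p k • w = plin v y ->
     exists v', Hv v' (fLen (snd (chain y k m))) /\ (forall i, i < fLen m -> v' i = v i) /\
       plin v' (fst (chain y k m) : P) = w).
Proof.
  intros A L. induction k as [|k IH].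
  - change (chain y 0 m) with (y, m). cbn [fst snd]. repeat split; auto.
    + now rewrite pw_0, zmul_1.
    + intros x Lx. exists x, 0%Z. split; auto. abel.
    + intros T v w H E. exists v. repeat split; auto. now rewrite pw_0, zmul_1 in E.
  - rewrite chain_S in *. cbn [fst snd] in *. set (q := chain y k m) in *.
    destruct IH as (I1 & I2 & I3 & I4); [eapply agree_ext; [apply mext_root | exact A]|].
    assert (El : fLen (root (fst q) (snd q)) = S (fLen (snd q))) by (now rewrite root_get).
    pose proof (root_mul _ _ A I1) as Em. change (gen p Hp2 c (fLen (snd q))) with (p ^ fLen (snd q) : P) in Em.
    rewrite El. repeat split.
    + apply ppow_lt; auto.
    + rewrite pw_S. replace ((pZ * pw p k)%Z • (p ^ fLen (snd q) : P)) with (pw p k • (pZ • (p ^ fLen (snd q) : P))) by abel.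
      rewrite Em. exact I2.
    + intros x Lx. destruct (split_digit p Hp2 _ x Lx) as (x' & a & -> & Lx' & La).
      destruct (I3 x' Lx') as (x0 & z & L0 & E0). exists x0, (z * pZ + Z.of_nat a)%Z. split; auto.
      rewrite <- (Pg_digit p Hp2 c _ x' a) by auto. rewrite E0. rewrite <- Em.
      change (gen p Hp2 c (fLen (snd q))) with (p ^ fLen (snd q) : P). abel.
    + intros T v w H E. destruct (I4 T v (pZ • w) H) as (v1 & H1 & E1 & W1).
      { rewrite <- E, pw_S. abel. }
      destruct (Hv_extend v1 _ w (fst q) H1 I1) as (v' & H' & E' & W').
      { now apply root_agree. } { now rewrite W1. }
      pose proof (chain_len p y k m) as CL. fold q in CL.
      exists v'. repeat split; auto. intros i Hi. rewrite E', E1; auto. lia.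
Qed.

Inductive Sp (m : mem) : P -> Prop :=
  | Sp_0 : Sp m g0
  | Sp_B s : Sp m (fB m s)
  | Sp_E k : Sp m (fE m k)
  | Sp_add x y : Sp m x -> Sp m y -> Sp m (x ⊕ y)
  | Sp_opp x : Sp m x -> Sp m (⊖ x).

Lemma Sp_zmul m z x : Sp m x -> Sp m (z • x).
Proof.
  intros S. assert (N : forall k, Sp m (nmul k x)).
  { induction k; [apply Sp_0|]. rewrite nmul_S. now apply Sp_add. }
  destruct z; [apply Sp_0 | apply N | apply Sp_opp, N].
Qed.

Lemma Sp_mono m m' x : (forall s, Sp m' (fB m s)) -> (forall k, Sp m' (fE m k)) -> Sp m x -> Sp m' x.
Proof. intros HB HE. induction 1; auto using Sp. Qed.

Definition rels (m : mem) {T : Grp} (be ep : nat -> T) : Prop :=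
  (forall s, fB m s <> 0 -> pZ • be s = lsum s be) /\
  (forall k, fOwn m k <> 0 -> pw p (fCur m k - 1) • ep k = be (fOwn m k)) /\
  (forall k, fOwn m k = 0 -> pw p (fCur m k) • ep k = g0).

Record Inv (m : mem) : Prop := {
  inv_B : forall s, fB m s <^ fLen m;
  inv_E : forall k, fE m k <^ fLen m;
  inv_b : forall s, fB m s <> 0 -> s <> 0 /\ (par s <> 0 -> fB m (par s) <> 0);
  inv_own : forall k, fOwn m k <> 0 -> fB m (fOwn m k) <> 0 /\ 2 <= fCur m k;
  inv_rels : rels m (fun s => fB m s : P) (fun k => fE m k : P);
  inv_gen : forall x : P, x <^ fLen m -> Sp m x;
  inv_hom : forall (T : Grp) (be ep : nat -> T), rels m be ep ->
    exists v, Hv v (fLen m) /\ (forall s, fB m s <> 0 -> plin v (fB m s) = be s) /\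
      forall k, plin v (fE m k) = ep k
}.

Lemma Inv_unused m k : Inv m -> fCur m k = 0 -> fOwn m k = 0 /\ fE m k = 0.
Proof.
  intros I E. assert (O : fOwn m k = 0).
  { destruct (Nat.eq_dec (fOwn m k) 0); auto. destruct (inv_own m I k) as [_ L]; auto. lia. }
  split; auto. destruct (inv_rels m I) as (_ & _ & R). specialize (R k O).
  rewrite E, pw_0, zmul_1 in R. exact R.
Qed.

Lemma Inv_anc m s t : Inv m -> tle s t -> fB m t <> 0 -> fB m s <> 0.
Proof.
  intros I T. induction T as [|t N T IH]; auto. intros B. apply IH.
  apply (inv_b m I t B). now apply tle_nz in T.
Qed.

Lemma ppow_nz j : p ^ j <> 0.
Proof. pose proof (ppow_pos p Hp2 j). lia. Qed.

Lemma Inv_act s m : Inv m -> agree (act p par dig s m) -> s <> 0 -> fB m s = 0 ->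
  (par s <> 0 -> fB m (par s) <> 0) -> Inv (act p par dig s m).
Proof.
  intros I A Ns Bs Ps.
  set (m' := act p par dig s m) in *.
  assert (Am : agree m) by (eapply agree_ext; [apply mext_act | exact A]).
  destruct (csum_eq m Am s (inv_B m I)) as [Ey Ly]. set (y := csum m s) in *.
  assert (Ar : agree (root y m)).
  { intros i Hi. rewrite (A i); unfold m', act; gu; auto. }
  assert (Lm : fLen m' = S (fLen m)) by (unfold m', act; gu; rewrite root_get; auto).
  assert (gB : forall t, fB m' t = if s =? t then p ^ fLen m else fB m t).
  { intros t. unfold m', act. gu. rewrite root_get. reflexivity. }
  assert (gE : forall k, fE m' k = fE m k) by (intros; unfold m', act; gu; now rewrite root_get).
  assert (gC : forall k, fCur m' k = fCur m k) by (intros; unfold m', act; gu; now rewrite root_get).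
  assert (gO : forall k, fOwn m' k = fOwn m k) by (intros; unfold m', act; gu; now rewrite root_get).
  pose proof (root_mul y m Ar Ly) as Em. change (gen p Hp2 c (fLen m)) with (p ^ fLen m : P) in Em.
  pose proof (ppow_lt p Hp2 (fLen m) (S (fLen m)) (Nat.lt_succ_diag_r _)) as Lt.
  assert (sameB : forall t, fB m t <> 0 -> fB m' t = fB m t).
  { intros t Ht. rewrite gB. destruct (Nat.eqb_spec s t) as [<-|]; auto. easy. }
  assert (B's : fB m' s = p ^ fLen m) by (rewrite gB, Nat.eqb_refl; auto).
  assert (act_anc : forall t, tle t (par s) -> fB m t <> 0).
  { intros t T. apply (Inv_anc m t (par s) I T). apply Ps. now apply tle_nz in T. }
  assert (act_anc' : forall u t, fB m u <> 0 -> tle t (par u) -> fB m t <> 0).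
  { intros u t Hu T. apply (Inv_anc m t u I); auto. apply tle_par; auto. now apply (inv_b m I). }
  constructor.
  - intros t. rewrite gB, Lm. destruct (s =? t); [auto|]. pose proof (inv_B m I t). lia.
  - intros k. rewrite gE, Lm. pose proof (inv_E m I k). lia.
  - intros t Ht. rewrite gB in Ht. rewrite gB. destruct (Nat.eqb_spec s t) as [E|N]; [subst t|].
    + split; auto. intros Np. destruct (s =? par s); auto using ppow_nz.
    + destruct (inv_b m I t Ht) as [Nt Pt]. split; auto. intros Np.
      destruct (s =? par t); auto using ppow_nz.
  - intros k Hk. rewrite gO in Hk. rewrite gO, gC. destruct (inv_own m I k Hk) as [Bk Ck]. split; auto. now rewrite sameB.
  - destruct (inv_rels m I) as (R1 & R2 & R3). repeat split.
    + intros t Ht. destruct (Nat.eq_dec s t) as [<-|N].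
      * rewrite B's, Em, Ey. apply (lsum_ext par par_lt dig). intros u T. now rewrite sameB by auto.
      * assert (Ht' : fB m t <> 0) by (rewrite gB in Ht; destruct (Nat.eqb_spec s t); easy).
        rewrite sameB, R1 by auto. apply (lsum_ext par par_lt dig). intros u T. rewrite sameB; auto. eauto.
    + intros k Hk. rewrite gO in Hk. rewrite gO, gC, gE. rewrite R2 by auto. rewrite sameB; auto. now apply (inv_own m I).
    + intros k Hk. rewrite gO in Hk. rewrite gC, gE. auto.
  - intros x Lx. rewrite Lm in Lx. destruct (split_digit p Hp2 _ x Lx) as (x' & a & -> & Lx' & La).
    rewrite <- (Pg_digit p Hp2 c _ x' a) by auto. apply Sp_add.
    + apply (Sp_mono m); [| |now apply (inv_gen m I)].
      * intros t. destruct (Nat.eq_dec (fB m t) 0) as [->|Ht]; [apply Sp_0|]. rewrite <- sameB by auto. apply Sp_B.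
      * intros k. rewrite <- gE. apply Sp_E.
    + apply Sp_zmul. change (gen p Hp2 c (fLen m)) with (p ^ fLen m : P). rewrite <- B's. apply Sp_B.
  - intros T be ep (R1 & R2 & R3).
    destruct (inv_hom m I T be ep) as (v & H & VB & VE).
    { repeat split.
      - intros t Ht. apply R1. now rewrite sameB.
      - intros k Hk. specialize (R2 k). rewrite gO, gC in R2. auto.
      - intros k Hk. specialize (R3 k). rewrite gO, gC in R3. auto. }
    destruct (Hv_extend v (fLen m) (be s) y H Ly) as (v' & H' & E' & W').
    { now apply root_agree. }
    { rewrite Ey, (Hv_lsum v (fLen m)) by (auto; apply (inv_B m I)).
      rewrite R1 by (rewrite B's; apply ppow_nz).
      apply (lsum_ext par par_lt dig). intros t T'. symmetry. apply VB. auto. }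
    exists v'. rewrite Lm. split; auto. split.
    + intros t Ht. destruct (Nat.eq_dec s t) as [<-|N].
      * rewrite B's. exact W'.
      * assert (Ht' : fB m t <> 0) by (rewrite gB in Ht; destruct (Nat.eqb_spec s t); easy).
        rewrite sameB by auto. rewrite (plin_agree v' v (fLen m)); auto. apply (inv_B m I).
    + intros k. rewrite gE. rewrite (plin_agree v' v (fLen m)); auto. apply (inv_E m I).
Qed.

(* Adjoining the component [K] as the end of a chain of roots of [y]. *)
Lemma Inv_new s K len y k m m' : Inv m -> agree m' -> mext (snd (chain y k m)) m' ->
  fLen m' = fLen (snd (chain y k m)) -> fCur m K = 0 -> y <^ fLen m ->
  (s = 0 /\ y = 0 /\ k = len \/ s <> 0 /\ fB m s <> 0 /\ y = fB m s /\ k = len - 1 /\ 2 <= len) ->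
  (forall t, fB m' t = fB m t) ->
  (forall l, fE m' l = if K =? l then fst (chain y k m) else fE m l) ->
  (forall l, fCur m' l = if K =? l then len else fCur m l) ->
  (forall l, fOwn m' l = if K =? l then s else fOwn m l) -> Inv m'.
Proof.
  intros I A' X El CK Ly Hs gB gE gC gO.
  assert (A : agree (snd (chain y k m))) by (eapply agree_ext; eauto).
  destruct (chain_spec y k m A Ly) as (I1 & I2 & I3 & I4).
  pose proof (chain_len p y k m) as CL.
  assert (LL : p ^ fLen m <= p ^ fLen m') by (apply ppow_le; auto; lia).
  destruct (Inv_unused m K I CK) as [OK EK].
  assert (E'K : fE m' K = fst (chain y k m)) by (rewrite gE, Nat.eqb_refl; auto).
  assert (E'l : forall l, l <> K -> fE m' l = fE m l).
  { intros l N. rewrite gE. destruct (Nat.eqb_spec K l); auto. subst. easy. }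
  constructor.
  - intros t. rewrite gB. pose proof (inv_B m I t). lia.
  - intros l. rewrite gE. destruct (K =? l); [now rewrite El|]. pose proof (inv_E m I l). lia.
  - intros t. rewrite !gB. apply (inv_b m I).
  - intros l. rewrite gO, gC, gB. destruct (K =? l); [|apply (inv_own m I)].
    intros N. destruct Hs as [Hs|Hs]; [lia|]. split; [tauto | lia].
  - destruct (inv_rels m I) as (R1 & R2 & R3). repeat split.
    + intros t. rewrite gB. intros Ht. rewrite R1 by auto. apply (lsum_ext par par_lt dig). intros u _. now rewrite gB.
    + intros l. rewrite gO, gC, gE, gB. destruct (K =? l); auto. intros N.
      destruct Hs as [Hs|(_ & _ & Hy & Hk & _)]; [lia|]. rewrite <- Hk, I2. auto.
    + intros l. rewrite gO, gC, gE. destruct (K =? l); auto. intros ->.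
      destruct Hs as [(_ & Hy & Hk)|Hs]; [|lia]. rewrite <- Hk, I2. auto.
  - intros x Lx. rewrite El in Lx. destruct (I3 x Lx) as (x0 & z & L0 & ->). apply Sp_add.
    + apply (Sp_mono m); [| |now apply (inv_gen m I)].
      * intros t. rewrite <- gB. apply Sp_B.
      * intros l. destruct (Nat.eq_dec l K) as [->|N]; [rewrite EK; apply Sp_0|]. rewrite <- E'l by auto. apply Sp_E.
    + apply Sp_zmul. rewrite <- E'K. apply Sp_E.
  - intros T be ep (R1 & R2 & R3).
    destruct (inv_hom m I T be (fun l => if K =? l then g0 else ep l)) as (v & H & VB & VE).
    { repeat split.
      - intros t Ht. apply R1. now rewrite gB.
      - intros l Hl. specialize (R2 l). rewrite gO, gC in R2. destruct (Nat.eqb_spec K l); auto. now subst.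
      - intros l Hl. specialize (R3 l). rewrite gO, gC in R3. destruct (Nat.eqb_spec K l); auto. apply zmul_g0. }
    destruct (I4 T v (ep K) H) as (v' & H' & E' & W').
    { destruct Hs as [(-> & -> & ->)|(Ns & Bs & -> & -> & _)].
      - specialize (R3 K). rewrite gO, gC, Nat.eqb_refl in R3. rewrite R3; auto.
      - specialize (R2 K). rewrite gO, gC, Nat.eqb_refl in R2. rewrite R2, VB; auto. }
    exists v'. rewrite El. split; auto. split.
    + intros t. rewrite gB. intros Ht. rewrite (plin_agree v' v (fLen m)); auto. apply (inv_B m I).
    + intros l. destruct (Nat.eq_dec l K) as [->|N]; [now rewrite E'K|].
      rewrite E'l by auto. rewrite (plin_agree v' v (fLen m)), VE; auto; [|apply (inv_E m I)].
      destruct (Nat.eqb_spec K l); auto. now subst.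
Qed.

Lemma Inv_newcar s K len m : Inv m -> agree (newcar p s K len m) -> fB m s <> 0 -> fCur m K = 0 ->
  2 <= len -> Inv (newcar p s K len m).
Proof.
  intros I A Bs CK L.
  apply (Inv_new s K len (fB m s) (pred len) m); auto.
  - repeat (apply mext_upd; [discriminate | discriminate |]). apply mext_refl.
  - apply (inv_B m I).
  - right. pose proof (inv_b m I s Bs). repeat split; auto; try tauto; lia.
  - intros t. unfold newcar. gu. now apply chain_get.
  - intros l. unfold newcar. gu. destruct (K =? l); auto. now apply chain_get.
  - intros l. unfold newcar. gu. destruct (K =? l); auto. now apply chain_get.
  - intros l. unfold newcar. gu. destruct (K =? l); auto. now apply chain_get.
Qed.

Lemma Inv_newret K len m : Inv m -> agree (newret p K len m) -> fCur m K = 0 ->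
  Inv (newret p K len m).
Proof.
  intros I A CK. destruct (Inv_unused m K I CK) as [OK EK].
  apply (Inv_new 0 K len 0 len m); auto.
  - repeat (apply mext_upd; [discriminate | discriminate |]). apply mext_refl.
  - apply (ppow_pos p Hp2).
  - intros t. unfold newret. gu. now apply chain_get.
  - intros l. unfold newret. gu. destruct (K =? l); auto. now apply chain_get.
  - intros l. unfold newret. gu. destruct (K =? l); auto. now apply chain_get.
  - intros l. unfold newret. gu. rewrite chain_get by auto. destruct (Nat.eqb_spec K l); now subst.
Qed.

(* Replacing [e_k] by a root of [e_k + y0]. *)
Lemma Inv_modify k m m' y (y0 : P) (dl : forall T : Grp, (nat -> T) -> T) :
  Inv m -> agree m' -> mext (root y m) m' -> fLen m' = S (fLen m) -> fCur m k <> 0 ->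
  y <^ fLen m -> y = (fE m k : P) ⊕ y0 -> Sp m' y0 ->
  (forall t, fB m' t = fB m t) -> (forall l, fE m' l = if k =? l then p ^ fLen m else fE m l) ->
  (forall l, l <> k -> fCur m' l = fCur m l /\ fOwn m' l = fOwn m l) ->
  (fOwn m' k <> 0 -> fB m (fOwn m' k) <> 0 /\ 2 <= fCur m' k) ->
  (fOwn m' k <> 0 -> pw p (fCur m' k - 1) • (p ^ fLen m : P) = fB m (fOwn m' k)) ->
  (fOwn m' k = 0 -> pw p (fCur m' k) • (p ^ fLen m : P) = g0) ->
  (forall T be ep, rels m' be ep -> rels m be (fun l => if k =? l then pZ • ep k ⊖ dl T ep else ep l) /\
     forall v, Hv v (fLen m) -> (forall s, fB m s <> 0 -> plin v (fB m s) = be s) ->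
       (forall l, plin v (fE m l) = if k =? l then pZ • ep k ⊖ dl T ep else ep l) -> plin v y = pZ • ep k) ->
  Inv m'.
Proof.
  intros I A' X El Ck Ly Ey Sy gB gE gO Hk1 Hk2 Hk3 Hh.
  assert (A : agree (root y m)) by (eapply agree_ext; eauto).
  pose proof (root_mul y m A Ly) as Em. change (gen p Hp2 c (fLen m)) with (p ^ fLen m : P) in Em.
  pose proof (ppow_lt p Hp2 (fLen m) (S (fLen m)) (Nat.lt_succ_diag_r _)) as Lt.
  assert (E'k : fE m' k = p ^ fLen m) by (rewrite gE, Nat.eqb_refl; auto).
  assert (E'l : forall l, l <> k -> fE m' l = fE m l).
  { intros l N. rewrite gE. destruct (Nat.eqb_spec k l); auto. subst. easy. }
  constructor.
  - intros t. rewrite gB, El. pose proof (inv_B m I t). lia.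
  - intros l. rewrite gE, El. destruct (k =? l); auto. pose proof (inv_E m I l). lia.
  - intros t. rewrite !gB. apply (inv_b m I).
  - intros l Hl. rewrite gB. destruct (Nat.eq_dec l k) as [->|N]; [auto|].
    destruct (gO l N) as [Cl Ol]. rewrite Ol in Hl. rewrite Cl, Ol. now apply (inv_own m I).
  - destruct (inv_rels m I) as (R1 & R2 & R3). repeat split.
    + intros t. rewrite gB. intros Ht. rewrite R1 by auto. apply (lsum_ext par par_lt dig). intros u _. now rewrite gB.
    + intros l Hl. rewrite gB. destruct (Nat.eq_dec l k) as [->|N]; [rewrite E'k; auto|].
      destruct (gO l N) as [Cl Ol]. rewrite Ol in Hl. rewrite ?Cl, ?Ol, E'l by auto. auto.
    + intros l Hl. destruct (Nat.eq_dec l k) as [->|N]; [rewrite E'k; auto|].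
      destruct (gO l N) as [Cl Ol]. rewrite Ol in Hl. rewrite ?Cl, ?Ol, E'l by auto. auto.
  - assert (Sroot : Sp m' (p ^ fLen m)) by (rewrite <- E'k; apply Sp_E).
    intros x Lx. rewrite El in Lx. destruct (split_digit p Hp2 _ x Lx) as (x' & a & -> & Lx' & La).
    rewrite <- (Pg_digit p Hp2 c _ x' a) by auto. apply Sp_add; [|now apply Sp_zmul].
    apply (Sp_mono m); [| |now apply (inv_gen m I)].
    + intros t. rewrite <- gB. apply Sp_B.
    + intros l. destruct (Nat.eq_dec l k) as [->|N]; [|rewrite <- E'l by auto; apply Sp_E].
      replace (fE m k : P) with (pZ • (p ^ fLen m : P) ⊖ y0).
      * apply Sp_add; [now apply Sp_zmul | now apply Sp_opp].
      * rewrite Em, Ey. abel.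
  (* A homomorphism on the new group restricts to the old one; there [e_k] must go to [p] times the
     image of the new generator minus the image [dl] of [y0]. *)
  - intros T be ep R. destruct (Hh T be ep R) as [Rm Vy].
    destruct (inv_hom m I T be _ Rm) as (v & H & VB & VE).
    destruct (Hv_extend v (fLen m) (ep k) y H Ly) as (v' & H' & E' & W').
    { now apply root_agree. }
    { symmetry. now apply Vy. }
    exists v'. rewrite El. split; auto. split.
    + intros t. rewrite gB. intros Ht. rewrite (plin_agree v' v (fLen m)); auto. apply (inv_B m I).
    + intros l. destruct (Nat.eq_dec l k) as [->|N]; [now rewrite E'k|].
      rewrite E'l by auto. rewrite (plin_agree v' v (fLen m)), VE; auto; [|apply (inv_E m I)].
      destruct (Nat.eqb_spec k l); auto. now subst.
Qed.

Lemma Inv_raise k m : Inv m -> agree (raise p k m) -> fCur m k <> 0 -> Inv (raise p k m).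
Proof.
  intros I A Ck. destruct (inv_rels m I) as (R1 & R2 & R3).
  assert (Ar : agree (root (fE m k) m)) by (eapply agree_ext; [|exact A]; repeat (apply mext_upd; [discriminate | discriminate |]); apply mext_refl).
  pose proof (root_mul _ m Ar (inv_E m I k)) as Em. change (gen p Hp2 c (fLen m)) with (p ^ fLen m : P) in Em.
  assert (gO : forall l, fOwn (raise p k m) l = fOwn m l) by (intros; unfold raise; gu; now rewrite root_get).
  assert (gC : forall l, fCur (raise p k m) l = if k =? l then S (fCur m k) else fCur m l)
    by (intros; unfold raise; gu; now rewrite root_get).
  assert (gCk : fCur (raise p k m) k = S (fCur m k)) by (rewrite gC, Nat.eqb_refl; auto).
  assert (gB : forall t, fB (raise p k m) t = fB m t) by (intros; unfold raise; gu; now rewrite root_get).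
  apply (Inv_modify k m (raise p k m) (fE m k) g0 (fun T _ => g0)); auto.
  - repeat (apply mext_upd; [discriminate | discriminate |]). apply mext_refl.
  - unfold raise. gu. now rewrite root_get.
  - apply (inv_E m I).
  - symmetry. apply (@gadd0r P).
  - apply Sp_0.
  - intros l. unfold raise. gu. rewrite root_get. reflexivity.
  - intros l N. rewrite gO, gC. destruct (Nat.eqb_spec k l); [now subst|]. auto.
  - rewrite gO, gCk. intros N. destruct (inv_own m I k N). split; auto.
  - rewrite gO, gCk. intros N. rewrite <- R2 by auto. rewrite <- Em.
    replace (S (fCur m k) - 1) with (S (fCur m k - 1)) by lia. rewrite pw_S. abel.
  - rewrite gO, gCk. intros N. rewrite <- (R3 k N). rewrite <- Em, pw_S. abel.
  - intros T be ep (Q1 & Q2 & Q3). split.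
    + repeat split.
      * intros t Ht. apply Q1. now rewrite gB.
      * intros l Hl. specialize (Q2 l). rewrite gO, gC in Q2. destruct (Nat.eqb_spec k l) as [El|]; [subst l|auto].
        rewrite <- Q2 by auto. replace (S (fCur m k) - 1) with (S (fCur m k - 1)) by lia. rewrite pw_S. abel.
      * intros l Hl. specialize (Q3 l). rewrite gO, gC in Q3. destruct (Nat.eqb_spec k l) as [El|]; [subst l|auto].
        etransitivity; [|apply (Q3 Hl)]. rewrite pw_S. abel.
    + intros v Hv' VB VE. rewrite VE, Nat.eqb_refl. abel.
Qed.

Lemma retire_elt k K m : Inv m -> agree m ->
  ad m (fE m k) (ng m (nm m (p ^ (fCur m K - fCur m k)) (fE m K))) =
  (fE m k : P) ⊖ pw p (fCur m K - fCur m k) • (fE m K : P).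
Proof.
  intros I A. pose proof (inv_E m I) as HE.
  rewrite nm_eq, ng_eq, ad_eq by auto using Pg_zmul_lt, Pg_opp_lt. reflexivity.
Qed.

Lemma Inv_retire k K m : Inv m -> agree (retire p k K m) -> k <> K -> fOwn m k <> 0 ->
  fOwn m K = fOwn m k -> fCur m k <= fCur m K -> Inv (retire p k K m).
Proof.
  intros I A NkK Nk OK LC. destruct (inv_rels m I) as (R1 & R2 & R3).
  assert (Am : agree m) by (eapply agree_ext; [|exact A]; apply mext_retire).
  pose proof (retire_elt k K m I Am) as Ey.
  pose proof (inv_E m I) as HE.
  set (y := ad m _ _) in *. set (d := fCur m K - fCur m k) in *.
  assert (Ly : y <^ fLen m).
  { rewrite Ey. apply Pg_add_lt; auto. now apply Pg_opp_lt, Pg_zmul_lt. }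
  assert (gR : forall t i, get (retire p k K m) t i = if ((2 =? t) && (k =? i))%bool then p ^ fLen m
     else if ((4 =? t) && (k =? i))%bool then 0 else get (root y m) t i).
  { intros t i. unfold retire. gu. fold d. fold y. reflexivity. }
  assert (Ar : agree (root y m)).
  { intros i Hi. rewrite A by (rewrite gR; auto). rewrite gR. reflexivity. }
  pose proof (root_mul _ m Ar Ly) as Em. change (gen p Hp2 c (fLen m)) with (p ^ fLen m : P) in Em.
  assert (gO : forall l, fOwn (retire p k K m) l = if k =? l then 0 else fOwn m l)
    by (intros; rewrite gR; simpl; now rewrite root_get).
  assert (gC : forall l, fCur (retire p k K m) l = fCur m l) by (intros; rewrite gR; simpl; now rewrite root_get).
  assert (gB : forall t, fB (retire p k K m) t = fB m t) by (intros; rewrite gR; simpl; now rewrite root_get).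
  assert (gE : forall l, fE (retire p k K m) l = if k =? l then p ^ fLen m else fE m l)
    by (intros; rewrite gR; simpl; now rewrite root_get).
  destruct (inv_own m I k Nk) as [Bk Ck2].
  assert (gOk : fOwn (retire p k K m) k = 0) by (rewrite gO, Nat.eqb_refl; auto).
  assert (gOK : fOwn (retire p k K m) K = fOwn m K) by (rewrite gO; destruct (Nat.eqb_spec k K); easy).
  apply (Inv_modify k m (retire p k K m) y (⊖ (pw p d • (fE m K : P))) (fun T ep => ⊖ (pw p d • ep K))); auto.
  - split; [rewrite gR; auto|]. intros i Hi. rewrite gR. reflexivity.
  - rewrite gR. simpl. now rewrite root_get.
  - lia.
  - apply Sp_opp, Sp_zmul. replace (fE m K) with (fE (retire p k K m) K); [apply Sp_E|].
    rewrite gE. destruct (Nat.eqb_spec k K); easy.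
  - intros l N. rewrite gC, gO. destruct (Nat.eqb_spec k l); [now subst|]. auto.
  - intros N. now rewrite gOk in N.
  - intros _. rewrite gC. replace (fCur m k) with (S (fCur m k - 1)) by lia. rewrite pw_S.
    replace ((pZ * pw p (fCur m k - 1))%Z • (p ^ fLen m : P)) with (pw p (fCur m k - 1) • (pZ • (p ^ fLen m : P))) by abel.
    rewrite Em, Ey, zmulD, R2, zmulN, <- zmul_mul, <- pw_add by auto.
    replace (fCur m k - 1 + d) with (fCur m K - 1) by (unfold d; lia).
    rewrite R2 by lia. rewrite OK. apply gaddN.
  - intros T be ep (Q1 & Q2 & Q3). split.
    + repeat split.
      * intros t Ht. apply Q1. now rewrite gB.
      * intros l Hl. destruct (Nat.eqb_spec k l) as [El|N]; [subst l|].
        { pose proof (Q3 k gOk) as E3. pose proof (Q2 K) as E2. rewrite gOK, gC in E2. rewrite gC in E3.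
          specialize (E2 ltac:(lia)).
          rewrite OK in E2. rewrite <- E2. replace (fCur m K - 1) with (fCur m k - 1 + d) by (unfold d; lia).
          rewrite pw_add. replace (fCur m k) with (S (fCur m k - 1)) in E3 by lia. rewrite pw_S in E3.
          replace (pw p (fCur m k - 1) • (pZ • ep k ⊖ ⊖ (pw p d • ep K))) with
            ((pZ * pw p (fCur m k - 1))%Z • ep k ⊕ (pw p (fCur m k - 1) * pw p d)%Z • ep K) by abel.
          rewrite E3. apply gadd0. }
        { specialize (Q2 l). rewrite gO, gC in Q2. destruct (Nat.eqb_spec k l); [easy|]. auto. }
      * intros l Hl. destruct (Nat.eqb_spec k l) as [El|N]; [subst l; easy|].
        specialize (Q3 l). rewrite gO, gC in Q3. destruct (Nat.eqb_spec k l); [easy|]. auto.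
    + intros v H VB VE. rewrite Ey, (Hv_add v (fLen m)), (Hv_opp v (fLen m)), (Hv_zmul v (fLen m))
        by auto using Pg_zmul_lt, Pg_opp_lt.
      rewrite !VE, Nat.eqb_refl. destruct (Nat.eqb_spec k K); [easy|]. abel.
Qed.

End Inv.

(** * The stages of the construction *)

Section Dyn.
Context (p : nat) (Hp : prime (Z.of_nat p)).
Context (par : nat -> nat) (par_lt : forall s, s <> 0 -> par s < s) (dig : nat -> nat -> nat).
Context (n : nat -> nat -> nat) (Lev : nat -> nat -> nat) (srch : mem -> nat).

Definition act' (m : mem) (s : nat) : mem := if fB m s =? 0 then act p par dig s m else m.

Definition refresh (m : mem) (s : nat) : mem :=
  let K := c1 (srch m) in
  let m1 := newcar p s K (n K (c2 (srch m))) m in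
  if fKap m s =? 0 then m1 else retire p (pred (fKap m s)) K m1.

(* Every ancestor of [s] receives a fresh component, the deepest ones first, so that the exponents
   keep decreasing by at least 2 along the branches of the tree. *)
Definition touch (s : nat) (m : mem) : mem :=
  fold_left refresh (rev (ancs par s)) (fold_left act' (ancs par s) m).

(** The request [c1 t] concerns component [h] if it is [2 h] and node [h] if it is [2 h + 1], and
    every request recurs. A raised exponent may come too close to the exponents above it, so the
    ancestors of the owner are renewed. The condition [h <= Lev h t] holds back large nodes: below a
    node of bounded level only finitely many are ever activated. *)
Definition stage (t : nat) (m : mem) : mem :=
  let h := c1 t / 2 in
  if c1 t mod 2 =? 0 then
    if fCur m h =? 0 then (if n h t =? 0 then m else newret p h (n h t) m)
    else if fCur m h <? n h t then touch (par (fOwn m h)) (raise p h m)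
    else m
  else if (negb (h =? 0) && (h <=? Lev h t) && (fLv m h <? Lev h t))%bool
    then touch h (upd m 6 h (Lev h t))
    else m.

(** The node passed to [touch] at this stage, 0 if there is none; the case distinction is that of
    [stage]. *)
Definition tgt (t : nat) (m : mem) : nat :=
  let h := c1 t / 2 in
  if c1 t mod 2 =? 0 then
    if fCur m h =? 0 then 0 else if fCur m h <? n h t then par (fOwn m h) else 0
  else if (negb (h =? 0) && (h <=? Lev h t) && (fLv m h <? Lev h t))%bool then h else 0.

Context (par0 : par 0 = 0).
Context (n_mono : forall k s s', s <= s' -> n k s <= n k s').
Context (srch_spec : forall m, fCur m (c1 (srch m)) = 0 /\ fLen m + 2 <= n (c1 (srch m)) (c2 (srch m))).
Context (c : nat -> nat).

Let Hp2 : 2 <= p := prime_ge2 p Hp.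
Notation P := (Pg p Hp2 c).
Notation Inv := (Inv p Hp par dig c).
Notation agree := (agree c).
Notation tle := (tle par).
Notation pZ := (Z.of_nat p).

(** The span of the components that came into use between [m] and [m']. *)
Inductive Fr (m m' : mem) : P -> Prop :=
  | Fr_0 : Fr m m' g0
  | Fr_E j : fCur m j = 0 -> Fr m m' (fE m' j)
  | Fr_add x y : Fr m m' x -> Fr m m' y -> Fr m m' (x ⊕ y)
  | Fr_opp x : Fr m m' x -> Fr m m' (⊖ x).

Lemma Fr_zmul m m' z x : Fr m m' x -> Fr m m' (z • x).
Proof.
  intros S. assert (N : forall k, Fr m m' (nmul k x)).
  { induction k; [apply Fr_0|]. rewrite nmul_S. now apply Fr_add. }
  destruct z; [apply Fr_0 | apply N | apply Fr_opp, N].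
Qed.

(** In [tr_E] the power of [p] counts the raises in between, plus one for the root taken if the
    component was retired. Fresh components enter only by retirement; as long as the owner stays,
    the correction vanishes. *)
Record Tr (m m' : mem) : Prop := {
  tr_ext : mext m m';
  tr_B : forall s, fB m s <> 0 -> fB m' s = fB m s;
  tr_cur : forall k, fCur m k <= fCur m' k;
  tr_own : forall k, fCur m k <> 0 -> fOwn m' k = fOwn m k \/ fOwn m k <> 0 /\ fOwn m' k = 0;
  tr_E : forall k, fCur m k <> 0 -> exists y, Fr m m' y /\
    (fE m k : P) = pw p (fCur m' k - fCur m k + Nat.b2n (negb (fOwn m' k =? fOwn m k))) • (fE m' k : P) ⊕ pZ • y /\
    (fOwn m' k = fOwn m k -> pZ • y = g0)
}.

Lemma Tr_same m m' : mext m m' -> (forall s, fB m s <> 0 -> fB m' s = fB m s) ->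
  (forall k, fCur m k <> 0 -> fCur m' k = fCur m k /\ fOwn m' k = fOwn m k /\ fE m' k = fE m k) -> Tr m m'.
Proof.
  intros X HB H. constructor; auto.
  - intros k. destruct (Nat.eq_dec (fCur m k) 0); [lia|]. destruct (H k); auto. lia.
  - intros k Hk. left. now apply H.
  - intros k Hk. destruct (H k Hk) as (-> & -> & ->). exists g0. split; [apply Fr_0|].
    rewrite Nat.sub_diag, Nat.eqb_refl. split; [|intros _; apply zmul_g0]. cbn [negb Nat.b2n Nat.add].
    rewrite pw_0. abel.
Qed.

Lemma Tr_refl m : Tr m m.
Proof. apply Tr_same; auto. apply mext_refl. Qed.

Lemma Fr_trans m m' m'' y : Inv m' -> Tr m m' -> Tr m' m'' -> Fr m m' y -> Fr m m'' y.
Proof.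
  intros I T T'. induction 1; auto using Fr.
  destruct (Nat.eq_dec (fCur m' j) 0) as [Z|N].
  - destruct (Inv_unused p Hp par dig c m' j I Z) as [_ E]. rewrite E. apply Fr_0.
  - destruct (tr_E _ _ T' j N) as (y & Fy & -> & _). apply Fr_add; apply Fr_zmul; [now apply Fr_E|].
    clear - T Fy. induction Fy; auto using Fr. apply Fr_E. pose proof (tr_cur _ _ T j). lia.
Qed.

Lemma Tr_trans m m' m'' : Inv m' -> Tr m m' -> Tr m' m'' -> Tr m m''.
Proof.
  intros I T T'. constructor.
  - eapply mext_trans; [apply T | apply T'].
  - intros s Hs. rewrite (tr_B _ _ T'); rewrite (tr_B _ _ T); auto.
  - intros k. pose proof (tr_cur _ _ T k). pose proof (tr_cur _ _ T' k). lia.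
  - intros k Hk. pose proof (tr_cur _ _ T k). destruct (tr_own _ _ T k Hk) as [E|E].
    + destruct (tr_own _ _ T' k) as [E'|E']; [lia| |]; rewrite E in E'; auto.
    + destruct (tr_own _ _ T' k) as [E'|E']; [lia| |]; right; split; try tauto. now rewrite E'.
  - intros k Hk. pose proof (tr_cur _ _ T k) as L. pose proof (tr_cur _ _ T' k) as L'.
    assert (Hk' : fCur m' k <> 0) by lia.
    destruct (tr_E _ _ T k Hk) as (y & Fy & Ey & Zy), (tr_E _ _ T' k Hk') as (y' & Fy' & Ey' & Zy').
    assert (F2 : Fr m m'' y').
    { clear - T Fy'. induction Fy'; auto using Fr. apply Fr_E. pose proof (tr_cur _ _ T j). lia. }
    exists (pw p (fCur m' k - fCur m k + Nat.b2n (negb (fOwn m' k =? fOwn m k))) • y' ⊕ y).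
    split; [apply Fr_add; [now apply Fr_zmul | now apply (Fr_trans m m')]|]. split.
    + rewrite Ey at 1. rewrite Ey', zmulD, <- zmul_mul, <- pw_add.
      replace (fCur m'' k - fCur m k + Nat.b2n (negb (fOwn m'' k =? fOwn m k))) with
        (fCur m' k - fCur m k + Nat.b2n (negb (fOwn m' k =? fOwn m k)) +
          (fCur m'' k - fCur m' k + Nat.b2n (negb (fOwn m'' k =? fOwn m' k)))); [abel|].
      destruct (tr_own _ _ T k Hk) as [E|[N E]]; rewrite E;
        destruct (tr_own _ _ T' k Hk') as [E'|[N' E']]; rewrite E'; rewrite E in *;
        repeat match goal with |- context [?a =? ?b] => destruct (Nat.eqb_spec a b) end; simpl; lia.
    + intros E''. destruct (tr_own _ _ T k Hk) as [E|[N E]].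
      * rewrite zmulD, (Zy E). assert (E2 : fOwn m'' k = fOwn m' k) by lia.
        replace (pZ • (_ • y')) with (pw p (fCur m' k - fCur m k + Nat.b2n (negb (fOwn m' k =? fOwn m k))) • (pZ • y')) by abel.
        rewrite (Zy' E2), zmul_g0. apply gadd0.
      * destruct (tr_own _ _ T' k Hk') as [E'|[N' E']]; lia.
Qed.

Record J (m : mem) : Prop := {
  j_kap : forall s k, fKap m s = S k -> fOwn m k = s /\ s <> 0;
  j_own : forall k, fOwn m k <> 0 -> fKap m (fOwn m k) = S k;
  j_len : forall k, fCur m k <= fLen m;
  j_n : forall k, fCur m k <> 0 -> exists u, fCur m k <= n k u
}.

(** Exponents fall by at least 2 from a node to its child. A gap of 2 is what gives [p^(fCur k) e_k]
    a height above [fCur k] in [limit_div]. Edges from [ex] to its children are exempt while a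
    renewal is under way. *)
Definition Ed (m : mem) (ex : nat) : Prop :=
  forall k k', fOwn m k <> 0 -> fOwn m k' <> 0 -> par (fOwn m k') = fOwn m k -> fOwn m k <> ex ->
    fCur m k' + 2 <= fCur m k.

Lemma ancs_S t : t <> 0 -> ancs par t = ancs par (par t) ++ [t].
Proof.
  pose (F := fun q : nat * list nat => if fst q =? 0 then q else (par (fst q), fst q :: snd q)).
  assert (A : forall i x l, x <= i -> snd (iterate i F (x, l)) = snd (iterate x F (x, [])) ++ l).
  { induction i as [i IH] using lt_wf_ind. intros x l L. destruct (Nat.eq_dec x 0) as [->|N].
    - clear. induction i as [|i IH]; auto. rewrite iterate_S'. exact IH.
    - destruct i as [|i]; [lia|]. destruct x as [|x]; [lia|].
      rewrite !iterate_S'. pose proof (par_lt (S x) N) as Lp.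
      assert (E : forall u, F (S x, u) = (par (S x), S x :: u)) by reflexivity. rewrite !E.
      rewrite (IH i) by lia. rewrite (IH x) by lia. rewrite <- app_assoc. reflexivity. }
  intros N. unfold ancs. fold F. destruct t as [|t]; [lia|]. rewrite iterate_S'.
  assert (E : F (S t, []) = (par (S t), [S t])) by reflexivity. rewrite E.
  pose proof (par_lt (S t) N). apply A. lia.
Qed.

Lemma ancs_0 : ancs par 0 = [].
Proof. reflexivity. Qed.

Lemma act_get s m t i : t <> 0 -> t <> 1 -> t <> 7 -> get (act p par dig s m) t i = get m t i.
Proof.
  intros N0 N1 N7. unfold act. rewrite get_upd, root_get.
  destruct (Nat.eqb_spec 1 t), (Nat.eqb_spec 7 t), (Nat.eqb_spec 0 t); try lia. auto.
Qed.

Lemma act_B s m t : fB (act p par dig s m) t = if s =? t then p ^ fLen m else fB m t.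
Proof. unfold act. rewrite get_upd, root_get. auto. Qed.

Lemma act_len s m : fLen (act p par dig s m) = S (fLen m).
Proof. unfold act. rewrite get_upd, root_get. auto. Qed.

Lemma Tr_act s m : fB m s = 0 -> Tr m (act p par dig s m).
Proof.
  intros B. apply Tr_same.
  - apply mext_act.
  - intros t Ht. rewrite act_B. destruct (Nat.eqb_spec s t); auto. now subst.
  - intros k _. rewrite !act_get by discriminate. auto.
Qed.

Lemma J_act s m : J m -> J (act p par dig s m).
Proof.
  intros [A B C D]. constructor; intros *; rewrite ?act_get, ?act_len by discriminate; auto.
Qed.

Lemma mext_act' s m : mext m (act' m s).
Proof. unfold act'. destruct (_ =? _); [apply mext_act | apply mext_refl]. Qed.

Lemma mext_acts l m : mext m (fold_left act' l m).
Proof.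
  revert m. induction l as [|s l IH]; intros m; simpl; [apply mext_refl|].
  eapply mext_trans; [apply (mext_act' s) | apply IH].
Qed.

Lemma acts_spec s m : Inv m -> J m -> agree (fold_left act' (ancs par s) m) ->
  let m' := fold_left act' (ancs par s) m in
  Inv m' /\ J m' /\ Tr m m' /\ (forall t, tle t s -> fB m' t <> 0) /\
  (forall t, ~ tle t s -> fB m' t = fB m t) /\
  (forall t i, 2 <= t <= 6 -> get m' t i = get m t i).
Proof.
  intros I HJ. induction s as [s IH] using lt_wf_ind.
  destruct (Nat.eq_dec s 0) as [->|N].
  { intros A. rewrite ancs_0 in *. cbn. refine (conj I (conj HJ (conj (Tr_refl m) (conj _ (conj _ _)))));
      [intros t T; apply tle_nz in T; tauto | reflexivity | reflexivity]. }
  rewrite ancs_S, fold_left_app by auto. cbn [fold_left].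
  set (m1 := fold_left act' (ancs par (par s)) m) in *. intros A.
  assert (A1 : agree m1) by (eapply agree_ext; [apply (mext_act' s) | exact A]).
  destruct (IH (par s) (par_lt s N) A1) as (I1 & J1 & T1 & B1 & C1 & D1).
  unfold act' in *. destruct (Nat.eqb_spec (fB m1 s) 0) as [Z|NZ].
  - assert (I2 : Inv (act p par dig s m1)).
    { apply (Inv_act p Hp par par_lt dig c); auto. intros Np. apply B1. now constructor. }
    split; [auto|]. split; [now apply J_act|]. split; [apply (Tr_trans _ m1); auto; now apply Tr_act|].
    split; [|split].
    + intros t T. rewrite act_B. destruct (Nat.eqb_spec s t) as [->|Ne]; [apply (ppow_nz p Hp)|].
      apply B1. inversion T; subst; auto; easy.
    + intros t T. rewrite act_B. destruct (Nat.eqb_spec s t) as [->|Ne].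
      * destruct T. now constructor.
      * apply C1. intros T'. apply T. now apply tle_par.
    + intros t i L. rewrite act_get by lia. now apply D1.
  - split; [auto|]. split; [auto|]. split; [auto|]. split; [|split].
    + intros t T. inversion T; subst; auto.
    + intros t T. apply C1. intros T'. apply T. now apply tle_par.
    + auto.
Qed.

Lemma newcar_get s K len m t i : t <> 0 -> t <> 7 -> get (newcar p s K len m) t i =
  if ((2 =? t) && (K =? i))%bool then fst (chain p (fB m s) (pred len) m)
  else if ((3 =? t) && (K =? i))%bool then len else if ((4 =? t) && (K =? i))%bool then s
  else if ((5 =? t) && (s =? i))%bool then S K else get m t i.
Proof. intros N0 N7. unfold newcar. rewrite !get_upd, chain_get by auto. reflexivity. Qed.

Lemma newcar_len s K len m : fLen (newcar p s K len m) = pred len + fLen m.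
Proof. unfold newcar. gu. apply chain_len. Qed.

Lemma retire_get k K m t i : t <> 0 -> t <> 7 -> get (retire p k K m) t i =
  if ((2 =? t) && (k =? i))%bool then p ^ fLen m
  else if ((4 =? t) && (k =? i))%bool then 0 else get m t i.
Proof.
  intros N0 N7. unfold retire. rewrite !get_upd, root_get.
  destruct (Nat.eqb_spec 7 t), (Nat.eqb_spec 0 t); try lia. reflexivity.
Qed.

Lemma retire_len k K m : fLen (retire p k K m) = S (fLen m).
Proof. unfold retire. gu. now rewrite root_get. Qed.

Lemma raise_get k m t i : t <> 0 -> t <> 7 -> get (raise p k m) t i =
  if ((2 =? t) && (k =? i))%bool then p ^ fLen m
  else if ((3 =? t) && (k =? i))%bool then S (fCur m k) else get m t i.
Proof.
  intros N0 N7. unfold raise. rewrite !get_upd, root_get.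
  destruct (Nat.eqb_spec 7 t), (Nat.eqb_spec 0 t); try lia. reflexivity.
Qed.

Lemma raise_len k m : fLen (raise p k m) = S (fLen m).
Proof. unfold raise. gu. now rewrite root_get. Qed.

Lemma newret_get K len m t i : t <> 0 -> t <> 7 -> get (newret p K len m) t i =
  if ((2 =? t) && (K =? i))%bool then fst (chain p 0 len m)
  else if ((3 =? t) && (K =? i))%bool then len else get m t i.
Proof. intros N0 N7. unfold newret. rewrite !get_upd, chain_get by auto. reflexivity. Qed.

Lemma newret_len K len m : fLen (newret p K len m) = len + fLen m.
Proof. unfold newret. gu. apply chain_len. Qed.

Lemma mext_refresh m s : mext m (refresh m s).
Proof.
  unfold refresh. destruct (_ =? _); [apply mext_newcar|].
  eapply mext_trans; [apply mext_newcar | apply mext_retire].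
Qed.

Lemma mext_refreshes l m : mext m (fold_left refresh l m).
Proof.
  revert m. induction l as [|s l IH]; intros m; simpl; [apply mext_refl|].
  eapply mext_trans; [apply mext_refresh | apply IH].
Qed.

(** The new exponent of [s] exceeds all others by 2, which repairs the edges to the children of [s]
    but may spoil the edge from its parent. So the exemption moves up one step and is gone after the
    top of the tree. *)
Lemma refresh_spec m s : Inv m -> J m -> agree (refresh m s) -> fB m s <> 0 ->
  let m' := refresh m s in
  Inv m' /\ J m' /\ Tr m m' /\ (Ed m s -> Ed m' (par s)) /\
  (forall t, t <> s -> fKap m' t = fKap m t) /\
  (exists K, fKap m' s = S K /\ fCur m K = 0 /\ fLen m + 2 <= fCur m' K) /\
  (forall t, fB m' t = fB m t) /\ (forall t, fLv m' t = fLv m t).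
Proof.
  intros I HJ A Bs. destruct (srch_spec m) as [CK LK].
  set (K := c1 (srch m)) in *. set (len := n K (c2 (srch m))) in *.
  set (m1 := newcar p s K len m).
  destruct (inv_b _ _ _ _ _ _ I s Bs) as [Ns _].
  assert (L1 : 1 <= fLen m).
  { pose proof (inv_B _ _ _ _ _ _ I s). destruct (fLen m); [simpl in *; lia | lia]. }
  assert (JL := j_len m HJ).
  destruct (Inv_unused p Hp par dig c m K I CK) as [OK EK].
  assert (A1 : agree m1).
  { eapply agree_ext; [|exact A]. unfold refresh. fold K len m1. destruct (_ =? _); [apply mext_refl | apply mext_retire]. }
  assert (I1 : Inv m1) by (apply (Inv_newcar p Hp par par_lt dig c); auto; lia).
  assert (gE : forall l, fE m1 l = if K =? l then fst (chain p (fB m s) (pred len) m) else fE m l)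
    by (intros; unfold m1; now rewrite newcar_get).
  assert (gC : forall l, fCur m1 l = if K =? l then len else fCur m l)
    by (intros; unfold m1; now rewrite newcar_get).
  assert (gO : forall l, fOwn m1 l = if K =? l then s else fOwn m l)
    by (intros; unfold m1; now rewrite newcar_get).
  assert (gK : forall l, fKap m1 l = if s =? l then S K else fKap m l)
    by (intros; unfold m1; now rewrite newcar_get).
  assert (gB : forall l, fB m1 l = fB m l) by (intros; unfold m1; now rewrite newcar_get).
  assert (gLv : forall l, fLv m1 l = fLv m l) by (intros; unfold m1; now rewrite newcar_get).
  assert (gLen : fLen m1 = pred len + fLen m) by apply newcar_len.
  assert (T1 : Tr m m1).
  { apply Tr_same; auto; [apply mext_newcar|]. intros k Hk. rewrite gC, gO, gE.
    destruct (Nat.eqb_spec K k); [now subst|]. auto. }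
  assert (JK : fKap m s <> S K).
  { intros E. apply (j_kap m HJ) in E. rewrite OK in E. lia. }
  cbv zeta. unfold refresh in *. fold K len m1 in A |- *.
  destruct (Nat.eqb_spec (fKap m s) 0) as [Z|NZ].
  - assert (Nown : forall k, fOwn m k <> s).
    { intros k E. pose proof (j_own m HJ k) as E'. rewrite E in E'. rewrite E' in Z; lia. }
    split; [auto|]. split; [|split; [auto|split; [|split; [|split; [|split]]]]].
    + constructor.
      * intros t k. rewrite gK, gO. destruct (Nat.eqb_spec s t) as [<-|N].
        { intros E. injection E as <-. rewrite Nat.eqb_refl. auto. }
        intros E. apply (j_kap m HJ) in E as [E E']. destruct (Nat.eqb_spec K k) as [<-|]; auto. lia.
      * intros k. rewrite gO, gK. destruct (Nat.eqb_spec K k) as [<-|N]; [now rewrite Nat.eqb_refl|].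
        intros Ok. destruct (Nat.eqb_spec s (fOwn m k)) as [E|]; [now destruct (Nown k)|]. now apply (j_own m HJ).
      * intros k. rewrite gC, gLen. destruct (K =? k); [lia|]. specialize (JL k). lia.
      * intros k. rewrite gC. destruct (Nat.eqb_spec K k) as [<-|]; [|apply (j_n m HJ)].
        intros _. exists (c2 (srch m)). auto.
    + intros E k k'. rewrite !gO, !gC. destruct (Nat.eqb_spec K k) as [<-|N], (Nat.eqb_spec K k') as [<-|N'].
      * intros _ _ Ep. pose proof (par_lt s Ns). lia.
      * intros _ Ok' Ep _. specialize (JL k'). lia.
      * intros _ _ Ep Ne. congruence.
      * intros Ok Ok' Ep Ne. apply E; auto.
    + intros t Nt. rewrite gK. destruct (Nat.eqb_spec s t); congruence.
    + exists K. rewrite gK, gC, !Nat.eqb_refl. auto.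
    + auto.
    + auto.
  - destruct (fKap m s) as [|k0] eqn:Ek0; [easy|]. cbn [pred] in *.
    destruct (j_kap m HJ s k0 Ek0) as [Ok0 _].
    assert (NkK : k0 <> K) by congruence.
    assert (Ck0 : fCur m k0 <> 0).
    { destruct (inv_own _ _ _ _ _ _ I k0); [congruence|lia]. }
    assert (C1k0 : fCur m1 k0 = fCur m k0) by (rewrite gC; destruct (Nat.eqb_spec K k0); congruence).
    assert (C1K : fCur m1 K = len) by (rewrite gC, Nat.eqb_refl; auto).
    assert (O1k0 : fOwn m1 k0 = s) by (rewrite gO; destruct (Nat.eqb_spec K k0); congruence).
    assert (O1K : fOwn m1 K = s) by (rewrite gO, Nat.eqb_refl; auto).
    set (m2 := retire p k0 K m1) in *.
    pose proof (JL k0) as Lk0.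
    assert (I2 : Inv m2).
    { apply (Inv_retire p Hp par par_lt dig c); auto; try congruence; try lia. }
    assert (hE : forall l, fE m2 l = if k0 =? l then p ^ fLen m1 else fE m1 l)
      by (intros; unfold m2; now rewrite retire_get).
    assert (hC : forall l, fCur m2 l = fCur m1 l) by (intros; unfold m2; now rewrite retire_get).
    assert (hO : forall l, fOwn m2 l = if k0 =? l then 0 else fOwn m1 l)
      by (intros; unfold m2; now rewrite retire_get).
    assert (hK : forall l, fKap m2 l = fKap m1 l) by (intros; unfold m2; now rewrite retire_get).
    assert (hB : forall l, fB m2 l = fB m l) by (intros; unfold m2; rewrite retire_get by discriminate; apply gB).
    assert (hLv : forall l, fLv m2 l = fLv m l) by (intros; unfold m2; rewrite retire_get by discriminate; apply gLv).
    assert (hLen : fLen m2 = S (fLen m1)) by apply retire_len.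
    assert (uniq : forall k, fOwn m k = s -> k = k0).
    { intros k E. pose proof (j_own m HJ k) as E'. rewrite E in E'. specialize (E' Ns). congruence. }
    split; [auto|]. split; [|split; [|split; [|split; [|split; [|split]]]]].
    + constructor.
      * intros t k. rewrite hK, gK, hO, gO. destruct (Nat.eqb_spec s t) as [<-|N].
        { intros E. injection E as <-. rewrite Nat.eqb_refl. destruct (Nat.eqb_spec k0 K); [easy|]. auto. }
        intros E. apply (j_kap m HJ) in E as [E E'].
        destruct (Nat.eqb_spec k0 k) as [<-|]; [congruence|].
        destruct (Nat.eqb_spec K k) as [<-|]; auto. lia.
      * intros k. rewrite hO, gO. destruct (Nat.eqb_spec k0 k) as [<-|]; [easy|]. rewrite hK, gK.
        destruct (Nat.eqb_spec K k) as [<-|N]; [now rewrite Nat.eqb_refl|].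
        intros Ok. destruct (Nat.eqb_spec s (fOwn m k)) as [E|]; [|now apply (j_own m HJ)].
        symmetry in E. apply uniq in E. congruence.
      * intros k. rewrite hC, gC, hLen, gLen. destruct (K =? k); [lia|]. specialize (JL k). lia.
      * intros k. rewrite hC, gC. destruct (Nat.eqb_spec K k) as [<-|]; [|apply (j_n m HJ)].
        intros _. exists (c2 (srch m)). auto.
    + constructor.
      * eapply mext_trans; [apply mext_newcar | apply mext_retire].
      * intros t Ht. apply hB.
      * intros k. rewrite hC, gC. destruct (Nat.eqb_spec K k); [subst; lia|auto].
      * intros k Hk. rewrite hO, gO. destruct (Nat.eqb_spec k0 k) as [<-|]; [right; split; congruence|].
        destruct (Nat.eqb_spec K k) as [<-|]; [easy|]. auto.
      * intros k Hk. destruct (Nat.eq_dec k0 k) as [<-|Nk].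
        { assert (Am1 : agree m1) by auto.
          pose proof (retire_elt p Hp par dig c k0 K m1 I1 Am1) as Ey.
          set (y := el_add p m1 _ _) in Ey.
          assert (Ly : (y : nat) < p ^ fLen m1).
          { pose proof (inv_E _ _ _ _ _ _ I1) as HE. rewrite Ey. apply Pg_add_lt; auto. now apply Pg_opp_lt, Pg_zmul_lt. }
          assert (Ar : agree (root y m1)).
          { eapply agree_ext; [|exact A]. unfold m2, retire. fold y.
            repeat (apply mext_upd; [discriminate | discriminate |]). apply mext_refl. }
          pose proof (root_mul p Hp c y m1 Ar Ly) as Em.
          change (gen p (prime_ge2 p Hp) c (fLen m1)) with (p ^ fLen m1 : P) in Em.
          rewrite hO, hC, hE, !Nat.eqb_refl, C1k0, Nat.sub_diag.
          assert (Eb : Nat.b2n (negb (0 =? fOwn m k0)) = 1).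
          { rewrite Ok0. destruct (Nat.eqb_spec 0 s); [congruence|]. auto. }
          fold Hp2 in Em, Ey. rewrite Eb. cbn [Nat.add]. rewrite pw_1, Em, Ey.
          exists (pw p (fCur m1 K - fCur m1 k0 - 1) • (fE m1 K : P)). split; [|split].
          - apply Fr_zmul. replace (fE m1 K) with (fE m2 K); [now apply Fr_E|].
            rewrite hE. destruct (Nat.eqb_spec k0 K); congruence.
          - replace (fE m k0) with (fE m1 k0) by (rewrite gE; destruct (Nat.eqb_spec K k0); congruence).
            replace (fCur m1 K - fCur m1 k0) with (S (fCur m1 K - fCur m1 k0 - 1)) at 1 by lia.
            rewrite pw_S. abel.
          - congruence. }
        { exists g0. split; [apply Fr_0|]. rewrite hO, hC, hE, gO, gC, gE.
          destruct (Nat.eqb_spec k0 k); [easy|]. destruct (Nat.eqb_spec K k); [congruence|].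
          rewrite Nat.eqb_refl, Nat.sub_diag. cbn [negb Nat.b2n Nat.add]. rewrite pw_0.
          split; [abel | intros _; apply zmul_g0]. }
    + intros E k k'. rewrite !hO, !gO, !hC, !gC.
      destruct (Nat.eqb_spec k0 k) as [<-|Nk0]; [easy|]. destruct (Nat.eqb_spec k0 k') as [<-|Nk0']; [easy|].
      destruct (Nat.eqb_spec K k) as [<-|N], (Nat.eqb_spec K k') as [<-|N'].
      * intros _ _ Ep. pose proof (par_lt s Ns). lia.
      * intros _ Ok' Ep _. specialize (JL k'). lia.
      * intros _ _ Ep Ne. congruence.
      * intros Ok Ok' Ep Ne. apply E; auto. intros Es. apply uniq in Es. congruence.
    + intros t Nt. rewrite hK, gK. destruct (Nat.eqb_spec s t); congruence.
    + exists K. rewrite hK, gK, hC, gC, !Nat.eqb_refl. auto.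
    + auto.
    + auto.
Qed.

Lemma refreshes_spec s : forall m, Inv m -> J m -> agree (fold_left refresh (rev (ancs par s)) m) ->
  (forall t, tle t s -> fB m t <> 0) -> Ed m s ->
  let m' := fold_left refresh (rev (ancs par s)) m in
  Inv m' /\ J m' /\ Tr m m' /\ Ed m' 0 /\
  (forall t, ~ tle t s -> fKap m' t = fKap m t) /\
  (forall t, tle t s -> exists K, fKap m' t = S K /\ fCur m K = 0 /\ fLen m + 2 <= fCur m' K) /\
  (forall t, fB m' t = fB m t) /\ (forall t, fLv m' t = fLv m t).
Proof.
  induction s as [s IH] using lt_wf_ind. intros m I HJ A B E.
  destruct (Nat.eq_dec s 0) as [->|N].
  { rewrite ancs_0 in *. cbn.
    refine (conj I (conj HJ (conj (Tr_refl m) (conj E (conj _ (conj _ (conj _ _)))))));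
      [reflexivity | intros t T; apply tle_nz in T; tauto | reflexivity | reflexivity]. }
  rewrite ancs_S, rev_unit in * by auto. cbn [fold_left] in *.
  assert (A1 : agree (refresh m s)) by (eapply agree_ext; [apply mext_refreshes | exact A]).
  assert (Tss : tle s s) by now constructor.
  destruct (refresh_spec m s I HJ A1 (B s Tss)) as (I1 & J1 & T1 & E1 & K1 & (K & KK & CK & LK) & B1 & V1).
  set (m1 := refresh m s) in *.
  destruct (IH (par s) (par_lt s N) m1 I1 J1 A) as (I2 & J2 & T2 & E2 & K2 & KK2 & B2 & V2); auto.
  { intros t T. rewrite B1. apply B. now apply tle_par. }
  set (m2 := fold_left refresh _ m1) in *.
  split; [auto|]. split; [auto|]. split; [now apply (Tr_trans m m1)|]. split; [auto|].
  split; [|split; [|split]].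
  - intros t T. rewrite K2, K1; auto.
    + intros ->. now apply T.
    + intros T'. apply T. now apply tle_par.
  - intros t T. destruct (Nat.eq_dec t s) as [->|Nt].
    + exists K. rewrite K2; [|intros T'; apply tle_le in T'; auto; specialize (par_lt s N); lia].
      split; auto. split; auto. pose proof (tr_cur _ _ T2 K). lia.
    + inversion T; subst; [easy|]. destruct (KK2 t) as (K' & E' & C' & L'); auto.
      exists K'. split; auto. pose proof (tr_cur _ _ T1 K'). destruct (tr_ext _ _ T1). lia.
  - intros t. now rewrite B2.
  - intros t. now rewrite V2.
Qed.

Lemma mext_touch s m : mext m (touch s m).
Proof. eapply mext_trans; [apply mext_acts | apply mext_refreshes]. Qed.

Lemma touch_spec s m : Inv m -> J m -> agree (touch s m) -> Ed m s ->
  let m' := touch s m in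
  Inv m' /\ J m' /\ Tr m m' /\ Ed m' 0 /\
  (forall t, ~ tle t s -> fKap m' t = fKap m t /\ fB m' t = fB m t) /\
  (forall t, tle t s -> fB m' t <> 0 /\ exists K, fKap m' t = S K /\ fCur m K = 0 /\ fLen m + 2 <= fCur m' K) /\
  (forall t, fLv m' t = fLv m t).
Proof.
  intros I HJ A E. unfold touch in *.
  assert (A1 : agree (fold_left act' (ancs par s) m)) by (eapply agree_ext; [apply mext_refreshes | exact A]).
  destruct (acts_spec s m I HJ A1) as (I1 & J1 & T1 & B1 & C1 & D1).
  set (m1 := fold_left act' (ancs par s) m) in *.
  destruct (refreshes_spec s m1 I1 J1 A B1) as (I2 & J2 & T2 & E2 & K2 & KK2 & B2 & V2).
  { intros k k'. rewrite !D1 by lia. apply E. }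
  cbv zeta. set (m2 := fold_left refresh _ m1) in *.
  split; [auto|]. split; [auto|]. split; [now apply (Tr_trans m m1)|]. split; [auto|]. split; [|split].
  - intros t T. rewrite K2, B2 by auto. rewrite D1 by lia. auto.
  - intros t T. rewrite B2. split; auto. destruct (KK2 t T) as (K & EK & CK & LK).
    exists K. rewrite D1 in CK by lia. destruct (tr_ext _ _ T1). split; auto. split; auto. lia.
  - intros t. rewrite V2, D1 by lia. auto.
Qed.

Record Stt (m : mem) : Prop := {
  st_inv : Inv m;
  st_j : J m;
  st_ed : Ed m 0;
  st_ca : forall s, fB m s <> 0 -> fKap m s <> 0
}.

Lemma mext_stage t m : mext m (stage t m).
Proof.
  unfold stage. set (h := c1 t / 2).
  repeat match goal with |- context [if ?b then _ else _] => destruct b end;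
    try apply mext_refl; try apply mext_newret.
  - eapply mext_trans; [apply mext_raise | apply mext_touch].
  - eapply mext_trans; [|apply mext_touch]. apply mext_upd; try discriminate. apply mext_refl.
Qed.

Lemma touch_Stt s m : Inv m -> J m -> agree (touch s m) -> Ed m s ->
  (forall t, fB m t <> 0 -> fKap m t <> 0) -> Stt (touch s m).
Proof.
  intros I HJ A E Ca. destruct (touch_spec s m I HJ A E) as (I1 & J1 & T1 & E1 & K1 & KK1 & V1).
  constructor; auto. intros t Bt. destruct (classic (tle t s)) as [T|T].
  - destruct (KK1 t T) as (_ & K & EK & _). lia.
  - destruct (K1 t T) as [EK EB]. rewrite EK. apply Ca. now rewrite <- EB.
Qed.

Lemma stage_spec t m : Stt m -> agree (stage t m) ->
  let m' := stage t m in let g := tgt t m in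
  Stt m' /\ Tr m m' /\
  (forall s, tle s g -> exists K, fKap m' s = S K /\ fCur m K = 0 /\ fLen m + 2 <= fCur m' K) /\
  (forall s, ~ tle s g -> fKap m' s = fKap m s /\ fB m' s = fB m s) /\
  (g <> 0 -> (g <= Lev g t /\ fLv m g < Lev g t /\ fLv m' g = Lev g t) \/
             (exists k, fOwn m k <> 0 /\ g = par (fOwn m k) /\ fCur m k < fCur m' k)) /\
  (forall s, fLv m s <= fLv m' s) /\
  (forall k, c1 t = 2 * k -> (n k t <> 0 -> fCur m' k <> 0) /\ (fCur m k <> 0 -> fCur m k < n k t -> fCur m k < fCur m' k)) /\
  (forall s, c1 t = 2 * s + 1 -> s <> 0 -> s <= Lev s t -> fLv m s < Lev s t -> g = s) /\
  (forall s, fLv m' s <> fLv m s -> g = s /\ fLv m' s = Lev s t).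
Proof.
  intros [I HJ E Ca] A. cbv zeta. unfold stage, tgt in *.
  set (h := c1 t / 2) in *. pose proof (Nat.div_mod (c1 t) 2 ltac:(lia)) as Dm. fold h in Dm.
  pose proof (Nat.mod_upper_bound (c1 t) 2 ltac:(lia)) as Ub.
  assert (none : forall s, ~ tle s 0) by (intros s T; apply tle_nz in T; tauto).
  (* The claim for stages that leave the memory unchanged, proved once for all such branches. *)
  assert (nc : (forall k, c1 t = 2 * k -> (n k t <> 0 -> fCur m k <> 0) /\
       (fCur m k <> 0 -> fCur m k < n k t -> fCur m k < fCur m k)) ->
     (forall s, c1 t = 2 * s + 1 -> s <> 0 -> s <= Lev s t -> fLv m s < Lev s t -> 0 = s) ->
     Stt m /\ Tr m m /\
     (forall s, tle s 0 -> exists K, fKap m s = S K /\ fCur m K = 0 /\ fLen m + 2 <= fCur m K) /\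
     (forall s, ~ tle s 0 -> fKap m s = fKap m s /\ fB m s = fB m s) /\
     (0 <> 0 -> (0 <= Lev 0 t /\ fLv m 0 < Lev 0 t /\ fLv m 0 = Lev 0 t) \/
             (exists k, fOwn m k <> 0 /\ 0 = par (fOwn m k) /\ fCur m k < fCur m k)) /\
     (forall s, fLv m s <= fLv m s) /\
     (forall k, c1 t = 2 * k -> (n k t <> 0 -> fCur m k <> 0) /\ (fCur m k <> 0 -> fCur m k < n k t -> fCur m k < fCur m k)) /\
     (forall s, c1 t = 2 * s + 1 -> s <> 0 -> s <= Lev s t -> fLv m s < Lev s t -> 0 = s) /\
     (forall s, fLv m s <> fLv m s -> 0 = s /\ fLv m s = Lev s t)).
  { intros N1 N2. split; [now constructor|]. split; [apply Tr_refl|].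
    split; [intros s T; now apply none in T|]. split; [auto|]. split; [easy|]. split; [auto|]. split; [auto|]. split; [auto|easy]. }
  destruct (Nat.eqb_spec (c1 t mod 2) 0) as [Ev|Od].
  - assert (Hk : forall k, c1 t = 2 * k -> k = h) by (intros; lia).
    assert (Hs : forall s, c1 t <> 2 * s + 1) by (intros; lia).
    destruct (Nat.eqb_spec (fCur m h) 0) as [Z|NZ].
    + destruct (Nat.eqb_spec (n h t) 0) as [Zn|Nn].
      * apply nc; [intros k Ek; apply Hk in Ek as ->; split; [easy | lia] | intros s Es; now apply Hs in Es].
      * assert (I' : Inv (newret p h (n h t) m)) by now apply (Inv_newret p Hp par par_lt dig c).
        destruct (Inv_unused p Hp par dig c m h I Z) as [Oh _].
        assert (T' : Tr m (newret p h (n h t) m)).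
        { apply Tr_same; [apply mext_newret | | ].
          - intros s _. now rewrite newret_get.
          - intros k Hk'. rewrite !newret_get by discriminate. cbn [Nat.eqb andb].
            destruct (Nat.eqb_spec h k); [now subst|]. auto. }
        split; [|split; [auto|]].
        { constructor; auto.
          - constructor.
            + intros s k. rewrite !newret_get by discriminate. apply (j_kap m HJ).
            + intros k. rewrite !newret_get by discriminate. apply (j_own m HJ).
            + intros k. rewrite newret_len, newret_get by discriminate. cbn [Nat.eqb andb].
              destruct (h =? k); [lia|]. pose proof (j_len m HJ k). lia.
            + intros k. rewrite newret_get by discriminate. cbn [Nat.eqb andb].
              destruct (Nat.eqb_spec h k) as [<-|]; [eauto | apply (j_n m HJ)].
          - intros k k'. rewrite !newret_get by discriminate. cbn [Nat.eqb andb].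
            destruct (Nat.eqb_spec h k) as [<-|]; [easy|].
            destruct (Nat.eqb_spec h k') as [<-|]; [easy|]. apply E.
          - intros s. rewrite !newret_get by discriminate. apply Ca. }
        split; [intros s T; now apply none in T|].
        split; [intros s _; now rewrite !newret_get by discriminate|].
        split; [easy|]. split; [intros s; now rewrite newret_get by discriminate|]. split; [|split].
        { intros k Ek. apply Hk in Ek as ->. rewrite newret_get by discriminate. cbn [Nat.eqb andb].
          rewrite Nat.eqb_refl. split; [auto | easy]. }
        { intros s Es. now apply Hs in Es. }
        { intros s. now rewrite newret_get by discriminate. }
    + destruct (Nat.ltb_spec (fCur m h) (n h t)) as [Lt|Ge].
      * set (m1 := raise p h m) in *.
        assert (A1 : agree m1) by (eapply agree_ext; [apply mext_touch | exact A]).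
        assert (I1 : Inv m1) by now apply (Inv_raise p Hp par par_lt dig c).
        assert (gC : forall k, fCur m1 k = if h =? k then S (fCur m h) else fCur m k)
          by (intros; unfold m1; now rewrite raise_get).
        assert (gO : forall k, fOwn m1 k = fOwn m k) by (intros; unfold m1; now rewrite raise_get).
        assert (gE : forall k, fE m1 k = if h =? k then p ^ fLen m else fE m k)
          by (intros; unfold m1; now rewrite raise_get).
        assert (gK : forall k, fKap m1 k = fKap m k) by (intros; unfold m1; now rewrite raise_get).
        assert (gB : forall k, fB m1 k = fB m k) by (intros; unfold m1; now rewrite raise_get).
        assert (gV : forall k, fLv m1 k = fLv m k) by (intros; unfold m1; now rewrite raise_get).
        assert (gL : fLen m1 = S (fLen m)) by apply raise_len.
        assert (T1 : Tr m m1).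
        { constructor.
          - apply mext_raise.
          - auto.
          - intros k. rewrite gC. destruct (Nat.eqb_spec h k); [subst; lia | auto].
          - intros k _. left. auto.
          - intros k Hk'. exists g0. split; [apply Fr_0|]. split; [|intros _; apply zmul_g0].
            rewrite gO, gC, gE, Nat.eqb_refl. cbn [negb Nat.b2n]. destruct (Nat.eqb_spec h k) as [<-|N].
            + assert (Ar : agree (root (fE m h) m)).
              { eapply agree_ext; [|exact A1]. unfold m1, raise.
                repeat (apply mext_upd; [discriminate | discriminate |]). apply mext_refl. }
              pose proof (root_mul p Hp c _ m Ar (inv_E _ _ _ _ _ _ I h)) as Em.
              change (gen p (prime_ge2 p Hp) c (fLen m)) with (p ^ fLen m : P) in Em.
              replace (S (fCur m h) - fCur m h + 0) with 1 by lia. rewrite pw_1.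
              fold Hp2 in Em. rewrite Em. abel.
            + replace (fCur m k - fCur m k + 0) with 0 by lia. rewrite pw_0. abel. }
        assert (J1 : J m1).
        { constructor.
          - intros s k. rewrite gK, gO. apply (j_kap m HJ).
          - intros k. rewrite gK, gO. apply (j_own m HJ).
          - intros k. rewrite gC, gL. pose proof (j_len m HJ k). pose proof (j_len m HJ h). destruct (h =? k); lia.
          - intros k. rewrite gC. destruct (Nat.eqb_spec h k) as [<-|]; [|apply (j_n m HJ)]. exists t. lia. }
        assert (E1 : Ed m1 (par (fOwn m h))).
        { intros k k'. rewrite !gO, !gC. intros Ok Ok' Ep Ne. specialize (E k k' Ok Ok' Ep Ok).
          destruct (Nat.eqb_spec h k'); [subst; congruence|]. destruct (Nat.eqb_spec h k); [subst; lia | lia]. }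
        pose proof (touch_Stt _ m1 I1 J1 A E1) as S2.
        destruct (touch_spec _ m1 I1 J1 A E1) as (I2 & J2 & T2 & E2 & K2 & KK2 & V2).
        set (m2 := touch (par (fOwn m h)) m1) in *.
        assert (Crise : fCur m h < fCur m2 h).
        { pose proof (tr_cur _ _ T2 h). rewrite gC, Nat.eqb_refl in *. lia. }
        split; [apply S2; intros s; rewrite gB, gK; apply Ca|].
        split; [now apply (Tr_trans m m1)|]. split; [|split; [|split; [|split; [|split; [|split]]]]].
        { intros s T. destruct (KK2 s T) as (_ & K & EK & CK & LK). exists K. split; auto.
          rewrite gC in CK. destruct (Nat.eqb_spec h K); [lia|]. split; auto. lia. }
        { intros s T. destruct (K2 s T) as [EK EB]. rewrite EK, EB. auto. }
        { intros Ng. right. exists h. split; [|auto]. intros Z. rewrite Z, par0 in Ng. easy. }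
        { intros s. rewrite V2, gV. auto. }
        { intros k H. apply Hk in H as ->. split; intros; lia. }
        { intros s H. now apply Hs in H. }
        { intros s. now rewrite V2, gV. }
      * apply nc; [intros k Ek; apply Hk in Ek as ->; split; [easy | lia] | intros s Es; now apply Hs in Es].
  - assert (Hk : forall k, c1 t <> 2 * k) by (intros; lia).
    assert (Hs : forall s, c1 t = 2 * s + 1 -> s = h) by (intros; lia).
    destruct (negb (h =? 0) && (h <=? Lev h t) && (fLv m h <? Lev h t))%bool eqn:G.
    + apply andb_prop in G as [G G3]. apply andb_prop in G as [G1 G2].
      apply Nat.leb_le in G2. apply Nat.ltb_lt in G3. apply Bool.negb_true_iff, Nat.eqb_neq in G1.
      set (m1 := upd m 6 h (Lev h t)) in *.
      assert (g1 : forall t' i, t' <> 6 -> get m1 t' i = get m t' i).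
      { intros t' i Nt. unfold m1. rewrite get_upd. destruct (Nat.eqb_spec 6 t'); [lia|]. auto. }
      assert (gV : forall i, fLv m1 i = if h =? i then Lev h t else fLv m i) by (intros; unfold m1; gu; auto).
      assert (A1 : agree m1) by (eapply agree_ext; [apply mext_touch | exact A]).
      assert (I1 : Inv m1).
      { destruct I as [P1 P2 P3 P4 (Q1 & Q2 & Q3) P6 P7].
        constructor; intros *; rewrite ?g1 by discriminate; auto.
        - repeat split; intros *; rewrite ?g1 by discriminate; auto.
        - intros Lx. assert (S0 : Sp p Hp c m x) by auto. clear Lx.
          apply (Sp_mono p Hp c m m1); auto; intros; rewrite <- (g1 _ _); try discriminate; constructor. }
      assert (J1 : J m1).
      { destruct HJ as [X1 X2 X3 X4]. constructor; intros *; rewrite ?g1 by discriminate; auto. }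
      assert (E1 : Ed m1 h).
      { intros k k'. rewrite !g1 by discriminate. intros Ok Ok' Ep _. apply E; auto. }
      assert (T1 : Tr m m1).
      { apply Tr_same; auto.
        - apply mext_upd; try discriminate. apply mext_refl. }
      pose proof (touch_Stt _ m1 I1 J1 A E1) as S2.
      destruct (touch_spec _ m1 I1 J1 A E1) as (I2 & J2 & T2 & E2 & K2 & KK2 & V2).
      set (m2 := touch h m1) in *.
      split; [apply S2; intros s; rewrite !g1 by discriminate; apply Ca|].
      split; [now apply (Tr_trans m m1)|]. split; [|split; [|split; [|split; [|split; [|split]]]]].
      * intros s T. destruct (KK2 s T) as (_ & K & EK & CK & LK). exists K. rewrite !g1 in * by discriminate. auto.
      * intros s T. destruct (K2 s T) as [EK EB]. rewrite EK, EB, !g1 by discriminate. auto.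
      * intros _. left. rewrite V2, gV, Nat.eqb_refl. auto.
      * intros s. rewrite V2, gV. destruct (Nat.eqb_spec h s); [subst; lia | auto].
      * intros k H. now apply Hk in H.
      * intros s H _ _ _. now rewrite (Hs s H).
      * intros s. rewrite V2, gV. destruct (Nat.eqb_spec h s); [subst; auto | easy].
    + apply nc; [intros k Ek; now apply Hk in Ek|].
      intros s Es Ns Ls Lv. apply Hs in Es as ->. exfalso.
        assert (X : (negb (h =? 0) && (h <=? Lev h t) && (fLv m h <? Lev h t))%bool = true).
        { apply andb_true_intro. split; [apply andb_true_intro; split|].
          - apply Bool.negb_true_iff. now apply Nat.eqb_neq.
          - now apply Nat.leb_le.
          - now apply Nat.ltb_lt. }
        congruence.
Qed.

End Dyn.

(** * The limit of the construction *)

Lemma strong_recursion {T : Type} (F : (nat -> T) -> nat -> T) (x0 : T) :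
  (forall g h i, (forall j, j < i -> g j = h j) -> F g i = F h i) -> exists g, forall i, g i = F g i.
Proof.
  intros HF.
  pose (G := fix G N := match N with 0 => fun _ => x0
    | S N => fun i => if i =? N then F (G N) N else G N i end).
  assert (E : forall N i, i < N -> G N i = F (G i) i).
  { induction N as [|N IH]; intros i L; [lia|]. simpl. destruct (Nat.eqb_spec i N) as [->|]; auto. apply IH. lia. }
  exists (fun i => F (G i) i). intros i. apply HF. intros j L. now apply E.
Qed.

Lemma eventually_const (f : nat -> nat) B : (forall t, f t <= f (S t)) -> (forall t, f t <= B) ->
  exists t0, forall t, t0 <= t -> f t = f t0.
Proof.
  intros M L. assert (mono : forall t t', t <= t' -> f t <= f t').
  { induction 1; auto. etransitivity; eauto. }
  induction B as [B IH] using lt_wf_ind.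
  destruct (classic (exists t0, forall t, t0 <= t -> f t = f t0)) as [|N]; auto.
  exfalso. assert (forall v, exists t, v <= f t).
  { induction v as [|v [t Ht]]; [exists 0; lia|].
    destruct (classic (exists t', t <= t' /\ f t' <> f t)) as [(t' & Lt & Ne)|Ne].
    - exists t'. specialize (mono t t' Lt). lia.
    - destruct N. exists t. intros t' Lt. apply NNPP. intros Q. apply Ne. eauto. }
  destruct (H (S B)) as [t Ht]. specialize (L t). lia.
Qed.

(** * Homomorphisms from a stage into cyclic groups *)

Section Homs.
Context (p : nat) (Hp : prime (Z.of_nat p)).
Context (par : nat -> nat) (par_lt : forall s, s <> 0 -> par s < s) (dig : nat -> nat -> nat).
Context (par0 : par 0 = 0) (n : nat -> nat -> nat) (c : nat -> nat).
Notation P := (Pg p (prime_ge2 p Hp) c).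
Notation plin := (plin p (prime_ge2 p Hp) c).
Notation Hv := (Hv p Hp c).
Notation Stt := (Stt p Hp par dig n c).
Notation tle := (tle par).
Notation LS := (lsum par dig).
Notation pZ := (Z.of_nat p).

Lemma lsum_zmul {G : Grp} s z (be : nat -> G) : z • LS s be = LS s (fun t => z • be t).
Proof.
  unfold lsum. assert (E : forall l a, z • fold_left (fun acc t => acc ⊕ Z.of_nat (dig s t) • be t) l a =
    fold_left (fun acc t => acc ⊕ Z.of_nat (dig s t) • (z • be t)) l (z • a)).
  { induction l as [|t l IH]; intros a; simpl; auto. rewrite IH. f_equal. abel. }
  rewrite E, zmul_g0. reflexivity.
Qed.

Lemma lsum_0 {G : Grp} s (be : nat -> G) : (forall t, tle t (par s) -> be t = g0) -> LS s be = g0.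
Proof.
  intros H. apply (lsum_closed par par_lt dig s be (fun x => x = g0)); auto.
  - intros x y -> ->. apply gadd0.
  - intros t T. rewrite H by auto. apply zmul_g0.
Qed.

Context (m : mem) (HS : Stt m).
Let HI := st_inv _ _ _ _ _ _ _ HS.
Let HJ := st_j _ _ _ _ _ _ _ HS.

Lemma carrier s : fB m s <> 0 -> exists k, fKap m s = S k /\ fOwn m k = s /\ 2 <= fCur m k.
Proof.
  intros B. pose proof (st_ca _ _ _ _ _ _ _ HS s B) as N. destruct (fKap m s) as [|k] eqn:E; [easy|].
  destruct (j_kap _ _ HJ s k E) as [O Ns]. exists k. repeat split; auto.
  apply (inv_own _ _ _ _ _ _ HI). congruence.
Qed.

Lemma carrier_desc s t k k' : fOwn m k = s -> fOwn m k' = t -> t <> 0 -> tle s (par t) -> fCur m k' + 2 <= fCur m k.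
Proof.
  intros Ok Ok' Nt T. revert k' Ok' Nt. remember (par t) as u eqn:Eu. revert t Eu.
  induction T as [Nu|u Nu T IH]; intros t Eu k' Ok' Nt.
  - apply (st_ed _ _ _ _ _ _ _ HS); congruence.
  - assert (Bt : fB m t <> 0) by (rewrite <- Ok'; apply (inv_own _ _ _ _ _ _ HI); congruence).
    assert (Bu : fB m u <> 0) by (subst u; now apply (inv_b _ _ _ _ _ _ HI t)).
    destruct (carrier u Bu) as (k'' & _ & Ok'' & _).
    assert (fCur m k'' + 2 <= fCur m k) by (apply (IH u); auto).
    assert (fCur m k' + 2 <= fCur m k'') by (apply (st_ed _ _ _ _ _ _ _ HS); congruence). lia.
Qed.

(** A retired component is a direct summand, and this is the projection onto it. *)
Lemma hom_retired k : fOwn m k = 0 ->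
  exists v : nat -> Zq (pw p (fCur m k)), Hv v (fLen m) /\ plin v (fE m k) = zq_of _ 1 /\
    (forall l, l <> k -> plin v (fE m l) = g0) /\ forall s, plin v (fB m s) = g0.
Proof.
  intros Ok. set (T := Zq (pw p (fCur m k))).
  destruct (inv_hom _ _ _ _ _ _ HI T (fun _ => g0) (fun l => if l =? k then zq_of _ 1 else g0)) as (v & H & VB & VE).
  - repeat split.
    + intros s _. rewrite zmul_g0, lsum_0; auto.
    + intros l Hl. destruct (Nat.eqb_spec l k); [congruence|]. apply zmul_g0.
    + intros l Hl. destruct (Nat.eqb_spec l k) as [->|]; [apply zq_kill, (pw_pos p Hp) | apply zmul_g0].
  - exists v. split; auto. split; [rewrite VE; now rewrite Nat.eqb_refl|]. split.
    + intros l N. rewrite VE. now destruct (Nat.eqb_spec l k).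
    + intros s. destruct (Nat.eq_dec (fB m s) 0) as [->|N]; auto.
Qed.

(** The coordinate of a component in use cannot be made to vanish on the components below [s], since
    the representative of [s] enters the relations of its descendants. The gaps of 2 allow it to be
    divisible by [p] there. *)
Lemma hom_carrier k s : fOwn m k = s -> s <> 0 ->
  exists v : nat -> Zq (pw p (fCur m k)), Hv v (fLen m) /\ plin v (fE m k) = zq_of _ 1 /\
    (forall l, l <> k -> exists w, plin v (fE m l) = pZ • w) /\
    (forall l, ~ tle s (fOwn m l) -> plin v (fE m l) = g0) /\
    (forall t, ~ tle s t -> plin v (fB m t) = g0) /\
    plin v (fB m s) = pw p (fCur m k - 1) • (zq_of _ 1 : Zq (pw p (fCur m k))).
Proof.
  intros Ok Ns. set (q := fCur m k). set (T := Zq (pw p q)). set (one := zq_of (pw p q) 1 : T).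
  assert (q2 : 2 <= q) by (apply (inv_own _ _ _ _ _ _ HI); congruence).
  pose (kap := fun t => pred (fKap m t)). pose (cu := fun t => fCur m (kap t)).
  assert (Hcu : forall t, fB m t <> 0 -> fOwn m (kap t) = t).
  { intros t Bt. destruct (carrier t Bt) as (k' & E & O & _). unfold kap. now rewrite E. }
  assert (kap_own : forall l, fOwn m l <> 0 -> kap (fOwn m l) = l).
  { intros l N. unfold kap. now rewrite (j_own _ _ HJ l N). }
  assert (cs : cu s = q) by (unfold cu; rewrite <- Ok, kap_own; [auto | congruence]).
  pose (td := fun t => if excluded_middle_informative (tle s t) then true else false).
  assert (Htd : forall t, td t = true <-> tle s t).
  { intros t. unfold td. destruct (excluded_middle_informative (tle s t)); split; easy. }
  assert (Htd' : forall t, td t = false <-> ~ tle s t).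
  { intros t. rewrite <- Htd. now destruct (td t). }
  (* For [u] below [s] the representative is to go to [p^(cu u) ga u] and its component to [p ga u].
     Dividing the relation for [p] times the representative of [u] by [p^(cu u + 1)] gives this
     recursion; the exponents are nonnegative by the gaps and by [cu s = q]. *)
  pose (GG := fun (g : nat -> T) (u t : nat) => if t =? s then pw p (q - 2 - cu u) • one
        else if td t then pw p (cu t - cu u - 1) • g t else g0).
  destruct (strong_recursion (fun g u => LS u (GG g u)) (@g0 T)) as [ga Hga].
  { intros g h i E. apply (lsum_ext par par_lt dig). intros t Tt. unfold GG.
    destruct (Nat.eq_dec i 0) as [->|Ni]; [rewrite par0 in Tt; apply tle_nz in Tt; tauto|].
    apply (tle_le par par_lt) in Tt. rewrite E; auto. specialize (par_lt i Ni). lia. }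
  pose (be := fun t => if t =? s then pw p (q - 1) • one else if td t then pw p (cu t) • ga t else g0).
  pose (ep := fun l => if l =? k then one else if td (fOwn m l) then pZ • ga (fOwn m l) else g0).
  assert (be_n : forall t, ~ tle s t -> be t = g0).
  { intros t N. unfold be. destruct (Nat.eqb_spec t s) as [->|]; [destruct N; now constructor|].
    apply Htd' in N. now rewrite N. }
  assert (be_s : be s = pw p (q - 1) • one) by (unfold be; now rewrite Nat.eqb_refl).
  assert (tle_strict : forall t, tle s t -> t <> s -> tle s (par t)).
  { intros t Tt N. inversion Tt; subst; auto. congruence. }
  destruct (inv_hom _ _ _ _ _ _ HI T be ep) as (v & H & VB & VE).
  { repeat split.
    - intros t Bt. destruct (Nat.eq_dec t s) as [->|Nt].
      + rewrite be_s. rewrite lsum_0.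
        * rewrite <- zmul_mul, <- pw_S. replace (S (q - 1)) with q by lia. apply zq_kill, (pw_pos p Hp).
        * intros u Tu. apply be_n. intros Tsu. pose proof (tle_le par par_lt _ _ (tle_trans par s u (par s) Tsu Tu)).
          specialize (par_lt s Ns). lia.
      + destruct (classic (tle s t)) as [Tt|Tt].
        * unfold be at 1. destruct (Nat.eqb_spec t s); [easy|]. pose proof Tt as Tt'. apply Htd in Tt'. rewrite Tt'.
          rewrite Hga, <- zmul_mul, <- pw_S, lsum_zmul. apply (lsum_ext par par_lt dig). intros u Tu.
          pose proof (tle_strict t Tt Nt) as Tp.
          assert (Ct : cu t + 2 <= q).
          { rewrite <- cs. unfold cu. apply (carrier_desc s t); auto; [apply Hcu|now apply tle_nz in Tt].
            apply (Inv_anc p Hp par dig c m s t HI); auto. }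
          unfold GG, be. destruct (Nat.eqb_spec u s) as [->|Nu].
          { rewrite <- zmul_mul, <- pw_add. f_equal. f_equal. lia. }
          destruct (td u) eqn:Tdu; [|apply zmul_g0].
          rewrite <- zmul_mul, <- pw_add. f_equal. f_equal.
          assert (cu t + 2 <= cu u).
          { assert (Nt0 : t <> 0) by now apply tle_nz in Tt.
            unfold cu. apply (carrier_desc u t); auto. apply Hcu.
            apply (Inv_anc p Hp par dig c m u t HI); auto. now apply tle_par. }
          lia.
        * rewrite be_n, zmul_g0 by auto. symmetry. apply lsum_0. intros u Tu. apply be_n.
          intros Tsu. apply Tt. apply tle_par; [apply (inv_b _ _ _ _ _ _ HI t Bt)|]. now apply (tle_trans par s u).
    - intros l Ol. unfold ep. destruct (Nat.eqb_spec l k) as [->|Nl]; [now rewrite Ok, be_s|].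
      destruct (td (fOwn m l)) eqn:Tl; [|rewrite be_n, zmul_g0; auto; now apply Htd'].
      unfold be. destruct (Nat.eqb_spec (fOwn m l) s) as [E|E].
      { destruct Nl. rewrite <- (kap_own l Ol), <- (kap_own k) by congruence. congruence. }
      rewrite Tl. unfold cu. rewrite kap_own by auto.
      assert (2 <= fCur m l) by now apply (inv_own _ _ _ _ _ _ HI).
      rewrite <- zmul_mul, Z.mul_comm, <- pw_S. f_equal. f_equal. lia.
    - intros l Ol. unfold ep. destruct (Nat.eqb_spec l k) as [->|Nl]; [congruence|].
      destruct (td (fOwn m l)) eqn:Tl; [|apply zmul_g0]. apply Htd in Tl. apply tle_nz in Tl. tauto. }
  exists v. split; [auto|]. split; [rewrite VE; unfold ep; now rewrite Nat.eqb_refl|]. split; [|split; [|split]].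
  - intros l Nl. rewrite VE. unfold ep. destruct (Nat.eqb_spec l k); [easy|].
    destruct (td (fOwn m l)); eauto. exists g0. now rewrite zmul_g0.
  - intros l Nl. rewrite VE. unfold ep. destruct (Nat.eqb_spec l k) as [->|].
    + destruct Nl. rewrite Ok. now constructor.
    + apply Htd' in Nl. now rewrite Nl.
  - intros t Nt. destruct (Nat.eq_dec (fB m t) 0) as [->|Bt]; [apply plin_0|]. rewrite VB; auto.
  - rewrite VB; auto. rewrite <- Ok. apply (inv_own _ _ _ _ _ _ HI). congruence.
Qed.

End Homs.

(** * The limit group: its invariants and its elements of infinite height *)

Section Limit.
Context (p : nat) (Hp : prime (Z.of_nat p)).
Context (par : nat -> nat) (par_lt : forall s, s <> 0 -> par s < s) (par0 : par 0 = 0).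
Context (dig n Lev : nat -> nat -> nat) (srch : mem -> nat).
Context (n_mono : forall k s s', s <= s' -> n k s <= n k s').
Context (srch_spec : forall m, fCur m (c1 (srch m)) = 0 /\ fLen m + 2 <= n (c1 (srch m)) (c2 (srch m))).
Context (nu : nat -> nat) (n_nu : forall k, exists s0, forall s, s0 <= s -> n k s = nu k).
Context (Lev_mono : forall s t t', t <= t' -> Lev s t <= Lev s t').
Context (Lev_par : forall s t, par s <> 0 -> Lev s t <= Lev (par s) t).

Definition run (t : nat) : mem := nat_rect (fun _ => mem) [] (stage p par dig n Lev srch) t.

Lemma run_S t : run (S t) = stage p par dig n Lev srch t (run t).
Proof. reflexivity. Qed.

Arguments run : simpl never.

Lemma run_ext t t' : t <= t' -> mext (run t) (run t').
Proof.
  induction 1; [apply mext_refl|]. eapply mext_trans; [exact IHle|]. rewrite run_S. apply mext_stage.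
Qed.

(** A relation never changes once its generator exists, so any stage that knows it will do. The
    default is never met, as the number of generators is unbounded. *)
Definition runc (i : nat) : nat :=
  match excluded_middle_informative (exists t, i < fLen (run t)) with
  | left H => fC (run (proj1_sig (constructive_indefinite_description _ H))) i
  | right _ => 0
  end.

Lemma runc_eq t i : i < fLen (run t) -> runc i = fC (run t) i.
Proof.
  intros L. unfold runc. destruct (excluded_middle_informative _) as [H|H]; [|destruct H; eauto].
  destruct (constructive_indefinite_description _ H) as [u Hu]. simpl.
  destruct (Nat.le_ge_cases t u) as [Le|Le]; [|symmetry]; now apply (run_ext _ _ Le).
Qed.

Notation c := runc.
Notation P := (Pg p (prime_ge2 p Hp) c).
Notation plin := (plin p (prime_ge2 p Hp) c).
Notation Hv := (Hv p Hp c).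
Notation Inv := (Inv p Hp par dig c).
Notation Stt := (Stt p Hp par dig n c).
Notation Tr := (Tr p Hp c).
Notation tle := (tle par).
Notation LS := (lsum par dig).
Notation pZ := (Z.of_nat p).
Notation Dv := (Dv p). Notation Om := (Om p).

Lemma run_agree t : agree c (run t).
Proof. intros i L. now apply runc_eq. Qed.

Lemma Stt_nil : Stt [].
Proof.
  constructor.
  - constructor; intros *; rewrite ?get_nil; try easy.
    + apply ppow_pos, prime_ge2. auto.
    + apply ppow_pos, prime_ge2. auto.
    + intros L. simpl in L. replace x with (@g0 P) by (simpl; lia). apply Sp_0.
    + intros (_ & _ & R3). exists (fun _ => g0). split; [intros i L; lia|]. split; intros *; rewrite ?get_nil; try easy.
      specialize (R3 k). rewrite !get_nil, pw_0, zmul_1 in R3. rewrite R3 by auto. apply plin_0.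
  - constructor; intros *; rewrite ?get_nil; try easy; lia.
  - intros k k'. rewrite !get_nil. easy.
  - intros s. rewrite !get_nil. easy.
Qed.

Lemma run_Stt t : Stt (run t).
Proof.
  induction t as [|t IH]; [apply Stt_nil|].
  apply (stage_spec p Hp par par_lt dig n Lev srch par0 srch_spec c t (run t) IH). apply (run_agree (S t)).
Qed.

Definition step_spec t := stage_spec p Hp par par_lt dig n Lev srch par0 srch_spec c t (run t) (run_Stt t) (run_agree (S t)).

Lemma run_inv t : Inv (run t).
Proof. apply (st_inv _ _ _ _ _ _ _ (run_Stt t)). Qed.

Lemma run_J t : J n (run t).
Proof. apply (st_j _ _ _ _ _ _ _ (run_Stt t)). Qed.

Lemma run_Tr t t' : t <= t' -> Tr (run t) (run t').
Proof.
  induction 1 as [|t' L IH]; [apply (Tr_refl p Hp par par0)|].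
  apply (Tr_trans p Hp par dig n par0 c _ (run t')); auto; [apply run_inv|]. apply (step_spec t').
Qed.

Notation tg t := (tgt par n Lev t (run t)).

Lemma n_le_nu k s : n k s <= nu k.
Proof.
  destruct (n_nu k) as [s0 H]. rewrite <- (H (s0 + s)) by lia. apply n_mono. lia.
Qed.

Lemma cur_le_nu t k : fCur (run t) k <= nu k.
Proof.
  destruct (Nat.eq_dec (fCur (run t) k) 0); [lia|].
  destruct (j_n _ _ (run_J t) k) as [u Hu]; auto. pose proof (n_le_nu k u). lia.
Qed.

Lemma schedule i T : exists t, T <= t /\ c1 t = i.
Proof. exists (cp i T). rewrite c1_cp. pose proof (cp_le i T). split; auto; lia. Qed.

Lemma E_stable t t' k : t <= t' -> fCur (run t') k = fCur (run t) k -> fOwn (run t') k = fOwn (run t) k ->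
  fE (run t') k = fE (run t) k.
Proof.
  intros L C O. destruct (Nat.eq_dec (fCur (run t) k) 0) as [Z|N].
  - rewrite (proj2 (Inv_unused p Hp par dig c _ k (run_inv t) Z)).
    apply (Inv_unused p Hp par dig c _ k (run_inv t')). lia.
  - destruct (tr_E _ _ _ _ _ (run_Tr t t' L) k N) as (y & _ & E & Zy).
    rewrite (Zy O), gadd0r, C, O, Nat.eqb_refl, Nat.sub_diag in E. cbn [negb Nat.b2n Nat.add] in E.
    rewrite pw_0, zmul_1 in E. auto.
Qed.

Lemma final k : exists t0, forall t, t0 <= t ->
  fCur (run t) k = nu k /\ fOwn (run t) k = fOwn (run t0) k /\ fE (run t) k = fE (run t0) k.
Proof.
  (* The owner of a used component changes at most once, namely to 0; counting this change as 1
     gives a bounded nondecreasing quantity that detects every change. *)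
  pose (f := fun t => fCur (run t) k + Nat.b2n (negb (fCur (run t) k =? 0) && (fOwn (run t) k =? 0))).
  assert (step : forall t, fCur (run t) k <= fCur (run (S t)) k /\ f t <= f (S t)).
  { intros t. pose proof (run_Tr t (S t) (Nat.le_succ_diag_r t)) as T. pose proof (tr_cur _ _ _ _ _ T k) as L.
    split; auto. unfold f. destruct (Nat.eqb_spec (fCur (run t) k) 0) as [Z|N]; [simpl; lia|].
    destruct (Nat.eqb_spec (fCur (run (S t)) k) 0); [lia|].
    destruct (tr_own _ _ _ _ _ T k N) as [->|[N' ->]]; [lia|].
    destruct (Nat.eqb_spec (fOwn (run t) k) 0); [easy|]. cbn [andb negb Nat.b2n Nat.eqb]. lia. }
  destruct (eventually_const (fun t => fCur (run t) k) (nu k)) as [t1 H1];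
    [apply step | intros; apply cur_le_nu|].
  destruct (eventually_const f (S (nu k))) as [t2 H2]; [apply step| |].
  { intros t. unfold f. pose proof (cur_le_nu t k). destruct (_ && _)%bool; simpl; lia. }
  set (t0 := t1 + t2). exists t0.
  assert (C0 : forall t, t0 <= t -> fCur (run t) k = fCur (run t0) k).
  { intros t L. rewrite (H1 t), (H1 t0) by lia. auto. }
  assert (O0 : forall t, t0 <= t -> fOwn (run t) k = fOwn (run t0) k).
  { intros t L. pose proof (run_Tr t0 t L) as T. destruct (Nat.eq_dec (fCur (run t0) k) 0) as [Z|N].
    - rewrite (proj1 (Inv_unused p Hp par dig c _ k (run_inv t0) Z)).
      apply (Inv_unused p Hp par dig c _ k (run_inv t)). rewrite C0; auto.
    - destruct (tr_own _ _ _ _ _ T k N) as [|[N' Z']]; auto. exfalso.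
      assert (Ef : f t = f t0) by (rewrite (H2 t), (H2 t0); lia).
      unfold f in Ef. rewrite C0, Z' in Ef by auto.
      destruct (Nat.eqb_spec (fCur (run t0) k) 0); [easy|].
      destruct (Nat.eqb_spec (fOwn (run t0) k) 0); [easy|]. simpl in Ef. lia. }
  assert (V : fCur (run t0) k = nu k).
  { destruct (n_nu k) as [s0 Hs0]. destruct (schedule (2 * k) (t0 + s0)) as (t & Lt & Et).
    destruct (step_spec t) as (_ & _ & _ & _ & _ & _ & Sc & _ & _). fold (run (S t)) in Sc.
    change (stage p par dig n Lev srch t (run t)) with (run (S t)) in Sc.
    destruct (Sc k Et) as [S1 S2].
    pose proof (C0 t ltac:(lia)). pose proof (C0 (S t) ltac:(lia)). pose proof (Hs0 t ltac:(lia)).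
    pose proof (cur_le_nu t0 k). lia. }
  intros t L. rewrite C0 by auto. repeat split; auto. apply E_stable; auto.
Qed.

Lemma len_unbounded N : exists t, N <= fLen (run t).
Proof.
  induction N as [|N [t Ht]]; [exists 0; lia|].
  destruct (srch_spec (run t)) as [_ L]. set (K := c1 (srch (run t))) in *.
  destruct (final K) as [t0 H0]. destruct (H0 t0) as [C _]; auto.
  exists t0. pose proof (j_len _ _ (run_J t0) K). pose proof (n_le_nu K (c2 (srch (run t)))). lia.
Qed.

Lemma Lev_tle s s' t : tle s s' -> Lev s' t <= Lev s t.
Proof.
  induction 1 as [|s' N T IH]; auto. etransitivity; [|exact IH]. apply Lev_par. now apply tle_nz in T.
Qed.

(** A touch begins either at a node [g <= Lev g t], and going up to an ancestor [s] lowers the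
    number and does not lower the level, or above an owner that was active before. *)
Lemma active_lev t s : fB (run t) s <> 0 -> exists u, s <= Lev s u.
Proof.
  revert s. induction t as [|t IH]; intros s B; [now rewrite get_nil in B|].
  destruct (step_spec t) as (_ & _ & _ & S1 & S2 & _).
  change (stage p par dig n Lev srch t (run t)) with (run (S t)) in *.
  destruct (classic (tle s (tg t))) as [T|T].
  - destruct (tle_nz _ _ _ T) as [_ Ng]. destruct (S2 Ng) as [(A & _)|(k & Ok & Eg & _)].
    + exists t. pose proof (Lev_tle s _ t T). pose proof (tle_le par par_lt _ _ T). lia.
    + apply IH. rewrite Eg in T. destruct (inv_own _ _ _ _ _ _ (run_inv t) k Ok) as [Bo _].
      apply (Inv_anc p Hp par dig c _ s (fOwn (run t) k) (run_inv t)); auto. now apply tle_par.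
  - destruct (S1 s T) as [_ EB]. rewrite EB in B. auto.
Qed.

Lemma Lv_mono t t' s : t <= t' -> fLv (run t) s <= fLv (run t') s.
Proof. induction 1; auto. etransitivity; [exact IHle|]. apply (step_spec m). Qed.

(** By [active_lev] the active nodes below [s] are at most [Lam], whence the induction on the
    distance from [s] to [Lam]. When the proper descendants have become quiet, their components and
    all recorded levels settle, and then nothing can cause a touch through [s]. *)
Lemma junk_quiet Lam d : forall s, (forall t, Lev s t <= Lam) -> Lam < s + d ->
  exists t0, forall t, t0 <= t -> ~ tle s (tg t).
Proof.
  induction d as [|d IH]; intros s HL Ld.
  - exists 0. intros t _ T. destruct (tle_nz _ _ _ T) as [_ Ng].
    pose proof (tle_le par par_lt _ _ T) as Ls.
    destruct (step_spec t) as (_ & _ & _ & _ & S2 & _).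
    destruct (S2 Ng) as [(A & _)|(k & Ok & Eg & _)].
    + pose proof (Lev_tle s _ t T). specialize (HL t). lia.
    + destruct (inv_own _ _ _ _ _ _ (run_inv t) k Ok) as [Bo _].
      destruct (active_lev t _ Bo) as [u Hu]. rewrite Eg in T, Ls.
      assert (T' : tle s (fOwn (run t) k)) by now apply tle_par.
      pose proof (Lev_tle s _ u T'). specialize (HL u). specialize (par_lt _ Ok). lia.
  (* Finitely many proper descendants have to be considered. Each is quiet by induction, so it keeps
     its component, and the exponent of that component becomes final. *)
  - assert (Q1 : exists t1, forall t, t1 <= t -> forall s', s' < S Lam -> tle s s' -> s' <> s ->
       ~ tle s' (tg t) /\ forall k, fOwn (run t) k = s' -> fCur (run (S t)) k = fCur (run t) k).
    { destruct (eventually_all (fun s' t => tle s s' -> s' <> s ->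
         ~ tle s' (tg t) /\ forall k, fOwn (run t) k = s' -> fCur (run (S t)) k = fCur (run t) k) (S Lam)) as [t1 H1];
        [|exists t1; intros; now apply H1].
      intros s' Ls'. destruct (classic (tle s s' /\ s' <> s)) as [[T N]|Q]; [|exists 0; tauto].
      pose proof (tle_le par par_lt _ _ T).
      destruct (IH s') as [t1 Ht1]; [intros t; specialize (HL t); pose proof (Lev_tle s s' t T); lia | lia|].
      assert (Kc : forall t, t1 <= t -> fKap (run t) s' = fKap (run t1) s').
      { induction 1 as [|t Lt IHt]; auto. rewrite <- IHt. apply (step_spec t). now apply Ht1. }
      destruct (tle_nz _ _ _ T) as [_ Ns'].
      destruct (fKap (run t1) s') as [|k0] eqn:E0.
      + exists t1. intros t Lt _ _. split; [now apply Ht1|]. intros k Ok.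
        pose proof (j_own _ _ (run_J t) k) as E. rewrite Ok, Kc in E by auto. now specialize (E Ns').
      + destruct (final k0) as [t2 Ht2]. exists (t1 + t2). intros t Lt _ _. split; [apply Ht1; lia|].
        intros k Ok. pose proof (j_own _ _ (run_J t) k) as E. rewrite Ok, Kc in E by lia.
        assert (k = k0) by (specialize (E Ns'); lia). subst k.
        destruct (Ht2 t) as [-> _]; [lia|]. destruct (Ht2 (S t)) as [-> _]; [lia|]. auto. }
    destruct Q1 as [t1 Ht1].
    assert (Q2 : exists t2, forall t, t2 <= t -> forall s', s' < S Lam -> tle s s' -> fLv (run (S t)) s' = fLv (run t) s').
    { destruct (eventually_all (fun s' t => tle s s' -> fLv (run (S t)) s' = fLv (run t) s') (S Lam)) as [t2 H2];
        [|exists t2; intros; now apply H2].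
      intros s' _. destruct (classic (tle s s')) as [T|T]; [|exists 0; tauto].
      destruct (eventually_const (fun t => fLv (run t) s') Lam) as [t2 Ht2].
      - intros t. apply Lv_mono. lia.
      - induction t as [|t IHt]; [rewrite get_nil; lia|].
        destruct (step_spec t) as (_ & _ & _ & _ & S2 & _ & _ & _ & S3).
        change (stage p par dig n Lev srch t (run t)) with (run (S t)) in *.
        destruct (Nat.eq_dec (fLv (run (S t)) s') (fLv (run t) s')) as [->|Ne]; auto.
        destruct (S3 s' Ne) as [_ ->]. pose proof (Lev_tle s s' t T). specialize (HL t). lia.
      - exists t2. intros t Lt _. rewrite (Ht2 t), (Ht2 (S t)) by lia. auto. }
    destruct Q2 as [t2 Ht2]. exists (t1 + t2). intros t Lt T. destruct (tle_nz _ _ _ T) as [_ Ng].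
    destruct (step_spec t) as (_ & _ & _ & _ & S2 & _).
    change (stage p par dig n Lev srch t (run t)) with (run (S t)) in *.
    destruct (S2 Ng) as [(A & A' & A'')|(k & Ok & Eg & Lk)].
    + assert (tg t < S Lam) by (pose proof (Lev_tle s _ t T); specialize (HL t); lia).
      specialize (Ht2 t ltac:(lia) (tg t) H T). lia.
    + destruct (inv_own _ _ _ _ _ _ (run_inv t) k Ok) as [Bo _].
      destruct (active_lev t _ Bo) as [u Hu]. rewrite Eg in T.
      assert (T' : tle s (fOwn (run t) k)) by now apply tle_par.
      pose proof (Lev_tle s _ u T'). pose proof (tle_le par par_lt _ _ T). specialize (par_lt _ Ok).
      destruct (Ht1 t ltac:(lia) (fOwn (run t) k)) as [_ Hc]; auto; [specialize (HL u); lia | lia|].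
      specialize (Hc k eq_refl). lia.
Qed.

Definition tru (s : nat) : Prop := s <> 0 /\ forall B, exists t, B <= Lev s t.

Lemma not_tru s : s <> 0 -> ~ tru s -> exists L, forall t, Lev s t <= L.
Proof.
  intros N H. apply NNPP. intros Q. apply H. split; auto. intros B. apply NNPP. intros Q'.
  apply Q. exists B. intros t. destruct (Nat.le_gt_cases (Lev s t) B); auto. destruct Q'. exists t. lia.
Qed.

Lemma B_stable t t' s : t <= t' -> fB (run t) s <> 0 -> fB (run t') s = fB (run t) s.
Proof. intros L. apply (tr_B _ _ _ _ _ (run_Tr t t' L)). Qed.

Lemma junk_final s t : ~ tru s -> fB (run t) s <> 0 ->
  exists t0 k, t <= t0 /\ forall t', t0 <= t' -> fOwn (run t') k = s.
Proof.
  intros NT B. destruct (inv_b _ _ _ _ _ _ (run_inv t) s B) as [Ns _].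
  destruct (not_tru s Ns NT) as [L HL]. destruct (junk_quiet L (S L) s HL) as [t0 H0]; [lia|].
  assert (Kc : forall t', t + t0 <= t' -> fKap (run t') s = fKap (run (t + t0)) s).
  { induction 1 as [|t' Lt IHt]; auto. rewrite <- IHt. apply (step_spec t'). apply H0. lia. }
  assert (B' : fB (run (t + t0)) s <> 0) by (rewrite (B_stable t) by (auto; lia); auto).
  destruct (carrier p Hp par dig n c _ (run_Stt (t + t0)) s B') as (k & Ek & _).
  exists (t + t0), k. split; [lia|]. intros t' Lt.
  apply (j_kap _ _ (run_J t')). now rewrite Kc.
Qed.

Lemma tru_touched s T : tru s -> exists t, T <= t /\ tle s (tg t).
Proof.
  intros [Ns H]. destruct (H (s + S (fLv (run T) s))) as [u Hu].
  destruct (schedule (2 * s + 1) (T + u)) as (t & Lt & Et).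
  assert (HLt : s + S (fLv (run T) s) <= Lev s t) by (etransitivity; [exact Hu | apply Lev_mono; lia]).
  (* Either the recorded level of [s] changes before [t], and this happens only in a touch of [s],
     or the request at [t] finds it still below the actual level. *)
  destruct (classic (exists t', T <= t' /\ t' < t /\ fLv (run (S t')) s <> fLv (run t') s)) as [(t' & L1 & L2 & Ne)|Q].
  - exists t'. split; auto. destruct (step_spec t') as (_ & _ & _ & _ & _ & _ & _ & _ & S3).
    destruct (S3 s Ne) as [-> _]. now constructor.
  - exists t. split; [lia|]. destruct (step_spec t) as (_ & _ & _ & _ & _ & _ & _ & S3 & _).
    rewrite (S3 s Et Ns); [now constructor | lia|].
    assert (C : forall t', T <= t' -> t' <= t -> fLv (run t') s = fLv (run T) s).
    { induction 1 as [|t' L IHt]; intros L'; auto. rewrite <- IHt by lia. apply NNPP. intros Ne.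
      apply Q. exists t'. split; [|split]; auto; lia. }
    rewrite C by lia. lia.
Qed.

Lemma own_mul t k s : fOwn (run t) k = s -> s <> 0 ->
  (fB (run t) s : P) = pw p (fCur (run t) k - 1) • (fE (run t) k : P) /\ fB (run t) s <> 0 /\ 2 <= fCur (run t) k.
Proof.
  intros O N. destruct (inv_rels _ _ _ _ _ _ (run_inv t)) as (_ & R2 & _).
  specialize (R2 k). rewrite O in R2. rewrite R2 by auto.
  pose proof (inv_own _ _ _ _ _ _ (run_inv t) k) as Q. rewrite O in Q. tauto.
Qed.

Lemma tru_Om s t : tru s -> Om (fB (run t) s : P).
Proof.
  intros Ts N. destruct (Nat.eq_dec (fB (run t) s) 0) as [->|B]; [apply Dv_g0|].
  destruct (len_unbounded N) as [t1 Ht1]. destruct (tru_touched s (t + t1) Ts) as (u & Lu & Tu).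
  destruct (step_spec u) as (_ & _ & S1 & _). destruct (S1 s Tu) as (K & EK & _ & LK).
  change (stage p par dig n Lev srch u (run u)) with (run (S u)) in *.
  destruct (j_kap _ _ (run_J (S u)) s K EK) as [O Ns].
  destruct (own_mul (S u) K s O Ns) as (E & _ & _).
  rewrite <- (B_stable t (S u)) by (auto; lia). rewrite E.
  assert (L : fLen (run t1) <= fLen (run u)) by (apply run_ext; lia).
  apply (Dv_le p N (fCur (run (S u)) K - 1)); [lia|]. now exists (fE (run (S u)) K : P).
Qed.

Definition fin (k : nat) : nat := proj1_sig (constructive_indefinite_description _ (final k)).

Lemma fin_spec k t : fin k <= t ->
  fCur (run t) k = nu k /\ fOwn (run t) k = fOwn (run (fin k)) k /\ fE (run t) k = fE (run (fin k)) k.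
Proof. apply (proj2_sig (constructive_indefinite_description _ (final k))). Qed.

Definition einf (k : nat) : P := fE (run (fin k)) k.

Lemma big_stage (x : P) : exists t0, forall t, t0 <= t -> (x : nat) < p ^ fLen (run t).
Proof.
  destruct (len_unbounded x) as [t0 H0]. exists t0. intros t L.
  apply (lt_ppow p (prime_ge2 p Hp)). pose proof (proj1 (run_ext t0 t L)). lia.
Qed.

Lemma fin_bound K : exists t0, forall l, l < K -> fin l <= t0.
Proof.
  induction K as [|K [t0 H0]]; [exists 0; lia|]. exists (t0 + fin K). intros l L.
  destruct (Nat.eq_dec l K) as [->|]; [lia|]. specialize (H0 l). lia.
Qed.

Lemma limit_gen (x : P) : exists K z y, (forall k, K <= k -> z k = 0%Z) /\
  x = gsum K (fun k => z k • einf k) ⊕ pZ • (y : P).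
Proof.
  destruct (big_stage x) as [t0 H0].
  pose proof (inv_gen _ _ _ _ _ _ (run_inv t0) x (H0 t0 (le_n _))) as S.
  assert (mulp : forall y : P, exists K z y', (forall k, K <= k -> z k = 0%Z) /\
     pZ • y = gsum K (fun k => z k • einf k) ⊕ pZ • (y' : P)).
  { intros y. exists 0, (fun _ => 0%Z), y. split; auto. cbn [gsum]. symmetry. apply gadd0. }
  clear H0. induction S as [|s|k|x y _ (K & z & w & Hz & ->) _ (K' & z' & w' & Hz' & ->)|x _ (K & z & w & Hz & ->)].
  - destruct (mulp g0) as (K & z & w & Hz & E). exists K, z, w. now rewrite <- E, zmul_g0.
  - destruct (Nat.eq_dec (fB (run t0) s) 0) as [->|B].
    + destruct (mulp g0) as (K & z & w & Hz & E). exists K, z, w. now rewrite <- E, zmul_g0.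
    + destruct (carrier p Hp par dig n c _ (run_Stt t0) s B) as (k & _ & O & _).
      destruct (own_mul t0 k s O) as (E & _ & C2); [apply (inv_b _ _ _ _ _ _ (run_inv t0) s B)|].
      rewrite E. replace (fCur (run t0) k - 1) with (S (fCur (run t0) k - 2)) by lia.
      rewrite pw_S, zmul_mul. apply mulp.
  - destruct (Nat.eq_dec (fCur (run t0) k) 0) as [Z|N].
    { rewrite (proj2 (Inv_unused p Hp par dig c _ k (run_inv t0) Z)).
      destruct (mulp g0) as (K & z & w & Hz & E). exists K, z, w. split; auto. rewrite <- E, zmul_g0. reflexivity. }
    pose proof (run_Tr t0 (t0 + fin k) ltac:(lia)) as T. destruct (tr_E _ _ _ _ _ T k N) as (y & _ & -> & _).
    set (a := (_ + Nat.b2n _)). destruct (fin_spec k (t0 + fin k)) as (_ & _ & ->); [lia|]. fold (einf k).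
    exists (S k), (fun l => if l =? k then pw p a else 0%Z), y. split.
    + intros l L. destruct (Nat.eqb_spec l k); auto. lia.
    + f_equal. rewrite (gsum_ext _ _ (fun l => if l =? k then pw p a • einf k else g0)).
      * rewrite gsum_single; auto.
      * intros l _. destruct (Nat.eqb_spec l k) as [->|]; auto.
  - exists (K + K'), (fun k => z k + z' k)%Z, (w ⊕ w'). split.
    + intros k L. rewrite Hz, Hz'; lia.
    + rewrite (gsum_ext _ (fun k => (z k + z' k)%Z • einf k) (fun k => z k • einf k ⊕ z' k • einf k)) by (intros; apply zmul_add).
      rewrite gsum_add. rewrite (gsum_extend K (K + K')), (gsum_extend K' (K + K')); try lia.
      * abel.
      * intros k L. now rewrite Hz'.
      * intros k L. now rewrite Hz.
  - exists K, (fun k => (-1) * z k)%Z, (⊖ w). split.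
    + intros k L. rewrite Hz; auto.
    + rewrite (gsum_ext _ (fun k => ((-1) * z k)%Z • einf k) (fun k => (-1)%Z • (z k • einf k))) by (intros; abel).
      rewrite gsum_zmul. abel.
Qed.

(** If the component is owned by [s], the element is [p] times the representative of [s], a
    combination of representatives of proper ancestors. Their components have exponents at least
    [nu k + 2], so they are divisible by [p^(nu k + 1)]. *)
Lemma limit_div k : Dv (S (nu k)) (pw p (nu k) • einf k).
Proof.
  destruct (fin_spec k (fin k) (le_n _)) as (C & _ & _). unfold einf. set (t := fin k) in *.
  destruct (inv_rels _ _ _ _ _ _ (run_inv t)) as (R1 & R2 & R3). rewrite <- C.
  destruct (Nat.eq_dec (fOwn (run t) k) 0) as [Z|N].
  - rewrite R3 by auto. apply Dv_g0.
  - set (s := fOwn (run t) k) in *.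
    destruct (own_mul t k s eq_refl N) as (E & Bs & C2).
    replace (fCur (run t) k) with (S (fCur (run t) k - 1)) at 2 by lia.
    rewrite pw_S, zmul_mul, <- E, R1 by auto.
    apply (lsum_closed par par_lt dig s (fun t' => fB (run t) t' : P) (Dv (S (fCur (run t) k)))).
    + apply Dv_g0.
    + intros. now apply Dv_add.
    + intros u Tu. apply Dv_zmul.
      assert (Bu : fB (run t) u <> 0).
      { apply (Inv_anc p Hp par dig c _ u s (run_inv t)); auto. now apply tle_par. }
      destruct (carrier p Hp par dig n c _ (run_Stt t) u Bu) as (k' & _ & O' & _).
      destruct (own_mul t k' u O') as (E' & _ & _); [now apply tle_nz in Tu|]. rewrite E'.
      assert (fCur (run t) k + 2 <= fCur (run t) k')
        by (apply (carrier_desc p Hp par dig par0 n c _ (run_Stt t) u s); auto).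
      apply (Dv_le p _ (fCur (run t) k' - 1)); [lia|]. now exists (fE (run t) k' : P).
Qed.

Theorem limit_Ubasis m : Ubasis p P m (fun k => nu k = S m) (fun k => pw p m • einf k).
Proof.
  apply (basic_Ubasis p Hp P einf nu).
  - intros x. destruct (limit_gen x) as (K & z & y & _ & E). eauto.
  - apply limit_div.
  (* At a stage that contains [y] and at which component [k] and those below [K] are final, the
     homomorphism for component [k] serves as coordinate. It is defined on the finite subgroup of
     that stage only. *)
  - intros k K y Nk.
    destruct (fin_bound K) as [t1 H1]. destruct (big_stage y) as [t2 H2].
    set (t := t1 + t2 + fin k).
    destruct (fin_spec k t) as (Ck & _ & Ek); [unfold t; lia|]. fold (einf k) in Ek.
    assert (El : forall l, l < K -> fE (run t) l = einf l).
    { intros l L. apply (fin_spec l t). specialize (H1 l L). unfold t. lia. }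
    pose proof (inv_E _ _ _ _ _ _ (run_inv t)) as HE.
    assert (H : exists v : nat -> Zq (pw p (fCur (run t) k)), Hv v (fLen (run t)) /\
       plin v (fE (run t) k) = zq_of _ 1 /\ forall l, l <> k -> exists w, plin v (fE (run t) l) = pZ • w).
    { destruct (Nat.eq_dec (fOwn (run t) k) 0) as [Z|N].
      - destruct (hom_retired p Hp par par_lt dig n c _ (run_Stt t) k Z) as (v & A & B & D & _).
        exists v. repeat split; auto. intros l Nl. exists g0. rewrite D, zmul_g0; auto.
      - destruct (hom_carrier p Hp par par_lt dig par0 n c _ (run_Stt t) k _ eq_refl N) as (v & A & B & D & _).
        exists v. auto. }
    rewrite Ck in H. destruct H as (v & A & B & D).
    exists (fun x => (x : nat) < p ^ fLen (run t)), (fun x => plin v x). repeat split.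
    + apply H2. unfold t. lia.
    + intros l L. rewrite <- El by auto. apply HE.
    + intros x x' L L'. now apply Pg_add_lt.
    + intros x L. now apply Pg_opp_lt.
    + intros x x' L L'. now apply (Hv_add p Hp c v (fLen (run t))).
    + rewrite <- Ek. exact B.
    + intros l L Nl. rewrite <- El by auto. auto.
Qed.

(** The span of the representatives of true nodes, to be identified with the first Ulm subgroup in
    [Om_BT]. *)
Inductive BT : P -> Prop :=
  | BT_0 : BT g0
  | BT_B t s : tru s -> BT (fB (run t) s)
  | BT_add x y : BT x -> BT y -> BT (x ⊕ y)
  | BT_opp x : BT x -> BT (⊖ x).

Lemma BT_zmul z x : BT x -> BT (z • x).
Proof.
  intros S. assert (N : forall k, BT (nmul k x)).
  { induction k; [apply BT_0|]. rewrite nmul_S. now apply BT_add. }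
  destruct z; [apply BT_0 | apply N | apply BT_opp, N].
Qed.

Lemma BT_Om x : BT x -> Om x.
Proof.
  induction 1.
  - apply Om_g0.
  - now apply tru_Om.
  - intros m. apply Dv_add; auto.
  - intros m. apply Dv_opp; auto.
Qed.

Lemma zq_pw_div q z a : a <= q -> (z * pw p a)%Z • (zq_of (pw p q) 1 : Zq (pw p q)) = g0 -> (pw p (q - a) | z)%Z.
Proof.
  intros L E. rewrite <- zq_of_mul in E. apply zq_of_0 in E; [|apply (pw_pos p Hp)].
  destruct E as [u Eu]. replace (pw p q) with (pw p (q - a) * pw p a)%Z in Eu by (rewrite <- pw_add; f_equal; lia).
  exists u. pose proof (pw_pos p Hp a). apply (Z.mul_reg_r _ _ (pw p a)); lia.
Qed.


Notation "x <^ t" := ((x : nat) < p ^ fLen (run t)) (at level 70).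

Lemma Hv_Om q (x : P) : Om x -> exists t0, forall t, t0 <= t -> x <^ t /\
  forall v : nat -> Zq (pw p q), Hv v (fLen (run t)) -> plin v x = g0.
Proof.
  intros O. destruct (O q) as [w E]. destruct (big_stage x) as [t1 H1]. destruct (big_stage w) as [t2 H2].
  exists (t1 + t2). intros t L. split; [apply H1; lia|]. intros v H.
  rewrite E, (Hv_zmul p Hp c v (fLen (run t))); [apply zq_kill, (pw_pos p Hp) | auto | apply H2; lia].
Qed.

(** The component in which [s] finally ends up. A true node has none, since it receives fresh
    components forever. *)
Definition fcar (s : nat) (e : P) : Prop :=
  exists t0 k, s <> 0 /\ forall t, t0 <= t -> fOwn (run t) k = s /\ fE (run t) k = e.

Inductive SpF (N : nat) : P -> Prop :=
  | SpF_0 : SpF N g0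
  | SpF_e s e : s < N -> fcar s e -> SpF N e
  | SpF_add x y : SpF N x -> SpF N y -> SpF N (x ⊕ y)
  | SpF_opp x : SpF N x -> SpF N (⊖ x).

Lemma SpF_zmul N z x : SpF N x -> SpF N (z • x).
Proof.
  intros S. assert (K : forall k, SpF N (nmul k x)).
  { induction k; [apply SpF_0|]. rewrite nmul_S. now apply SpF_add. }
  destruct z; [apply SpF_0 | apply K | apply SpF_opp, K].
Qed.

Lemma SpF_le N N' x : N <= N' -> SpF N x -> SpF N' x.
Proof. intros L. induction 1; eauto using SpF. apply (SpF_e N' s); auto. lia. Qed.

Definition BF (N : nat) (x : P) : Prop := exists b w, BT b /\ SpF N w /\ x = b ⊕ w.

Lemma BF_BT N b : BT b -> BF N b.
Proof. intros B. exists b, g0. split; [auto|]. split; [apply SpF_0|]. symmetry. apply gadd0r. Qed.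

Lemma BF_SpF N w : SpF N w -> BF N w.
Proof. intros B. exists g0, w. split; [apply BT_0|]. split; [auto|]. symmetry. apply gadd0. Qed.

Lemma BF_add N x y : BF N x -> BF N y -> BF N (x ⊕ y).
Proof.
  intros (b & w & B & W & ->) (b' & w' & B' & W' & ->). exists (b ⊕ b'), (w ⊕ w'). split; [now apply BT_add|]. split; [now apply SpF_add|]. abel.
Qed.

Lemma BF_zmul N z x : BF N x -> BF N (z • x).
Proof.
  intros (b & w & B & W & ->). exists (z • b), (z • w). split; [now apply BT_zmul|]. split; [now apply SpF_zmul|]. abel.
Qed.

Lemma BF_le N N' x : N <= N' -> BF N x -> BF N' x.
Proof. intros L (b & w & B & W & E). exists b, w. eauto using SpF_le. Qed.

Lemma fcar_own t k : fOwn (run t) k <> 0 -> (forall t', t <= t' -> fOwn (run t') k = fOwn (run t) k) ->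
  fcar (fOwn (run t) k) (einf k) /\ exists z, (fE (run t) k : P) = z • einf k.
Proof.
  intros N H. split.
  - exists (t + fin k), k. split; auto. intros t' L. split; [apply H; lia|]. apply (fin_spec k t'). lia.
  - assert (Nk : fCur (run t) k <> 0).
    { intros Z. apply N. now apply (Inv_unused p Hp par dig c _ k (run_inv t) Z). }
    destruct (tr_E _ _ _ _ _ (run_Tr t (t + fin k) ltac:(lia)) k Nk) as (y & _ & E & Zy).
    specialize (Zy (H (t + fin k) ltac:(lia))). rewrite Zy, gadd0r in E.
    destruct (fin_spec k (t + fin k)) as (_ & _ & Ek); [lia|]. fold (einf k) in Ek. rewrite Ek in E. eauto.
Qed.

Lemma B_BF t s : BF (S s) (fB (run t) s).
Proof.
  destruct (Nat.eq_dec (fB (run t) s) 0) as [->|B]; [apply BF_BT, BT_0|].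
  destruct (classic (tru s)) as [T|T]; [now apply BF_BT, BT_B|].
  destruct (junk_final s t T B) as (t0 & k & L & H0).
  destruct (inv_b _ _ _ _ _ _ (run_inv t) s B) as [Ns _].
  destruct (own_mul t0 k s (H0 t0 (le_n _)) Ns) as (E & _ & _).
  rewrite <- (B_stable t t0) by auto. rewrite E. apply BF_zmul.
  destruct (fcar_own t0 k) as [F [z ->]].
  - now rewrite H0.
  - intros t' L'. rewrite !H0; auto.
  - apply BF_zmul, BF_SpF, (SpF_e _ s); auto. now rewrite (H0 t0 (le_n _)) in F.
Qed.

Lemma fcar_late N : exists t0, forall t, t0 <= t -> forall s, s < N -> forall e, fcar s e ->
  exists k, fOwn (run t) k = s /\ fE (run t) k = e.
Proof.
  apply (eventually_all (fun s t => forall e, fcar s e -> exists k, fOwn (run t) k = s /\ fE (run t) k = e)).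
  intros s _. destruct (classic (exists e, fcar s e)) as [[e (t0 & k & Ns & H)]|Q];
    [|exists 0; intros t _ e He; destruct Q; eauto].
  exists t0. intros t L e' (t1 & k' & _ & H'). exists k. destruct (H t L) as [O E]. split; auto.
  destruct (H (t0 + t1) ltac:(lia)) as [O1 E1]. destruct (H' (t0 + t1) ltac:(lia)) as [O2 E2].
  assert (k = k').
  { pose proof (j_own _ _ (run_J (t0 + t1)) k) as A. pose proof (j_own _ _ (run_J (t0 + t1)) k') as A'.
    rewrite O1 in A. rewrite O2 in A'. specialize (A Ns). specialize (A' Ns). congruence. }
  subst k'. rewrite E. congruence.
Qed.

Lemma SpF_split N x : SpF (S N) x -> SpF N x \/ exists e, fcar N e.
Proof.
  intros S. destruct (classic (exists e, fcar N e)) as [|Q]; auto. left.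
  induction S as [|s e L F|x y _ IH _ IH'|x _ IH]; [apply SpF_0| |now apply SpF_add|now apply SpF_opp].
  apply (SpF_e N s); auto. destruct (Nat.eq_dec s N) as [->|]; [|lia]. destruct Q; eauto.
Qed.

Lemma fcar_unique s e e' : fcar s e -> fcar s e' -> e = e'.
Proof.
  intros (t0 & k & Ns & H) (t1 & k' & _ & H').
  destruct (H (t0 + t1) ltac:(lia)) as [O1 E1]. destruct (H' (t0 + t1) ltac:(lia)) as [O2 E2].
  assert (k = k').
  { pose proof (j_own _ _ (run_J (t0 + t1)) k) as A. pose proof (j_own _ _ (run_J (t0 + t1)) k') as A'.
    rewrite O1 in A. rewrite O2 in A'. specialize (A Ns). specialize (A' Ns). congruence. }
  subst k'. congruence.
Qed.

Lemma SpF_top N x e : fcar N e -> SpF (S N) x -> exists y w, SpF N w /\ x = y • e ⊕ w.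
Proof.
  intros F. induction 1 as [|s e' L F'|x x' _ (y & w & W & ->) _ (y' & w' & W' & ->)|x _ (y & w & W & ->)].
  - exists 0%Z, g0. split; [apply SpF_0 | abel].
  - destruct (Nat.eq_dec s N) as [->|].
    + rewrite (fcar_unique N e' e) by auto. exists 1%Z, g0. split; [apply SpF_0 | abel].
    + exists 0%Z, e'. split; [|abel]. apply (SpF_e N s); auto; lia.
  - exists (y + y')%Z, (w ⊕ w'). split; [now apply SpF_add | abel].
  - exists (-y)%Z, (⊖ w). split; [now apply SpF_opp | abel].
Qed.

(** Induction on the largest node involved. The coordinate of its final component [e] vanishes on
    [x], so [p^(fCur k)] divides the coefficient [y]. Then [y • e] is a multiple of [p] times the
    representative of [N], which is a combination of representatives of smaller nodes. *)
Lemma BT_of_SpF N : forall x, Om x -> SpF N x -> BT x.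
Proof.
  induction N as [|N IH]; intros x O Sx.
  { clear O. induction Sx; auto using BT. lia. }
  destruct (SpF_split N x Sx) as [|[e Fe]]; [now apply IH|].
  destruct (SpF_top N x e Fe Sx) as (y & w & W & Ex).
  pose proof Fe as (t0 & k & Ns & H0).
  destruct (Hv_Om (nu k) x O) as [t1 H1]. destruct (fcar_late (S N)) as [t2 H2].
  set (t := t0 + t1 + t2 + fin k).
  destruct (H0 t) as [Ok Ee]; [unfold t; lia|]. destruct (H1 t) as [Lx Vx]; [unfold t; lia|].
  destruct (fin_spec k t) as (Ck & _ & _); [unfold t; lia|].
  specialize (H2 t ltac:(unfold t; lia)).
  destruct (hom_carrier p Hp par par_lt dig par0 n c _ (run_Stt t) k N Ok Ns) as (v & Hv & V1 & _ & V0 & _ & _).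
  destruct (own_mul t k N Ok Ns) as (EB & BN & C2).
  pose proof (inv_E _ _ _ _ _ _ (run_inv t)) as HE.
  assert (Kw : w <^ t /\ plin v w = g0).
  { clear - W H2 V0 HE Hv par_lt Ns. induction W as [|s e' L F'|x x' _ [L IH] _ [L' IH']|x _ [L IH]].
    - split; [apply ppow_pos, prime_ge2; auto | apply plin_0].
    - destruct (H2 s ltac:(lia) e' F') as (l & Ol & El). rewrite <- El. split; [apply HE|]. apply V0.
      rewrite Ol. intros T. apply (tle_le par par_lt) in T. lia.
    - split; [now apply Pg_add_lt|]. rewrite (Hv_add p Hp c v (fLen (run t))), IH, IH' by auto. apply gadd0.
    - split; [now apply Pg_opp_lt|]. rewrite (Hv_opp p Hp c v (fLen (run t))), IH by auto. abel. }
  destruct Kw as [Lw Vw].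
  assert (Ve : plin v e = zq_of _ 1) by (rewrite <- Ee; exact V1).
  assert (Le : e <^ t) by (rewrite <- Ee; apply HE).
  assert (Z0 : plin v x = y • (zq_of (pw p (fCur (run t) k)) 1 : Zq _)).
  { rewrite Ex, (Hv_add p Hp c v (fLen (run t))), Vw, gadd0r, (Hv_zmul p Hp c v (fLen (run t))), Ve; auto.
    now apply Pg_zmul_lt. }
  assert (Dy : (pw p (fCur (run t) k) | y)%Z).
  { assert (Z1 : plin v x = g0) by (clear - Vx Ck Hv; revert v Hv; rewrite Ck; auto).
    rewrite Z1 in Z0. replace (fCur (run t) k) with (fCur (run t) k - 0) at 1 by lia.
    apply zq_pw_div; [lia|]. now rewrite pw_0, Z.mul_1_r. }
  destruct Dy as [y' Ey].
  assert (BFy : BF N (y • e)).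
  { replace (y • e) with (y' • (pZ • (fB (run t) N : P))).
    - apply BF_zmul. destruct (inv_rels _ _ _ _ _ _ (run_inv t)) as (R1 & _). rewrite R1 by auto.
      apply (lsum_closed par par_lt dig N (fun t' => fB (run t) t' : P) (BF N)).
      + apply BF_BT, BT_0.
      + intros. now apply BF_add.
      + intros u Tu. apply BF_zmul. apply (BF_le (S u)); [|apply B_BF].
        apply (tle_le par par_lt) in Tu. pose proof (par_lt N Ns). lia.
    - rewrite EB, Ey, <- !zmul_mul. replace (fCur (run t) k) with (S (fCur (run t) k - 1)) at 2 by lia.
      rewrite pw_S. rewrite Ee. f_equal. ring. }
  destruct BFy as (b & w' & Bb & W' & Eb).
  assert (Sw : BT (w' ⊕ w)).
  { apply IH; [|now apply SpF_add]. replace (w' ⊕ w) with (x ⊖ b).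
    - intros m. apply Dv_sub; auto. now apply BT_Om.
    - rewrite Ex, Eb. abel. }
  replace x with (b ⊕ (w' ⊕ w)); [now apply BT_add|]. rewrite Ex, Eb. abel.
Qed.

Inductive SB (t : nat) : P -> Prop :=
  | SB_0 : SB t g0
  | SB_B s : SB t (fB (run t) s)
  | SB_add x y : SB t x -> SB t y -> SB t (x ⊕ y)
  | SB_opp x : SB t x -> SB t (⊖ x).

Lemma SB_BF t x : SB t x -> exists N, BF N x.
Proof.
  induction 1 as [|s|x y _ [N H] _ [N' H']|x _ [N H]].
  - exists 0. apply BF_BT, BT_0.
  - exists (S s). apply B_BF.
  - exists (N + N'). apply BF_add; [apply (BF_le N) | apply (BF_le N')]; auto; lia.
  - exists N. replace (⊖ x) with ((-1)%Z • x) by abel. now apply BF_zmul.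
Qed.

Lemma Sp_split t x : Sp p Hp c (run t) x -> exists K z y, SB t y /\ (forall k, K <= k -> z k = 0%Z) /\
  x = y ⊕ gsum K (fun k => z k • (fE (run t) k : P)).
Proof.
  induction 1 as [|s|k|x x' _ (K & z & y & S & Hz & ->) _ (K' & z' & y' & S' & Hz' & ->)|x _ (K & z & y & S & Hz & ->)].
  - exists 0, (fun _ => 0%Z), g0. split; [apply SB_0|]. now split.
  - exists 0, (fun _ => 0%Z), (fB (run t) s : P). split; [apply SB_B|]. split; auto. cbn [gsum]. abel.
  - exists (S k), (fun l => if l =? k then 1%Z else 0%Z), g0. split; [apply SB_0|]. split.
    + intros l L. destruct (Nat.eqb_spec l k); auto; lia.
    + rewrite (gsum_ext _ _ (fun l => if l =? k then (fE (run t) k : P) else g0)).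
      * rewrite gsum_single; auto. symmetry. apply gadd0.
      * intros l _. destruct (Nat.eqb_spec l k) as [->|]; auto. apply zmul_1.
  - exists (K + K'), (fun k => z k + z' k)%Z, (y ⊕ y'). split; [now apply SB_add|]. split.
    + intros k L. rewrite Hz, Hz'; lia.
    + rewrite (gsum_ext _ (fun k => (z k + z' k)%Z • (fE (run t) k : P))
        (fun k => z k • (fE (run t) k : P) ⊕ z' k • (fE (run t) k : P))) by (intros; apply zmul_add).
      rewrite gsum_add. rewrite (gsum_extend K (K + K')), (gsum_extend K' (K + K')); try lia.
      * abel.
      * intros k L. now rewrite Hz'.
      * intros k L. now rewrite Hz.
  - exists K, (fun k => (-1) * z k)%Z, (⊖ y). split; [now apply SB_opp|]. split.
    + intros k L. rewrite Hz; auto.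
    + rewrite (gsum_ext _ (fun k => ((-1) * z k)%Z • (fE (run t) k : P)) (fun k => (-1)%Z • (z k • (fE (run t) k : P)))) by (intros; abel).
      rewrite gsum_zmul. abel.
Qed.

Lemma own_eventually t k : fCur (run t) k <> 0 -> fOwn (run t) k <> 0 ->
  (forall t', t <= t' -> fOwn (run t') k = fOwn (run t) k) \/ exists t1, forall t', t1 <= t' -> fOwn (run t') k = 0.
Proof.
  intros C N. destruct (classic (exists t1, t <= t1 /\ fOwn (run t1) k <> fOwn (run t) k)) as [(t1 & L & Ne)|Q].
  - right. exists t1. intros t' L'. destruct (tr_own _ _ _ _ _ (run_Tr t t1 L) k C) as [|[_ Z]]; [easy|].
    assert (C1 : fCur (run t1) k <> 0) by (pose proof (tr_cur _ _ _ _ _ (run_Tr t t1 L) k); lia).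
    destruct (tr_own _ _ _ _ _ (run_Tr t1 t' L') k C1) as [E|[N' _]]; congruence.
  - left. intros t' L. apply NNPP. intros Ne. apply Q. eauto.
Qed.

(** A component that keeps its owner forever is final. Otherwise one passes to a stage after its
    retirement, where the projection onto it kills all other terms. It also kills [x], so [z k] is
    divisible by such a power of [p] that the term is 0 or a multiple of the representative of the
    former owner. *)
Lemma term_BF t x K z y : Om x -> SB t y -> x = y ⊕ gsum K (fun k => z k • (fE (run t) k : P)) ->
  forall k, k < K -> exists N, BF N (z k • (fE (run t) k : P)).
Proof.
  intros O Sy Ex k Lk. destruct (Nat.eq_dec (fCur (run t) k) 0) as [Z|C].
  { exists 0. rewrite (proj2 (Inv_unused p Hp par dig c _ k (run_inv t) Z)), (zmul_g0 (G := P)). apply BF_BT, BT_0. }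
  destruct (inv_rels _ _ _ _ _ _ (run_inv t)) as (R1 & R2 & R3).
  assert (cases : (fOwn (run t) k <> 0 /\ forall t', t <= t' -> fOwn (run t') k = fOwn (run t) k) \/
     exists t1, forall t', t1 <= t' -> fOwn (run t') k = 0).
  { destruct (Nat.eq_dec (fOwn (run t) k) 0) as [Z|N].
    - right. exists t. intros t' L. destruct (tr_own _ _ _ _ _ (run_Tr t t' L) k C) as [|[N _]]; congruence.
    - destruct (own_eventually t k C N); auto. }
  destruct cases as [[N H]|[t1 H1]].
  { destruct (fcar_own t k N H) as [F [w ->]]. exists (S (fOwn (run t) k)).
    apply BF_zmul, BF_zmul, BF_SpF, (SpF_e _ (fOwn (run t) k)); auto. }
  destruct (Hv_Om (nu k) x O) as [t2 H2]. set (t' := t + t1 + t2 + fin k).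
  assert (Lt : t <= t') by (unfold t'; lia).
  specialize (H1 t' ltac:(unfold t'; lia)). destruct (H2 t') as [Lx Vx]; [unfold t'; lia|].
  destruct (fin_spec k t') as (Ck & _ & _); [unfold t'; lia|].
  destruct (hom_retired p Hp par par_lt dig n c _ (run_Stt t') k H1) as (v & Hv & V1 & V0 & VB).
  pose proof (run_Tr t t' Lt) as T.
  pose proof (inv_E _ _ _ _ _ _ (run_inv t')) as HE. pose proof (inv_B _ _ _ _ _ _ (run_inv t')) as HB.
  assert (grow : forall u : P, u <^ t -> u <^ t').
  { intros u L. eapply Nat.lt_le_trans; [exact L|]. apply Nat.pow_le_mono_r; [pose proof (prime_ge2 p Hp); lia|].
    apply (run_ext t t' Lt). }
  assert (VFr : forall u : P, Fr p Hp c (run t) (run t') u -> u <^ t' /\ plin v u = g0).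
  { clear - V0 HE Hv C. induction 1 as [|j Z|u u' _ [L IH] _ [L' IH']|u _ [L IH]].
    - split; [apply ppow_pos, prime_ge2; auto | apply plin_0].
    - split; [apply HE | apply V0]. congruence.
    - split; [now apply Pg_add_lt|]. rewrite (Hv_add p Hp c v (fLen (run t'))), IH, IH' by auto. apply gadd0.
    - split; [now apply Pg_opp_lt|]. rewrite (Hv_opp p Hp c v (fLen (run t'))), IH by auto. abel. }
  assert (Vy : y <^ t' /\ plin v y = g0).
  { clear - Sy VB HB Hv Lt T. induction Sy as [|s|u u' _ [L IH] _ [L' IH']|u _ [L IH]].
    - split; [apply ppow_pos, prime_ge2; auto | apply plin_0].
    - destruct (Nat.eq_dec (fB (run t) s) 0) as [->|B].
      + split; [apply ppow_pos, prime_ge2; auto | apply plin_0].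
      + rewrite <- (B_stable t t') by auto. split; [apply HB | apply VB].
    - split; [now apply Pg_add_lt|]. rewrite (Hv_add p Hp c v (fLen (run t'))), IH, IH' by auto. apply gadd0.
    - split; [now apply Pg_opp_lt|]. rewrite (Hv_opp p Hp c v (fLen (run t'))), IH by auto. abel. }
  set (a := fCur (run t') k - fCur (run t) k + Nat.b2n (negb (fOwn (run t') k =? fOwn (run t) k))).
  set (one := zq_of (pw p (fCur (run t') k)) 1 : Zq (pw p (fCur (run t') k))) in *.
  assert (VE : forall l, plin v (fE (run t) l) = if l =? k then pw p a • one else g0).
  { intros l. destruct (Nat.eq_dec (fCur (run t) l) 0) as [Z|N].
    - destruct (Nat.eqb_spec l k) as [El|]; [congruence|].
      rewrite (proj2 (Inv_unused p Hp par dig c _ l (run_inv t) Z)). apply plin_0.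
    - destruct (tr_E _ _ _ _ _ T l N) as (u & Fu & E & _). destruct (VFr u Fu) as [Lu Vu]. rewrite E.
      rewrite (Hv_add p Hp c v (fLen (run t'))), !(Hv_zmul p Hp c v (fLen (run t'))), Vu, zmul_g0, gadd0r; auto using Pg_zmul_lt.
      destruct (Nat.eqb_spec l k) as [->|Nl]; [now rewrite V1|]. rewrite V0 by auto. apply zmul_g0. }
  assert (VS : forall K', gsum K' (fun k => z k • (fE (run t) k : P)) <^ t' /\
     plin v (gsum K' (fun k => z k • (fE (run t) k : P))) = gsum K' (fun l => if l =? k then (z k * pw p a)%Z • one else g0)).
  { induction K' as [|K' [L IH]]; cbn [gsum].
    - split; [apply ppow_pos, prime_ge2; auto | apply plin_0].
    - assert (Lk' : z K' • (fE (run t) K' : P) <^ t').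
      { apply Pg_zmul_lt, grow. apply (inv_E _ _ _ _ _ _ (run_inv t)). }
      split; [now apply Pg_add_lt|]. rewrite (Hv_add p Hp c v (fLen (run t'))), IH by auto. f_equal.
      rewrite (Hv_zmul p Hp c v (fLen (run t'))), VE; auto; [|apply grow, (inv_E _ _ _ _ _ _ (run_inv t))].
      destruct (Nat.eqb_spec K' k) as [->|]; [now rewrite zmul_mul | apply zmul_g0]. }
  destruct (VS K) as [LS VS']. rewrite gsum_single in VS' by auto.
  assert (Z1 : plin v x = g0) by (clear - Vx Ck Hv; revert v Hv; rewrite Ck; auto).
  rewrite Ex, (Hv_add p Hp c v (fLen (run t'))), VS', (proj2 Vy), gadd0 in Z1 by tauto.
  pose proof (tr_cur _ _ _ _ _ T k) as Lc.
  assert (La : a <= fCur (run t') k).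
  { unfold a. destruct (Nat.eqb_spec (fOwn (run t') k) (fOwn (run t) k)); cbn [negb Nat.b2n]; lia. }
  destruct (zq_pw_div _ _ _ La Z1) as [z' Ez].
  destruct (Nat.eq_dec (fOwn (run t) k) 0) as [Z|N].
  - exists 0. replace (z k • (fE (run t) k : P)) with (@g0 P); [apply BF_BT, BT_0|].
    rewrite Ez. replace (fCur (run t') k - a) with (fCur (run t) k).
    + rewrite zmul_mul, R3 by auto. now rewrite zmul_g0.
    + unfold a. rewrite H1, Z. cbn [negb Nat.b2n Nat.eqb]. lia.
  - exists (S (fOwn (run t) k)). replace (z k • (fE (run t) k : P)) with (z' • (fB (run t) (fOwn (run t) k) : P)); [apply BF_zmul, B_BF|].
    rewrite Ez. replace (fCur (run t') k - a) with (fCur (run t) k - 1).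
    + rewrite zmul_mul, R2 by auto. reflexivity.
    + unfold a. rewrite H1. destruct (Nat.eqb_spec 0 (fOwn (run t) k)); [congruence|]. cbn [negb Nat.b2n]. lia.
Qed.

Theorem Om_BT x : Om x <-> BT x.
Proof.
  split; [|apply BT_Om]. intros O. destruct (big_stage x) as [t H]. specialize (H t (le_n _)).
  destruct (Sp_split t x (inv_gen _ _ _ _ _ _ (run_inv t) x H)) as (K & z & y & Sy & _ & Ex).
  pose proof (term_BF t x K z y O Sy Ex) as HT. destruct (SB_BF t y Sy) as [N0 H0].
  assert (HS : exists N, BF N (gsum K (fun k => z k • (fE (run t) k : P)))).
  { clear Ex. induction K as [|K IH]; [exists 0; apply BF_BT, BT_0|]. cbn [gsum].
    destruct IH as [N HN]; [auto|]. destruct (HT K) as [N' HN']; auto.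
    exists (N + N'). apply BF_add; [apply (BF_le N) | apply (BF_le N')]; auto; lia. }
  destruct HS as [N HN].
  assert (HB : BF (N0 + N) x).
  { rewrite Ex. apply BF_add; [apply (BF_le N0) | apply (BF_le N)]; auto; lia. }
  destruct HB as (b & w & Bb & W & E). rewrite E. apply BT_add; auto.
  apply (BT_of_SpF (N0 + N)); auto. replace w with (x ⊖ b) by (rewrite E; abel).
  intros m. apply Dv_sub; auto. now apply BT_Om.
Qed.


(** * The first Ulm subgroup as a digit group along the true path *)

Section Path.
Context (ok : nat -> Prop) (vv sg : nat -> nat).
Context (sg0 : sg 0 = 0) (sg_nz : forall i, sg (S i) <> 0) (sg_par : forall i, par (sg (S i)) = sg i).
Context (sg_dig : forall i e, dig (sg (S i)) (sg (S e)) = (vv i / p ^ e) mod p).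
Context (sg_tru : forall s, tru s <-> exists i, s = sg (S i) /\ forall i', i' <= i -> ok i').
Notation D x := (forall j, p ^ j <= x -> ok j).
Notation Q := (Pg p (prime_ge2 p Hp) vv).

Definition pb (i : nat) : P :=
  match excluded_middle_informative (exists t, fB (run t) (sg (S i)) <> 0) with
  | left H => fB (run (proj1_sig (constructive_indefinite_description _ H))) (sg (S i))
  | right _ => g0
  end.

Lemma pb_eq t i : fB (run t) (sg (S i)) <> 0 -> fB (run t) (sg (S i)) = pb i.
Proof.
  intros N. unfold pb. destruct (excluded_middle_informative _) as [H|H]; [|destruct H; eauto].
  destruct (constructive_indefinite_description _ H) as [u Hu]. simpl.
  destruct (Nat.le_ge_cases t u) as [L|L]; [symmetry|]; now apply B_stable.
Qed.

Lemma pb_late j : (forall i, i < j -> ok i) -> exists t0, forall t, t0 <= t -> forall i, i < j ->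
  fB (run t) (sg (S i)) <> 0 /\ fB (run t) (sg (S i)) = pb i.
Proof.
  intros H. apply (eventually_all (fun i t => fB (run t) (sg (S i)) <> 0 /\ fB (run t) (sg (S i)) = pb i)).
  intros i Li. assert (T : tru (sg (S i))) by (apply sg_tru; exists i; split; auto; intros; apply H; lia).
  destruct (tru_touched _ 0 T) as (u & _ & Tu).
  destruct (step_spec u) as (_ & _ & S1 & _). destruct (S1 _ Tu) as (K & EK & _ & _).
  change (stage p par dig n Lev srch u (run u)) with (run (S u)) in EK.
  destruct (j_kap _ _ (run_J (S u)) _ K EK) as [O Ns]. destruct (own_mul (S u) K _ O Ns) as (_ & B & _).
  exists (S u). intros t L. assert (B' : fB (run t) (sg (S i)) <> 0) by (rewrite (B_stable (S u)); auto).
  split; auto. now apply pb_eq.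
Qed.

(** The coefficients met along the branch are the base [p] digits of [vv i], so the first [k]
    ancestors contribute the part of [vv i] below [p ^ k]. *)
Lemma lin_path t i k : k <= i -> (forall e, e < i -> fB (run t) (sg (S e)) = pb e) ->
  fold_left (fun acc t' => acc ⊕ Z.of_nat (dig (sg (S i)) t') • (fB (run t) t' : P)) (ancs par (sg k)) g0 =
  lin p pb k (vv i mod p ^ k).
Proof.
  intros L HB. induction k as [|k IH]; [now rewrite sg0|].
  rewrite (ancs_S p Hp par par_lt par0), sg_par, fold_left_app, IH by (auto; lia). cbn [fold_left lin].
  rewrite HB, sg_dig by lia. pose proof (ppow_pos p (prime_ge2 p Hp) k).
  rewrite (ppow_S p (prime_ge2 p Hp) k), Nat.Div0.mod_mul_r.
  destruct (dm p (prime_ge2 p Hp) (p ^ k) (vv i mod p ^ k) ((vv i / p ^ k) mod p)) as [-> ->]; [apply Nat.mod_upper_bound; lia|].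
  reflexivity.
Qed.

Lemma pb_rel i : (forall i', i' <= i -> ok i') -> pZ • pb i = lin p pb i (vv i mod p ^ i).
Proof.
  intros H. destruct (pb_late (S i)) as [t Ht]; [intros; apply H; lia|]. specialize (Ht t (le_n _)).
  destruct (inv_rels _ _ _ _ _ _ (run_inv t)) as (R1 & _). destruct (Ht i) as [B E]; auto.
  specialize (R1 _ B). rewrite E in R1. rewrite R1. unfold lsum. rewrite sg_par. apply lin_path; auto.
  intros e L. apply Ht. lia.
Qed.

(** The coordinate of the component owned by the node [sg (S i)] is 0 on the earlier
    representatives, but on its own one it is [p^(fCur k - 1)], which is not 0 modulo
    [p^(fCur k)]. *)
Lemma pb_new i x : (forall i', i' <= i -> ok i') -> x < p ^ i -> pb i <> lin p pb i x.
Proof.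
  intros H Lx E0. destruct (pb_late (S i)) as [t Ht]; [intros; apply H; lia|]. specialize (Ht t (le_n _)).
  destruct (Ht i) as [Bj Ej]; auto. set (s := sg (S i)) in *.
  destruct (carrier p Hp par dig n c _ (run_Stt t) s Bj) as (k & _ & Ok & C2).
  destruct (hom_carrier p Hp par par_lt dig par0 n c _ (run_Stt t) k s Ok (sg_nz i)) as (v & Hv & _ & _ & _ & V0 & V1).
  pose proof (inv_B _ _ _ _ _ _ (run_inv t)) as HB.
  assert (Vx : forall e y, e <= i -> lin p pb e y <^ t /\ plin v (lin p pb e y) = g0).
  { induction e as [|e IHe]; intros y Le; cbn [lin]; [split; [apply ppow_pos, prime_ge2; auto | apply plin_0]|].
    destruct (IHe (y mod p ^ e)) as [L1 E1]; [lia|]. destruct (Ht e) as [Be Ee]; [lia|].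
    assert (Lb : pb e <^ t) by (rewrite <- Ee; apply HB).
    split; [now apply Pg_add_lt, Pg_zmul_lt|].
    rewrite (Hv_add p Hp c v (fLen (run t))), E1, gadd0, (Hv_zmul p Hp c v (fLen (run t))), <- Ee, V0, zmul_g0;
      auto using Pg_zmul_lt.
    intros T. apply (tle_le par par_lt) in T. revert T. unfold s.
    assert (mono : forall a b, a < b -> sg a < sg b).
    { intros a0 b. induction 1; [|etransitivity; [eassumption|]]; rewrite <- (sg_par) at 1; apply par_lt; auto. }
    pose proof (mono (S e) (S i) ltac:(lia)). lia. }
  destruct (Vx i x (le_n _)) as [_ E1]. rewrite <- E0, <- Ej, V1, <- (Z.mul_1_l (pw p (_ - 1))) in E1.
  apply zq_pw_div in E1; [|lia].
  replace (fCur (run t) k - (fCur (run t) k - 1)) with 1 in E1 by lia. rewrite pw_1 in E1.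
  pose proof (prime_ge2 p Hp). apply Z.divide_pos_le in E1; lia.
Qed.

Notation pf := (pf p pb).

Lemma pf_BT x : D x -> BT (pf x).
Proof.
  intros Dx. apply (D_iff p Hp) in Dx. destruct Dx as (j & L & H). rewrite (pf_lin p Hp vv pb j) by auto. clear L. revert x.
  destruct (pb_late j H) as [t Ht]. specialize (Ht t (le_n _)).
  induction j as [|j IH]; intros x; cbn [lin]; [apply BT_0|]. apply BT_add; [apply IH; intros; [apply H|apply Ht]; lia|].
  apply BT_zmul. rewrite <- (proj2 (Ht j (Nat.lt_succ_diag_r j))). apply BT_B, sg_tru. exists j. split; auto.
  intros; apply H; lia.
Qed.

Theorem path_iso : (forall x, D x -> Om (pf x)) /\ (forall x y, D x -> D y -> pf ((x : Q) ⊕ (y : Q)) = pf x ⊕ pf y) /\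
  (forall x y, D x -> D y -> pf x = pf y -> x = y) /\ forall y, Om y -> exists x, D x /\ pf x = y.
Proof.
  split; [|split; [|split]].
  - intros x Dx. now apply Om_BT, pf_BT.
  - exact (pf_add p Hp ok vv pb pb_rel).
  - exact (pf_inj p Hp ok vv pb pb_rel pb_new).
  - intros y O. apply Om_BT in O. induction O as [|t s T|x y _ (u & Du & <-) _ (w & Dw & <-)|x _ (u & Du & <-)].
    + exists 0. split; [apply (D_0 p Hp) | reflexivity].
    + apply sg_tru in T. destruct T as (i & -> & H). destruct (Nat.eq_dec (fB (run t) (sg (S i))) 0) as [Z|N].
      * exists 0. split; [apply (D_0 p Hp)|]. rewrite Z. reflexivity.
      * exists (p ^ i). split.
        -- apply (D_iff p Hp). exists (S i). split; [apply ppow_lt; auto; now apply prime_ge2|]. intros; apply H; lia.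
        -- rewrite pb_eq by auto. rewrite (pf_lin p Hp vv pb (S i)) by (apply ppow_lt; auto; now apply prime_ge2).
           apply lin_gen; auto. now apply prime_ge2.
    + exists ((u : Q) ⊕ (w : Q)). split; [now apply (D_add p Hp) | now apply (pf_add p Hp ok vv pb pb_rel)].
    + exists (⊖ (u : Q)). split; [now apply (D_opp p Hp) | now apply (pf_opp p Hp ok vv pb pb_rel)].
Qed.

End Path.
End Limit.

(** * Approximating the Ulm invariants by monotone sequences *)

Definition ev (P : nat -> Prop) : Prop := exists s0, forall s, s0 <= s -> P s.

Lemma ev_and P Q : ev P -> ev Q -> ev (fun s => P s /\ Q s).
Proof. intros [a Ha] [b Hb]. exists (a + b). intros s L. split; [apply Ha | apply Hb]; lia. Qed.

Lemma ev_mono (P Q : nat -> Prop) : (forall s, P s -> Q s) -> ev P -> ev Q.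
Proof. intros H [a Ha]. exists a. auto. Qed.

Lemma ev_ex P : ev P -> exists s, P s.
Proof. intros [a Ha]. exists a. auto. Qed.

Lemma ev_all (P : nat -> nat -> Prop) n : (forall y, y < n -> ev (P y)) -> ev (fun s => forall y, y < n -> P y s).
Proof. apply eventually_all. Qed.

Section Core.
Context (R F : nat -> nat -> nat).
Context (R_mono : forall j s s', s <= s' -> R j s <= R j s') (R_le : forall j s, R j s <= S s).
Context (F_mono : forall t s s', s <= s' -> F t s <= F t s') (F_inc : forall t s, F t s < F (S t) s).
Context (f : nat -> nat) (F_f : forall t, ev (fun s => F t s = f t)) (F_pos : forall s, 0 < F 0 s).
Context (f_R : forall t, exists j, ev (fun s => R j s = f t)).

(** In the limit exactly one index is suppressed for every value [f t], to make up for the one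
    component that follows [F t]. It suffices to try [t <= R j s] because [F t s] exceeds [t]. *)
Definition blocked (j s : nat) : bool :=
  bex (S (R j s)) (fun t => F t s =? R j s) && negb (bex j (fun i => R i s =? R j s)).

Definition phi (j s : nat) : nat := if blocked j s then 0 else R j s.

Definition born (j s : nat) : bool :=
  negb (phi j s =? 0) && ((s =? 0) || negb (phi j (pred s) =? phi j s)).

(* The first stage in [s, u] at which [phi j] differs from its value at [s]; [S u] if there is none. *)
Definition chg (j s u : nat) : nat := bmu (S u) (fun i => (s <? i) && negb (phi j i =? phi j s)).

Definition waits (t : nat) : bool :=
  let j := c1 t in let s := c2 t in negb (s =? 0) && negb (phi j (pred s) =? 0) && negb (phi j s =? phi j (pred s)).

(* The even component [2 t] follows [F t] unless [t] is awaited by an odd one.  The component [2 <j, s> + 1]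
   holds the value taken by [phi j] at [s]; when [phi j] changes, at [s'], it moves on to follow [F <j, s'>].
   The follower of [F t] has a limit that is attained by [R] anyway, and one index is [blocked] in return. *)
Definition comp (k u : nat) : nat :=
  let h := k / 2 in
  if k mod 2 =? 0 then (if waits h then 0 else F h u)
  else let j := c1 h in let s := c2 h in
    if born j s then (if chg j s u <=? u then F (cp j (chg j s u)) u else phi j s) else 0.

Lemma Rdich j : (exists m, ev (fun s => R j s = m)) \/ forall B, exists s, B < R j s.
Proof.
  destruct (classic (forall B, exists s, B < R j s)) as [|Q]; auto. left.
  apply not_all_ex_not in Q. destruct Q as [B Q].
  assert (Hb : forall s, R j s <= B) by (intros s; destruct (Nat.le_gt_cases (R j s) B); auto; destruct Q; eauto).
  clear Q. induction B as [|B IH].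
  - exists 0, 0. intros s _. specialize (Hb s). lia.
  - destruct (classic (exists s, R j s = S B)) as [[s Es]|Q].
    + exists (S B), s. intros s' L. pose proof (R_mono j s s' L). specialize (Hb s'). lia.
    + apply IH. intros s. specialize (Hb s). destruct (Nat.eq_dec (R j s) (S B)); [destruct Q; eauto | lia].
Qed.

Lemma Rdec j m : ev (fun s => R j s = m) \/ ev (fun s => R j s <> m).
Proof.
  destruct (Rdich j) as [[m' H]|H].
  - destruct (Nat.eq_dec m' m) as [->|N]; auto. right. revert H. apply ev_mono. intros s ->. auto.
  - right. destruct (H m) as [s Hs]. exists s. intros s' L. pose proof (R_mono j s s' L). lia.
Qed.

Lemma F_ge t s : S t <= F t s.
Proof. induction t; [apply F_pos|]. pose proof (F_inc t s). lia. Qed.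

Lemma f_lt t t' : t < t' -> f t < f t'.
Proof.
  intros L. destruct (ev_ex _ (ev_and _ _ (F_f t) (F_f t'))) as [s [<- <-]].
  induction L; [apply F_inc|]. pose proof (F_inc m s). lia.
Qed.

Lemma f_inj t t' : f t = f t' -> t = t'.
Proof.
  intros E. destruct (lt_eq_lt_dec t t') as [[L|]|L]; auto; apply f_lt in L; lia.
Qed.

Lemma f_ge t : S t <= f t.
Proof. destruct (ev_ex _ (F_f t)) as [s <-]. apply F_ge. Qed.

Definition least (j m : nat) : Prop := ev (fun s => R j s = m) /\ forall i, i < j -> ~ ev (fun s => R i s = m).

Lemma least_unique j j' m : least j m -> least j' m -> j = j'.
Proof.
  intros [A B] [A' B']. destruct (lt_eq_lt_dec j j') as [[L|]|L]; auto; exfalso; [eapply B' | eapply B]; eauto.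
Qed.

Lemma least_ex j m : ev (fun s => R j s = m) -> exists j', least j' m.
Proof.
  induction j as [j IH] using lt_wf_ind. intros H.
  destruct (classic (exists i, i < j /\ ev (fun s => R i s = m))) as [(i & L & E)|Q]; [now apply (IH i)|].
  exists j. split; auto. intros i L E. apply Q. eauto.
Qed.

Lemma phi_lim j m : ev (fun s => R j s = m) -> m <> 0 ->
  ((exists t, f t = m) /\ least j m /\ ev (fun s => phi j s = 0)) \/
  (~ ((exists t, f t = m) /\ least j m) /\ ev (fun s => phi j s = m)).
Proof.
  intros H Nm.
  destruct (classic ((exists t, f t = m) /\ least j m)) as [[[t Et] Le]|Q].
  - left. split; [eauto|]. split; auto. destruct Le as [_ Le].
    assert (A : ev (fun s => forall i, i < j -> R i s <> m)).
    { apply ev_all. intros i L. destruct (Rdec i m) as [E|]; auto. now apply Le in E. }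
    generalize (ev_and _ _ H (ev_and _ _ A (F_f t))). apply ev_mono. intros s (E & B & C).
    unfold phi, blocked. rewrite (proj2 (bex_spec _ _)), (proj2 (Bool.negb_true_iff _)); auto.
    + apply Bool.not_true_iff_false. rewrite bex_spec. intros (i & L & Ei).
      apply Nat.eqb_eq in Ei. apply (B i L). lia.
    + exists t. rewrite E, C, Et. split; [pose proof (f_ge t); lia | apply Nat.eqb_refl].
  - right. split; auto.
    destruct (classic (exists t, f t = m)) as [Ht|Ht].
    + assert (L : exists i, i < j /\ ev (fun s => R i s = m)).
      { apply NNPP. intros Q'. apply Q. split; auto. split; auto. intros i L E. apply Q'. eauto. }
      destruct L as (i & L & E). generalize (ev_and _ _ H E). apply ev_mono. intros s (E1 & E2).
      unfold phi, blocked. replace (bex j _) with true; [now rewrite Bool.andb_false_r|].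
      symmetry. apply bex_spec. exists i. split; auto. apply Nat.eqb_eq. lia.
    + assert (A : ev (fun s => forall t, t < S m -> F t s <> m)).
      { apply ev_all. intros t _. generalize (F_f t). apply ev_mono. intros s -> E. apply Ht. eauto. }
      generalize (ev_and _ _ H A). apply ev_mono. intros s (E1 & E2).
      unfold phi, blocked. replace (bex (S _) _) with false; [auto|].
      symmetry. apply Bool.not_true_iff_false. rewrite bex_spec, E1. intros (t & L & E).
      apply Nat.eqb_eq in E. now apply (E2 t L).
Qed.

Lemma chg_spec j s u : chg j s u <= u ->
  s < chg j s u /\ phi j (chg j s u) <> phi j s /\ forall i, s <= i < chg j s u -> phi j i = phi j s.
Proof.
  intros L. unfold chg in *. set (q := fun i => _). fold q in L.
  assert (Q : q (bmu (S u) q) = true) by (apply bmu_true; lia).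
  pose proof (bmu_least (S u) q) as Lst. set (b := bmu _ _) in *.
  unfold q in Q. apply andb_prop in Q. destruct Q as [Q1 Q2]. apply Nat.ltb_lt in Q1.
  apply Bool.negb_true_iff, Nat.eqb_neq in Q2. repeat split; auto.
  intros i [L1 L2]. destruct (Nat.eq_dec i s) as [->|N]; auto. specialize (Lst i L2). unfold q in Lst.
  destruct (Nat.ltb_spec s i); [|lia]. destruct (Nat.eqb_spec (phi j i) (phi j s)); [auto | discriminate].
Qed.

Lemma chg_eq j s s' u : s < s' <= u -> phi j s' <> phi j s -> (forall i, s <= i < s' -> phi j i = phi j s) ->
  chg j s u = s'.
Proof.
  intros [L L'] N C. assert (chg j s u <= s').
  { apply bmu_found; [lia|]. destruct (Nat.ltb_spec s s'); [|lia]. destruct (Nat.eqb_spec (phi j s') (phi j s)); easy. }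
  destruct (chg_spec j s u) as (A & B & _); [lia|].
  destruct (Nat.eq_dec (chg j s u) s'); auto. destruct B. apply C. lia.
Qed.

Lemma chg_none j s u : (forall i, s <= i <= u -> phi j i = phi j s) -> u < chg j s u.
Proof.
  intros C. destruct (Nat.le_gt_cases (chg j s u) u) as [L|]; auto.
  destruct (chg_spec j s u L) as (A & B & _). destruct B. apply C. lia.
Qed.

Definition fixd (k j : nat) : Prop :=
  exists s, k = 2 * cp j s + 1 /\ born j s = true /\ forall u, s <= u -> phi j u = phi j s.

(** A component that is not constantly 0 either keeps a value of some [phi j] forever ([fixd]) or
    ends up following some [F t]. The test [waits] arranges that each [t] has exactly one
    follower. *)
Definition foll (k t : nat) : Prop :=
  (k = 2 * t /\ waits t = false) \/
  exists j s s', k = 2 * cp j s + 1 /\ born j s = true /\ t = cp j s' /\ s < s' /\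
    phi j s' <> phi j s /\ forall i, s <= i < s' -> phi j i = phi j s.

Lemma half_even h : (2 * h) / 2 = h /\ (2 * h) mod 2 = 0.
Proof. rewrite Nat.mul_comm, Nat.div_mul, Nat.Div0.mod_mul by lia. auto. Qed.

Lemma half_odd h : (2 * h + 1) / 2 = h /\ (2 * h + 1) mod 2 = 1.
Proof.
  split.
  - symmetry. apply (Nat.div_unique _ 2 h 1); lia.
  - symmetry. apply (Nat.mod_unique _ 2 h 1); lia.
Qed.

Lemma parity k : (exists h, k = 2 * h) \/ exists h, k = 2 * h + 1.
Proof.
  pose proof (Nat.div_mod k 2 ltac:(lia)). pose proof (Nat.mod_upper_bound k 2 ltac:(lia)).
  destruct (k mod 2) as [|[|]] eqn:E; [left | right | lia]; exists (k / 2); lia.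
Qed.

Lemma comp_cases k : (forall u, comp k u = 0) \/ (exists j, fixd k j) \/ exists t, foll k t.
Proof.
  destruct (parity k) as [[h ->]|[h ->]].
  - destruct (waits h) eqn:W.
    + left. intros u. unfold comp. destruct (half_even h) as [-> ->]. simpl. now rewrite W.
    + right. right. exists h. left. auto.
  - rewrite <- (cp_c h). set (j := c1 h). set (s := c2 h). destruct (born j s) eqn:B.
    + right. destruct (classic (exists u, s <= u /\ phi j u <> phi j s)) as [(u & L & N)|Q].
      * right. assert (Lc : chg j s u <= u).
        { apply bmu_found; [lia|]. destruct (Nat.ltb_spec s u); [|assert (u = s) by lia; congruence].
          destruct (Nat.eqb_spec (phi j u) (phi j s)); easy. }
        destruct (chg_spec j s u Lc) as (A & A' & A''). exists (cp j (chg j s u)). right.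
        exists j, s, (chg j s u). auto 10.
      * left. exists j, s. repeat split; auto. intros u L. apply NNPP. intros N. apply Q. eauto.
    + left. intros u. unfold comp. destruct (half_odd (cp j s)) as [-> ->]. simpl.
      now rewrite c1_cp, c2_cp, B.
Qed.

Lemma comp_fixd k j : fixd k j -> exists s, phi j s <> 0 /\ (forall u, s <= u -> phi j u = phi j s) /\
  forall u, comp k u = phi j s.
Proof.
  intros (s & -> & B & C). exists s. repeat split; auto.
  - unfold born in B. destruct (Nat.eqb_spec (phi j s) 0); easy.
  - intros u. unfold comp. destruct (half_odd (cp j s)) as [-> ->]. simpl. rewrite c1_cp, c2_cp, B.
    assert (u < chg j s u) by (apply chg_none; intros i L; apply C; lia).
    destruct (Nat.leb_spec (chg j s u) u); [lia|auto].
Qed.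

(** The bound on [a] keeps the component nondecreasing at the handover: its old value is at most
    [S s] by [R_le], the change happens at [s' > s], and [t], being a pair with second entry [s'],
    is at least [s']. *)
Lemma comp_foll k t : foll k t -> exists a s', a <= S t /\ forall u, comp k u = if s' <=? u then F t u else a.
Proof.
  intros [[-> W]|(j & s & s' & -> & B & -> & L & N & C)].
  - exists 0, 0. split; [lia|]. intros u. unfold comp. destruct (half_even t) as [-> ->]. simpl. now rewrite W.
  - exists (phi j s), s'. split.
    + pose proof (cp_le j s'). pose proof (R_le j s). unfold phi. destruct (blocked j s); lia.
    + intros u. unfold comp. destruct (half_odd (cp j s)) as [-> ->]. simpl. rewrite c1_cp, c2_cp, B.
      destruct (Nat.leb_spec s' u) as [Lu|Lu].
      * rewrite (chg_eq j s s' u) by (auto; lia). destruct (Nat.leb_spec s' u); [auto|lia].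
      * assert (u < chg j s u) by (apply chg_none; intros i Li; apply C; lia).
        destruct (Nat.leb_spec (chg j s u) u); [lia|auto].
Qed.

Lemma comp_mono k u u' : u <= u' -> comp k u <= comp k u'.
Proof.
  intros L. destruct (comp_cases k) as [Z|[[j H]|[t H]]].
  - rewrite !Z. lia.
  - destruct (comp_fixd k j H) as (s & _ & _ & E). rewrite !E. lia.
  - destruct (comp_foll k t H) as (a & s' & La & E). rewrite !E.
    pose proof (F_mono t u u' L). pose proof (F_ge t u').
    destruct (Nat.leb_spec s' u), (Nat.leb_spec s' u'); lia.
Qed.

Lemma fixd_lim k j : fixd k j -> exists m, m <> 0 /\ ev (fun u => comp k u = m) /\ ev (fun u => phi j u = m) /\
  ev (fun u => R j u = m).
Proof.
  intros H. destruct (comp_fixd k j H) as (s & N & C & E). exists (phi j s). repeat split; auto.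
  - now exists 0.
  - exists s. auto.
  - exists s. intros u L. specialize (C u L). unfold phi at 1 in C. destruct (blocked j u); lia.
Qed.

Lemma foll_lim k t : foll k t -> ev (fun u => comp k u = f t).
Proof.
  intros H. destruct (comp_foll k t H) as (a & s' & _ & E). destruct (F_f t) as [s0 H0].
  exists (s0 + s'). intros u L. rewrite E. destruct (Nat.leb_spec s' u); [apply H0|]; lia.
Qed.

Lemma comp_lim k : exists m, ev (fun u => comp k u = m).
Proof.
  destruct (comp_cases k) as [Z|[[j H]|[t H]]].
  - exists 0, 0. auto.
  - destruct (fixd_lim k j H) as (m & _ & E & _). eauto.
  - eauto using foll_lim.
Qed.

Lemma ev_eq (g : nat -> nat) m m' : ev (fun u => g u = m) -> ev (fun u => g u = m') -> m = m'.
Proof. intros A B. destruct (ev_ex _ (ev_and _ _ A B)) as [s [<- <-]]. auto. Qed.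

Lemma born_unique j s s' : born j s = true -> born j s' = true -> s <= s' ->
  (forall i, s <= i < s' -> phi j i = phi j s) -> phi j s' = phi j s -> s = s'.
Proof.
  intros B B' L C E. destruct (Nat.eq_dec s s') as [|N]; auto. unfold born in B'.
  destruct (Nat.eqb_spec s' 0); [lia|]. rewrite (C (pred s')), E, Nat.eqb_refl in B' by lia.
  destruct (phi j s =? 0); discriminate.
Qed.

Lemma fixd_inj k k' j : fixd k j -> fixd k' j -> k = k'.
Proof.
  intros (s & -> & B & C) (s' & -> & B' & C').
  destruct (Nat.le_ge_cases s s') as [L|L].
  - rewrite (born_unique j s s'); auto. intros i Li. apply C. lia.
  - rewrite (born_unique j s' s); auto. intros i Li. apply C'. lia.
Qed.

Lemma odd_eq a b : 2 * a + 1 = 2 * b + 1 -> a = b.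
Proof. lia. Qed.

Lemma fixd_fun k j j' : fixd k j -> fixd k j' -> j = j'.
Proof.
  intros (s & E & _) (s' & E' & _). rewrite E in E'. apply odd_eq in E'. now apply cp_inj in E'.
Qed.

Lemma waits_spec j s' : waits (cp j s') = true <-> s' <> 0 /\ phi j (pred s') <> 0 /\ phi j s' <> phi j (pred s').
Proof.
  unfold waits. rewrite c1_cp, c2_cp, !Bool.andb_true_iff, !Bool.negb_true_iff, !Nat.eqb_neq. tauto.
Qed.

Lemma born_nz j s : born j s = true -> phi j s <> 0.
Proof. unfold born. destruct (Nat.eqb_spec (phi j s) 0); easy. Qed.

Lemma foll_waits j s s' : born j s = true -> s < s' -> phi j s' <> phi j s ->
  (forall i, s <= i < s' -> phi j i = phi j s) -> waits (cp j s') = true.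
Proof.
  intros B L N C. apply waits_spec. rewrite (C (pred s')) by lia. pose proof (born_nz j s B). repeat split; auto; lia.
Qed.

Lemma foll_inj k k' t : foll k t -> foll k' t -> k = k'.
Proof.
  intros [[-> W]|(j & s & s' & -> & B & Et & L & N & C)] [[-> W']|(j' & s1 & s1' & -> & B' & Et' & L' & N' & C')]; auto.
  - rewrite Et', foll_waits with (s := s1) in W; auto. discriminate.
  - rewrite Et, foll_waits with (s := s) in W'; auto. discriminate.
  - rewrite Et in Et'. apply cp_inj in Et'. destruct Et' as [<- <-].
    assert (E : phi j s = phi j s1) by (rewrite <- (C (pred s')), <- (C' (pred s')); auto; lia).
    destruct (Nat.le_ge_cases s s1) as [Ls|Ls].
    + rewrite (born_unique j s s1); auto. intros i Li. apply C. lia.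
    + rewrite (born_unique j s1 s); auto. intros i Li. apply C'. lia.
Qed.

Lemma fixd_foll k j t : fixd k j -> ~ foll k t.
Proof.
  intros (s & E & B & C) [[E' _]|(j' & s1 & s' & E' & _ & _ & L & N & _)]; [lia|].
  rewrite E in E'. apply odd_eq, cp_inj in E'. destruct E' as [<- <-]. apply N, C. lia.
Qed.

Lemma last_born j u : phi j u <> 0 -> exists s, s <= u /\ born j s = true /\ forall i, s <= i <= u -> phi j i = phi j u.
Proof.
  induction u as [|u IH]; intros N.
  - exists 0. repeat split; auto; [|intros i L; now replace i with 0 by lia].
    unfold born. destruct (Nat.eqb_spec (phi j 0) 0); easy.
  - destruct (Nat.eq_dec (phi j u) (phi j (S u))) as [E|E].
    + destruct IH as (s & L & B & C); [congruence|]. exists s. repeat split; auto.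
      intros i Li. destruct (Nat.eq_dec i (S u)) as [->|]; auto. rewrite <- E. apply C. lia.
    + exists (S u). repeat split; auto; [|intros i L; now replace i with (S u) by lia].
      unfold born. simpl. destruct (Nat.eqb_spec (phi j (S u)) 0), (Nat.eqb_spec (phi j u) (phi j (S u))); easy.
Qed.

Lemma fixd_ex j m : m <> 0 -> ev (fun u => phi j u = m) -> exists k, fixd k j.
Proof.
  intros N [u0 H]. destruct (last_born j u0) as (s & L & B & C); [rewrite H; auto|].
  exists (2 * cp j s + 1), s. repeat split; auto. intros u Lu. rewrite (C s) by lia.
  destruct (Nat.le_gt_cases u u0); [apply C; lia | rewrite !H; auto; lia].
Qed.

Lemma foll_ex t : exists k, foll k t.
Proof.
  destruct (waits t) eqn:W; [|exists (2 * t); left; auto].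
  rewrite <- (cp_c t) in W |- *. set (j := c1 t) in *. set (s' := c2 t) in *.
  apply waits_spec in W. destruct W as (Ns & N & D).
  destruct (last_born j (pred s') N) as (s & L & B & C).
  exists (2 * cp j s + 1). right. exists j, s, s'. repeat split; auto; try lia.
  - rewrite (C s) by lia. auto.
  - intros i Li. rewrite (C i), (C s); auto; lia.
Qed.

(** The bijection between the components and the indices of limit [m]: a component that stays with
    [phi j] is assigned [j], and the follower of the [F t] with [f t = m] is assigned the suppressed
    index. *)
Definition matched (m k j : nat) : Prop := fixd k j \/ (exists t, foll k t) /\ least j m.

Lemma matched_comp m k : m <> 0 -> ev (fun u => comp k u = m) -> exists j, matched m k j /\ ev (fun s => R j s = m).
Proof.
  intros N H. destruct (comp_cases k) as [Z|[[j Hj]|[t Ht]]].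
  - destruct H as [s H]. rewrite <- (H s), Z in N; auto. lia.
  - exists j. split; [now left|]. destruct (fixd_lim k j Hj) as (m' & _ & E & _ & E').
    now rewrite (ev_eq _ m m' H E).
  - assert (f t = m) by (eapply ev_eq; [apply foll_lim|]; eauto). subst m.
    destruct (f_R t) as [j0 H0]. destruct (least_ex j0 _ H0) as [j Hj]. exists j. split; [|apply Hj].
    right. eauto.
Qed.

Lemma matched_index m j : m <> 0 -> ev (fun s => R j s = m) -> exists k, matched m k j /\ ev (fun u => comp k u = m).
Proof.
  intros N H. destruct (phi_lim j m H N) as [((t & Et) & L & _)|[_ E]].
  - destruct (foll_ex t) as [k Hk]. exists k. split; [right; eauto|]. rewrite <- Et. now apply foll_lim.
  - destruct (fixd_ex j m N E) as [k Hk]. exists k. split; [now left|].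
    destruct (fixd_lim k j Hk) as (m' & _ & E1 & E2 & _). now rewrite (ev_eq _ m m' E E2).
Qed.

Lemma matched_fix_foll m k k' j t : m <> 0 -> ev (fun u => comp k u = m) -> ev (fun u => comp k' u = m) ->
  fixd k j -> foll k' t -> least j m -> False.
Proof.
  intros N H H' Hk Ht L. assert (f t = m) by (eapply ev_eq; [apply foll_lim|]; eauto).
  destruct (fixd_lim k j Hk) as (m' & N' & E1 & E2 & E3).
  destruct (phi_lim j m (proj1 L) N) as [(_ & _ & E)|[Q _]]; [|apply Q; eauto].
  rewrite (ev_eq _ _ _ E2 E) in N'. auto.
Qed.

Lemma matched_inj m k k' j : m <> 0 -> ev (fun u => comp k u = m) -> ev (fun u => comp k' u = m) ->
  matched m k j -> matched m k' j -> k = k'.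
Proof.
  intros N H H' [Hk|[[t Ht] L]] [Hk'|[[t' Ht'] L']].
  - now apply (fixd_inj k k' j).
  - destruct (matched_fix_foll m k k' j t'); auto.
  - destruct (matched_fix_foll m k' k j t); auto.
  - assert (f t = m) by (eapply ev_eq; [apply foll_lim|]; eauto).
    assert (f t' = m) by (eapply ev_eq; [apply foll_lim|]; eauto).
    assert (t = t') by (apply f_inj; congruence). subst t'. now apply (foll_inj k k' t).
Qed.

Lemma matched_fun m k j j' : matched m k j -> matched m k j' -> j = j'.
Proof.
  intros [Hk|[[t Ht] L]] [Hk'|[[t' Ht'] L']].
  - now apply (fixd_fun k).
  - now apply (fixd_foll k j t') in Hk.
  - now apply (fixd_foll k j' t) in Hk'.
  - now apply (least_unique j j' m).
Qed.

(** No change can take place at stage 0, so a number coding a pair with second entry 0 is not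
    awaited, and its even component follows [F] from the beginning. *)
Lemma comp_large N B : exists k u, B <= k /\ N <= comp k u.
Proof.
  set (t := cp (N + B) 0). exists (2 * t), 0. pose proof (cp_le (N + B) 0). split; [unfold t; lia|].
  unfold comp. destruct (half_even t) as [-> ->]. simpl.
  replace (waits t) with false; [pose proof (F_ge t 0); unfold t in *; lia|].
  unfold waits, t. now rewrite c2_cp.
Qed.

End Core.

Lemma comp_Comp (K : (nat -> nat) -> Prop) {HK : CClass K} R F : Comp2 K R -> Comp2 K F -> Comp2 K (comp R F).
Proof.
  intros HR HF.
  assert (H1 : Comp2 K (phi R F)) by (unfold phi, blocked; kc).
  assert (H2 : CompB2 K (born R F)) by (unfold born; kc).
  assert (H3 : Comp3 K (chg R F)) by (unfold chg; kc).
  assert (H4 : CompB K (waits R F)) by (unfold waits; kc).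
  unfold comp. kc.
Qed.

(** * Computability of the digit groups and of the construction *)

Section CompMem.
Context (K : (nat -> nat) -> Prop) {HK : CClass K}.

Lemma Comp_upd {X} `{Enc X} (m : X -> mem) t i v : Comp K m -> Comp K t -> Comp K i -> Comp K v ->
  Comp K (fun x => upd (m x) (t x) (i x) (v x)).
Proof.
  intros Hm Ht Hi Hv. exact (Comp_cons K _ _ (Comp_pair K _ _ (Comp_pair K _ _ Ht Hi) Hv) Hm).
Qed.

Transparent get.
Lemma Comp_get {X} `{Enc X} (m : X -> mem) t i : Comp K m -> Comp K t -> Comp K i ->
  Comp K (fun x => get (m x) (t x) (i x)).
Proof.
  intros Hm Ht Hi. unfold get. apply Comp_pred; auto.
  apply (Comp_fold K m (fun _ => 0) (fun x r q => if r =? 0 then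
    (if (fst (fst q) =? t x) && (snd (fst q) =? i x) then S (snd q) else 0) else r)%bool); kc.
Qed.
Opaque get.

End CompMem.

Ltac kc_user ::= first [simple apply Comp_upd | simple apply Comp_get].

Section PaddComp.
Context (p : nat) (Hp : 2 <= p).

(** The recursive calls of [padd] have varying arguments and are nested, which [K_rec] does not
    provide. Instead the whole addition table below [p ^ i] is computed, for one [i] after the
    other. *)
Definition pstep (c : nat -> nat) (T : mem) (i x y : nat) : nat :=
  let q := p ^ i in
  let z := get T (x mod q) (y mod q) in
  (if p <=? x / q + y / q then get T z (c i mod q) else z) + q * ((x / q + y / q) mod p).

Definition ptab (c : nat -> nat) (i : nat) : mem :=
  nat_rect (fun _ => mem) [] (fun i T => let q := p ^ S i in
    nat_rect (fun _ => mem) [] (fun k T' => upd T' (k / q) (k mod q) (pstep c T i (k / q) (k mod q))) (q * q)) i.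

Lemma ptab_fill q (g : nat -> nat -> nat) N : q <> 0 -> forall x y, y < q -> x * q + y < N ->
  get (nat_rect (fun _ => mem) [] (fun k T' => upd T' (k / q) (k mod q) (g (k / q) (k mod q))) N) x y = g x y.
Proof.
  intros Nq x y Ly. induction N as [|N IH]; intros L; [lia|]. simpl. rewrite get_upd.
  destruct (Nat.eqb_spec (N / q) x) as [Ex|Ex]; cbn [andb].
  - destruct (Nat.eqb_spec (N mod q) y) as [Ey|Ey]; [now rewrite Ex, Ey|].
    apply IH. pose proof (Nat.div_mod N q Nq). subst x. nia.
  - apply IH. assert (x * q + y <> N); [|lia]. intros <-. apply Ex.
    symmetry. apply (Nat.div_unique _ q x y); lia.
Qed.

Lemma ptab_get c i x y : x < p ^ i -> y < p ^ i -> get (ptab c i) x y = padd p c i x y.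
Proof.
  revert x y. induction i as [|i IH]; intros x y Lx Ly.
  - now rewrite get_nil.
  - cbn [ptab nat_rect]. fold (ptab c i).
    pose proof (ppow_pos p Hp i) as Pq. pose proof (ppow_pos p Hp (S i)) as Pq'.
    rewrite (ptab_fill (p ^ S i) (pstep c (ptab c i) i)) by nia. unfold pstep. cbn [padd].
    pose proof (fun z => Nat.mod_upper_bound z (p ^ i) ltac:(lia)) as Mb.
    rewrite (IH (x mod _)) by apply Mb. rewrite IH; [reflexivity | now apply padd_lt | apply Mb].
Qed.

Lemma padd_tab c j x y : padd p c j x y = match j with 0 => 0 | S i => pstep c (ptab c i) i x y end.
Proof.
  destruct j as [|i]; auto. unfold pstep. cbn [padd].
  pose proof (ppow_pos p Hp i) as Pq.
  pose proof (fun z => Nat.mod_upper_bound z (p ^ i) ltac:(lia)) as Mb.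
  rewrite (ptab_get c i (x mod _)) by apply Mb. rewrite ptab_get; [reflexivity | now apply padd_lt | apply Mb].
Qed.

Lemma Comp_padd (K : (nat -> nat) -> Prop) {HK : CClass K} {X} `{Enc X} (c : X -> nat -> nat) (j x y : X -> nat) :
  Comp2 K c -> Comp K j -> Comp K x -> Comp K y -> Comp K (fun w => padd p (c w) (j w) (x w) (y w)).
Proof.
  intros Hc Hj Hx Hy.
  apply (Comp_ext K (fun w => match j w with 0 => 0 | S i => pstep (c w) (ptab (c w) i) i (x w) (y w) end)).
  { intros w. symmetry. apply padd_tab. }
  assert (H2 : Comp K (fun q : X * nat => ptab (c (fst q)) (snd q))).
  { unfold ptab, pstep. kc. }
  unfold pstep. apply Comp_natcase; auto; [kc|].
  kc.
Qed.

End PaddComp.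

Section StageComp.
Context (K : (nat -> nat) -> Prop) {HK : CClass K}.
Context (p : nat) (Hp : 2 <= p) (par : nat -> nat) (dig n : nat -> nat -> nat) (srch : mem -> nat).
Context (H_par : Comp K par) (H_dig : Comp2 K dig) (H_n : Comp2 K n) (H_srch : Comp K srch).

Lemma Comp_rev {X Y} `{Enc X} `{Enc Y} (l : X -> list Y) : Comp K l -> Comp K (fun x => rev (l x)).
Proof.
  intros Hl. apply (Comp_ext K (fun x => fold_left (fun acc y => y :: acc) (l x) [])).
  - intros x. rewrite <- (app_nil_r (rev (l x))). generalize (@nil Y). induction (l x) as [|y u IH]; intros v; simpl; auto.
    rewrite IH, <- app_assoc. reflexivity.
  - kc.
Qed.

Lemma Comp_ancs : Comp K (ancs par).
Proof. unfold ancs. kc. Qed.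

Lemma Comp_el_add : Comp3 K (el_add p).
Proof. unfold Comp3, el_add. apply (Comp_padd p Hp); kc. Qed.

Lemma Comp_el_mul : Comp3 K (el_mul p).
Proof. pose proof Comp_el_add. unfold Comp3, el_mul. kc. Qed.

Lemma Comp_el_opp : Comp2 K (el_opp p).
Proof. pose proof Comp_el_mul. unfold Comp2, el_opp. kc. Qed.

Lemma Comp_root : Comp2 K root.
Proof. unfold Comp2, root. kc. Qed.

Lemma Comp_chain : Comp3 K (chain p).
Proof. pose proof Comp_root. unfold Comp3, chain. kc. Qed.

Lemma Comp_csum : Comp2 K (el_csum p par dig).
Proof. pose proof Comp_el_add. pose proof Comp_el_mul. pose proof Comp_ancs. unfold Comp2, el_csum. kc. Qed.

Lemma Comp_act : Comp2 K (act p par dig).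
Proof. pose proof Comp_root. pose proof Comp_csum. unfold Comp2, act. kc. Qed.

Lemma Comp_newcar : Comp K (fun q : nat * (nat * (nat * mem)) =>
  newcar p (fst q) (fst (snd q)) (fst (snd (snd q))) (snd (snd (snd q)))).
Proof. pose proof Comp_chain. unfold newcar. kc. Qed.

Lemma Comp_retire : Comp3 K (retire p).
Proof.
  pose proof Comp_root. pose proof Comp_el_add. pose proof Comp_el_mul. pose proof Comp_el_opp. unfold Comp3, retire. kc.
Qed.

Lemma Comp_raise : Comp2 K (raise p).
Proof. pose proof Comp_root. unfold Comp2, raise. kc. Qed.

Lemma Comp_newret : Comp3 K (newret p).
Proof. pose proof Comp_chain. unfold Comp3, newret. kc. Qed.

Lemma Comp_refresh : Comp2 K (refresh p n srch).
Proof.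
  pose proof Comp_retire as Hr.
  pose (nc := fun (m : mem) (s : nat) => newcar p s (c1 (srch m)) (n (c1 (srch m)) (c2 (srch m))) m).
  assert (Hn : Comp2 K nc).
  { unfold Comp2, nc.
    apply (Comp_app K _ (fun q : mem * nat => (snd q, (c1 (srch (fst q)), (n (c1 (srch (fst q))) (c2 (srch (fst q))), fst q)))) Comp_newcar).
    kc. }
  unfold Comp2, refresh.
  apply (Comp_ext K (fun q : mem * nat => if fKap (fst q) (snd q) =? 0 then nc (fst q) (snd q)
     else retire p (pred (fKap (fst q) (snd q))) (c1 (srch (fst q))) (nc (fst q) (snd q)))); [reflexivity|].
  kc.
Qed.

Lemma Comp_touch : Comp2 K (touch p par dig n srch).
Proof.
  pose proof Comp_refresh as H1. pose proof Comp_act. pose proof Comp_ancs as H3.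
  assert (H2 : Comp2 K (act' p par dig)) by (unfold Comp2, act'; kc).
  pose proof (fun l => Comp_rev (X := nat * mem) (Y := nat) l) as H4.
  unfold Comp2, touch.
  apply (Comp_fold K (fun q : nat * mem => rev (ancs par (fst q))) (fun q => fold_left (act' p par dig) (ancs par (fst q)) (snd q))
    (fun _ => refresh p n srch)).
  - apply H4. kc.
  - apply (Comp_fold K (fun q : nat * mem => ancs par (fst q)) (fun q => snd q) (fun _ => act' p par dig)); kc.
  - kc.
Qed.

Lemma Comp_stage {X} `{Enc X} (Lev : X -> nat -> nat -> nat) : Comp3 K Lev ->
  Comp3 K (fun x => stage p par dig n (Lev x) srch).
Proof.
  intros HL. pose proof Comp_touch. pose proof Comp_raise. pose proof Comp_newret.
  unfold Comp3, stage. kc.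
Qed.

Lemma Comp_run {X} `{Enc X} (Lev : X -> nat -> nat -> nat) : Comp3 K Lev ->
  Comp2 K (fun x t => nat_rect (fun _ => mem) [] (stage p par dig n (Lev x) srch) t).
Proof.
  intros HL. pose proof (Comp_stage Lev HL) as HS. unfold Comp2. apply Comp_rec; auto; [kc|kc|].
  apply (Comp_app3 K (fun x => stage p par dig n (Lev x) srch)); auto; kc.
Qed.

End StageComp.

(** * Heights and the socle of a digit group, approximated from below *)

Definition bmax (N : nat) (f : nat -> nat) : nat := nat_rect (fun _ => nat) 0 (fun i r => Nat.max r (f i)) N.

Lemma bmax_ge N f i : i < N -> f i <= bmax N f.
Proof.
  induction N; [lia|]. intros L. simpl. destruct (Nat.eq_dec i N) as [->|]; [lia|].
  specialize (IHN ltac:(lia)). lia.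
Qed.

Lemma bmax_ex N f : bmax N f = 0 \/ exists i, i < N /\ f i = bmax N f.
Proof.
  induction N; auto. simpl. destruct (Nat.max_spec (bmax N f) (f N)) as [[_ ->]|[_ ->]]; [right; eauto|].
  destruct IHN as [|(i & L & E)]; [left; auto|]. right. exists i. split; auto.
Qed.

Section Heights.
Context (p : nat) (Hp : prime (Z.of_nat p)) (a : nat -> nat).
Notation P := (Pg p (prime_ge2 p Hp) a).
Notation pZ := (Z.of_nat p).
Notation Dv := (Dv p). Notation Om := (Om p).
Notation "x <^ j" := ((x : nat) < p ^ j) (at level 70).

Definition ad (x y : nat) : nat := padd p a (x + y) x y.
Definition ml (x : nat) : nat := iterate p (ad x) 0.
Definition mw (m x : nat) : nat := iterate m ml x.

Lemma ml_eq (x : P) : ml x = pZ • x.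
Proof.
  rewrite zmul_nat. unfold ml. assert (H : forall q, iterate q (ad x) 0 = nmul q x); [|apply H].
  induction q as [|q IH]; [reflexivity|]. rewrite iterate_S, nmul_S, IH. reflexivity.
Qed.

Lemma mw_eq m (x : P) : mw m x = pw p m • x.
Proof.
  unfold mw. induction m as [|m IH]; [rewrite pw_0, zmul_1; auto|].
  rewrite iterate_S, pw_S, zmul_mul, <- IH. apply ml_eq.
Qed.

(** The largest [m <= s] for which [x] is [p^m] times some [y <= s], and 0 if there is none: a
    nondecreasing approximation of the height. The search index is [s - m], so large [m] come
    first. *)
Definition ht (s x : nat) : nat :=
  s - bmu (S s) (fun i => bex (S s) (fun y => mw (s - i) y =? x)).

Lemma ht_le s x : ht s x <= s.
Proof. unfold ht. lia. Qed.

Lemma ht_ge s (x : P) m (y : nat) : m <= s -> y <= s -> x = pw p m • (y : P) -> m <= ht s x.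
Proof.
  intros L Ly E. unfold ht. set (q := fun i => _).
  assert (bmu (S s) q <= s - m); [|lia]. apply bmu_found; [lia|]. unfold q. apply bex_spec.
  exists y. split; [lia|]. replace (s - (s - m)) with m by lia. apply Nat.eqb_eq. rewrite mw_eq. auto.
Qed.

Lemma ht_wit s (x : P) : ht s x = 0 \/ exists y : nat, y <= s /\ x = pw p (ht s x) • (y : P).
Proof.
  unfold ht. set (q := fun i => _). destruct (Nat.lt_ge_cases (bmu (S s) q) (S s)) as [L|L]; [|left; lia].
  right. pose proof (bmu_true _ _ L) as T. set (b := bmu _ _) in *. unfold q in T. apply bex_spec in T.
  destruct T as (y & Ly & E). apply Nat.eqb_eq in E. exists y. split; [lia|]. now rewrite <- mw_eq.
Qed.

Lemma ht_Dv s (x : P) : Dv (ht s x) x.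
Proof. destruct (ht_wit s x) as [->|(y & _ & E)]; [apply Dv_0 | now exists (y : P)]. Qed.

Lemma ht_mono s s' (x : P) : s <= s' -> ht s x <= ht s' x.
Proof.
  intros L. destruct (ht_wit s x) as [->|(y & Ly & E)]; [lia|].
  apply (ht_ge s' x _ y); auto; [pose proof (ht_le s x); lia | lia].
Qed.

Lemma ht_ev m (x : P) : Dv m x -> ev (fun s => m <= ht s x).
Proof.
  intros [y E]. exists (m + y). intros s L. apply (ht_ge s x m y); auto; lia.
Qed.

Definition soc (j x : nat) : bool := (p ^ j <=? x) && (x <? p ^ S j) && (ml x =? 0).

Lemma soc_spec j (x : P) : soc j x = true <-> ~ x <^ j /\ x <^ S j /\ pZ • x = g0.
Proof.
  unfold soc. rewrite !Bool.andb_true_iff, Nat.leb_le, Nat.ltb_lt, Nat.eqb_eq, ml_eq. simpl (g0 : P). lia.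
Qed.

(** One more than the greatest height seen in the socle at leading position [j]. Filtered by leading
    position the socle has quotients of dimension at most 1, and the positions whose greatest height
    is [m] are as many as the [m]-th invariant. If an element of infinite height occurs, the
    sequence is unbounded. *)
Definition Rj (j s : nat) : nat := bmax (p ^ S j) (fun x => if soc j x then S (ht s x) else 0).

Lemma Rj_ge j s (x : P) : soc j x = true -> S (ht s x) <= Rj j s.
Proof.
  intros H. pose proof (proj1 (soc_spec j x) H) as (_ & L & _).
  pose proof (bmax_ge (p ^ S j) (fun x => if soc j x then S (ht s x) else 0) x L) as B.
  cbn beta in B. rewrite H in B. exact B.
Qed.

Lemma Rj_ex j s : Rj j s = 0 \/ exists x : P, soc j x = true /\ Rj j s = S (ht s x).
Proof.
  unfold Rj. destruct (bmax_ex (p ^ S j) (fun x => if soc j x then S (ht s x) else 0)) as [|(x & L & E)]; auto.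
  rewrite <- E. destruct (soc j x) eqn:S; auto. right. eauto.
Qed.

Lemma Rj_mono j s s' : s <= s' -> Rj j s <= Rj j s'.
Proof.
  intros L. destruct (Rj_ex j s) as [->|(x & S & ->)]; [lia|].
  etransitivity; [|apply (Rj_ge j s' x S)]. pose proof (ht_mono s s' x L). lia.
Qed.

Lemma Rj_le j s : Rj j s <= S s.
Proof. destruct (Rj_ex j s) as [->|(x & S & ->)]; [lia|]. pose proof (ht_le s x). lia. Qed.

Lemma Rj_lim j m : ev (fun s => Rj j s = S m) <->
  (exists x : P, soc j x = true /\ Dv m x) /\ forall x : P, soc j x = true -> ~ Dv (S m) x.
Proof.
  split.
  - intros H. split.
    + destruct (ev_ex _ H) as [s E]. destruct (Rj_ex j s) as [|(x & S & E')]; [lia|].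
      exists x. split; auto. replace m with (ht s x) by lia. apply ht_Dv.
    + intros x S D. destruct (ev_ex _ (ev_and _ _ H (ht_ev _ _ D))) as [s [E L]].
      pose proof (Rj_ge j s x S). lia.
  - intros [(x & S & D) N]. generalize (ht_ev _ _ D). apply ev_mono. intros s L.
    pose proof (Rj_ge j s x S). destruct (Rj_ex j s) as [|(x' & S' & E)]; [lia|].
    destruct (Nat.le_gt_cases (ht s x') m) as [L'|L']; [lia|].
    destruct (N x' S'). apply (Dv_le p _ _ _ L'). apply ht_Dv.
Qed.

Lemma lead_sub j (x y : P) : x <^ S j -> y <^ S j -> ~ y <^ j -> exists z, x ⊖ z • y <^ j.
Proof.
  intros Lx Ly Ny.
  destruct (split_digit p (prime_ge2 p Hp) j x Lx) as (x' & d & -> & Lx' & Ld).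
  destruct (split_digit p (prime_ge2 p Hp) j y Ly) as (y' & b & -> & Ly' & Lb).
  assert (Nb : ~ (pZ | Z.of_nat b)%Z).
  { intros D. destruct (Nat.eq_dec b 0) as [->|]; [apply Ny; lia|]. apply Z.divide_pos_le in D; lia. }
  destruct (coprime_inv p Hp _ Nb) as (k & u & E). exists (Z.of_nat d * k)%Z.
  rewrite <- !(Pg_digit p (prime_ge2 p Hp) a) by auto.
  set (g := gen p (prime_ge2 p Hp) a j).
  assert (E2 : ((x' : P) ⊕ Z.of_nat d • g) ⊖ (Z.of_nat d * k)%Z • ((y' : P) ⊕ Z.of_nat b • g) =
    (x' : P) ⊖ (Z.of_nat d * k)%Z • (y' : P) ⊖ (Z.of_nat d * u)%Z • (pZ • g)).
  { rewrite zmulD, <- !zmul_mul. replace (Z.of_nat d * k * Z.of_nat b)%Z with (Z.of_nat d + Z.of_nat d * u * pZ)%Z by nia. abel. }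
  rewrite E2. assert (Lg : pZ • g <^ j).
  { unfold g. rewrite Pg_pgen. apply Nat.mod_upper_bound. pose proof (ppow_pos p (prime_ge2 p Hp) j). lia. }
  apply Pg_add_lt; [apply Pg_add_lt; auto|]; apply Pg_opp_lt, Pg_zmul_lt; auto.
Qed.

Definition Jm (m j : nat) : Prop := ev (fun s => Rj j s = S m).

Definition vm (m j : nat) : P :=
  match excluded_middle_informative (exists x : P, soc j x = true /\ Dv m x) with
  | left H => proj1_sig (constructive_indefinite_description _ H)
  | right _ => g0
  end.

Lemma vm_spec m j : Jm m j -> soc j (vm m j) = true /\ Dv m (vm m j).
Proof.
  intros H. apply Rj_lim in H. destruct H as [H _]. unfold vm.
  destruct (excluded_middle_informative _) as [E|E]; [|easy].
  apply (proj2_sig (constructive_indefinite_description _ E)).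
Qed.

Lemma socle_span m j : forall x : P, x <^ j -> pZ • x = g0 -> Dv m x ->
  exists K z, (forall k, Jm m k \/ z k = 0%Z) /\ (forall k, K <= k -> z k = 0%Z) /\
    Dv (S m) (x ⊖ gsum K (fun k => z k • vm m k)).
Proof.
  induction j as [|j IH]; intros x L Px D.
  - exists 0, (fun _ => 0%Z). repeat split; auto. cbn [gsum]. simpl in L.
    replace x with (@g0 P) by (simpl; lia). replace (g0 ⊖ g0) with (@g0 P) by abel. apply Dv_g0.
  - destruct (classic (x <^ j)) as [L'|L']; [now apply IH|].
    assert (Sx : soc j x = true) by now apply soc_spec.
    destruct (classic (exists y : P, soc j y = true /\ Dv (S m) y)) as [(y & Sy & Dy)|Q].
    + destruct (proj1 (soc_spec j y) Sy) as (Ny & Ly & Py). destruct (lead_sub j x y L Ly Ny) as [z Lz].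
      destruct (IH (x ⊖ z • y)) as (K & zz & A & B & E); auto.
      * replace (pZ • (x ⊖ z • y)) with (pZ • x ⊖ z • (pZ • y)) by abel. rewrite Px, Py. abel.
      * apply Dv_sub; auto. apply Dv_zmul. apply (Dv_le p m (S m)); auto.
      * exists K, zz. repeat split; auto.
        replace (x ⊖ gsum K (fun k => zz k • vm m k)) with
          (x ⊖ z • y ⊖ gsum K (fun k => zz k • vm m k) ⊕ z • y) by abel.
        apply Dv_add; auto. now apply Dv_zmul.
    + assert (HJ : Jm m j).
      { apply Rj_lim. split; [eauto|]. intros y Sy Dy. apply Q. eauto. }
      destruct (vm_spec m j HJ) as [Sy Dy]. set (y := vm m j) in *.
      destruct (proj1 (soc_spec j y) Sy) as (Ny & Ly & Py). destruct (lead_sub j x y L Ly Ny) as [z Lz].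
      destruct (IH (x ⊖ z • y)) as (K & zz & A & B & E); auto.
      * replace (pZ • (x ⊖ z • y)) with (pZ • x ⊖ z • (pZ • y)) by abel. rewrite Px, Py. abel.
      * apply Dv_sub; auto. now apply Dv_zmul.
      * exists (K + S j), (fun k => zz k + if Nat.eqb k j then z else 0)%Z. split; [|split].
        -- intros k. destruct (Nat.eqb_spec k j) as [->|]; auto. destruct (A k) as [|Zk]; auto. right. lia.
        -- intros k Lk. rewrite B by lia. destruct (Nat.eqb_spec k j); lia.
        -- rewrite (gsum_ext _ _ (fun k => zz k • vm m k ⊕ (if k =? j then z • y else g0))).
           ++ rewrite gsum_add, gsum_single by lia. rewrite (gsum_extend K (K + _)); [|lia|intros k Lk; now rewrite B].
              replace (x ⊖ (gsum K (fun k => zz k • vm m k) ⊕ z • y)) with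
                (x ⊖ z • y ⊖ gsum K (fun k => zz k • vm m k)) by abel. auto.
           ++ intros k _. rewrite zmul_add. destruct (Nat.eqb_spec k j) as [->|]; auto.
Qed.

Lemma gsum_vm_lt m K z : (forall k, Jm m k \/ z k = 0%Z) ->
  gsum K (fun k => z k • vm m k) <^ K /\ pZ • gsum K (fun k => z k • vm m k) = g0.
Proof.
  intros A. induction K as [|K [L E]]; cbn [gsum]; [split; [apply ppow_pos, prime_ge2; auto | apply zmul_g0]|].
  assert (B : z K • vm m K <^ S K /\ pZ • (z K • vm m K) = g0).
  { destruct (A K) as [HJ|Z0].
    - destruct (proj1 (soc_spec K _) (proj1 (vm_spec m K HJ))) as (_ & Lv & Pv). split; [now apply Pg_zmul_lt|].
      replace (pZ • (z K • vm m K)) with (z K • (pZ • vm m K)) by abel. rewrite Pv. apply zmul_g0.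
    - rewrite Z0. split; [apply ppow_pos, prime_ge2; auto | apply zmul_g0]. }
  split; [|rewrite zmulD, E, (proj2 B); apply gadd0]. apply Pg_add_lt; [|apply B].
  eapply Nat.lt_trans; [exact L|]. apply ppow_lt; [now apply prime_ge2 | lia].
Qed.

(** If [p • x] is [p^(m+2) • w], then [x] differs from a socle element by [p^(m+1) • w], so the
    spanning of the socle suffices. A combination whose last coefficient is prime to [p] is a socle
    element with leading position [K], where heights above [m] do not occur; this gives
    independence. *)
Theorem Pg_Ubasis m : Ubasis p P m (Jm m) (vm m).
Proof.
  constructor.
  - intros k HJ. destruct (vm_spec m k HJ) as [S D]. split; auto.
    apply soc_spec in S. destruct S as (_ & _ & ->). apply Dv_g0.
  - intros x [D [w Ew]].
    destruct (socle_span m (x ⊖ pw p (S m) • w) (x ⊖ pw p (S m) • w)) as (K & z & A & B & E).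
    + apply lt_ppow; [now apply prime_ge2 | lia].
    + rewrite zmulD, zmulN, <- zmul_mul, <- pw_S, Ew. abel.
    + apply Dv_sub; auto. apply (Dv_le p m (S m)); auto. now exists w.
    + exists K, z. repeat split; auto.
      replace (x ⊖ gsum K (fun k => z k • vm m k)) with
        (x ⊖ pw p (S m) • w ⊖ gsum K (fun k => z k • vm m k) ⊕ pw p (S m) • w) by abel.
      apply Dv_add; auto. now exists w.
  - intros K z A. induction K as [|K IH]; intros D k L; [lia|]. cbn [gsum] in D.
    destruct (classic (pZ | z K)%Z) as [[u Eu]|N].
    + destruct (Nat.eq_dec k K) as [->|]; [now exists u|]. apply IH; [|lia].
      replace (z K • vm m K) with (@g0 P) in D; [now rewrite gadd0r in D|].
      destruct (A K) as [HJ|Z0]; [|now rewrite Z0].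
      destruct (proj1 (soc_spec K _) (proj1 (vm_spec m K HJ))) as (_ & _ & Pv).
      rewrite Eu, zmul_mul, Pv. symmetry. apply zmul_g0.
    + exfalso. destruct (A K) as [HJ|Z0]; [|apply N; rewrite Z0; apply Z.divide_0_r].
      pose proof (vm_spec m K HJ) as [Sv _]. destruct (proj1 (soc_spec K _) Sv) as (Nv & Lv & Pv).
      destruct (gsum_vm_lt m K z A) as [Ls Ps]. apply Rj_lim in HJ. destruct HJ as [_ HJ].
      refine (HJ _ _ D). apply soc_spec. split; [|split].
      * intros Lt. apply Nv. destruct (coprime_inv p Hp _ N) as (k' & u & E).
        replace (vm m K) with (k' • (z K • vm m K)).
        { apply Pg_zmul_lt. replace (z K • vm m K) with
            (⊖ gsum K (fun k => z k • vm m k) ⊕ (gsum K (fun k => z k • vm m k) ⊕ z K • vm m K)) by abel.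
          apply Pg_add_lt; auto. now apply Pg_opp_lt. }
        rewrite <- zmul_mul, E, zmul_add, zmul_mul, Pv, zmul_g0. abel.
      * apply Pg_add_lt; [|now apply Pg_zmul_lt]. eapply Nat.lt_trans; [exact Ls|]. apply ppow_lt; [now apply prime_ge2 | lia].
      * rewrite zmulD, Ps. replace (pZ • (z K • vm m K)) with (z K • (pZ • vm m K)) by abel. rewrite Pv, zmul_g0. apply gadd0.
Qed.

(** * Arbitrarily large heights with nonzero invariants *)

Section Target.
Context (x0 : P) (x0_Om : Om x0) (x0_not : ~ exists y, Om y /\ pZ • y = x0).
Context (zs : nat -> P) (zs_Dv : forall N, Dv N (zs N)) (zs_p : forall N, pZ • zs N = x0).

Definition hz (N s : nat) : nat := Nat.max N (ht s (zs N)).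

(** The minimum of [hz N' s] over all [N' >= N]; since [hz N' s >= N'], a value [v] can only be
    reached by [N' <= v]. Taking the minimum over a tail makes it nondecreasing in [N] as well as in
    [s], which the iteration in [Gt] relies on. *)
Definition Hm (N s : nat) : nat := bmu (hz N s) (fun v => bex (S v) (fun N' => (N <=? N') && (hz N' s <=? v))).

Definition Gt (t s : nat) : nat := nat_rect (fun _ => nat) (Hm 0 s) (fun _ g => Hm (S g) s) t.

Lemma hz_mono N s s' : s <= s' -> hz N s <= hz N s'.
Proof. intros L. unfold hz. pose proof (ht_mono s s' (zs N) L). lia. Qed.

Lemma hz_Dv N s : Dv (hz N s) (zs N).
Proof.
  unfold hz. destruct (Nat.max_spec N (ht s (zs N))) as [[_ ->]|[_ ->]]; [apply ht_Dv | apply zs_Dv].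
Qed.

Lemma Hm_low N N' s : N <= N' -> Hm N s <= hz N' s.
Proof.
  intros L. destruct (Nat.le_gt_cases (Hm N s) (hz N' s)) as [|G]; auto.
  apply bmu_least in G. apply Bool.not_true_iff_false in G. destruct G. apply bex_spec. exists N'.
  split; [unfold hz; lia|]. destruct (Nat.leb_spec N N'); [|lia]. simpl. apply Nat.leb_le. auto.
Qed.

Lemma Hm_ex N s : exists N', N <= N' /\ N' <= hz N s /\ hz N' s = Hm N s.
Proof.
  pose proof (bmu_le (hz N s) (fun v => bex (S v) (fun N' => (N <=? N') && (hz N' s <=? v)))) as B.
  fold (Hm N s) in B. destruct (Nat.eq_dec (Hm N s) (hz N s)) as [E|E].
  - exists N. repeat split; auto. unfold hz. lia.
  - assert (L : Hm N s < hz N s) by lia. apply bmu_true in L. fold (Hm N s) in L. apply bex_spec in L.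
    destruct L as (N' & L & T). apply andb_prop in T. destruct T as [T1 T2].
    apply Nat.leb_le in T1, T2. exists N'. pose proof (Hm_low N N' s T1). repeat split; auto; lia.
Qed.

Lemma Hm_mono N N1 s s1 : N <= N1 -> s <= s1 -> Hm N s <= Hm N1 s1.
Proof.
  intros L Ls. destruct (Hm_ex N1 s1) as (N' & L' & _ & <-).
  etransitivity; [apply (Hm_low N N'); lia | now apply hz_mono].
Qed.

Lemma Hm_ge N s : N <= Hm N s.
Proof. destruct (Hm_ex N s) as (N' & L & _ & <-). unfold hz. lia. Qed.

Lemma zs_bound N : exists B, forall s, hz N s <= B.
Proof.
  assert (Q : ~ Om (zs N)) by (intros O; apply x0_not; eauto).
  apply not_all_ex_not in Q. destruct Q as [B Q]. exists B. intros s.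
  destruct (Nat.le_gt_cases (hz N s) B) as [|G]; auto. destruct Q. apply (Dv_le p B (hz N s)); [lia|]. apply hz_Dv.
Qed.

Lemma mono_lim (g : nat -> nat) B : (forall s s', s <= s' -> g s <= g s') -> (forall s, g s <= B) ->
  exists m, ev (fun s => g s = m).
Proof.
  intros Hm. induction B as [|B IH]; intros Hb.
  - exists 0, 0. intros s _. specialize (Hb s). lia.
  - destruct (classic (exists s, g s = S B)) as [[s Es]|Q].
    + exists (S B), s. intros s' L. pose proof (Hm s s' L). specialize (Hb s'). lia.
    + apply IH. intros s. specialize (Hb s). destruct (Nat.eq_dec (g s) (S B)); [destruct Q; eauto | lia].
Qed.

(** The limit is finite because a [zs N] of infinite height would put [x0] into [p] times [Om]. It
    is the exact height [m] of some [zs N1]; subtracting [zs (S m)] leaves a socle element of exact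
    height [m], so the [m]-th invariant is not 0. *)
Lemma Hm_lim N : exists m, ev (fun s => Hm N s = m) /\ exists j, ev (fun s => Rj j s = S m).
Proof.
  destruct (zs_bound N) as [B HB].
  destruct (mono_lim (fun s => Hm N s) B) as [m Hlim].
  { intros. now apply Hm_mono. }
  { intros s. etransitivity; [apply (Hm_low N N s (le_n _)) | apply HB]. }
  exists m. split; auto.
  (* The minimum is attained at some [N1 <= B]. At a stage where all heights above [m] among these
     finitely many elements have shown up, a minimum of [m] is a true height. *)
  assert (A : exists N1, Dv m (zs N1) /\ ~ Dv (S m) (zs N1)).
  { assert (Hs : ev (fun s => forall N1, N1 < S B -> Dv (S m) (zs N1) -> S m <= hz N1 s)).
    { apply ev_all. intros N1 _. destruct (classic (Dv (S m) (zs N1))) as [D|D]; [|exists 0; tauto].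
      generalize (ht_ev _ _ D). apply ev_mono. intros s L _. unfold hz. lia. }
    destruct (ev_ex _ (ev_and _ _ Hlim Hs)) as [s [E Q]]. destruct (Hm_ex N s) as (N1 & L1 & L2 & E').
    exists N1. specialize (HB s). split.
    - rewrite <- E, <- E'. apply hz_Dv.
    - intros D. specialize (Q N1 ltac:(lia) D). lia. }
  destruct A as (N1 & D & ND). set (x := zs N1 ⊖ zs (S m)).
  assert (Dx : Dv m x) by (apply Dv_sub; auto; apply (Dv_le p m (S m)); auto).
  destruct (socle_span m x x) as (K & z & A & B' & E); auto.
  - apply lt_ppow; [now apply prime_ge2 | lia].
  - unfold x. rewrite zmulD, zmulN, !zs_p. abel.
  - apply NNPP. intros Q. apply ND. replace (zs N1) with (x ⊖ gsum K (fun k => z k • vm m k) ⊕ zs (S m)).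
    + apply Dv_add; auto.
    + rewrite gsum_0; [unfold x; abel|]. intros k _. destruct (A k) as [HJ| ->]; auto. destruct Q. now exists k.
Qed.

Lemma Gt_lim t : exists m, ev (fun s => Gt t s = m) /\ exists j, ev (fun s => Rj j s = S m).
Proof.
  induction t as [|t (g & Hg & _)]; [apply Hm_lim|].
  destruct (Hm_lim (S g)) as (m & H & J). exists m. split; auto.
  generalize (ev_and _ _ Hg H). apply ev_mono. intros s [E <-]. simpl. now rewrite E.
Qed.

Lemma Gt_mono t s s' : s <= s' -> Gt t s <= Gt t s'.
Proof. intros L. induction t as [|t IH]; simpl; apply Hm_mono; lia. Qed.

Lemma Gt_inc t s : Gt t s < Gt (S t) s.
Proof. simpl. pose proof (Hm_ge (S (Gt t s)) s). unfold Gt in *. lia. Qed.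

End Target.
End Heights.

Lemma inj_of_rel (I J : nat -> Prop) (Q : nat -> nat -> Prop) :
  (forall k, I k -> exists j, J j /\ Q k j) -> (forall k k' j, I k -> I k' -> Q k j -> Q k' j -> k = k') ->
  exists g, (forall k, I k -> J (g k)) /\ forall k k', I k -> I k' -> g k = g k' -> k = k'.
Proof.
  intros H U. assert (C : forall k, exists j, I k -> J j /\ Q k j).
  { intros k. destruct (classic (I k)) as [Ik|N]; [|exists 0; tauto]. destruct (H k Ik) as [j Hj]. eauto. }
  destruct (fun_choice _ C) as [g G].
  exists g. split; [intros k Ik; now apply G|]. intros k k' Ik Ik' E. apply (U k k' (g k)); auto; [now apply G|].
  rewrite E. now apply G.
Qed.

Theorem Ulm_approx (K : (nat -> nat) -> Prop) {HK : CClass K} (p : nat) (Hp : prime (Z.of_nat p)) (a : nat -> nat)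
  (x0 : Pg p (prime_ge2 p Hp) a) :
  Comp K a -> Om p x0 -> (~ exists y, Om p y /\ Z.of_nat p • y = x0) ->
  exists n nu : _, Comp2 K n /\ (forall k s s', s <= s' -> n k s <= n k s') /\
    (forall k, exists s0, forall s, s0 <= s -> n k s = nu k) /\
    (forall N B, exists k u, B <= k /\ N <= n k u) /\
    forall m, exists J v, Ubasis p (Pg p (prime_ge2 p Hp) a) m J v /\
      (exists g, (forall k, nu k = S m -> J (g k)) /\ forall k k', nu k = S m -> nu k' = S m -> g k = g k' -> k = k') /\
      (exists g, (forall j, J j -> nu (g j) = S m) /\ forall j j', J j -> J j' -> g j = g j' -> j = j').
Proof.
  intros Ha O NO.
  assert (Had : Comp2 K (ad p a)).
  { unfold Comp2, ad. apply (Comp_padd p (prime_ge2 p Hp)); kc. }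
  assert (Hml : Comp K (ml p a)) by (unfold ml; kc).
  assert (Hmw : Comp2 K (mw p a)) by (unfold mw; kc).
  assert (Hht : Comp2 K (ht p a)) by (unfold ht; kc).
  assert (Hsoc : CompB2 K (soc p a)) by (unfold soc; kc).
  assert (HR : Comp2 K (Rj p a)) by (unfold Rj, bmax; kc).
  assert (Ex : forall N, exists y, (mw p a (S N) y =? x0) = true).
  { intros N. destruct (O (S N)) as [y Ey]. exists y. apply Nat.eqb_eq. rewrite (mw_eq p Hp). auto. }
  (* As [x0] is [p^(N+1)] times [r N], the element [p^N • r N] has height at least [N] and its
     [p]-multiple is [x0]. *)
  destruct (Comp_mu_ex K (fun N y => mw p a (S N) y =? x0)) as (r & Cr & Hr); auto; [kc|].
  pose (zs := fun N => mw p a N (r N)).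
  assert (Cz : Comp K zs) by (unfold zs; kc).
  assert (Ez : forall N, zs N = pw p N • (r N : Pg p (prime_ge2 p Hp) a)) by (intros N; apply mw_eq).
  assert (Dz : forall N, Dv p N (zs N : Pg p (prime_ge2 p Hp) a)) by (intros N; exists (r N); apply Ez).
  assert (Pz : forall N, Z.of_nat p • (zs N : Pg p (prime_ge2 p Hp) a) = x0).
  { intros N. rewrite Ez, <- zmul_mul, <- pw_S, <- mw_eq. apply Nat.eqb_eq, Hr. }
  clearbody zs.
  assert (Hhz : Comp2 K (hz p Hp a zs)) by (unfold hz; kc).
  assert (HHm : Comp2 K (Hm p Hp a zs)) by (unfold Hm; kc).
  assert (HG : Comp2 K (Gt p Hp a zs)) by (unfold Gt; kc).
  (* The exponent of a component is one more than the height that its socle contributes. *)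
  pose (F := fun t s => S (Gt p Hp a zs t s)).
  assert (HF : Comp2 K F) by (unfold F; kc).
  assert (FL : forall t, exists m, ev (fun s => F t s = m) /\ exists j, ev (fun s => Rj p a j s = m)).
  { intros t. destruct (Gt_lim p Hp a x0 NO zs Dz Pz t) as (m & A & B). exists (S m). split; auto.
    revert A. apply ev_mono. intros s E. unfold F. now rewrite E. }
  destruct (fun_choice _ FL) as [f Hf].
  assert (Fm : forall t s s', s <= s' -> F t s <= F t s').
  { intros t s s' L. unfold F. pose proof (Gt_mono p Hp a zs t s s' L). lia. }
  assert (Fi : forall t s, F t s < F (S t) s).
  { intros t s. unfold F. pose proof (Gt_inc p Hp a zs t s). lia. }
  assert (F0 : forall s, 0 < F 0 s) by (intros; unfold F; lia).
  assert (Ff : forall t, ev (fun s => F t s = f t)) by apply Hf.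
  assert (fR : forall t, exists j, ev (fun s => Rj p a j s = f t)) by apply Hf.
  clear Hf FL. pose (n := comp (Rj p a) F).
  assert (Ln : forall k, exists m, ev (fun u => n k u = m)).
  { intros k. apply (comp_lim (Rj p a) F (Rj_le p Hp a) f Ff). }
  destruct (fun_choice _ Ln) as [nu Hnu].
  exists n, nu. split; [now apply comp_Comp|]. split; [|split; [exact Hnu|split]].
  - apply (comp_mono (Rj p a) F (Rj_le p Hp a) Fm Fi F0).
  - apply (comp_large (Rj p a) F Fi F0).
  - intros m. exists (Jm p a m), (vm p Hp a m). split; [apply Pg_Ubasis|].
    assert (nuI : forall k, nu k = S m <-> ev (fun u => n k u = S m)).
    { intros k. split; [intros <-; apply Hnu|]. intros E. apply (ev_eq (n k)); auto. }
    split.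
    + apply (inj_of_rel _ _ (fun k j => matched (Rj p a) F (S m) k j)).
      * intros k E. apply nuI in E.
        destruct (matched_comp (Rj p a) F (Rj_le p Hp a) f Ff fR (S m) k ltac:(lia) E) as (j & M1 & M2). eauto.
      * intros k k' j E E' M1 M2. apply nuI in E, E'.
        apply (matched_inj (Rj p a) F (Rj_mono p Hp a) (Rj_le p Hp a) Fi f Ff F0 (S m) k k' j); auto.
    + apply (inj_of_rel _ (fun k => nu k = S m) (fun j k => matched (Rj p a) F (S m) k j)).
      * intros j E. destruct (matched_index (Rj p a) F (Rj_mono p Hp a) (Rj_le p Hp a) Fi f Ff F0 (S m) j ltac:(lia) E) as (k & M1 & M2).
        exists k. split; auto. now apply nuI.
      * intros j j' k E E' M1 M2. apply (matched_fun (Rj p a) F (S m) k j j'); auto.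
Qed.

(** * The tree of guesses *)

(* A node [S j] of depth [S i] guesses that the double limit at [i] is [S v] with modulus [w],
   where [(v, w)] is coded by [c2 j]; its parent is [c1 j]. *)
Definition npar (s : nat) : nat := match s with 0 => 0 | S j => c1 j end.
Definition nv (s : nat) : nat := c1 (c2 (pred s)).
Definition nw (s : nat) : nat := c2 (c2 (pred s)).
Definition ndep (s : nat) : nat := length (ancs npar s).
(** A node of depth [e + 1] represents the [e]-th generator, hence the digit of weight [p ^ e]. *)
Definition ndig (p s t : nat) : nat := (nv s / p ^ pred (ndep t)) mod p.

Lemma npar_lt s : s <> 0 -> npar s < s.
Proof.
  destruct s as [|j]; [easy|]. intros _. simpl. pose proof (cp_le (c1 j) (c2 j)). rewrite cp_c in H. lia.
Qed.

Lemma ndep_S (p : nat) (Hp : prime (Z.of_nat p)) s : s <> 0 -> ndep s = S (ndep (npar s)).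
Proof.
  intros N. unfold ndep. rewrite (ancs_S p Hp npar npar_lt eq_refl s N), length_app. simpl. lia.
Qed.

Section Guess.
Context (g : nat -> nat -> nat -> nat).

(* Evidence for the guess [s] at stages [>= a]; it turns up for every [a] exactly when the guess is correct. *)
Definition ent (s a t : nat) : bool :=
  let i := pred (ndep s) in
  ball (S a) (fun s' => bex (S t) (fun t' => (a <=? t') && (g i (nw s + s') t' =? S (nv s)))) &&
  ((nw s =? 0) || bex (S t) (fun t' => (a <=? t') && negb (g i (pred (nw s)) t' =? S (nv s)))).

Definition conf (s a t : nat) : bool := fold_left (fun r s' => if ent s' a t then r else 1) (ancs npar s) 0 =? 0.

(** Counts the consecutive [a] at which the whole branch up to [s] is confirmed by stage [t]. It
    grows without bound exactly when every node of the branch is correct. *)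
Definition NLev (s t : nat) : nat := bmu t (fun a => negb (conf s a t)).

Lemma ent_spec s a t : ent s a t = true <->
  (forall s', s' <= a -> exists t', a <= t' <= t /\ g (pred (ndep s)) (nw s + s') t' = S (nv s)) /\
  (nw s = 0 \/ exists t', a <= t' <= t /\ g (pred (ndep s)) (pred (nw s)) t' <> S (nv s)).
Proof.
  unfold ent. rewrite Bool.andb_true_iff, ball_spec, Bool.orb_true_iff, bex_spec, Nat.eqb_eq.
  split; intros [A B]; (split; [|destruct B as [|(t' & L & B)]; auto; right; exists t']).
  - intros s' L. specialize (A s' ltac:(lia)). apply bex_spec in A. destruct A as (t' & L' & A).
    apply andb_prop in A. destruct A as [A1 A2]. apply Nat.leb_le in A1. apply Nat.eqb_eq in A2. exists t'. split; auto. lia.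
  - apply andb_prop in B. destruct B as [B1 B2]. apply Nat.leb_le in B1.
    apply Bool.negb_true_iff, Nat.eqb_neq in B2. split; auto. lia.
  - intros s' L. destruct (A s' ltac:(lia)) as (t' & L' & A'). apply bex_spec. exists t'. split; [lia|].
    rewrite A', Nat.eqb_refl. destruct (Nat.leb_spec a t'); auto; lia.
  - split; [lia|]. destruct (Nat.leb_spec a t'); [|lia]. now destruct (Nat.eqb_spec (g (pred (ndep s)) (pred (nw s)) t') (S (nv s))).
Qed.

Lemma ent_mono s a t t' : t <= t' -> ent s a t = true -> ent s a t' = true.
Proof.
  intros L. rewrite !ent_spec. intros [A B]. split.
  - intros s' L'. destruct (A s' L') as (u & Lu & E). exists u. split; auto; lia.
  - destruct B as [|(u & Lu & E)]; auto. right. exists u. split; auto; lia.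
Qed.

Lemma conf_spec s a t : conf s a t = true <-> forall s', tle npar s' s -> ent s' a t = true.
Proof.
  unfold conf. rewrite Nat.eqb_eq. setoid_rewrite <- (ancs_in npar npar_lt).
  assert (One : forall l, fold_left (fun r s' => if ent s' a t then r else 1) l 1 = 1).
  { induction l as [|u l IH]; auto. simpl. now destruct (ent u a t). }
  induction (ancs npar s) as [|u l IH]; simpl; [tauto|]. destruct (ent u a t) eqn:E.
  - rewrite IH. split; intros H s' Hs; [destruct Hs as [<-|]; auto | auto].
  - rewrite One. split; [discriminate|]. intros H. rewrite H in E; auto. discriminate.
Qed.

Lemma NLev_ge s t b : b <= t -> (forall a, a < b -> conf s a t = true) -> b <= NLev s t.
Proof.
  intros L H. destruct (Nat.le_gt_cases b (NLev s t)) as [|G]; auto.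
  assert (Q : NLev s t < t) by lia. apply bmu_true in Q. fold (NLev s t) in Q. rewrite H in Q; auto. discriminate.
Qed.

Lemma NLev_conf s t a : a < NLev s t -> conf s a t = true.
Proof. intros L. apply bmu_least in L. now apply Bool.negb_false_iff in L. Qed.

Lemma NLev_le s t : NLev s t <= t.
Proof. apply bmu_le. Qed.

Lemma NLev_mono s t t' : t <= t' -> NLev s t <= NLev s t'.
Proof.
  intros L. apply NLev_ge; [pose proof (NLev_le s t); lia|]. intros a La. apply NLev_conf in La.
  rewrite conf_spec in *. intros s' T. now apply (ent_mono s' a t), La.
Qed.

Lemma NLev_par s t : npar s <> 0 -> NLev s t <= NLev (npar s) t.
Proof.
  intros N. apply NLev_ge; [apply NLev_le|]. intros a La. apply NLev_conf in La. rewrite conf_spec in *.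
  intros s' T. apply La. apply tle_par; auto. intros ->. now apply N.
Qed.

Context (G : nat -> nat -> nat) (g_lim : forall i s, ev (fun t => g i s t = G i s)).
Context (c : nat -> nat) (G_lim : forall i, ev (fun s => G i s = c i)).

(** The second clause makes [nw s] the least modulus. Hence a node has at most one correct child and
    the true path is unique. *)
Definition correct (s : nat) : Prop :=
  let i := pred (ndep s) in
  (forall s', nw s <= s' -> G i s' = S (nv s)) /\ (nw s = 0 \/ G i (pred (nw s)) <> S (nv s)).

Lemma correct_iff s : correct s <-> forall a, exists t, ent s a t = true.
Proof.
  unfold correct. set (i := pred (ndep s)). split.
  - intros [A B] a.
    assert (E1 : ev (fun t => forall s', s' < S a -> exists t', a <= t' <= t /\ g i (nw s + s') t' = S (nv s))).
    { apply ev_all. intros s' _. destruct (g_lim i (nw s + s')) as [t0 H0]. exists (t0 + a). intros t L.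
      exists t. split; [lia|]. rewrite H0 by lia. apply A. lia. }
    destruct E1 as [t1 H1].
    destruct (g_lim i (pred (nw s))) as [t2 H2]. exists (t1 + t2 + a). apply ent_spec. split.
    + intros s' L. apply H1; lia.
    + destruct B as [|B]; auto. right. exists (t1 + t2 + a). split; [lia|]. fold i. rewrite H2 by lia. auto.
  - intros H. split.
    + intros s' L. destruct (g_lim i s') as [t0 H0]. destruct (H (t0 + s')) as [t Ht].
      apply ent_spec in Ht. destruct Ht as [A _]. destruct (A (s' - nw s)) as (t' & L' & E); [lia|].
      fold i in E. replace (nw s + (s' - nw s)) with s' in E by lia. rewrite <- E. symmetry. apply H0. lia.
    + destruct (g_lim i (pred (nw s))) as [t0 H0]. destruct (H t0) as [t Ht]. apply ent_spec in Ht.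
      destruct Ht as [_ [|(t' & L' & E)]]; auto. right. fold i in E. rewrite H0 in E by lia. auto.
Qed.

Lemma tru_iff s : tru NLev s <-> s <> 0 /\ forall s', tle npar s' s -> correct s'.
Proof.
  split.
  - intros [N H]. split; auto. intros s' T. apply correct_iff. intros a. destruct (H (S a)) as [t Ht].
    exists t. apply (proj1 (conf_spec s a t)); auto. apply NLev_conf. lia.
  - intros [N H]. split; auto. intros B.
    assert (E : ev (fun t => forall a, a < B -> conf s a t = true)).
    { apply ev_all. intros a _.
      assert (E : ev (fun t => forall s', s' < S s -> tle npar s' s -> ent s' a t = true)).
      { apply ev_all. intros s' _. destruct (classic (tle npar s' s)) as [T|T]; [|exists 0; tauto].
        destruct (proj1 (correct_iff s') (H s' T) a) as [t0 H0]. exists t0. intros t L _. now apply (ent_mono s' a t0). }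
      revert E. apply ev_mono. intros t Ht. apply conf_spec. intros s' T. apply Ht; auto.
      apply (tle_le npar npar_lt) in T. lia. }
    destruct E as [t0 H0]. exists (t0 + B). apply NLev_ge; [lia|]. intros a La. apply H0; auto. lia.
Qed.

Lemma wl_ex i : exists w, (forall s, w <= s -> G i s = c i) /\ (w = 0 \/ G i (pred w) <> c i).
Proof.
  destruct (G_lim i) as [w H]. induction w as [|w IH]; [exists 0; auto|].
  destruct (Nat.eq_dec (G i w) (c i)) as [E|E]; [|exists (S w); auto].
  apply IH. intros s L. destruct (Nat.eq_dec s w) as [->|]; auto. apply H. lia.
Qed.

Definition wl (i : nat) : nat := proj1_sig (constructive_indefinite_description _ (wl_ex i)).

Lemma wl_spec i : (forall s, wl i <= s -> G i s = c i) /\ (wl i = 0 \/ G i (pred (wl i)) <> c i).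
Proof. apply (proj2_sig (constructive_indefinite_description _ (wl_ex i))). Qed.

Fixpoint sg (i : nat) : nat :=
  match i with 0 => 0 | S i => S (cp (sg i) (cp (pred (c i)) (wl i))) end.

Lemma sg_nz i : sg (S i) <> 0.
Proof. discriminate. Qed.

Lemma sg_par i : npar (sg (S i)) = sg i.
Proof. simpl. apply c1_cp. Qed.

Lemma sg_nv i : nv (sg (S i)) = pred (c i).
Proof. unfold nv. simpl. now rewrite c2_cp, c1_cp. Qed.

Lemma sg_nw i : nw (sg (S i)) = wl i.
Proof. unfold nw. simpl. now rewrite !c2_cp. Qed.

Section WithP.
Context (p : nat) (Hp : prime (Z.of_nat p)).

Lemma sg_dep i : ndep (sg i) = i.
Proof.
  induction i as [|i IH]; auto. rewrite (ndep_S p Hp) by apply sg_nz. now rewrite sg_par, IH.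
Qed.

Lemma sg_dig i e : ndig p (sg (S i)) (sg (S e)) = (pred (c i) / p ^ e) mod p.
Proof. unfold ndig. now rewrite sg_nv, sg_dep. Qed.

Lemma correct_eq s : correct s -> let i := pred (ndep s) in c i = S (nv s) /\ nw s = wl i.
Proof.
  intros [A B] i. fold i in A, B.
  assert (E : c i = S (nv s)).
  { destruct (G_lim i) as [s0 H]. rewrite <- (H (s0 + nw s)) by lia. apply A. lia. }
  split; auto. destruct (wl_spec i) as [A' B']. rewrite E in *.
  destruct (lt_eq_lt_dec (nw s) (wl i)) as [[L|]|L]; auto; exfalso.
  - destruct B' as [|B']; [lia|]. apply B', A. lia.
  - destruct B as [|B]; [lia|]. apply B, A'. lia.
Qed.

(** Only successors are guessed, so a limit 0 has no correct node and the true path stops there;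
    this is how groups with finitely many generators are treated. *)
Lemma sg_tru s : tru NLev s <-> exists i, s = sg (S i) /\ forall i', i' <= i -> c i' <> 0.
Proof.
  rewrite tru_iff. split.
  - induction s as [s IH] using lt_wf_ind. intros [N H].
    assert (P : npar s = sg (ndep (npar s)) /\ forall i', i' < ndep (npar s) -> c i' <> 0).
    { destruct (Nat.eq_dec (npar s) 0) as [Z|Np]; [rewrite Z; split; [reflexivity | intros i' L; exfalso; revert L; change (ndep 0) with 0; lia]|].
      destruct (IH (npar s)) as (i & E & Hi); [now apply npar_lt| |].
      - split; auto. intros s' T. apply H. now apply tle_par.
      - rewrite E, sg_dep. split; auto. intros i' L. apply Hi. lia. }
    destruct P as [P1 P2]. set (d := ndep (npar s)) in *.
    pose proof (correct_eq s (H s (tle_refl _ _ N))) as E12. cbv zeta in E12. destruct E12 as [E1 E2].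
    rewrite (ndep_S p Hp s N) in E1, E2. fold d in E1, E2. simpl in E1, E2.
    exists d. split.
    + destruct s as [|j]; [easy|]. simpl. f_equal. rewrite <- P1, E1, <- E2. simpl.
      unfold nv, nw. simpl. now rewrite !cp_c.
    + intros i' L. destruct (Nat.eq_dec i' d) as [->|]; [rewrite E1; discriminate | apply P2; lia].
  - intros (i & -> & H). split; [apply sg_nz|]. intros s' T.
    assert (Q : exists e, e <= i /\ s' = sg (S e)).
    { clear H. induction i as [|i IH].
      - inversion T; subst; [eauto|]. rewrite sg_par in *. simpl in *. apply tle_nz in H0. tauto.
      - inversion T; subst; [exists (S i); auto|]. rewrite sg_par in *. destruct (IH H0) as (e & L & E). exists e. split; auto. }
    destruct Q as (e & L & ->). unfold correct. rewrite sg_dep, sg_nv, sg_nw. simpl pred at 1 3.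
    destruct (wl_spec e) as [A B]. specialize (H e L). replace (S (pred (c e))) with (c e) by lia. auto.
Qed.

End WithP.
End Guess.

Lemma get_bound (m : mem) t : exists B, forall i, B <= i -> get m t i = 0.
Proof.
  induction m as [|[[t' i'] v] m [B IH]]; [exists 0; intros; apply get_nil|].
  exists (B + S i'). intros i L. change ((t', i', v) :: m) with (upd m t' i' v).
  rewrite get_upd. destruct (Nat.eqb_spec i' i); [lia|]. rewrite Bool.andb_false_r. apply IH. lia.
Qed.

Lemma Comp_ancs_npar (K : (nat -> nat) -> Prop) {HK : CClass K} : Comp K (ancs npar).
Proof.
  apply Comp_ancs; auto. unfold npar. kc.
Qed.

Lemma Comp_ndep (K : (nat -> nat) -> Prop) {HK : CClass K} : Comp K ndep.
Proof.
  pose proof (Comp_ancs_npar K). apply (Comp_ext K (fun s => fold_left (fun r _ => S r) (ancs npar s) 0)).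
  - intros s. unfold ndep. rewrite <- (Nat.add_0_l (length _)). generalize 0. induction (ancs npar s) as [|u l IH]; intros r; simpl; [lia|].
    rewrite IH. lia.
  - kc.
Qed.

Lemma Comp_NLev (K : (nat -> nat) -> Prop) {HK : CClass K} (g : nat -> nat -> nat -> nat -> nat) :
  Comp K (fun q : nat * (nat * (nat * nat)) => g (fst q) (fst (snd q)) (fst (snd (snd q))) (snd (snd (snd q)))) ->
  Comp3 K (fun z => NLev (g z)).
Proof.
  intros Hg. pose proof (Comp_ancs_npar K) as Ha. pose proof (Comp_ndep K) as Hd.
  assert (Hv : Comp K nv) by (unfold nv; kc). assert (Hw : Comp K nw) by (unfold nw; kc).
  assert (Hg' : forall X (EX : Enc X) (a b c d : X -> nat), Comp K a -> Comp K b -> Comp K c -> Comp K d ->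
    Comp K (fun x => g (a x) (b x) (c x) (d x))).
  { intros X EX a b c d A B C D. exact (Comp_app K _ (fun x => (a x, (b x, (c x, d x)))) Hg ltac:(kc)). }
  assert (He : CompB K (fun q : nat * (nat * (nat * nat)) => ent (g (fst q)) (fst (snd q)) (fst (snd (snd q))) (snd (snd (snd q))))).
  { unfold ent. kc; apply Hg'; kc. }
  assert (He' : forall X (EX : Enc X) (a b c d : X -> nat), Comp K a -> Comp K b -> Comp K c -> Comp K d ->
    CompB K (fun x => ent (g (a x)) (b x) (c x) (d x))).
  { intros X EX a b c d A B C D. exact (CompB_app K _ (fun x => (a x, (b x, (c x, d x)))) He ltac:(kc)). }
  unfold Comp3, NLev, conf. kc. apply He'; kc.
Qed.

(** Here [c j = 0] says that the generators end before [j], and [c j = S v] that [p] times the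
    [j]-th generator is given by [v]. *)
Definition Dom (p : nat) (c : nat -> nat) (x : nat) : Prop := forall j, p ^ j <= x -> c j <> 0.

Theorem realize (K : (nat -> nat) -> Prop) {HK : CClass K} (p : nat) (Hp : prime (Z.of_nat p)) (a : nat -> nat)
  (x0 : Pg p (prime_ge2 p Hp) a) (cc : nat -> nat) :
  Comp K a -> Om p x0 -> (~ exists y, Om p y /\ Z.of_nat p • y = x0) -> Lim (Lim K) cc ->
  exists c', Comp2 K c' /\ forall z,
    (forall m, Uinj p (Pg p (prime_ge2 p Hp) (c' z)) (Pg p (prime_ge2 p Hp) a) m) /\
    (forall m, Uinj p (Pg p (prime_ge2 p Hp) a) (Pg p (prime_ge2 p Hp) (c' z)) m) /\
    exists f : nat -> Pg p (prime_ge2 p Hp) (c' z),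
      let D := Dom p (fun j => cc (cp z j)) in
      (forall x, D x -> Om p (f x)) /\
      (forall x y, D x -> D y -> f ((x : Pg p (prime_ge2 p Hp) (fun i => pred (cc (cp z i)))) ⊕ y) = f x ⊕ f y) /\
      (forall x y, D x -> D y -> f x = f y -> x = y) /\ (forall y, Om p y -> exists x, D x /\ f x = y).
Proof.
  intros Ha O NO (G' & (g' & Kg & Hg) & HG).
  destruct (Ulm_approx K p Hp a x0 Ha O NO) as (n & nu & Cn & n_mono & n_nu & n_large & UB).
  pose (g := fun z i s t => g' (cp (cp (cp z i) s) t)). pose (G := fun z i s => G' (cp (cp z i) s)).
  destruct (Comp_mu_ex K (fun (m : mem) w => (fCur m (c1 w) =? 0) && (fLen m + 2 <=? n (c1 w) (c2 w)))) as (srch & Cs & Hs).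
  { kc. }
  { intros m. destruct (get_bound m 3) as [B HB]. destruct (n_large (fLen m + 2) B) as (k & u & L & L').
    exists (cp k u). rewrite c1_cp, c2_cp, HB, Nat.eqb_refl by auto. now apply Nat.leb_le. }
  assert (srch_spec : forall m, fCur m (c1 (srch m)) = 0 /\ fLen m + 2 <= n (c1 (srch m)) (c2 (srch m))).
  { intros m. specialize (Hs m). apply andb_prop in Hs. now rewrite Nat.eqb_eq, Nat.leb_le in Hs. }
  clear Hs. pose (Lev := fun z => NLev (g z)).
  assert (CL : Comp3 K Lev).
  { apply Comp_NLev; auto. unfold g. assert (Comp K g') by exact Kg. kc. }
  assert (Cp : Comp K npar) by (unfold npar; kc).
  assert (Cd : Comp2 K (ndig p)).
  { unfold ndig. pose proof (Comp_ndep K). unfold nv. kc. }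
  pose proof (Comp_run K p (prime_ge2 p Hp) npar (ndig p) n srch Cp Cd Cn Cs Lev CL) as Cr.
  change (fun x t => nat_rect (fun _ => mem) [] (stage p npar (ndig p) n (Lev x) srch) t)
    with (fun x t => run p npar (ndig p) n (Lev x) srch t) in Cr.
  pose (rn := fun x t => run p npar (ndig p) n (Lev x) srch t). fold rn in Cr.
  assert (len : forall z N, exists t, N <= fLen (rn z t)).
  { intros z N. apply (len_unbounded p Hp npar npar_lt eq_refl (ndig p) n (Lev z) srch n_mono srch_spec nu n_nu N). }
  (* The relation of generator [i] is read off at the first stage found to have more than [i]
     generators; this puts the limit relations into [K] without passing to a limit. *)
  destruct (Comp_mu_ex K (fun q t => snd q <? fLen (rn (fst q) t))) as (T & CT & HT).
  { clearbody rn. kc. }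
  { intros [z i]. destruct (len z (S i)) as [t Ht]. exists t. now apply Nat.ltb_lt. }
  exists (fun z => runc p npar (ndig p) n (Lev z) srch). split.
  { unfold Comp2. apply (Comp_ext K (fun q => fC (rn (fst q) (T q)) (snd q))).
    - intros q. symmetry. apply runc_eq. specialize (HT q). now apply Nat.ltb_lt in HT.
    - clearbody rn. kc. }
  intros z. pose proof (limit_Ubasis p Hp npar npar_lt eq_refl (ndig p) n (Lev z) srch n_mono srch_spec nu n_nu) as LU.
  split; [|split].
  - intros m. destruct (UB m) as (J & v & B & (h & H1 & H2) & _). apply (Ubasis_Uinj p _ _ m _ _ _ _ h (LU m) B H1 H2).
  - intros m. destruct (UB m) as (J & v & B & _ & (h & H1 & H2)). apply (Ubasis_Uinj p _ _ m _ _ _ _ h B (LU m) H1 H2).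
  - assert (gl : forall i s, ev (fun t => g z i s t = G z i s)) by (intros; apply Hg).
    assert (Gl : forall i, ev (fun s => G z i s = cc (cp z i))) by (intros; apply HG).
    eexists. apply (path_iso p Hp npar npar_lt eq_refl (ndig p) n (Lev z) srch n_mono srch_spec nu n_nu
      (NLev_mono (g z)) (NLev_par (g z)) (fun j => cc (cp z j) <> 0) (fun i => pred (cc (cp z i)))
      (sg (G z) (fun i => cc (cp z i)) Gl)).
    + reflexivity.
    + apply sg_nz.
    + apply sg_par.
    + apply (sg_dig (G z) _ Gl p Hp).
    + apply (sg_tru (g z) (G z) gl _ Gl p Hp).
Qed.

(** * Structures and groups *)

Lemma iso_sym A B : iso A B -> iso B A.
Proof.
  intros (f & f1 & f2 & f3 & f4 & f5).
  assert (C : forall y, exists x, dom B y -> dom A x /\ f x = y).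
  { intros y. destruct (classic (dom B y)) as [H|H]; [|exists 0; tauto]. destruct (f3 y H) as [x Hx]. eauto. }
  destruct (fun_choice _ C) as [g G]. exists g. split; [|split; [|split; [|split]]].
  - intros y H. now apply G.
  - intros y y' H H' E. rewrite <- (proj2 (G y H)), <- (proj2 (G y' H')). now rewrite E.
  - intros x H. exists (f x). split; auto. apply f2; auto; now apply G, f1.
  - apply f2; [apply G, zero_dom | apply zero_dom|]. rewrite (proj2 (G _ (zero_dom B))). auto.
  - intros y y' H H'. destruct (G y H) as [D E]. destruct (G y' H') as [D' E'].
    destruct (G (add B y y') (add_dom B y y' H H')) as [D'' E''].
    apply f2; auto; [now apply add_dom|]. rewrite f5, E'', E, E' by auto. reflexivity.
Qed.

(** An isomorphism of [X] onto the part [Q] of [G]. Two structures with the same image are then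
    isomorphic, which replaces compositions with inverse maps. *)
Definition emb (X : Struct) (G : Grp) (f : nat -> G) (Q : G -> Prop) : Prop :=
  (forall x, dom X x -> Q (f x)) /\ (forall x y, dom X x -> dom X y -> f (add X x y) = f x ⊕ f y) /\
  (forall x y, dom X x -> dom X y -> f x = f y -> x = y) /\ (forall y, Q y -> exists x, dom X x /\ f x = y) /\
  f (zero X) = g0.

Lemma emb_iso X Y G f g Q : emb X G f Q -> emb Y G g Q -> iso X Y.
Proof.
  intros (f1 & f2 & f3 & f4 & f5) (g1 & g2 & g3 & g4 & g5).
  assert (C : forall x, exists y, dom X x -> dom Y y /\ g y = f x).
  { intros x. destruct (classic (dom X x)) as [H|H]; [|exists 0; tauto]. destruct (g4 (f x)) as [y Hy]; auto. eauto. }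
  destruct (fun_choice _ C) as [h H]. exists h. split; [|split; [|split; [|split]]].
  - intros x D. now apply H.
  - intros x x' D D' E. apply f3; auto. rewrite <- (proj2 (H x D)), <- (proj2 (H x' D')). now rewrite E.
  - intros y D. destruct (f4 (g y)) as (x & Dx & E); auto. exists x. split; auto. apply g3; auto; [now apply H|].
    now rewrite (proj2 (H x Dx)).
  - apply g3; [apply H, zero_dom | apply zero_dom|]. rewrite (proj2 (H _ (zero_dom X))). congruence.
  - intros x x' D D'. destruct (H x D) as [E1 E2]. destruct (H x' D') as [E1' E2'].
    destruct (H (add X x x') (add_dom X x x' D D')) as [E3 E4].
    apply g3; auto; [now apply add_dom|]. rewrite g2, E4, E2, E2', f2 by auto. reflexivity.
Qed.

Lemma iso_emb X Y G g Q : iso X Y -> emb Y G g Q -> exists f, emb X G f Q.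
Proof.
  intros (h & h1 & h2 & h3 & h4 & h5) (g1 & g2 & g3 & g4 & g5). exists (fun x => g (h x)).
  split; [|split; [|split; [|split]]]; auto.
  - intros x y Dx Dy. rewrite h5, g2 by auto. reflexivity.
  - intros y Qy. destruct (g4 y Qy) as (x & Dx & <-). destruct (h3 x Dx) as (x' & Dx' & <-). eauto.
  - now rewrite h4.
Qed.

Section PStruct.
Context (p : nat) (Hp : prime (Z.of_nat p)) (c : nat -> nat).

Definition PStruct : Struct.
Proof.
  refine {| dom := Dom p c; add := fun x y => padd p (fun i => pred (c i)) (x + y) x y; zero := 0 |}.
  - exact (D_0 p Hp (fun j => c j <> 0)).
  - exact (D_add p Hp (fun j => c j <> 0) (fun i => pred (c i))).
Defined.

Lemma PStruct_emb : (forall j, c j <> 0) ->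
  emb PStruct (Pg p (prime_ge2 p Hp) (fun i => pred (c i))) (fun x => x) (fun _ => True).
Proof.
  intros H. split; [|split; [|split; [|split]]]; auto. intros y _. exists y. split; auto. intros j _. apply H.
Qed.

End PStruct.

Section Laws.
Context (p : nat) (A : Struct) (HA : abelian_pgroup p A).

Lemma nsmul_dom n x : dom A x -> dom A (nsmul A n x).
Proof. intros D. induction n; [apply zero_dom|]. apply add_dom; auto. Qed.

Lemma nsmul_S n x : nsmul A (S n) x = add A x (nsmul A n x).
Proof. reflexivity. Qed.

Lemma sig_eq (x y : {x | dom A x}) : proj1_sig x = proj1_sig y -> x = y.
Proof. destruct x as [x Hx], y as [y Hy]. simpl. intros <-. f_equal. apply proof_irrelevance. Qed.

Definition gop (x : {x | dom A x}) : {y | dom A y /\ add A (proj1_sig x) y = zero A} :=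
  constructive_indefinite_description _ (proj1 (proj2 (proj2 (proj2 HA))) (proj1_sig x) (proj2_sig x)).

Definition SG : Grp.
Proof.
  refine {| car := {x | dom A x};
    gadd := fun x y => exist _ (add A (proj1_sig x) (proj1_sig y)) (add_dom A _ _ (proj2_sig x) (proj2_sig y));
    g0 := exist _ (zero A) (zero_dom A);
    gopp := fun x => exist _ (proj1_sig (gop x)) (proj1 (proj2_sig (gop x))) |}.
  - intros x y z. apply sig_eq. simpl. apply HA; apply proj2_sig.
  - intros x y. apply sig_eq. simpl. apply HA; apply proj2_sig.
  - intros x. apply sig_eq. simpl. apply HA; apply proj2_sig.
  - intros x. apply sig_eq. simpl. apply (proj2_sig (gop x)).
Defined.

Definition inc (x : nat) : SG :=
  match excluded_middle_informative (dom A x) with left H => exist _ x H | right _ => g0 end.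

Lemma inc_val x : dom A x -> proj1_sig (inc x) = x.
Proof. intros D. unfold inc. destruct (excluded_middle_informative (dom A x)); easy. Qed.

Lemma inc_proj (x : SG) : inc (proj1_sig x) = x.
Proof. apply sig_eq. apply inc_val, proj2_sig. Qed.

Lemma SG_nmul n (x : SG) : proj1_sig (nmul n x) = nsmul A n (proj1_sig x).
Proof. induction n as [|n IH]; auto. rewrite nsmul_S, <- IH. reflexivity. Qed.

Lemma SG_tors : ptors p SG.
Proof.
  intros x. destruct (proj2 (proj2 (proj2 (proj2 HA))) _ (proj2_sig x)) as [k E]. exists k.
  apply sig_eq. unfold pw. rewrite zmul_nat, SG_nmul. exact E.
Qed.

Lemma SG_emb : emb A SG inc (fun _ => True).
Proof.
  split; [|split; [|split; [|split]]]; auto.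
  - intros x y Dx Dy. apply sig_eq. rewrite inc_val by now apply add_dom. simpl. now rewrite !inc_val.
  - intros x y Dx Dy E. now rewrite <- (inc_val x Dx), <- (inc_val y Dy), E.
  - intros y _. exists (proj1_sig y). split; [apply proj2_sig | apply inc_proj].
  - apply sig_eq. apply inc_val, zero_dom.
Qed.

Definition subclosed (Q : nat -> Prop) : Prop :=
  Q (zero A) /\ (forall x y, Q x -> Q y -> Q (add A x y)) /\ forall x, Q x -> dom A x.

Definition Sub (Q : nat -> Prop) (H : subclosed Q) : Struct :=
  {| dom := Q; add := add A; zero := zero A; zero_dom := proj1 H; add_dom := proj1 (proj2 H) |}.

Lemma nsmul_Q Q n x : subclosed Q -> Q x -> Q (nsmul A n x).
Proof. intros (H0 & H1 & _) D. induction n; auto. rewrite nsmul_S. auto. Qed.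

Lemma Sub_group (Hp : prime (Z.of_nat p)) Q (H : subclosed Q) : abelian_pgroup p (Sub Q H).
Proof.
  destruct HA as (hA & hC & h0 & hN & hT). pose proof H as (H0 & H1 & H2).
  split; [|split; [|split; [|split]]]; simpl; auto.
  (* In a torsion group a negative is a positive multiple, so closure under addition already gives
     inverses in [Q]. *)
  - intros x D. destruct (hT x (H2 x D)) as [k E]. exists (nsmul A (p ^ k - 1) x). split; [now apply nsmul_Q|].
    rewrite <- nsmul_S, <- E. f_equal. pose proof (ppow_pos p (prime_ge2 p Hp) k). lia.
  - intros x D. destruct (hT x (H2 x D)) as [k E]. exists k. exact E.
Qed.

Lemma nsmul_add n x y : dom A x -> dom A y -> nsmul A n (add A x y) = add A (nsmul A n x) (nsmul A n y).
Proof.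
  intros Dx Dy. rewrite <- (inc_val x Dx), <- (inc_val y Dy).
  change (add A (proj1_sig (inc x)) (proj1_sig (inc y))) with (proj1_sig (inc x ⊕ inc y)).
  rewrite <- !SG_nmul, nmulD. reflexivity.
Qed.

Lemma nsmul_zero n : nsmul A n (zero A) = zero A.
Proof.
  change (zero A) with (proj1_sig (@g0 SG)) at 1. rewrite <- SG_nmul, nmul0. reflexivity.
Qed.

Lemma pmul_subclosed Q : subclosed Q -> subclosed (pmul p A Q).
Proof.
  intros (H0 & H1 & H2). split; [|split].
  - exists (zero A). split; auto. now rewrite nsmul_zero.
  - intros x y (x' & Q1 & ->) (y' & Q2 & ->). exists (add A x' y'). split; auto. now rewrite nsmul_add by auto.
  - intros x (x' & Q1 & ->). apply nsmul_dom. auto.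
Qed.

Lemma pmul_iter_subclosed Q n : subclosed Q -> subclosed (pmul_iter p A n Q).
Proof. intros H. induction n; auto. now apply pmul_subclosed. Qed.

Lemma ulm_subclosed i : subclosed (ulm_omega p A i).
Proof.
  induction i as [|i IH].
  - split; [apply zero_dom | split; auto]. apply add_dom.
  - split; [|split].
    + intros n. now apply pmul_iter_subclosed.
    + intros x y Hx Hy n. apply (pmul_iter_subclosed _ n IH); auto.
    + intros x Hx. apply IH. exact (Hx 0).
Qed.

End Laws.

Lemma pmul_iter_iff p A Q n x : pmul_iter p A n Q x <-> exists y, Q y /\ x = Nat.iter n (nsmul A p) y.
Proof.
  revert x. induction n as [|n IH]; intros x; simpl.
  - split; [eauto|]. intros (y & H & ->). auto.
  - split.
    + intros (y & H & ->). apply IH in H. destruct H as (z & Hz & ->). eauto.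
    + intros (y & H & ->). exists (Nat.iter n (nsmul A p) y). split; auto. apply IH. eauto.
Qed.

Lemma emb_smul X (G : Grp) f Q n x : emb X G f Q -> dom X x -> dom X (nsmul X n x) /\ f (nsmul X n x) = nmul n (f x).
Proof.
  intros (f1 & f2 & f3 & f4 & f5) D. induction n as [|n [IH1 IH2]]; [split; [apply zero_dom | auto]|].
  rewrite nsmul_S. split; [now apply add_dom|]. now rewrite f2, IH2, nmul_S by auto.
Qed.

Lemma emb_ulm p X (G : Grp) f x : emb X G f (fun _ => True) -> dom X x -> (ulm_omega p X 1 x <-> Om p (f x)).
Proof.
  intros E D. pose proof E as (f1 & f2 & f3 & f4 & f5).
  assert (It : forall n y, dom X y -> dom X (Nat.iter n (nsmul X p) y) /\ f (Nat.iter n (nsmul X p) y) = pw p n • f y).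
  { induction n as [|n IH]; intros y Dy; [split; auto; now rewrite pw_0, zmul_1|]. destruct (IH y Dy) as [I1 I2].
    destruct (emb_smul X G f _ p _ E I1) as [J1 J2]. split; auto. simpl. rewrite J2, I2, pw_S, zmul_mul, zmul_nat. auto. }
  simpl. split; intros H n.
  - specialize (H n). apply pmul_iter_iff in H. destruct H as (y & Dy & ->). exists (f y). now apply It.
  - apply pmul_iter_iff. destruct (H n) as [y Ey]. destruct (f4 y I) as (y' & Dy' & <-). exists y'. split; auto.
    destruct (It n y' Dy') as [I1 I2]. apply f3; auto. congruence.
Qed.

(** * Digit presentations of computable groups *)

Definition KStruct (K : (nat -> nat) -> Prop) (X : Struct) : Prop :=
  exists d ad, CompB K d /\ Comp2 K ad /\ (forall x, d x = true <-> dom X x) /\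
    forall x y, dom X x -> dom X y -> ad x y = add X x y.

Lemma bounded_not_injective (f : nat -> nat) v : (forall n, f n <= v) -> ~ Injective f.
Proof.
  intros B I. assert (L : length (map f (seq 0 (S (S v)))) <= length (seq 0 (S v))).
  { apply NoDup_incl_length; [apply Injective_map_NoDup; auto; apply seq_NoDup|].
    intros x Hx. apply in_map_iff in Hx. destruct Hx as (n & <- & _). apply in_seq. specialize (B n). lia. }
  rewrite length_map, !length_seq in L. lia.
Qed.

Section Poly.
Context (p : nat) (Hp : prime (Z.of_nat p)) (X : Struct) (HX : abelian_pgroup p X).
Context (d : nat -> bool) (ad : nat -> nat -> nat).
Context (d_spec : forall x, d x = true <-> dom X x) (ad_spec : forall x y, dom X x -> dom X y -> ad x y = add X x y).
Notation G := (SG p X HX). Notation inc := (inc p X HX).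

Definition nm (n x : nat) : nat := iterate n (ad x) (zero X).
Definition lc (y : nat -> nat) (j x : nat) : nat :=
  nat_rect (fun _ => nat) (zero X) (fun i r => ad r (nm ((x / p ^ i) mod p) (y i))) j.
(** A candidate for the next generator is not yet spanned but has a spanned [p]-multiple, so it
    enlarges the span by a factor [p]. The span is finite, hence both tests are bounded searches. *)
Definition sel (y : nat -> nat) (j v : nat) : bool :=
  d v && negb (bex (p ^ j) (fun x => lc y j x =? v)) && bex (p ^ j) (fun x => lc y j x =? nm p v).
Definition lsel (y : nat -> nat) (j v : nat) : bool := sel y j v && negb (bex v (sel y j)).
Definition tbl (j : nat) (m : mem) : bool := ball j (fun i => lsel (get m 0) i (get m 0 i)).

Lemma nm_val n x : dom X x -> nm n x = proj1_sig (nmul n (inc x)).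
Proof.
  intros D. unfold nm. induction n as [|n IH]; auto. rewrite iterate_S, IH, nmul_S. simpl.
  rewrite inc_val by auto. apply ad_spec; auto. apply proj2_sig.
Qed.

Lemma nm_dom n x : dom X x -> dom X (nm n x).
Proof. intros D. rewrite nm_val by auto. apply proj2_sig. Qed.

Lemma inc_nm n x : dom X x -> inc (nm n x) = Z.of_nat n • inc x.
Proof. intros D. rewrite nm_val, inc_proj, zmul_nat; auto. Qed.

Lemma lc_digits y j x x' : (forall i, i < j -> (x / p ^ i) mod p = (x' / p ^ i) mod p) -> lc y j x = lc y j x'.
Proof. unfold lc. induction j as [|j IH]; intros H; simpl; auto. rewrite IH, H; auto. Qed.

Lemma lc_ext y y' j x : (forall i, i < j -> y i = y' i) -> lc y j x = lc y' j x.
Proof. unfold lc. induction j as [|j IH]; intros H; simpl; auto. rewrite IH, H; auto. Qed.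

Lemma mod_digit x i k : k < i -> ((x mod p ^ i) / p ^ k) mod p = (x / p ^ k) mod p.
Proof.
  intros L. pose proof (prime_ge2 p Hp) as H2. pose proof (ppow_pos p H2 k). pose proof (ppow_pos p H2 i).
  rewrite (Nat.div_mod x (p ^ i)) at 2 by lia. set (q := x / p ^ i).
  replace (p ^ i * q + x mod p ^ i) with (x mod p ^ i + (q * p ^ (i - k - 1) * p) * p ^ k).
  - rewrite Nat.div_add, Nat.Div0.mod_add by lia. reflexivity.
  - replace i with (k + 1 + (i - k - 1)) at 3 by lia. rewrite !Nat.pow_add_r, Nat.pow_1_r. ring.
Qed.

Lemma lc_eq y j x : (forall i, i < j -> dom X (y i)) -> x < p ^ j ->
  lc y j x = proj1_sig (lin p (fun i => inc (y i)) j x).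
Proof.
  pose proof (prime_ge2 p Hp) as H2. revert x. induction j as [|j IH]; intros x D L; auto.
  cbn [lin]. simpl proj1_sig. change (lc y (S j) x) with (ad (lc y j x) (nm ((x / p ^ j) mod p) (y j))).
  rewrite (lc_digits y j x (x mod p ^ j)) by (intros; symmetry; now apply mod_digit).
  pose proof (ppow_pos p H2 j).
  rewrite IH by (auto; apply Nat.mod_upper_bound; lia). rewrite zmul_nat, nm_val by auto.
  rewrite (Nat.mod_small (x / p ^ j)) by (apply Nat.Div0.div_lt_upper_bound; rewrite <- ppow_S; auto).
  apply ad_spec; apply proj2_sig.
Qed.

Definition spanned (y : nat -> nat) (j v : nat) : Prop := exists x, x < p ^ j /\ lc y j x = v.

Lemma bex_spanned y j v : bex (p ^ j) (fun x => lc y j x =? v) = true <-> spanned y j v.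
Proof.
  rewrite bex_spec. split; intros (x & L & E); exists x; split; auto; now apply Nat.eqb_eq.
Qed.

Lemma sel_iff y j v : sel y j v = true <-> dom X v /\ ~ spanned y j v /\ spanned y j (nm p v).
Proof.
  unfold sel. rewrite !Bool.andb_true_iff, d_spec, bex_spanned, Bool.negb_true_iff, <- Bool.not_true_iff_false, bex_spanned. tauto.
Qed.

Lemma lsel_iff y j v : lsel y j v = true <-> sel y j v = true /\ forall v', v' < v -> sel y j v' = false.
Proof.
  unfold lsel. rewrite Bool.andb_true_iff, Bool.negb_true_iff, <- Bool.not_true_iff_false, bex_spec. split; intros [A B]; split; auto.
  - intros v' L. apply Bool.not_true_iff_false. intros E. apply B. eauto.
  - intros (v' & L & E). rewrite B in E; easy.
Qed.

Lemma lsel_ex y j v : sel y j v = true -> exists v', lsel y j v' = true.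
Proof.
  induction v as [v IH] using lt_wf_ind. intros S.
  destruct (classic (exists v', v' < v /\ sel y j v' = true)) as [(v' & L & E)|Q]; [eauto|].
  exists v. apply lsel_iff. split; auto. intros v' L. apply Bool.not_true_iff_false. intros E. apply Q. eauto.
Qed.

Lemma sel_ext y y' j v : (forall i, i < j -> y i = y' i) -> sel y j v = sel y' j v.
Proof.
  intros E. apply Bool.eq_iff_eq_true. rewrite !sel_iff. unfold spanned.
  assert (Ex : forall x, lc y j x = lc y' j x) by (intros; now apply lc_ext). now setoid_rewrite Ex.
Qed.

Lemma lsel_ext y y' j v : (forall i, i < j -> y i = y' i) -> lsel y j v = lsel y' j v.
Proof.
  intros E. apply Bool.eq_iff_eq_true. rewrite !lsel_iff.
  assert (Ex : forall v, sel y j v = sel y' j v) by (intros; now apply sel_ext). now setoid_rewrite Ex.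
Qed.

Lemma lsel_det y j v v' : lsel y j v = true -> lsel y j v' = true -> v = v'.
Proof.
  rewrite !lsel_iff. intros [A B] [A' B']. destruct (lt_eq_lt_dec v v') as [[L|]|L]; auto.
  - rewrite B' in A; easy.
  - rewrite B in A'; easy.
Qed.

Lemma tbl_det j m y : tbl j m = true -> (forall i, i < j -> lsel y i (y i) = true) -> forall i, i < j -> get m 0 i = y i.
Proof.
  unfold tbl. rewrite ball_spec. intros T T' i. induction i as [i IH] using lt_wf_ind. intros L.
  apply (lsel_det y i); auto. rewrite <- (lsel_ext (get m 0)); auto. intros k Lk. apply IH; auto. lia.
Qed.

Lemma tbl_S j m v : tbl j m = true -> lsel (get m 0) j v = true -> tbl (S j) (upd m 0 j v) = true.
Proof.
  unfold tbl. rewrite !ball_spec. intros T L i Li.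
  assert (E : forall k, k < j -> get m 0 k = get (upd m 0 j v) 0 k).
  { intros k Lk. rewrite get_upd. cbn [Nat.eqb andb]. destruct (Nat.eqb_spec j k); [lia|auto]. }
  rewrite <- (lsel_ext (get m 0)) by (intros; apply E; lia).
  destruct (Nat.eq_dec i j) as [->|N].
  - rewrite get_upd. cbn [Nat.eqb andb]. now rewrite Nat.eqb_refl.
  - rewrite <- E by lia. apply T. lia.
Qed.

Section Seq.
Context (y : nat -> nat) (J : nat) (HJ : forall j, j < J -> lsel y j (y j) = true).

Lemma y_dom i : i < J -> dom X (y i).
Proof. intros L. specialize (HJ i L). apply lsel_iff in HJ. destruct HJ as [S _]. now apply sel_iff in S. Qed.

Lemma spanned_zero j : j <= J -> spanned y j (zero X).
Proof.
  intros L. exists 0. split; [apply ppow_pos, prime_ge2; auto|].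
  rewrite lc_eq; [|intros; apply y_dom; lia|apply ppow_pos, prime_ge2; auto]. now rewrite lin_0 by now apply prime_ge2.
Qed.

Lemma spanned_le i j v : i <= j -> j <= J -> spanned y i v -> spanned y j v.
Proof.
  pose proof (prime_ge2 p Hp) as H2. intros L LJ (x & Lx & E). pose proof (ppow_le p H2 i j L). exists x. split; [lia|].
  rewrite <- E. rewrite !lc_eq by (try lia; intros; apply y_dom; lia). now rewrite (lin_stable p H2 _ i j) by auto.
Qed.

Lemma spanned_gen i j : i < j -> j <= J -> spanned y j (y i).
Proof.
  pose proof (prime_ge2 p Hp) as H2. intros L LJ. exists (p ^ i). pose proof (ppow_lt p H2 i j L). split; auto.
  rewrite lc_eq by (auto; intros; apply y_dom; lia). rewrite lin_gen by auto. apply inc_val, y_dom. lia.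
Qed.

Lemma sel_ex j v : j <= J -> dom X v -> ~ spanned y j v -> exists v', sel y j v' = true.
Proof.
  intros L D N. destruct (SG_tors p X HX (inc v)) as [k E]. revert v D N E. induction k as [|k IH]; intros v D N E.
  - rewrite pw_0, zmul_1 in E. destruct N. rewrite <- (inc_val p X HX v D), E. now apply spanned_zero.
  - destruct (classic (spanned y j (nm p v))) as [Hv|Hv]; [exists v; now apply sel_iff|].
    apply (IH (nm p v)); auto using nm_dom. rewrite inc_nm by auto. rewrite <- E, pw_S, Z.mul_comm. symmetry. apply zmul_mul.
Qed.

End Seq.

(** Induction on the order of [v]: once [nm p v] is spanned, [v] remains a candidate until it is
    spanned. If that never happened, all later choices, being least candidates, would be at most
    [v]; but they are distinct. *)
Lemma spanned_all y : (forall j, lsel y j (y j) = true) -> forall v, dom X v -> exists j, spanned y j v.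
Proof.
  intros HJ v D. apply NNPP. intros Q. assert (N : forall j, ~ spanned y j v) by eauto. clear Q.
  destruct (SG_tors p X HX (inc v)) as [k E]. revert v D N E. induction k as [|k IH]; intros v D N E.
  - rewrite pw_0, zmul_1 in E. apply (N 0). rewrite <- (inc_val p X HX v D), E. now apply (spanned_zero y 0 ltac:(auto)).
  - destruct (classic (exists j, spanned y j (nm p v))) as [[j Hv]|Hv].
    + apply (bounded_not_injective (fun n => y (j + n)) v).
      * intros n. destruct (Nat.le_gt_cases (y (j + n)) v) as [|L]; auto. specialize (HJ (j + n)) as Hs.
        apply lsel_iff in Hs. destruct Hs as [_ Hs]. specialize (Hs v L).
        assert (S : sel y (j + n) v = true).
        { apply sel_iff. repeat split; auto. apply (spanned_le y (j + n) ltac:(auto) j); auto; lia. }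
        congruence.
      * assert (I : forall a b, a < b -> y a <> y b).
        { intros a b L Eab. specialize (HJ b) as Hs. apply lsel_iff in Hs. destruct Hs as [Hs _]. apply sel_iff in Hs.
          destruct Hs as (_ & Hs & _). apply Hs. rewrite <- Eab. apply (spanned_gen y b ltac:(auto)); auto. }
        intros a b Eab. destruct (lt_eq_lt_dec a b) as [[L|]|L]; auto; exfalso.
        -- apply (I (j + a) (j + b)); auto; lia.
        -- apply (I (j + b) (j + a)); auto; lia.
    + apply (IH (nm p v)); auto using nm_dom; [eauto|]. rewrite inc_nm by auto. rewrite <- E, pw_S, Z.mul_comm. symmetry. apply zmul_mul.
Qed.

Context (K : (nat -> nat) -> Prop) {HK : CClass K} (Cd : CompB K d) (Ca : Comp2 K ad).

Lemma Comp_lc {Z} {EZ : Enc Z} (y : Z -> nat -> nat) (j x : Z -> nat) :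
  Comp2 K y -> Comp K j -> Comp K x -> Comp K (fun z => lc (y z) (j z) (x z)).
Proof.
  intros Hy Hj Hx. assert (Hn : Comp2 K nm) by (unfold nm; kc). unfold lc. apply Comp_rec; auto; kc.
Qed.

(** If tables of every length exist, whole tables are searched for: this search is total, whereas a
    recursion with an inner search would have to succeed on wrong tables too. Least candidates are
    determined, so the tables cohere. Otherwise a longest table exists and already spans [X]. *)
Lemma generators : exists y ok, Comp K y /\ CompB K ok /\
  (forall i j, i <= j -> ok j = true -> ok i = true) /\
  (forall j, ok j = true -> lsel y j (y j) = true) /\
  (forall v, dom X v -> exists j, (forall i, i < j -> ok i = true) /\ spanned y j v) /\
  ((exists j, ok j = false) -> exists N, forall v, dom X v -> v < N).
Proof.
  destruct (classic (forall j, exists m, tbl j m = true)) as [A|A].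
  - assert (Cn : Comp2 K nm) by (unfold nm; kc).
    assert (Ct : CompB2 K (fun j w => tbl (S j) (dec w))).
    { assert (Cs : CompB K (fun q : mem * (nat * nat) => sel (get (fst q) 0) (fst (snd q)) (snd (snd q)))).
      { assert (Cl : Comp K (fun q : (mem * (nat * nat)) * nat => lc (get (fst (fst q)) 0) (fst (snd (fst q))) (snd q))).
        { apply Comp_lc; kc. }
        unfold sel. kc. }
      assert (Cs' : forall Z (EZ : Enc Z) (m : Z -> mem) (j v : Z -> nat), Comp K m -> Comp K j -> Comp K v ->
         CompB K (fun z => sel (get (m z) 0) (j z) (v z))).
      { intros Z EZ m j v Cm Cj Cv. exact (CompB_app K _ (fun z => (m z, (j z, v z))) Cs ltac:(kc)). }
      unfold tbl, lsel.
      pose proof (Comp_dec K (X := mem)) as Cdec. kc; apply Cs'; kc. }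
    destruct (Comp_mu_ex K (fun j w => tbl (S j) (dec w)) Ct) as (h & Ch & Hh).
    { intros j. destruct (A (S j)) as [m Hm]. exists (enc m). now rewrite dec_enc. }
    pose (y := fun j => get (dec (h j)) 0 j).
    assert (Hy : forall j, lsel y j (y j) = true).
    { assert (S : forall j i, i < j -> lsel y i (y i) = true).
      { induction j as [|j IH]; [lia|]. intros i L. destruct (Nat.eq_dec i j) as [->|]; [|apply IH; lia].
        pose proof (Hh j) as T. unfold tbl in T. rewrite ball_spec in T. specialize (T j (Nat.lt_succ_diag_r j)).
        fold (y j) in T. rewrite (lsel_ext (get (dec (h j)) 0) y) in T; auto.
        apply (tbl_det j); auto. specialize (Hh j). unfold tbl in *. rewrite ball_spec in *. intros; apply Hh; lia. }
      intros j. apply (S (Datatypes.S j)). lia. }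
    exists y, (fun _ => true). split; [|split; [|split; [|split; [|split]]]]; auto.
    + pose proof (Comp_dec K (X := mem)) as Cdec. unfold y. kc.
    + kc.
    + intros v D. destruct (spanned_all y Hy v D) as [j Hj]. eauto.
    + intros [j E]. discriminate.
  - assert (B : exists j, (exists m, tbl j m = true) /\ ~ exists m, tbl (S j) m = true).
    { apply NNPP. intros Q. apply A. induction j as [|j IH]; [exists []; reflexivity|].
      apply NNPP. intros Q'. apply Q. eauto. }
    destruct B as (J & (m & Hm) & Hn). clear A.
    pose (y := get m 0). assert (Hy : forall j, j < J -> lsel y j (y j) = true).
    { unfold tbl in Hm. rewrite ball_spec in Hm. auto. }
    assert (All : forall v, dom X v -> spanned y J v).
    { intros v D. apply NNPP. intros N. destruct (sel_ex y J Hy J v (le_n _) D N) as [v' S].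
      destruct (lsel_ex _ _ _ S) as [w L]. apply Hn. exists (upd m 0 J w). now apply tbl_S. }
    exists y, (fun j => j <? J). split; [|split; [|split; [|split; [|split]]]].
    + unfold y. kc.
    + kc.
    + intros i j L. rewrite !Nat.ltb_lt. lia.
    + intros j L. apply Hy. now apply Nat.ltb_lt.
    + intros v D. exists J. split; auto. intros i L. now apply Nat.ltb_lt.
    + intros _. exists (S (bmax (p ^ J) (fun x => lc y J x))). intros v D. destruct (All v D) as (x & L & E).
      pose proof (bmax_ge (p ^ J) (fun x => lc y J x) x L) as B. cbn beta in B. lia.
Qed.

End Poly.

Theorem polycyclic (K : (nat -> nat) -> Prop) {HK : CClass K} (p : nat) (Hp : prime (Z.of_nat p)) (X : Struct) :
  abelian_pgroup p X -> KStruct K X ->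
  exists c, Comp K c /\ iso (PStruct p Hp c) X /\ ((forall N, exists v, dom X v /\ N <= v) -> forall j, c j <> 0).
Proof.
  intros HX (d & ad & Cd & Ca & Hd & Ha).
  destruct (generators p Hp X HX d ad Hd Ha K Cd Ca) as (y & ok & Cy & Cok & Dn & Hy & All & Fin).
  assert (Cn : Comp2 K (nm X ad)) by (unfold nm; kc).
  pose (c := fun j => if ok j then S (bmu (p ^ j) (fun x => lc p X ad y j x =? nm X ad p (y j))) else 0).
  assert (okc : forall j, c j <> 0 <-> ok j = true) by (intros j; unfold c; destruct (ok j); split; easy).
  exists c. split; [|split].
  - assert (Cl : Comp K (fun q : nat * nat => lc p X ad y (fst q) (snd q))) by (apply (Comp_lc p X ad K Ca (fun _ => y)); kc).
    unfold c. kc.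
  - pose (Y := fun i => inc p X HX (y i)).
    assert (J : forall i, (forall i', i' <= i -> c i' <> 0) -> forall j, j < S i -> lsel p X d ad y j (y j) = true).
    { intros i H j L. apply Hy, okc, H. lia. }
    assert (DY : forall i, (forall i', i' <= i -> c i' <> 0) -> forall j, j < S i -> dom X (y j)).
    { intros i H j L. now apply (y_dom p X d ad Hd y (S i) (J i H)). }
    assert (rel : forall i, (forall i', i' <= i -> c i' <> 0) ->
      Z.of_nat p • Y i = lin p Y i (pred (c i) mod p ^ i)).
    { intros i Hi. assert (Oi : ok i = true) by now apply okc, Hi.
      pose proof (Hy i Oi) as S. apply (lsel_iff p X d ad) in S. destruct S as [S _].
      apply (sel_iff p X d ad Hd) in S. destruct S as (D & _ & HS). apply bex_spanned in HS.
      unfold c. rewrite Oi. simpl pred. set (q := fun x => lc p X ad y i x =? nm X ad p (y i)) in *.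
      assert (L : bmu (p ^ i) q < p ^ i) by now apply Nat.ltb_lt.
      rewrite Nat.mod_small by auto. pose proof (bmu_true _ _ L) as T. unfold q at 1 in T. apply Nat.eqb_eq in T.
      apply sig_eq. rewrite (lc_eq p Hp X HX ad Ha) in T by (auto; intros; apply (DY i Hi); lia).
      unfold Y at 2. rewrite T, zmul_nat. unfold Y. symmetry. now apply nm_val. }
    assert (new : forall i x, (forall i', i' <= i -> c i' <> 0) -> x < p ^ i -> Y i <> lin p Y i x).
    { intros i x Hi L E. pose proof (J i Hi i ltac:(lia)) as S. apply (lsel_iff p X d ad) in S. destruct S as [S _].
      apply (sel_iff p X d ad Hd) in S. destruct S as (D & N & _). apply N. exists x. split; auto.
      rewrite (lc_eq p Hp X HX ad Ha) by (auto; intros; apply (DY i Hi); lia). fold Y. rewrite <- E. now apply inc_val. }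
    exists (fun x => proj1_sig (pf p Y x)). split; [|split; [|split; [|split]]].
    + intros x _. apply proj2_sig.
    + intros x x' Dx Dx' E. apply sig_eq in E. now apply (pf_inj p Hp (fun j => c j <> 0) (fun i => pred (c i)) Y rel new).
    + intros v D. destruct (All v D) as (j & Oj & x & L & E). exists x. split.
      * simpl. unfold Dom. apply (D_iff p Hp (fun j => c j <> 0)). exists j. split; auto. intros i Li. now apply okc, Oj.
      * rewrite (pf_lin p Hp y Y j) by auto. rewrite <- E. symmetry. apply (lc_eq p Hp X HX ad Ha); auto.
        intros i Li. apply (DY i); auto. intros i' Li'. apply okc, Oj. lia.
    + reflexivity.
    + intros x x' Dx Dx'. exact (f_equal (@proj1_sig _ _) (pf_add p Hp (fun j => c j <> 0) (fun i => pred (c i)) Y rel x x' Dx Dx')).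
  - intros Inf j. apply okc. destruct (ok j) eqn:E; auto. destruct Fin as [N HN]; eauto.
    destruct (Inf N) as (v & D & L). specialize (HN v D). lia.
Qed.

(** * Pulling back along one Ulm subgroup *)

Lemma emb_Om_iso p Y (G H : Grp) f k : emb Y G f (Om p) -> emb Y H k (Om p) -> exists g, Om_iso p G H g.
Proof.
  intros (f1 & f2 & f3 & f4 & f5) (k1 & k2 & k3 & k4 & k5).
  assert (C : forall y, exists x, Om p y -> dom Y x /\ f x = y).
  { intros y. destruct (classic (Om p y)) as [Oy|Oy]; [|exists 0; tauto]. destruct (f4 y Oy) as [x Hx]. eauto. }
  destruct (fun_choice _ C) as [h Hh]. exists (fun y => k (h y)). split; [|split; [|split]].
  - intros x O. now apply k1, Hh.
  - intros x y O O'. destruct (Hh x O) as [D E], (Hh y O') as [D' E'].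
    assert (O2 : Om p (x ⊕ y)) by (intros m; apply Dv_add; auto). destruct (Hh _ O2) as [D2 E2].
    rewrite <- k2 by auto. f_equal. apply f3; auto; [now apply add_dom|]. rewrite f2, E2, E, E' by auto. reflexivity.
  - intros x y O O' E. destruct (Hh x O) as [D Ex], (Hh y O') as [D' Ey]. apply k3 in E; auto. congruence.
  - intros y O. destruct (k4 y O) as (x & D & <-). exists (f x). split; auto. f_equal.
    destruct (Hh (f x) (f1 x D)) as [D' E']. apply f3; auto.
Qed.

Lemma emb_giso X (G H : Grp) v F : emb X G v (fun _ => True) -> giso G H F ->
  emb X H (fun x => F (v x)) (fun _ => True).
Proof.
  intros (v1 & v2 & v3 & v4 & v5) (F1 & F2 & F3). split; [|split; [|split; [|split]]]; auto.
  - intros x y Dx Dy. now rewrite v2, F1 by auto.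
  - intros y _. destruct (F3 y) as [x <-]. destruct (v4 x I) as (x' & D & <-). eauto.
  - rewrite v5. apply (gaddI (F g0)). rewrite <- F1, gadd0, gadd0r. reflexivity.
Qed.

Lemma emb_Om p X (HX : abelian_pgroup p X) (G : Grp) v : emb X G v (fun _ => True) ->
  emb (Sub X _ (ulm_subclosed p X HX 1)) G v (Om p).
Proof.
  intros E. pose proof E as (v1 & v2 & v3 & v4 & v5).
  assert (D : forall x, ulm_omega p X 1 x -> dom X x) by apply (ulm_subclosed p X HX 1).
  split; [|split; [|split; [|split]]]; cbn [dom add zero Sub]; auto.
  - intros x Hx. apply (emb_ulm p X G v x E); auto.
  - intros y O. destruct (v4 y I) as (x & Dx & <-). exists x. split; auto. now apply (emb_ulm p X G v x E).
Qed.

Lemma emb_giso_Om p Y (G H : Grp) f F : emb Y G f (Om p) -> giso G H F -> emb Y H (fun x => F (f x)) (Om p).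
Proof.
  intros (f1 & f2 & f3 & f4 & f5) (F1 & F2 & F3).
  assert (F0 : F g0 = g0) by (apply (gaddI (F g0)); now rewrite <- F1, gadd0, gadd0r).
  assert (FN : forall n x, F (nmul n x) = nmul n (F x)).
  { induction n as [|n IH]; intros x; [apply F0|]. now rewrite !nmul_S, F1, IH. }
  assert (FD : forall m x, Dv p m x <-> Dv p m (F x)).
  { intros m x. unfold Dv, pw. split; intros [y E].
    - exists (F y). rewrite E, !zmul_nat. apply FN.
    - destruct (F3 y) as [y' <-]. exists y'. apply F2. rewrite E, !zmul_nat. symmetry. apply FN. }
  split; [|split; [|split; [|split]]]; auto.
  - intros x D m. apply FD. now apply f1.
  - intros x y D D'. now rewrite f2, F1 by auto.
  - intros y O. destruct (F3 y) as [y' <-]. destruct (f4 y') as (x & D & <-); [intros m; now apply FD|]. eauto.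
  - now rewrite f5.
Qed.

(** A finite [p]-group is killed by some power of [p], so its only element of infinite height is
    0. *)
Lemma Om_infinite p (Hp : prime (Z.of_nat p)) X (HX : abelian_pgroup p X) x0 : ulm_omega p X 1 x0 -> x0 <> zero X ->
  forall N, exists v, dom X v /\ N <= v.
Proof.
  intros U Nz N. apply NNPP. intros Q.
  assert (B : forall v, dom X v -> v < N).
  { intros v D. destruct (Nat.lt_ge_cases v N) as [|L]; auto. destruct Q. eauto. }
  assert (Dx : dom X x0) by now apply (ulm_subclosed p X HX 1).
  assert (Ex : exists k, forall v, v < N -> pw p k • inc p X HX v = g0).
  { clear. induction N as [|N [k Hk]]; [exists 0; lia|]. destruct (SG_tors p X HX (inc p X HX N)) as [k' Hk'].
    exists (k + k'). intros v L. destruct (Nat.eq_dec v N) as [->|].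
    - rewrite pw_add, zmul_mul, Hk'. apply zmul_g0.
    - rewrite pw_add, Z.mul_comm, zmul_mul, Hk by lia. apply zmul_g0. }
  destruct Ex as [k Hk]. apply (emb_ulm p X _ _ x0 (SG_emb p X HX) Dx) in U. destruct (U k) as [y Ey].
  rewrite <- (inc_proj p X HX y), Hk in Ey by apply B, proj2_sig.
  apply Nz. rewrite <- (inc_val p X HX x0 Dx), Ey. reflexivity.
Qed.

Theorem pull (K : (nat -> nat) -> Prop) {HK : CClass K} p (Hp : prime (Z.of_nat p)) X (HX : abelian_pgroup p X) x0 cc :
  KStruct K X -> ulm_omega p X 1 x0 -> ~ pmul p X (ulm_omega p X 1) x0 -> Lim (Lim K) cc ->
  exists c', K c' /\ forall z, iso (PStruct p Hp (fun j => c' (cp z j))) X <->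
    iso (PStruct p Hp (fun j => cc (cp z j))) (Sub X _ (ulm_subclosed p X HX 1)).
Proof.
  intros KX U NU HL.
  assert (Dx : dom X x0) by now apply (ulm_subclosed p X HX 1).
  assert (Nz : x0 <> zero X).
  { intros ->. apply NU. apply (pmul_subclosed p X HX), ulm_subclosed; auto. }
  destruct (polycyclic K p Hp X HX KX) as (a & Ca & Ia & Ina).
  (* So [X] is infinite, its generators never end, and the carrier of its digit presentation is all
     of [nat]. *)
  specialize (Ina (Om_infinite p Hp X HX x0 U Nz)).
  set (a' := fun i => pred (a i)). assert (Ca' : Comp K a') by (unfold a'; kc).
  destruct (iso_emb _ _ _ _ _ (iso_sym _ _ Ia) (PStruct_emb p Hp a Ina)) as [v Ev]. fold a' in v, Ev.
  pose proof (emb_Om p X HX _ v Ev) as EO.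
  destruct (realize K p Hp a' (v x0) cc Ca') as (c'' & Cc & Hc); auto.
  { now apply (emb_ulm p X _ v x0 Ev). }
  { intros (y & Oy & Ey). apply NU. pose proof Ev as (_ & _ & v3 & v4 & _). destruct (v4 y I) as (y' & Dy & <-).
    exists y'. split; [now apply (emb_ulm p X _ v y' Ev)|].
    destruct (emb_smul X _ v _ p y' Ev Dy) as [D1 E1]. apply v3; auto. rewrite <- Ey, E1, zmul_nat. reflexivity. }
  (* The successor records that every generator is present. *)
  exists (fun w => S (c'' (c1 w) (c2 w))). split.
  { change (Comp K (fun w => S (c'' (c1 w) (c2 w)))). kc. }
  intros z. replace (fun j => S (c'' (c1 (cp z j)) (c2 (cp z j)))) with (fun j => S (c'' z j)).
  2: { apply functional_extensionality. intros j. now rewrite c1_cp, c2_cp. }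
  destruct (Hc z) as (U1 & U2 & f & f1 & f2 & f3 & f4).
  pose proof (PStruct_emb p Hp (fun j => S (c'' z j)) ltac:(discriminate)) as Ez.
  change (fun i => pred (S (c'' z i))) with (fun i => c'' z i) in Ez.
  assert (Ef : emb (PStruct p Hp (fun j => cc (cp z j))) (Pg p (prime_ge2 p Hp) (c'' z)) f (Om p)).
  { split; [|split; [|split; [|split]]]; auto. cbn [zero PStruct].
    pose proof (zero_dom (PStruct p Hp (fun j => cc (cp z j)))) as D0.
    apply (gaddI (f 0)). rewrite <- (f2 0 0 D0 D0), gadd0r. reflexivity. }
  split; intros Iz.
  - destruct (iso_emb _ _ _ _ _ Iz Ev) as [h (h1 & h2 & h3 & h4 & h5)].
    assert (Gh : giso (Pg p (prime_ge2 p Hp) (c'' z)) (Pg p (prime_ge2 p Hp) a') h).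
    { assert (All : forall x, dom (PStruct p Hp (fun j => S (c'' z j))) x) by (intros x j _; discriminate).
      split; [|split].
      - intros x y. apply (h2 x y); auto.
      - intros x y. apply h3; auto.
      - intros y. destruct (h4 y I) as (x & _ & E). eauto. }
    apply (emb_iso _ _ _ _ _ _ (emb_giso_Om p _ _ _ f h Ef Gh) EO).
  - destruct (iso_emb _ _ _ _ _ Iz EO) as [k Ek].
    destruct (emb_Om_iso p _ _ _ f k Ef Ek) as [g Hg].
    destruct (Om_iso_extends p Hp (Pg p (prime_ge2 p Hp) (c'' z)) (Pg p (prime_ge2 p Hp) a') (fun n => n) (fun n => n) g)
      as [F HF]; auto; try apply Pg_tors; eauto.
    apply (emb_iso _ _ _ _ _ _ (emb_giso _ _ _ _ F Ez HF) Ev).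
Qed.

(** * The iterated Ulm subgroups *)

Lemma KStruct_computable A : computable_structure A -> KStruct K0 A.
Proof.
  intros [Hd (g & (cd & Hc) & Hg)]. destruct (Sigma_LimN 0 1 _ Hd) as (f & Cf & Hf).
  exists (fun x => f [x]), (fun x y => g [x; y]). split; [|split; [|split]].
  - assert (HK := K0_class). apply (CompB_app K0 f (fun x => [x]) Cf). kc.
  - apply (cf_comp2 1 g (fun xs => c1 (hd 0 xs)) (fun xs => c2 (hd 0 xs)));
      [exists cd; exact Hc | apply K0_c1 | apply K0_c2].
  - intros x. symmetry. apply (Hf [x]). reflexivity.
  - exact Hg.
Qed.

Section Ulm.
Context (p : nat) (A : Struct) (HA : abelian_pgroup p A).

Definition Xi (i : nat) : Struct := Sub A _ (ulm_subclosed p A HA i).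

(** Having infinite height means that for every [n] there is a root for [p^n]; each of the two
    quantifiers costs one limit. *)
Lemma KStruct_Lim (K : (nat -> nat) -> Prop) {HK : CClass K} i : KStruct K (Xi i) -> KStruct (Lim (Lim K)) (Xi (S i)).
Proof.
  intros (d & ad & Cd & Ca & Hd & Ha). assert (HL : CClass (Lim K)) by (apply Lim_class; auto).
  pose (nmC := fun n x => iterate n (ad x) (zero A)). assert (Cn : Comp2 K nmC) by (unfold nmC; kc).
  pose (mwC := fun n x => iterate n (nmC p) x). assert (Cm : Comp2 K mwC) by (unfold mwC; kc).
  assert (En : forall n x, ulm_omega p A i x -> ulm_omega p A i (nsmul A n x) /\ nmC n x = nsmul A n x).
  { intros n x Hx. assert (Dn : forall n, ulm_omega p A i (nsmul A n x)) by (intros m; apply nsmul_Q; auto; now apply ulm_subclosed).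
    split; auto. unfold nmC. induction n as [|n IH]; auto. rewrite iterate_S, IH, nsmul_S. apply (Ha x (nsmul A n x)); [exact Hx | apply Dn]. }
  assert (Em : forall n x, ulm_omega p A i x -> ulm_omega p A i (Nat.iter n (nsmul A p) x) /\ mwC n x = Nat.iter n (nsmul A p) x).
  { intros n x Hx. induction n as [|n [I1 I2]]; auto. unfold mwC in *. rewrite iterate_S, I2. simpl. now apply En. }
  destruct (CompB_Lim_ex K (fun (q : nat * nat) y => d y && (mwC (snd q) y =? fst q))
    (fun q => pmul_iter p A (snd q) (ulm_omega p A i) (fst q))) as (e & Ce & He).
  { kc. }
  { intros [x n]. cbn [fst snd]. rewrite pmul_iter_iff. split; intros (y & H).
    - destruct H as [Hy ->]. exists y. rewrite (proj2 (Hd y) Hy), (proj2 (Em n y Hy)). apply Nat.eqb_refl.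
    - apply andb_prop in H. destruct H as [H1 H2]. apply Hd in H1. apply Nat.eqb_eq in H2. exists y.
      split; auto. now rewrite <- H2, (proj2 (Em n y H1)). }
  destruct (CompB_Lim_ex (Lim K) (fun (x : nat) n => negb (e (x, n))) (fun x => ~ ulm_omega p A (S i) x)) as (e' & Ce' & He').
  { kc. }
  { intros x. cbn [ulm_omega]. setoid_rewrite (He (x, _)). split.
    - intros N. apply not_all_ex_not in N. destruct N as [n N]. exists n. now destruct (e (x, n)).
    - intros [n E] H. rewrite (H n) in E. discriminate. }
  assert (HLL : CClass (Lim (Lim K))) by (apply Lim_class; auto).
  exists (fun x => negb (e' x)), ad. split; [kc|]. split; [|split].
  - apply Comp_Lim, Comp_Lim; auto.
  - intros x. cbn [dom Xi Sub]. specialize (He' x). destruct (e' x); simpl; split; auto; intros H.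
    + discriminate.
    + exfalso. now apply He'.
    + apply NNPP. intros N. apply He' in N. discriminate.
  - intros x y Hx Hy. apply Ha; [exact (Hx 0) | exact (Hy 0)].
Qed.

Lemma KStruct_Xi i : KStruct K0 A -> KStruct (LimN (2 * i)) (Xi i).
Proof.
  intros H. induction i as [|i IH]; [exact H|]. replace (2 * S i) with (S (S (2 * i))) by lia.
  apply (KStruct_Lim (LimN (2 * i))). exact IH.
Qed.

Lemma length_gt_witness M i : length_gt_omega_mul p A M -> i <= M ->
  exists x, ulm_omega p A i x /\ ~ pmul p A (ulm_omega p A i) x.
Proof.
  intros HL L. apply NNPP. intros Q. apply (HL i 0); [lia|]. intros x. split.
  - intros H. apply NNPP. intros N. apply Q. eauto.
  - intros (y & Hy & ->). apply nsmul_Q; auto. now apply ulm_subclosed.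
Qed.

End Ulm.

(** * The induction over the Ulm subgroups and the computable sequence *)

Lemma Comp2_cf (F : nat -> nat -> nat) : Comp2 K0 F -> computable_fun 2 (fun xs => F (nth 0 xs 0) (nth 1 xs 0)).
Proof.
  intros H. apply (cf_ext 2 (fun xs => (fun w => F (c1 w) (c2 w)) (cp (nth 0 xs 0) (nth 1 xs 0)))).
  - intros xs _. cbn beta. now rewrite c1_cp, c2_cp.
  - apply (K0_app 2 (fun w => F (c1 w) (c2 w))); [exact H|]. apply cf_cp; apply cf_proj; lia.
Qed.

Lemma Comp3_cf (F : nat -> nat -> nat -> nat) : Comp3 K0 F ->
  computable_fun 3 (fun xs => F (nth 0 xs 0) (nth 1 xs 0) (nth 2 xs 0)).
Proof.
  intros H. apply (cf_ext 3 (fun xs => (fun w => F (c1 w) (c1 (c2 w)) (c2 (c2 w)))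
    (cp (nth 0 xs 0) (cp (nth 1 xs 0) (nth 2 xs 0))))).
  - intros xs _. cbn beta. now rewrite !c2_cp, !c1_cp.
  - apply (K0_app 3 (fun w => F (c1 w) (c1 (c2 w)) (c2 (c2 w)))); [exact H|].
    repeat apply cf_cp; apply cf_proj; lia.
Qed.

Theorem theorem5p16 (p M : nat) (A : Struct) :
  prime (Z.of_nat p) ->
  computable_structure A ->
  abelian_pgroup p A ->
  reduced p A ->
  length_gt_omega_mul p A M ->
  forall S : nat -> Prop, Delta_set (2 * M + 1) S ->
  exists As : nat -> Struct,
    unif_computable As /\ (forall n, iso (As n) A <-> S n).
Proof.
  intros Hp CA HA _ HL S HS. apply KStruct_computable in CA.
  assert (Step : forall k, k <= M -> exists c, LimN (2 * (M - k)) c /\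
    forall n, iso (PStruct p Hp (fun j => c (cp n j))) (Xi p A HA (M - k)) <-> S n).
  { induction k as [|k IH]; intros L.
    - rewrite Nat.sub_0_r. destruct (Delta_LimN (2 * M) S HS) as (s & Cs & Hs).
      destruct (polycyclic (LimN (2 * M)) p Hp (Xi p A HA M)) as (a & Ca & Ia & _).
      { now apply Sub_group. } { now apply KStruct_Xi. }
      exists (fun w => if s (c1 w) then a (c2 w) else 0). split.
      { change (Comp (LimN (2 * M)) (fun w => if s (c1 w) then a (c2 w) else 0)). kc. }
      intros n. replace (fun j => if s (c1 (cp n j)) then a (c2 (cp n j)) else 0) with (fun j => if s n then a j else 0).
      2: { apply functional_extensionality. intros j. now rewrite c1_cp, c2_cp. }
      (* The code 0 throughout gives the trivial group, whereas by the hypothesis on the length the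
         [M]-th subgroup has an element outside its [p]-multiples. *)
      rewrite Hs. destruct (s n); [tauto|]. split; [|discriminate]. intros (f & _ & _ & f3 & f4 & _).
      destruct (length_gt_witness p A HA M M HL (le_n _)) as (x & Ux & Nx). exfalso. apply Nx.
      destruct (f3 x Ux) as (y & Dy & <-). replace y with 0.
      + cbn [zero PStruct] in f4. rewrite f4. apply (pmul_subclosed p A HA), ulm_subclosed; auto.
      + destruct y as [|y]; auto. destruct (Dy 0); auto. simpl. lia.
    - destruct IH as (cc & Kc & Hc); [lia|]. set (i := M - Datatypes.S k) in *.
      replace (M - k) with (Datatypes.S i) in * by lia.
      replace (2 * Datatypes.S i) with (Datatypes.S (Datatypes.S (2 * i))) in Kc by lia.
      destruct (length_gt_witness p A HA M (Datatypes.S i) HL ltac:(lia)) as (x0 & Ux & Nx).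
      destruct (pull (LimN (2 * i)) p Hp (Xi p A HA i) (Sub_group p A HA Hp _ _) x0 cc) as (c' & Kc' & Hc'); auto.
      { now apply KStruct_Xi. }
      exists c'. split; auto. intros n. rewrite Hc'. apply Hc. }
  destruct (Step M (le_n _)) as (c & Kc & Hc). rewrite Nat.sub_diag in Kc, Hc. change (K0 c) in Kc.
  pose proof K0_class as HK. exists (fun n => PStruct p Hp (fun j => c (cp n j))). split; [|exact Hc].
  assert (Cc : Comp K0 c) by exact Kc.
  split; [|split].
  (* Positions [j > x] impose no condition because [j < p ^ j], so membership in the universe is a
     bounded check; the subtraction from 1 turns truth into the value 0 that [computable_rel]
     expects. *)
  - pose (e := fun n x => ball (Datatypes.S x) (fun j => negb (p ^ j <=? x) || negb (c (cp n j) =? 0))).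
    assert (Ce : Comp2 K0 (fun n x => 1 - Nat.b2n (e n x))) by (unfold e; kc).
    destruct (Comp2_cf _ Ce) as [cd Hcd]. exists cd. intros xs L. eexists. split; [now apply Hcd|].
    set (n := nth 0 xs 0). set (x := nth 1 xs 0). cbn [dom PStruct].
    transitivity (e n x = true); [|destruct (e n x); simpl; split; easy].
    unfold e. rewrite ball_spec. split.
    + intros D j _. destruct (Nat.leb_spec (p ^ j) x) as [Lj|]; auto. simpl. specialize (D j Lj).
      now destruct (Nat.eqb_spec (c (cp n j)) 0).
    + intros H j Lj. pose proof (lt_ppow p (prime_ge2 p Hp) j j (le_n _)). specialize (H j ltac:(lia)).
      destruct (Nat.leb_spec (p ^ j) x); [|lia]. now destruct (Nat.eqb_spec (c (cp n j)) 0).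
  - exists (fun _ => 0). split; [apply cf_zero | reflexivity].
  - exists (fun xs => (fun n x y => padd p (fun i => pred (c (cp n i))) (x + y) x y) (nth 0 xs 0) (nth 1 xs 0) (nth 2 xs 0)).
    split; [|reflexivity].
    apply (Comp3_cf (fun n x y => padd p (fun i => pred (c (cp n i))) (x + y) x y)). apply (Comp_padd p (prime_ge2 p Hp)); kc.
Qed.
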